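(* Let $\nu,T>0$, and let $(v,\pi,g)$ be a periodic solution of the Navier--Stokes equations with viscosity $\nu$ on $\mathbb T^3$, smooth on $[0,T+\delta]$, with $\delta>0$, $g\in\mathcal F$ and $v(0)=a\in\mathcal X$. Fix any nonempty coordinate ball in $\mathbb T^3$. For all sufficiently small $\varepsilon>0$, there are $g_\varepsilon\in\mathcal F$ and a solution $u_\varepsilon$ (with force $g_\varepsilon$ and initial velocity $a$) with (i) $T^\nu_{\max}(a,g_\varepsilon)=T$ and $\limsup_{t\uparrow T}\|u_\varepsilon(t)\|_{L^\infty}=\infty$; (ii) $u_\varepsilon=v$ for $0\le t\le T-2\varepsilon^2$; (iii) $u_\varepsilon-v$ is divergence free and supported, for every $t<T$, in a ball of diameter $O(\varepsilon)$ inside the chosen ball; (iv) the simultaneous bounds $$\|u_\varepsilon-v\|_{E_T}\le(M+D)\varepsilon^{1/2}+C\varepsilon^{3/2},$$ $$\|g_\varepsilon-g\|_{L^q(0,\infty;L^p)}\le C_{p,q}\bigl(\varepsilon^{\alpha(p,q)}+\varepsilon^{\alpha(p,q)+1}\bigr)\qquad(1\le p,q\le\infty),$$ $$\|g_\varepsilon-g\|_{L^1(0,\infty;H^s)}\le C_s\bigl(\varepsilon^{1/2-s}+\varepsilon^{3/2-s}\bigr)\qquad(0\le s<1/2),$$ where $\alpha(p,q)=-3+3/p+2/q$ and the constants do not depend on $\varepsilon$. For $s<0$, the force difference $g_\varepsilon-g$ also tends to zero in $L^1(0,\infty;H^s)$ as $\varepsilon\to0$.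
   Context: Work on the unit torus $\mathbb T^3=\mathbb R^3/\mathbb Z^3$. The Navier--Stokes equations with force $f$ and initial velocity $a$ are $\partial_tu+(u\cdot\nabla)u-\nu\Delta u+\nabla p=f$, $\nabla\cdot u=0$, $u(\cdot,0)=a$, with $u,p$ periodic and $\int_{\mathbb T^3}p=0$. $\mathcal X=C^\infty_{\mathrm{div}}(\mathbb T^3;\mathbb R^3)$ (smooth divergence-free fields), $\mathcal F=C_c^\infty(\mathbb T^3\times(0,\infty);\mathbb R^3)$. $T^\nu_{\max}(a,f)\in(0,\infty]$ is the maximal lifespan of the unique maximal smooth solution with data $(a,f)$. Building block: for the given $\nu$, a triple $(U,P,F)$ is fixed once and for all, where $F\in C_c^\infty(\mathbb R^3\times(0,\infty);\mathbb R^3)$, $U,P$ are smooth on $\mathbb R^3\times[0,1)$, $\partial_tU+(U\cdot\nabla)U-\nu\Delta U+\nabla P=F$, $\nabla\cdot U=0$, $U(\cdot,0)=0$ on $\mathbb R^3\times[0,1)$; there is a compact $K\subset\mathbb R^3$ containing $\operatorname{supp}U(\cdot,t)\cup\operatorname{supp}P(\cdot,t)$ for all $0\le t<1$; $\sup_{0\le t<1}\|U(t)\|_{L^2}<\infty$; and $\limsup_{t\uparrow1}\|U(t)\|_{L^\infty}=\infty$. (Existence of such a triple for every $\nu>0$ is a previously known theorem.) Put $M=\sup_{0\le t<1}\|U(t)\|_{L^2(\mathbb R^3)}$ and $D=\|\nabla U\|_{L^2((0,1)\times\mathbb R^3)}$. Norms: $\|z\|_{H^s(\mathbb T^3)}^2=\sum_k(1+4\pi^2|k|^2)^s|\widehat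 z(k)|^2$; $\|z\|_{E_T}=\|z\|_{L^\infty(0,T;L^2)}+\|\nabla z\|_{L^2(0,T;L^2)}$; $L^q(0,\infty;X)$ are Bochner norms; spatial norms are over $\mathbb T^3$. *)

(* Defs.v *)
From HB Require Import structures.
From mathcomp Require Import all_boot all_order all_algebra.
From mathcomp Require Import complex.
From mathcomp Require Import all_classical all_reals all_analysis.

Set Implicit Arguments.
Unset Strict Implicit.
Unset Printing Implicit Defensive.

Import Order.TTheory GRing.Theory Num.Theory.
Import numFieldNormedType.Exports.

Local Open Scope classical_set_scope.
Local Open Scope ring_scope.

Section Calculus.
Context {R : realType}.
Local Notation E := 'rV[R]_3.

Definition basis_vec (i : 'I_3) : E := delta_mx 0 i.

(* Only times in I are used: the time derivative is one-sided at an end point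
   that belongs to I. *)
Definition tquot {V : normedModType R} (f : R -> E -> V) (t : R) (x : E)
    (s : R) : V :=
  (s - t)^-1 *: (f s x - f t x).

Definition tderivable {V : normedModType R} (I : set R) (f : R -> E -> V)
    (t : R) (x : E) : Prop :=
  cvg (tquot f t x s @[s --> within I t^']).

Definition dt {V : normedModType R} (I : set R) (f : R -> E -> V)
    (t : R) (x : E) : V :=
  lim (tquot f t x s @[s --> within I t^']).

Definition dx {V : normedModType R} (i : 'I_3) (z : E -> V) (x : E) : V :=
  'D_(basis_vec i) z x.

(* All mixed partial derivatives of order <= n in (t, x) exist and are
   continuous on I x R^3. *)
Fixpoint Cn {V : normedModType R} (I : set R) (n : nat) (f : R -> E -> V) :
    Prop :=
  {within I `*` [set: E], continuous (fun q : R * E => f q.1 q.2)} /\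
  (if n is m.+1 then
     [/\ forall t x, I t -> tderivable I f t x,
         forall t x i, I t -> derivable (f t) x (basis_vec i),
         Cn I m (dt I f)
       & forall i, Cn I m (fun t => dx i (f t))]
   else True).

Definition smooth_on {V : normedModType R} (I : set R) (f : R -> E -> V) :
    Prop :=
  forall n, Cn I n f.

Definition dot (x y : E) : R := \sum_i x 0 i * y 0 i.

(* The Euclidean norm; the library norm of 'rV[R]_3 is the max norm. *)
Definition enorm (x : E) : R := Num.sqrt (dot x x).

Definition div (z : E -> E) (x : E) : R := \sum_i (dx i z x) 0 i.

Definition grad (q : E -> R) (x : E) : E := \row_i dx i q x.

Definition laplacian (z : E -> E) (x : E) : E := \sum_i dx i (dx i z) x.

(* (w . nabla) z *)
Definition advect (w z : E -> E) (x : E) : E := \sum_i (w x 0 i) *: dx i z x.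

(* |nabla z|, the Frobenius norm of the Jacobian matrix *)
Definition grad_norm (z : E -> E) (x : E) : R :=
  Num.sqrt (\sum_i enorm (dx i z x) ^+ 2).

Definition supp {V : normedModType R} (z : E -> V) : set E :=
  closure [set x | z x != 0].

Definition int_vec (k : 'rV[int]_3) : E := map_mx intr k.

Definition periodic {V : Type} (z : E -> V) : Prop :=
  forall (x : E) (k : 'rV[int]_3), z (x + int_vec k) = z x.

(* The preimage in R^3 of the ball of T^3 with centre x0 and radius r. *)
Definition torus_ball (x0 : E) (r : R) : set E :=
  [set x | exists k : 'rV[int]_3, enorm (x + int_vec k - x0) < r].

End Calculus.

Section Norms.
Context {R : realType}.
Local Notation E := 'rV[R]_3.
Local Notation leb := (@lebesgue_measure R).

Definition vec3 (x : R * R * R) : E :=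
  \row_(i < 3) [:: x.1.1; x.1.2; x.2]`_i.

Definition leb3 := ((leb \x leb) \x leb)%E.

(* Fields on T^3 = R^3/Z^3 are Z^3-periodic functions on R^3, integrated over
   this fundamental domain. *)
Definition cell : set (R * R * R) :=
  [set x | [/\ 0 <= x.1.1 < 1, 0 <= x.1.2 < 1 & 0 <= x.2 < 1]].

Definition int_T3 (h : E -> R) : R := (\int[leb3]_(x in cell) h (vec3 x))%R.

Definition Lp_on (D : set (R * R * R)) (p : \bar R) (h : E -> R) : \bar R :=
  'N[leb3]_p[(fun x => (h (vec3 x))%:E) \_ D].

Definition Lp_R3 (p : \bar R) (z : E -> E) : \bar R :=
  Lp_on setT p (fun x => enorm (z x)).

Definition Lp_T3 (p : \bar R) (z : E -> E) : \bar R :=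
  Lp_on cell p (fun x => enorm (z x)).

(* The Bochner norm of L^q(J; X), for a field with X-norm h t at time t. *)
Definition Lq_time (J : set R) (q : \bar R) (h : R -> \bar R) : \bar R :=
  'N[leb]_q[h \_ J].

Definition energy_norm (T : R) (z : R -> E -> E) : \bar R :=
  let J := [set t : R | 0 < t < T] in
  (Lq_time J +oo (fun t => Lp_T3 2%:E (z t)) +
   Lq_time J 2%:E (fun t => Lp_on cell 2%:E (grad_norm (z t))))%E.

Definition LqLp_norm (q p : \bar R) (z : R -> E -> E) : \bar R :=
  Lq_time `]0, +oo[ q (fun t => Lp_T3 p (z t)).

Definition fourier (z : E -> E) (k : 'rV[int]_3) (j : 'I_3) : R[i] :=
  let phase x := 2 * pi * dot (int_vec k) x in
  Complex (int_T3 (fun x => z x 0 j * cos (phase x)))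
          (- int_T3 (fun x => z x 0 j * sin (phase x))).

Definition Hs_norm (s : R) (z : E -> E) : \bar R :=
  let term k : R := (1 + 4 * pi ^+ 2 * enorm (int_vec k) ^+ 2) `^ s *
                    (\sum_j Normc.normc (fourier z k j) ^+ 2) in
  ((\esum_(k in [set: 'rV[int]_3]) (term k)%:E)%R `^ 2^-1)%E.

Definition L1Hs_norm (s : R) (z : R -> E -> E) : \bar R :=
  Lq_time `]0, +oo[ 1%:E (fun t => Hs_norm s (z t)).

Definition supL2 (U : R -> E -> E) : \bar R :=
  ereal_sup [set Lp_R3 2%:E (U t) | t in (`[0, 1[ : set R)].

Definition gradL2 (U : R -> E -> E) : \bar R :=
  'N[(leb3 \x leb)%E]_2%:E[
    (fun xt => (grad_norm (U xt.2) (vec3 xt.1))%:E) \_ (setT `*` `]0, 1[)].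

End Norms.

Section NavierStokes.
Context {R : realType}.
Local Notation E := 'rV[R]_3.

Definition NS_eqns (nu : R) (I : set R) (f u : R -> E -> E) (p : R -> E -> R) :
    Prop :=
  forall t x, I t ->
    dt I u t x + advect (u t) (u t) x - nu *: laplacian (u t) x + grad (p t) x
      = f t x /\
    div (u t) x = 0.

Record NS_solution (nu : R) (I : set R) (a : E -> E) (f u : R -> E -> E)
    (p : R -> E -> R) : Prop := {
  NS_smooth_u : smooth_on I u ;
  NS_smooth_p : smooth_on I p ;
  NS_periodic_u : forall t, I t -> periodic (u t) ;
  NS_periodic_p : forall t, I t -> periodic (p t) ;
  NS_mean_p : forall t, I t -> int_T3 (p t) = 0 ;
  NS_equations : NS_eqns nu I f u p ;
  NS_initial : u 0 = a }.

Definition velocity_space (a : E -> E) : Prop :=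
  [/\ smooth_on setT (fun _ : R => a), periodic a & forall x, div a x = 0].

(* C_c^oo(T^3 x (0, oo)), its elements being extended by 0 to t <= 0 *)
Definition force_space (f : R -> E -> E) : Prop :=
  [/\ smooth_on setT f, forall t, periodic (f t)
    & exists K : set R, [/\ compact K, K `<=` `]0, +oo[
        & forall t x, ~ K t -> f t x = 0]].

(* Smooth solutions with the same data agree on their common interval, so this
   supremum is the lifespan of the maximal one. *)
Definition Tmax (nu : R) (a : E -> E) (f : R -> E -> E) : \bar R :=
  ereal_sup [set tau%:E | tau in
    [set tau : R | 0 < tau /\ exists u p, NS_solution nu `[0, tau[ a f u p]].

Record building_block (nu : R) (U : R -> E -> E) (P : R -> E -> R)
    (F : R -> E -> E) : Prop := {
  bb_smooth_F : smooth_on setT F ;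
  bb_supp_F : exists K : set (R * E), [/\ compact K,
    K `<=` `]0, +oo[ `*` setT & forall t x, ~ K (t, x) -> F t x = 0] ;
  bb_smooth_U : smooth_on `[0, 1[ U ;
  bb_smooth_P : smooth_on `[0, 1[ P ;
  bb_equations : NS_eqns nu `[0, 1[ F U P ;
  bb_initial : forall x, U 0 x = 0 ;
  bb_supp : exists K : set E, compact K /\
    forall t, 0 <= t < 1 -> supp (U t) `|` supp (P t) `<=` K ;
  bb_L2 : (supL2 U < +oo)%E ;
  bb_blowup : limf_esup (fun t => Lp_R3 +oo (U t)) (1 : R)^'- = +oo%E }.

(* alpha(p, q) = -3 + 3/p + 2/q, with 1/oo = 0 *)
Definition alpha (p q : \bar R) : R :=
  -3 + 3 * fine (p^-1)%E + 2 * fine (q^-1)%E.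

End NavierStokes.

(* Main.v *)
From HB Require Import structures.
From mathcomp Require Import all_boot all_order all_algebra.
From mathcomp Require Import complex.
From mathcomp Require Import all_classical all_reals all_analysis.
From mathcomp Require Import ess_sup_inf measurable_realfun.
From mathcomp Require Import ring lra zify.
Require Import Defs.

(** The equations are invariant under the scaling
    [U_e t x = e^-1 *: U (1 + (t - T) / e ^+ 2) (e^-1 *: (x - y))], which moves
    the singularity of the building block to [(T, y)], multiplies its energy
    norm by [e ^ (1 / 2)] and its force by [e ^- 3]. It remains to superpose
    the rescaled block and the given flow [v] without interaction.

    Near [(T, y)] the solenoidal field [v] is the curl of a vector potential that
    is linear in [x - y] with smooth coefficients ([curl_potential]). Cutting
    this potential off at scale [e] gives the [corrector]: a solenoidal field,
    bounded uniformly in [e], supported where [|t - T| <= 3 / 2 * e ^+ 2] and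
    [x - y = O(e)], and equal to [v] around the support of the block. Hence in
    [v - corrector + U_e] the block and the rest have disjoint supports
    ([glued_dichotomy]), all cross terms of the nonlinearity vanish, and the
    momentum equation holds with a force that differs from [g] by the explicit
    [force_diff] ([glued_momentum]). For [U_e] to be defined at all times before
    [T] the block is first multiplied by a ramp in time, which changes its force
    by a smooth compactly supported term ([ramp_force]). Since the modification
    takes place well inside the cell, the result extends periodically
    ([periodize_local]).

    The corrector and the change of force belong to the class [oscillating] of
    sums of bumps seen at scale [e] times smooth functions, with amplitude
    [e ^ (1 - o)]; derivatives in space and time raise the order [o] by 1 and 2.
    The corrector has order 1 and the force order 4, and sizes of supports turn
    this into the bounds in [L^q L^p] and, for the corrector, into the error
    [e ^ (3 / 2)] of the energy norm. For the Sobolev norms the weight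
    [(1 + 4 pi^2 |k|^2)^s] is split at [e ^- 2] into multiples of 1 and of
    [1 + 4 pi^2 |k|^2], so that Bessel's inequality for the force and its gradient
    suffices ([Hs_bound]); a negative exponent is compared with exponent 0.

    The supremum norm of the block scales by [e^-1], and where the block lives
    it is the whole velocity, so the solution blows up at [T]
    ([velocity_blowup]). Its lifespan is exactly [T]: by the energy method smooth
    solutions with the same data agree ([smooth_solutions_agree]), and a solution
    beyond [T] would be bounded near [T] ([velocity_lifespan]). *)

Set Implicit Arguments.
Unset Strict Implicit.
Unset Printing Implicit Defensive.

Import Order.TTheory GRing.Theory Num.Theory.
Import numFieldNormedType.Exports.

Local Open Scope classical_set_scope.
Local Open Scope ring_scope.

(** * Calculus of functions of time and space *)

Section SmoothCalculus.
Context {R : realType}.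
Local Notation E := 'rV[R]_3.
Implicit Types (I J : set R) (t : R) (x : E).

Definition has_dt {V : normedModType R} I (f : R -> E -> V) t x (l : V) : Prop :=
  tquot f t x s @[s --> within I t^'] --> l.

(** No point of [I] is isolated, so that time derivatives on [I] are unique. *)
Definition time_set I := forall t, I t -> ProperFilter (within I t^').

Definition joint_cont {V : normedModType R} I (f : R -> E -> V) :=
  forall t x, I t ->
    f q.1 q.2 @[q --> within (I `*` [set: E]) (nbhs (t, x))] --> f t x.

Lemma joint_contP {V : normedModType R} I (f : R -> E -> V) :
  {within I `*` [set: E], continuous (fun q : R * E => f q.1 q.2)} <->
  joint_cont I f.
Proof.
split => [/subspace_continuousP H t x It|H].
  by apply: (H (t, x)); split.
by apply/subspace_continuousP => -[t x] [/= It _]; exact: H.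
Qed.

Lemma has_dt_uniq {V : normedModType R} I (f : R -> E -> V) t x l :
  time_set I -> I t -> has_dt I f t x l -> dt I f t x = l.
Proof.
by move=> tI It fl; apply: cvg_lim => //; exact: (tI _ It).
Qed.

Lemma tderivableP {V : normedModType R} I (f : R -> E -> V) t x :
  tderivable I f t x -> has_dt I f t x (dt I f t x).
Proof. by []. Qed.

Lemma has_dt_tderivable {V : normedModType R} I (f : R -> E -> V) t x l :
  has_dt I f t x l -> tderivable I f t x.
Proof. by move=> fl; apply/cvg_ex; exists l. Qed.

Lemma within_dnbhs_local I J t (P : set R) : (\forall s \near t, I s <-> J s) ->
  within I t^' P -> within J t^' P.
Proof.
move=> IJ; rewrite /within /= => H.
have IJ' : \forall s \near t^', I s <-> J s by exact: (nbhs_dnbhs IJ).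
by apply: filterS2 H IJ' => s Hs Is Js; apply: Hs; apply/Is.
Qed.

Lemma within_dnbhs_localE I J t : (\forall s \near t, I s <-> J s) ->
  within I t^' = within J t^'.
Proof.
move=> IJ; apply/seteqP; split => P; apply: within_dnbhs_local => //.
by apply: filterS IJ => s; tauto.
Qed.

Lemma near_slice_t t x (P : set (R * E)) : (\forall z \near (t, x), P z) ->
  \forall s \near t, P (s, x).
Proof.
move=> -[[A B] [/= tA xB] AB]; apply: filterS tA => s As.
by apply: AB; split => //=; exact: nbhs_singleton.
Qed.

Lemma near_slice_x t x (P : set (R * E)) : (\forall z \near (t, x), P z) ->
  \forall y \near x, P (t, y).
Proof.
move=> -[[A B] [/= tA xB] AB]; apply: filterS xB => s As.
by apply: AB; split => //=; exact: nbhs_singleton.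
Qed.

Lemma near_time t x (P : set R) : (\forall s \near t, P s) ->
  \forall z \near (t, x), P z.1.
Proof. by move=> H; exists (P, setT) => /=; [split => //; exact: filterT|case=> a b []]. Qed.

Lemma has_dt_local {V : normedModType R} I J (f g : R -> E -> V) t x l :
  I t -> (\forall s \near t, I s <-> J s) ->
  (\forall s \near t, I s -> f s x = g s x) ->
  has_dt J g t x l -> has_dt I f t x l.
Proof.
move=> It IJ fg; rewrite /has_dt (within_dnbhs_localE IJ) => H.
have E0 : f t x = g t x by apply: (nbhs_singleton fg).
apply: cvg_trans H; apply: near_eq_cvg; rewrite /within /=.
have fg' := nbhs_dnbhs fg; have IJ' := nbhs_dnbhs IJ.
apply: filterS2 fg' IJ' => s Hs IJs Js.
by rewrite /tquot E0 Hs//; apply/IJs.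
Qed.

Lemma dt_local {V : normedModType R} I J (f g : R -> E -> V) t x :
  I t -> (\forall s \near t, I s <-> J s) ->
  (\forall s \near t, I s -> f s x = g s x) ->
  dt I f t x = dt J g t x.
Proof.
move=> It IJ fg; rewrite /dt (within_dnbhs_localE IJ); congr (lim _).
have E0 : f t x = g t x by apply: (nbhs_singleton fg).
have E1 : {near within J t^', tquot f t x =1 tquot g t x}.
  rewrite /within /=.
  apply: filterS2 (nbhs_dnbhs fg) (nbhs_dnbhs IJ) => s Hs IJs Js.
  by rewrite /tquot E0 Hs//; apply/IJs.
apply/seteqP; split; apply: near_eq_cvg => //.
by apply: filterS E1.
Qed.

Lemma dx_local {V : normedModType R} i (f g : E -> V) x :
  (\forall y \near x, f y = g y) -> dx i f x = dx i g x.
Proof. by move=> fg; apply: near_eq_derive. Qed.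

Lemma derivable_local {V : normedModType R} i (f g : E -> V) x :
  (\forall y \near x, f y = g y) -> derivable g x (basis_vec i) ->
  derivable f x (basis_vec i).
Proof. by move=> fg; apply: near_eq_derivable; apply: filterS fg. Qed.

Lemma joint_cont_local {V : normedModType R} I J (f g : R -> E -> V) t x :
  I t -> (\forall s \near t, I s <-> J s) ->
  (\forall z \near (t, x), I z.1 -> f z.1 z.2 = g z.1 z.2) ->
  joint_cont J g ->
  f q.1 q.2 @[q --> within (I `*` [set: E]) (nbhs (t, x))] --> f t x.
Proof.
move=> It IJ fg cg; have Jt : J t by apply/(nbhs_singleton IJ).
have -> : f t x = g t x by exact: (nbhs_singleton fg).
move=> A /(cg t x Jt) gA.
have {}gA : \forall z \near (t, x), (J `*` [set: E]) z -> A (g z.1 z.2) by [].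
suff : \forall z \near (t, x), (I `*` [set: E]) z -> A (f z.1 z.2) by [].
apply: filterS3 gA (near_time x IJ) fg => z gA IJz fg [/= Iz _].
by rewrite fg//; apply: gA; split => //; apply/IJz.
Qed.

Lemma Cn0P {V : normedModType R} I (f : R -> E -> V) :
  Cn I 0 f <-> joint_cont I f.
Proof. by split => [[/joint_contP]//|/joint_contP]. Qed.

Lemma CnSP {V : normedModType R} n I (f : R -> E -> V) :
  Cn I n.+1 f <-> [/\ joint_cont I f, forall t x, I t -> tderivable I f t x,
    forall t x i, I t -> derivable (f t) x (basis_vec i),
    Cn I n (dt I f) & forall i, Cn I n (fun t => dx i (f t))].
Proof.
split; first by move=> [/joint_contP cf [d1 d2 d3 d4]].
by move=> [/joint_contP cf d1 d2 d3 d4].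
Qed.

(** Smoothness is local in time and space, and depends on [f] only through its
    values at times of [I]: this one statement gives restriction, extension by
    zero and gluing. *)
Lemma Cn_local {V : normedModType R} n I (f : R -> E -> V) :
  (forall t x, I t -> exists J (g : R -> E -> V), [/\ Cn J n g,
     \forall s \near t, I s <-> J s &
     \forall z \near (t, x), I z.1 -> f z.1 z.2 = g z.1 z.2]) ->
  Cn I n f.
Proof.
elim: n I f => [|n IHn] I f H.
  apply/Cn0P => t x It.
  have [J [g [/Cn0P cg IJ fg]]] := H t x It.
  exact: joint_cont_local cg.
apply/CnSP; split.
- move=> t x It.
  have [J [g [/CnSP[cg _ _ _ _] IJ fg]]] := H t x It.
  exact: joint_cont_local cg.
- move=> t x It; have [J [g [/CnSP[_ dg _ _ _] IJ fg]]] := H t x It.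
  have Jt : J t by apply/(nbhs_singleton IJ).
  apply: has_dt_tderivable; apply: (has_dt_local It IJ (near_slice_t fg)).
  exact: tderivableP (dg _ _ Jt).
- move=> t x i It; have [J [g [/CnSP[_ _ dg _ _] IJ fg]]] := H t x It.
  have Jt : J t by apply/(nbhs_singleton IJ).
  apply: (derivable_local _ (dg _ _ i Jt)).
  by apply: filterS (near_slice_x fg) => y; apply.
- apply: IHn => t x It; have [J [g [/CnSP[_ _ _ dg _] IJ fg]]] := H t x It.
  exists J, (dt J g); split => //.
  have IJ' := near_time x (near_join IJ); have fg' := near_join fg.
  near=> z => Iz; apply: dt_local => //; first by near: z.
  apply: (@near_slice_t z.1 z.2 (fun w => I w.1 -> f w.1 w.2 = g w.1 w.2)).
  by rewrite -surjective_pairing; near: z; exact: fg'.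
- move=> i; apply: IHn => t x It.
  have [J [g [/CnSP[_ _ _ _ dg] IJ fg]]] := H t x It.
  exists J, (fun t => dx i (g t)); split => //.
  have fg' := near_join fg.
  near=> z => Iz; apply: dx_local.
  have : \forall w \near (z.1, z.2), I w.1 -> f w.1 w.2 = g w.1 w.2.
    by rewrite -surjective_pairing; near: z; exact: fg'.
  by move=> /near_slice_x; apply: filterS => y; apply.
Unshelve. all: by end_near. Qed.

Lemma Cn_cont {V : normedModType R} n I (f : R -> E -> V) : Cn I n f -> joint_cont I f.
Proof. by case: n => [|n]; [move/Cn0P|case/CnSP]. Qed.

Lemma Cn_ext {V : normedModType R} n I (f g : R -> E -> V) :
  (forall t x, I t -> f t x = g t x) -> Cn I n g -> Cn I n f.
Proof.
move=> fg gn; apply: Cn_local => t x It; exists I, g; split => //.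
  exact: (@filterE _ (nbhs t)).
by apply: (@filterE _ (nbhs (t, x))) => z Iz; exact: fg.
Qed.

(** Smoothness is established by exhibiting the derivatives: the limits that
    define [dt] and [dx] are unique, hence equal to them. *)
Lemma CnS {V : normedModType R} n I (f ft : R -> E -> V) (fx : 'I_3 -> R -> E -> V) :
  time_set I -> joint_cont I f ->
  (forall t x, I t -> has_dt I f t x (ft t x)) ->
  (forall t x i, I t -> is_derive x (basis_vec i) (f t) (fx i t x)) ->
  Cn I n ft -> (forall i, Cn I n (fx i)) -> Cn I n.+1 f.
Proof.
move=> tI cf dft dfx nft nfx; apply/CnSP; split => //.
- by move=> t x It; exact: has_dt_tderivable (dft t x It).
- by move=> t x i It; have [] := dfx t x i It.
- apply: Cn_ext nft => t x It; apply: has_dt_uniq => //; exact: dft.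
- move=> i; apply: Cn_ext (nfx i) => t x It.
  by have [_ <-] := dfx t x i It.
Qed.

Lemma CnW {V : normedModType R} n I (f : R -> E -> V) : Cn I n.+1 f -> Cn I n f.
Proof.
elim: n I f => [|n IHn] I f /CnSP[cf d1 d2 d3 d4]; first exact/Cn0P.
by apply/CnSP; split => //; [exact: IHn|move=> i; apply: IHn; exact: d4].
Qed.

Section CnSucc.
Context {V : normedModType R} (n : nat) (I : set R) (f : R -> E -> V).
Hypothesis fn : Cn I n.+1 f.

Lemma Cn_has_dt t x : I t -> has_dt I f t x (dt I f t x).
Proof. by move=> It; case/CnSP : fn => _ d1 _ _ _; exact: d1. Qed.

Lemma Cn_is_derive t x i : I t -> is_derive x (basis_vec i) (f t) (dx i (f t) x).
Proof. by move=> It; case/CnSP : fn => _ _ /(_ t x i It) d2 _ _; exact: DeriveDef. Qed.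

Lemma Cn_dt : Cn I n (dt I f).
Proof. by case/CnSP : fn. Qed.

Lemma Cn_dx i : Cn I n (fun t => dx i (f t)).
Proof. by case/CnSP : fn => _ _ _ _. Qed.
End CnSucc.

Lemma time_setT : time_set setT.
Proof.
move=> t _; rewrite (_ : within setT t^' = t^'); first exact: Proper_dnbhs_numFieldType.
by apply/seteqP; split => P; rewrite /within /=; apply: filterS => x; tauto.
Qed.

Section linear_comp.
Context {V W : normedModType R} (L : {linear V -> W}).
Hypothesis cL : continuous L.

Lemma has_dt_lin I (f : R -> E -> V) t x l :
  has_dt I f t x l -> has_dt I (fun t x => L (f t x)) t x (L l).
Proof.
move=> H; rewrite /has_dt (_ : tquot _ _ _ = L \o tquot f t x).
  by apply: continuous_cvg => //; exact: cL.
by apply/funext => s; rewrite /tquot /= -linearB -linearZ_LR.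
Qed.

Lemma is_derive_lin (f : E -> V) x v l :
  is_derive x v f l -> is_derive x v (L \o f) (L l).
Proof.
move=> [df <-].
suff H : h^-1 *: (((L \o f) \o shift x) (h *: v) - (L \o f) x) @[h --> 0^'] --> L ('D_v f x).
  split; first by apply/cvg_ex; exists (L ('D_v f x)).
  exact: cvg_lim.
rewrite (_ : (fun h => _) = L \o (fun h => h^-1 *: ((f \o shift x) (h *: v) - f x))).
  by apply: continuous_cvg => //; exact: cL.
by apply/funext => s /=; rewrite -linearB -linearZ_LR.
Qed.

Lemma Cn_lin n I (f : R -> E -> V) : time_set I ->
  Cn I n f -> Cn I n (fun t x => L (f t x)).
Proof.
move=> tI; elim: n f => [|n IHn] f fn.
  apply/Cn0P => t x It.
  apply: (@continuous_cvg _ _ _ _ _ _ L); first exact: cL.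
  exact: Cn_cont fn _ _ It.
apply: (@CnS _ n _ _ (fun t x => L (dt I f t x)) (fun i t x => L (dx i (f t) x))) => //.
- move=> t x It; apply: (@continuous_cvg _ _ _ _ _ _ L); first exact: cL.
  exact: Cn_cont fn _ _ It.
- by move=> t x It; apply: has_dt_lin; exact: Cn_has_dt fn _ _ It.
- by move=> t x i It; apply: is_derive_lin; exact: Cn_is_derive fn _ _ _ It.
- by apply: IHn; exact: Cn_dt.
- by move=> i; apply: IHn; exact: (Cn_dx fn i).
Qed.
End linear_comp.

Lemma has_dtD {V : normedModType R} I (f g : R -> E -> V) t x l m :
  has_dt I f t x l -> has_dt I g t x m ->
  has_dt I (fun t x => f t x + g t x) t x (l + m).
Proof.
move=> fl gm; rewrite /has_dt (_ : tquot _ _ _ = tquot f t x \+ tquot g t x).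
  exact: cvgD.
by apply/funext => s; rewrite /tquot /= -scalerDr opprD addrACA.
Qed.

Lemma Cn_add {V : normedModType R} n I (f g : R -> E -> V) : time_set I ->
  Cn I n f -> Cn I n g -> Cn I n (fun t x => f t x + g t x).
Proof.
move=> tI; elim: n f g => [|n IHn] f g fn gn.
  apply/Cn0P => t x It.
  by apply: cvgD; [exact: Cn_cont fn _ _ It|exact: Cn_cont gn _ _ It].
apply: (@CnS _ n _ _ (fun t x => dt I f t x + dt I g t x)
                     (fun i t x => dx i (f t) x + dx i (g t) x)) => //.
- move=> t x It.
  by apply: cvgD; [exact: Cn_cont fn _ _ It|exact: Cn_cont gn _ _ It].
- by move=> t x It; apply: has_dtD; [exact: Cn_has_dt fn _ _ It|exact: Cn_has_dt gn _ _ It].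
- move=> t x i It; apply: is_deriveD; [exact: Cn_is_derive fn _ _ _ It|exact: Cn_is_derive gn _ _ _ It].
- by apply: IHn; exact: Cn_dt.
- by move=> i; apply: IHn; [exact: (Cn_dx fn i)|exact: (Cn_dx gn i)].
Qed.

Lemma Cn_cst {V : normedModType R} n I (v : V) : time_set I -> Cn I n (fun _ _ => v).
Proof.
move=> tI; elim: n v => [|n IHn] v.
  by apply/Cn0P => t x It; exact: cvg_cst.
apply: (@CnS _ n _ _ (fun _ _ => 0) (fun _ _ _ => 0)) => //.
- by move=> t x It; exact: cvg_cst.
- move=> t x It; rewrite /has_dt (_ : tquot _ _ _ = cst 0); first exact: cvg_cst.
  by apply/funext => s; rewrite /tquot subrr scaler0.
Qed.

Section scalar_product_rule.
Implicit Types (f g : R -> E -> R).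

Lemma joint_cont_time {V : normedModType R} I (f : R -> E -> V) t x :
  joint_cont I f -> I t -> f s x @[s --> within I t^'] --> f t x.
Proof.
move=> cf It A /(cf t x It) fA.
have {}fA : \forall z \near (t, x), (I `*` [set: E]) z -> A (f z.1 z.2) by [].
have /nbhs_dnbhs {}fA := near_slice_t fA.
suff : \forall s \near t^', I s -> A (f s x) by [].
by apply: filterS fA => s H Is; apply: H; split.
Qed.

Lemma has_dtM I f g t x l m : I t -> joint_cont I g ->
  has_dt I f t x l -> has_dt I g t x m ->
  has_dt I (fun t x => f t x * g t x) t x (l * g t x + f t x * m).
Proof.
move=> It cg fl gm.
rewrite /has_dt (_ : tquot _ _ _ = (fun s => tquot f t x s * g s x + f t x * tquot g t x s)).
  apply: cvgD; first by apply: cvgM => //; exact: joint_cont_time.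
  by apply: cvgM => //; exact: cvg_cst.
apply/funext => s; rewrite /tquot /=  /GRing.scale /=.
ring.
Qed.

Lemma Cn_mul n I f g : time_set I ->
  Cn I n f -> Cn I n g -> Cn I n (fun t x => f t x * g t x).
Proof.
move=> tI; elim: n f g => [|n IHn] f g fn gn.
  apply/Cn0P => t x It.
  by apply: cvgM; [exact: Cn_cont fn _ _ It|exact: Cn_cont gn _ _ It].
have fn' := CnW fn; have gn' := CnW gn.
apply: (@CnS _ n _ _ (fun t x => dt I f t x * g t x + f t x * dt I g t x)
          (fun i t x => dx i (f t) x * g t x + f t x * dx i (g t) x)) => //.
- move=> t x It.
  by apply: cvgM; [exact: Cn_cont fn _ _ It|exact: Cn_cont gn _ _ It].
- move=> t x It; apply: has_dtM => //; first exact: Cn_cont gn.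
    exact: Cn_has_dt fn _ _ It.
  exact: Cn_has_dt gn _ _ It.
- move=> t x i It.
  have df := Cn_is_derive fn x i It; have dg := Cn_is_derive gn x i It.
  have := is_deriveM df dg; move=> /is_derive_eq; apply.
  by rewrite addrC mulrC.
- by apply: Cn_add => //; apply: IHn => //; exact: Cn_dt.
- by move=> i; apply: Cn_add => //; apply: IHn => //;
    [exact: (Cn_dx fn i)|exact: (Cn_dx gn i)].
Qed.

End scalar_product_rule.

End SmoothCalculus.

Section SmoothComposition.
Context {R : realType}.
Local Notation E := 'rV[R]_3.
Implicit Types (I J : set R) (t : R) (x c d : E).

Lemma row_delta_sum x : x = \sum_j x 0 j *: basis_vec j.
Proof. by rewrite {1}(row_sum_delta x). Qed.

Lemma cvg_row {T : Type} (F : set_system T) {FF : Filter F} (f : T -> E) (l : E) :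
  (forall j, f y 0 j @[y --> F] --> l 0 j) -> f y @[y --> F] --> l.
Proof.
move=> H; rewrite [l]row_delta_sum.
rewrite (_ : f = fun y => \sum_j f y 0 j *: basis_vec j); last first.
  by apply/funext => y; rewrite {1}[f y]row_delta_sum.
apply: cvg_big => [|j _]; first exact: add_continuous.
by apply: cvgZ; [exact: H|exact: cvg_cst].
Qed.

Lemma is_derive_line {V : normedModType R} (f : E -> V) x v l :
  is_derive x v f l <-> is_derive (0 : R) 1 (fun h : R => f (h *: v + x)) l.
Proof.
have e : (fun h : R => h^-1 *: ((f \o shift x) (h *: v) - f x)) =
  (fun h : R => h^-1 *: (((fun h : R => f (h *: v + x)) \o shift 0) (h *: 1) -
     (fun h : R => f (h *: v + x)) 0)).
  by apply/funext => h /=; rewrite addr0 scale0r add0r /GRing.scale /= mulr1.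
by split => -[d <-]; split; rewrite /derivable /derive ?e // -?e.
Qed.

(** Affine maps acting separately on each coordinate: composition with them
    rescales each partial derivative without mixing them. *)
Definition coord_affine c d x : E := \row_j (c 0 j + d 0 j * x 0 j).

Lemma coord_affine_continuous c d : continuous (coord_affine c d).
Proof.
move=> x; apply: (@cvg_row _ (nbhs x)) => j; rewrite mxE.
under eq_fun do rewrite mxE.
apply: cvgD; first exact: cvg_cst.
apply: cvgM; first exact: cvg_cst.
exact: coord_continuous.
Qed.

Lemma coord_affine_shift c d x i (h : R) :
  coord_affine c d (h *: basis_vec i + x) = (d 0 i * h) *: basis_vec i + coord_affine c d x.
Proof.
apply/rowP => j; rewrite !mxE eqxx /=.
have [->|] := eqVneq j i; first by rewrite /=; ring.
by rewrite /= => _; ring.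
Qed.

Lemma is_derive_coord_affine (g : E -> R) c d x i l :
  is_derive (coord_affine c d x) (basis_vec i) g l ->
  is_derive x (basis_vec i) (g \o coord_affine c d) (d 0 i * l).
Proof.
move=> /is_derive_line H; apply/is_derive_line => /=.
rewrite (_ : (fun _ => _) = (fun h : R => g (h *: basis_vec i + coord_affine c d x)) \o
   (fun h => d 0 i * h)); last by apply/funext => h /=; rewrite coord_affine_shift.
rewrite mulrC; apply: is_derive1_comp; first by rewrite mulr0.
have := @is_deriveZ R R R id (d 0 i) 0 1 1 (is_derive_id _ _).
by rewrite /GRing.scale /= mulr1.
Qed.

Lemma has_dt_affine I J (f : R -> E -> R) c d (al be : R) t x l : al != 0 ->
  (forall s, I s -> J (al * s + be)) ->
  has_dt J f (al * t + be) (coord_affine c d x) l ->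
  has_dt I (fun t x => f (al * t + be) (coord_affine c d x)) t x (al * l).
Proof.
move=> al0 IJ H; rewrite /has_dt.
rewrite (_ : tquot _ _ _ = fun s => al *: tquot f (al * t + be) (coord_affine c d x) (al * s + be)).
  apply: cvgZr; move=> A /H HA.
  have {}HA : \forall r \near (al * t + be), r != al * t + be -> J r ->
    A (tquot f (al * t + be) (coord_affine c d x) r) by [].
  suff : \forall s \near t, s != t -> I s ->
    A (tquot f (al * t + be) (coord_affine c d x) (al * s + be)) by [].
  have ca : al * s + be @[s --> t] --> al * t + be.
    apply: cvgD; last exact: cvg_cst.
    by apply: cvgM => //; exact: cvg_cst.
  have {}ca := ca _ HA.
  have {}ca : \forall s \near t, al * s + be != al * t + be -> J (al * s + be) ->
    A (tquot f (al * t + be) (coord_affine c d x) (al * s + be)) by [].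
  apply: filterS ca => s Hs st Is; apply: Hs; last exact: IJ.
  by apply: contra st => /eqP /addIr /(mulfI al0) ->.
apply/funext => s; rewrite /tquot scalerA; congr (_ *: _).
rewrite (_ : al * s + be - (al * t + be) = al * (s - t)); last by ring.
by rewrite invfM mulrA divff// mul1r.
Qed.

Lemma joint_cont_affine {V : normedModType R} I J (f : R -> E -> V) c d (al be : R) :
  (forall s, I s -> J (al * s + be)) -> joint_cont J f ->
  joint_cont I (fun t x => f (al * t + be) (coord_affine c d x)).
Proof.
move=> IJ cf t x It A /(cf _ (coord_affine c d x) (IJ _ It)) HA.
have {}HA : \forall z \near (al * t + be, coord_affine c d x),
  (J `*` [set: E]) z -> A (f z.1 z.2) by [].
suff : \forall z \near (t, x), (I `*` [set: E]) z ->
   A (f (al * z.1 + be) (coord_affine c d z.2)) by [].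
have ca : (al * z.1 + be, coord_affine c d z.2) @[z --> (t, x)] -->
          (al * t + be, coord_affine c d x).
  have H1 : al * z.1 + be @[z --> (t, x)] --> al * t + be.
    apply: cvgD; last exact: cvg_cst.
    by apply: cvgM => //; [exact: cvg_cst|exact: cvg_fst].
  have H2 : coord_affine c d z.2 @[z --> (t, x)] --> coord_affine c d x.
    apply: (@continuous_cvg _ _ _ _ _ _ (coord_affine c d)).
      exact: coord_affine_continuous.
    exact: cvg_snd.
  exact: cvg_pair H1 H2.
have {}ca := ca _ HA.
have {}ca : \forall z \near (t, x), (J `*` [set: E]) (al * z.1 + be, coord_affine c d z.2) ->
    A (f (al * z.1 + be) (coord_affine c d z.2)) by [].
by apply: filterS ca => z Hz [/= Iz _]; apply: Hz; split => //=; exact: IJ.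
Qed.

Lemma Cn_affine n I J (f : R -> E -> R) c d (al be : R) : al != 0 -> time_set I ->
  (forall s, I s -> J (al * s + be)) -> Cn J n f ->
  Cn I n (fun t x => f (al * t + be) (coord_affine c d x)).
Proof.
move=> al0 tI IJ; elim: n f => [|n IHn] f fn.
  by apply/Cn0P; apply: joint_cont_affine IJ _; exact: Cn_cont fn.
apply: (@CnS _ _ n _ _ (fun t x => al * (dt J f (al * t + be) (coord_affine c d x)))
  (fun i t x => d 0 i * dx i (f (al * t + be)) (coord_affine c d x))) => //.
- by apply: joint_cont_affine IJ _; exact: Cn_cont fn.
- move=> t x It; apply: has_dt_affine => //; first exact: IJ.
  by apply: (Cn_has_dt fn); exact: IJ.
- move=> t x i It; apply: (@is_derive_coord_affine (f (al * t + be))).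
  by apply: (Cn_is_derive fn); exact: IJ.
- apply: Cn_mul => //; first exact: Cn_cst.
  by apply: IHn; exact: Cn_dt.
- move=> i; apply: Cn_mul => //; first exact: Cn_cst.
  by apply: (IHn (fun t => dx i (f t))); exact: (Cn_dx fn).
Qed.

(** The successive derivatives are given as a sequence, so that closure
    properties are statements about sequences and no derivative operator is
    iterated. *)
Definition smooth1 (h : R -> R) := exists hs : nat -> R -> R,
  hs 0%N = h /\ forall n (r : R), is_derive r 1 (hs n) (hs n.+1 r).

Lemma has_dt_is_derive I (h : R -> E -> R) t x l : is_derive t 1 (h ^~ x) l ->
  has_dt I h t x l.
Proof.
move=> [dh <-]; rewrite /has_dt; apply: cvg_within_filter.
have H : r^-1 *: (h (r *: 1 + t) x - h t x) @[r --> 0^'] --> 'D_1 (h ^~ x) t.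
  exact: dh.
move=> A /H HA.
suff : \forall s \near t, s != t -> A (tquot h t x s) by [].
rewrite (near_shift (0 : R)).
have {}HA : \forall r \near (0 : R), r != 0 -> A (r^-1 *: (h (r *: 1 + t) x - h t x)) by [].
apply: filterS HA => r /= Hr; rewrite subr0 => rt.
rewrite /tquot addrK.
have := Hr _; rewrite /GRing.scale /= mulr1; apply.
by apply: contra rt => /eqP ->; rewrite add0r.
Qed.

Lemma is_derive_has_dt I (h : R -> E -> R) t x l : nbhs t I ->
  has_dt I h t x l -> is_derive t 1 (h ^~ x) l.
Proof.
move=> nI; rewrite /has_dt => H.
suff K : r^-1 *: (h (r *: 1 + t) x - h t x) @[r --> 0^'] --> l.
  split; first by apply/cvg_ex; exists l.
  by apply: cvg_lim.
move=> A /H HA.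
have {}HA : \forall s \near t, s != t -> I s -> A (tquot h t x s) by [].
suff : \forall r \near (0 : R), r != 0 -> A (r^-1 *: (h (r *: 1 + t) x - h t x)) by [].
move: HA; rewrite (near_shift (0 : R)).
move: nI; rewrite -[nbhs t I]/(\forall s \near t, I s) (near_shift (0 : R)).
apply: filterS2 => r /=; rewrite subr0 => Ir + rt.
rewrite /tquot addrK /GRing.scale /= mulr1; apply => //.
by apply: contra rt => /eqP e; apply/eqP; apply: (addIr t); rewrite add0r.
Qed.

Lemma smooth1_der h : smooth1 h -> exists2 h' : R -> R, smooth1 h' &
  forall r : R, is_derive r 1 h (h' r).
Proof.
move=> [hs [<- dh]]; exists (hs 1%N) => //.
by exists (fun n => hs n.+1).
Qed.

Lemma smooth1_cont h : smooth1 h -> continuous h.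
Proof.
move=> /smooth1_der [h' _ dh] r; apply: differentiable_continuous.
by apply/derivable1_diffP; have [] := dh r.
Qed.

Lemma Cn_smooth1_time n I h : time_set I -> smooth1 h -> Cn I n (fun t _ => h t).
Proof.
move=> tI; elim: n h => [|n IHn] h sh.
  apply/Cn0P => t x It; apply: cvg_within_filter.
  apply: (@continuous_cvg _ _ _ _ _ _ h); first exact: smooth1_cont.
  exact: cvg_fst.
have [h' sh' dh] := smooth1_der sh.
apply: (@CnS _ _ n _ _ (fun t _ => h' t) (fun _ _ _ => 0)) => //.
- move=> t x It; apply: cvg_within_filter.
  apply: (@continuous_cvg _ _ _ _ _ _ h); first exact: smooth1_cont.
  exact: cvg_fst.
- by move=> t x _; exact: has_dt_is_derive.
- exact: IHn.
- by move=> i; exact: Cn_cst.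
Qed.

Lemma is_derive_coord (h : R -> R) x i j l : is_derive (x 0 j) 1 h l ->
  is_derive x (basis_vec i) (fun x : E => h (x 0 j)) ((i == j)%:R * l).
Proof.
move=> dh; apply/is_derive_line.
have -> : (fun r : R => h ((r *: basis_vec i + x) 0 j)) = h \o (fun r => (i == j)%:R * r + x 0 j).
  by apply/funext => r /=; rewrite !mxE eqxx /= [j == i]eq_sym mulrC.
rewrite mulrC; apply: is_derive1_comp; first by rewrite mulr0 add0r.
have H := @is_deriveZ R R R id (i == j)%:R 0 1 1 (is_derive_id _ _).
have := is_deriveD H (is_derive_cst (x 0 j : R) (0 : R) (1 : R)).
by rewrite addr0 /GRing.scale /= mulr1.
Qed.

Lemma cvg_coord (h : R -> R) I t x (j : 'I_3) : continuous h ->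
  h ((q : R * E).2 0 j) @[q --> within (I `*` [set: E]) (nbhs (t, x))] --> h (x 0 j).
Proof.
move=> ch; apply: cvg_within_filter.
apply: (@continuous_cvg _ _ _ _ _ _ (fun x : E => h (x 0 j))); last exact: cvg_snd.
apply: continuous_comp; last exact: ch.
exact: coord_continuous.
Qed.

Lemma Cn_smooth1_coord n I h j : time_set I -> smooth1 h ->
  Cn I n (fun _ x => h (x 0 j)).
Proof.
move=> tI; elim: n h => [|n IHn] h sh.
  by apply/Cn0P => t x It; apply: cvg_coord; exact: smooth1_cont.
have [h' sh' dh] := smooth1_der sh.
apply: (@CnS _ _ n _ _ (fun _ _ => 0) (fun i t x => (i == j)%:R * h' (x 0 j))) => //.
- by move=> t x It; apply: cvg_coord; exact: smooth1_cont.
- by move=> t x _; apply: has_dt_is_derive; exact: is_derive_cst.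
- by move=> t x i _; exact: is_derive_coord.
- exact: Cn_cst.
- by move=> i; apply: Cn_mul => //; [exact: Cn_cst|exact: IHn].
Qed.

Lemma smooth1_id : smooth1 id.
Proof.
exists (fun n => match n with 0%N => id | 1%N => fun=> 1 | _ => fun=> 0 end).
by split => //; case=> [|[|n]] r; [exact: is_derive_id|exact: is_derive_cst..].
Qed.

Lemma smooth1_affine h (al be : R) : smooth1 h -> smooth1 (fun r => h (al * r + be)).
Proof.
move=> [hs [<- dh]]; exists (fun n r => al ^+ n * hs n (al * r + be)); split.
  by apply/funext => r; rewrite expr0 mul1r.
move=> n r.
have d1 : is_derive r 1 (fun r => al * r + be) al.
  have H := @is_deriveZ R R R id al r 1 1 (is_derive_id _ _).
  have := is_deriveD H (is_derive_cst (be : R) (r : R) (1 : R)).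
  by rewrite addr0 /GRing.scale /= mulr1.
have := is_deriveZ (al ^+ n) (is_derive1_comp (dh n _) d1).
by rewrite /GRing.scale /= exprSr mulrAC mulrA -mulrA [hs _ _ * _]mulrC mulrA.
Qed.

(** By induction on the order: the derivatives of [f ^-1] are those of [f]
    multiplied by [- f ^-1 * f ^-1]. *)
Lemma Cn_inv n I (f : R -> E -> R) : time_set I ->
  (forall t x, I t -> f t x != 0) -> Cn I n f -> Cn I n (fun t x => (f t x)^-1).
Proof.
move=> tI f0; elim: n => [|n IHn] fn.
  apply/Cn0P => t x It; apply: cvgV; first exact: f0.
  exact: Cn_cont fn _ _ It.
have fi := IHn (CnW fn).
have cfi : joint_cont I (fun t x => (f t x)^-1).
  by move=> t x It; apply: cvgV; [exact: f0|exact: Cn_cont fn _ _ It].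
apply: (@CnS _ _ n _ _ (fun t x => -1 * (dt I f t x * ((f t x)^-1 * (f t x)^-1)))
   (fun i t x => -1 * (dx i (f t) x * ((f t x)^-1 * (f t x)^-1)))) => //.
- move=> t x It; rewrite /has_dt.
  have H : -1 * (tquot f t x s * ((f s x)^-1 * (f t x)^-1)) @[s --> within I t^'] -->
     -1 * (dt I f t x * ((f t x)^-1 * (f t x)^-1)).
    apply: cvgM; first exact: cvg_cst.
    apply: cvgM; first exact: Cn_has_dt fn _ _ It.
    apply: cvgM; last exact: cvg_cst.
    exact: (@joint_cont_time _ _ _ (fun t x => (f t x)^-1)).
  apply: cvg_trans H; apply: near_eq_cvg.
  suff : \forall s \near t^', I s ->
    -1 * (tquot f t x s * ((f s x)^-1 * (f t x)^-1)) = tquot (fun t x => (f t x)^-1) t x s by [].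
  near=> s => Is; rewrite /tquot /GRing.scale /=.
  have := f0 s x Is; have := f0 t x It; move: (f s x) (f t x) => u v v0 u0.
  have st : s - t != 0 by rewrite subr_eq0; near: s; exact: nbhs_dnbhs_neq.
  by field; rewrite v0 u0 st.
- move=> t x i It.
  have [d e] := Cn_is_derive fn x i It.
  split; first exact: derivableV (f0 t x It) d.
  rewrite deriveV ?f0// /GRing.scale /= /dx exprSr expr1 invfM; ring.
- apply: Cn_mul => //; first exact: Cn_cst.
  apply: Cn_mul => //; first exact: Cn_dt.
  exact: Cn_mul.
- move=> i; apply: Cn_mul => //; first exact: Cn_cst.
  apply: Cn_mul => //; first exact: (Cn_dx fn).
  exact: Cn_mul.
Unshelve. all: by end_near. Qed.

End SmoothComposition.

(** * Smooth cutoffs *)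

Section Cutoff.
Context {R : realType}.
Local Notation E := 'rV[R]_3.

(** The functions p(1/x) exp(-1/x), extended by 0 to x <= 0, form a family
    stable under differentiation. *)
Definition flat (p : {poly R}) (x : R) : R :=
  if 0 < x then p.[x^-1] * expR (- x^-1) else 0.

Lemma poly_growth (p : {poly R}) :
  exists2 C : R, 0 <= C & forall y, 1 <= y -> `|p.[y]| <= C * y ^+ size p.
Proof.
exists (\sum_(i < size p) `|p`_i|); first exact: sumr_ge0.
move=> y y1; rewrite horner_coef (le_trans (ler_norm_sum _ _ _))// mulr_suml.
apply: ler_sum => i _; rewrite normrM ler_wpM2l// normrX ger0_norm; last exact: le_trans y1.
by apply: ler_weXn2l => //; exact: ltnW.
Qed.

(** [exp (1 / x)] exceeds every power of [1 / x], by its Taylor expansion. *)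
Lemma flat_sqr_bound p : exists2 K : R, 0 <= K & forall x, x <= 1 -> `|flat p x| <= K * x ^+ 2.
Proof.
have [C C0 pC] := poly_growth p.
exists (C * (size p).+2`!%:R); first by rewrite mulr_ge0.
move=> x x1; rewrite /flat; case: ifPn => [x0|_]; last first.
  by rewrite normr0 mulr_ge0 ?sqr_ge0// mulr_ge0.
set y := x^-1; have y1 : 1 <= y by rewrite /y invf_ge1.
have y0 : 0 < y by exact: lt_le_trans y1.
rewrite normrM (ger0_norm (expR_ge0 _)) expRN.
have H : y ^+ (size p).+2 / (size p).+2`!%:R <= expR y.
  by rewrite (le_trans _ (expR_ge1Dxn (size p).+1 (ltW y0)))// lerDr.
have f0 : 0 < ((size p).+2`!%:R : R) by rewrite ltr0n fact_gt0.
have H2 : (expR y)^-1 <= (size p).+2`!%:R / y ^+ (size p).+2.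
  by rewrite -[leRHS]invrK invf_div lef_pV2 // posrE ?expR_gt0// divr_gt0// exprn_gt0.
apply: le_trans (_ : C * y ^+ size p * ((size p).+2`!%:R / y ^+ (size p).+2) <= _).
  by apply: ler_pM => //; exact: pC.
have -> : x ^+ 2 = y ^- 2 by rewrite /y exprVn invrK.
rewrite -mulrA -[leRHS]mulrA ler_wpM2l//.
rewrite mulrCA ler_wpM2l ?(ltW f0)//.
rewrite -[X in y ^+ X.+2](addn0) -!addnS exprD invfM mulrA divff ?mul1r//.
by rewrite expf_neq0// gt_eqF.
Qed.

(** At 0 the quadratic bound makes the difference quotient tend to 0. *)
Lemma is_derive_flat p (x : R) : is_derive x 1 (flat p) (flat ((p - p^`()) * 'X^2) x).
Proof.
have [x0|x0|->] := ltgtP x 0.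
- have e : \forall y \near x, flat p y = cst 0 y.
    near=> y; rewrite /flat ltNge (_ : y <= 0)//=; apply/ltW.
    by near: y; exact: lt_nbhsl.
  rewrite {2}/flat ltNge (ltW x0) /=.
  split; first by apply: near_eq_derivable (derivable_cst (0 : R) x 1); apply: filterS e.
  by rewrite (near_eq_derive _ e) derive_cst.
- pose g y : R := p.[y^-1] * expR (- y^-1).
  have e : \forall y \near x, flat p y = g y.
    near=> y; rewrite /flat (_ : 0 < y)//.
    by near: y; exact: lt_nbhsr.
  suff dg : is_derive x 1 g (flat ((p - p^`()) * 'X^2) x).
    have [d <-] := dg.
    split; first by apply: near_eq_derivable d; apply: filterS e.
    by rewrite (near_eq_derive _ e).
  rewrite /flat x0.
  have x0' : x != 0 by rewrite gt_eqF.
  have dinv : is_derive x 1 (fun y : R => y^-1) (- x ^- 2).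
      have := @is_deriveV R id x 1 1 x0' (is_derive_id _ _).
    by rewrite /GRing.scale /= mulr1.
  have d1 := is_derive1_comp (is_derive_poly p (x^-1)) dinv.
  have d2 := @is_derive1_comp _ expR (fun y : R => - y^-1) x _ _
    (is_derive_expR (- x^-1)) (is_deriveN dinv).
  have := is_deriveM d1 d2; move=> /is_derive_eq; apply.
  rewrite /GRing.scale /= !hornerE /=; move: (p.[_]) (p^`().[_]) (expR _) => a b c.
  by field.
- rewrite {2}/flat ltxx.
  have [K K0 HK] := flat_sqr_bound p.
  have f0 : flat p 0 = 0 by rewrite /flat ltxx.
  suff H : h^-1 *: ((flat p \o shift 0) (h *: 1) - flat p 0) @[h --> 0^'] --> (0 : R).
    split; first by apply/cvg_ex; exists 0.
    exact: cvg_lim.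
  apply/cvgr0Pnorm_lt => e e0.
  have nb1 : \forall h \near (0 : R), h <= 1.
    by near=> h; apply/ltW; near: h; exact: (lt_nbhsl (@ltr01 R)).
  near=> h.
  have h0 : h != 0 by near: h; exact: nbhs_dnbhs_neq.
  rewrite /= f0 subr0 addr0 /GRing.scale /= mulr1 normrM normfV.
  rewrite ltr_pdivrMl ?normr_gt0//.
  have h1 : h <= 1.
    by near: h; exact: nbhs_dnbhs nb1.
  apply: (le_lt_trans (HK h h1)).
  rewrite -real_normK ?num_real// expr2 mulrA mulrC ltr_pM2l ?normr_gt0//.
  apply: (@le_lt_trans _ _ ((K + 1) * `|h|)); first by rewrite ler_wpM2r// lerDl.
  rewrite -ltr_pdivlMl ?ltr_wpDl// mulrC.
  near: h; apply: nbhs_dnbhs.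
  apply: (@cvgr0_norm_lt _ _ _ (nbhs (0:R)) _ id); first exact: cvg_id.
  by rewrite divr_gt0// ltr_wpDl.
Unshelve. all: by end_near. Qed.

Lemma smooth1_flat p : smooth1 (flat p).
Proof.
exists (fun n => flat (iter n (fun q : {poly R} => (q - q^`()) * 'X^2) p)).
by split => // n r; exact: is_derive_flat.
Qed.

(** The bridge back to one variable: products and reciprocals are formed for
    functions of time and space and then read at a single point of space. *)
Lemma smooth_on_smooth1 (h : R -> R) :
  smooth_on setT (fun (t : R) (_ : E) => h t) -> smooth1 h.
Proof.
move=> sh; exists (fun n => derive1n n h); split; first by [].
suff H n : smooth_on setT (fun (t : R) (_ : E) => derive1n n h t).
  move=> n r; rewrite derive1nS derive1E.
  apply: derivableP.
  have := Cn_has_dt (H n 1%N) (t := r) (x := 0) I.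
  by move=> /(@is_derive_has_dt _ _ (fun t _ => derive1n n h t) _ _ _ filterT) [].
elim: n => // n IHn k; rewrite derive1nS.
apply: Cn_ext (Cn_dt (IHn k.+1)) => t x _.
have /(@is_derive_has_dt _ _ (fun t _ => derive1n n h t) _ _ _ filterT) [_ <-] :=
  Cn_has_dt (IHn 1%N) (t := t) (x := x) I.
by rewrite derive1E.
Qed.

Definition step (r : R) : R := flat 1 r / (flat 1 r + flat 1 (1 - r)).

Lemma flat1_ge0 r : 0 <= flat 1 r.
Proof. by rewrite /flat; case: ifPn => // _; rewrite hornerE mul1r expR_ge0. Qed.

Lemma flat1_gt0 r : 0 < r -> 0 < flat 1 r.
Proof. by move=> r0; rewrite /flat r0 hornerE mul1r expR_gt0. Qed.

Lemma flat1_eq0 r : r <= 0 -> flat 1 r = 0.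
Proof. by move=> r0; rewrite /flat ltNge r0. Qed.

Lemma step_den_gt0 r : 0 < flat 1 r + flat 1 (1 - r).
Proof.
have [r0|r0] := ltP 0 r; first by rewrite ltr_wpDr ?flat1_ge0 ?flat1_gt0.
by rewrite ltr_wpDl ?flat1_ge0 ?flat1_gt0// subr_gt0 (le_lt_trans r0).
Qed.

Lemma smooth1_step : smooth1 step.
Proof.
apply: smooth_on_smooth1 => n; rewrite /step.
have c1 : Cn setT n (fun t (_ : E) => flat 1 t).
  by apply: Cn_smooth1_time; [exact: time_setT|exact: smooth1_flat].
apply: Cn_mul => //; first exact: time_setT.
apply: Cn_inv; first exact: time_setT.
  by move=> t x _; rewrite gt_eqF// step_den_gt0.
apply: Cn_add => //; first exact: time_setT.
have := smooth1_affine (-1) 1 (smooth1_flat 1).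
have -> : (fun r => flat 1 (-1 * r + 1)) = (fun r => flat 1 (1 - r)).
  by apply/funext => r; congr flat; ring.
by move=> ?; apply: Cn_smooth1_time => //; exact: time_setT.
Qed.

Lemma step0 r : r <= 0 -> step r = 0.
Proof. by move=> r0; rewrite /step flat1_eq0// mul0r. Qed.

Lemma step1 r : 1 <= r -> step r = 1.
Proof.
move=> r1; rewrite /step (@flat1_eq0 (1 - r)) ?subr_le0// addr0 divff//.
by rewrite gt_eqF// flat1_gt0// (lt_le_trans _ r1).
Qed.

Lemma step_ge0 r : 0 <= step r.
Proof. by rewrite divr_ge0 ?flat1_ge0// ltW// step_den_gt0. Qed.

Lemma step_le1 r : step r <= 1.
Proof. by rewrite ler_pdivrMr ?step_den_gt0// mul1r lerDl flat1_ge0. Qed.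

Lemma smooth1_mul (h k : R -> R) : smooth1 h -> smooth1 k -> smooth1 (fun r => h r * k r).
Proof.
move=> sh sk; apply: smooth_on_smooth1 => n.
apply: (Cn_mul (@time_setT R) (Cn_smooth1_time n (@time_setT R) sh)).
exact: (Cn_smooth1_time n (@time_setT R) sk).
Qed.

(** A plateau: 1 on [-a, a], 0 outside ]-b, b[. *)
Definition plateau (a b r : R) : R := step ((b + r) / (b - a)) * step ((b - r) / (b - a)).

Section plateau.
Variables (a b : R).
Hypothesis ab : a < b.

Lemma smooth1_plateau : smooth1 (plateau a b).
Proof.
have e1 := smooth1_affine (b - a)^-1 (b / (b - a)) smooth1_step.
have e2 := smooth1_affine (- (b - a)^-1) (b / (b - a)) smooth1_step.
have := smooth1_mul e1 e2; congr smooth1; apply/funext => r; rewrite /plateau.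
by congr (step _ * step _); ring.
Qed.

Lemma plateau1 r : `|r| <= a -> plateau a b r = 1.
Proof.
move=> ra; have [r1 r2] : - a <= r /\ r <= a by move: ra; rewrite ler_norml => /andP.
by rewrite /plateau !step1 ?mulr1// ler_pdivlMr ?subr_gt0// mul1r; lra.
Qed.

Lemma plateau0 r : b <= `|r| -> plateau a b r = 0.
Proof.
rewrite /plateau ler_normr => /orP[] rb.
  rewrite (@step0 ((b - r) / _)) ?mulr0//.
  by rewrite ler_pdivrMr ?subr_gt0// mul0r; lra.
rewrite (@step0 ((b + r) / _)) ?mul0r//.
by rewrite ler_pdivrMr ?subr_gt0// mul0r; lra.
Qed.

End plateau.
End Cutoff.

(** * Measure and integration on R^3 *)

Section GeneralIntegration.
Local Open Scope ereal_scope.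
Context d (T : measurableType d) (R : realType).
Variable mu : {measure set T -> \bar R}.

(** The integral of a nonnegative function is a supremum over simple functions
    from below, which makes it monotone for arbitrary functions. *)
Lemma le_integral_ge0 (f g : T -> \bar R) : (forall x, 0 <= f x) ->
  (forall x, f x <= g x) -> \int[mu]_x f x <= \int[mu]_x g x.
Proof.
move=> f0 fg; have g0 x : 0 <= g x by exact: le_trans (f0 x) (fg x).
rewrite !ge0_integralTE//; apply: le_ereal_sup => y /= [h hf <-].
by exists h => // x; exact: le_trans (hf x) (fg x).
Qed.

Lemma le_Lnorm (p : \bar R) (f g : T -> \bar R) : 1 <= p ->
  (forall x, `|f x| <= `|g x|) -> 'N[mu]_p[f] <= 'N[mu]_p[g].
Proof.
rewrite unlock; case: p => [r| |//] p1 fg /=.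
  have r0 : (0 <= r)%R by rewrite -lee_fin (le_trans _ p1).
  apply: gt0_ler_poweR; rewrite ?invr_ge0//.
  - by rewrite in_itv /= leey andbT; apply: integral_ge0 => x _; exact: poweR_ge0.
  - by rewrite in_itv /= leey andbT; apply: integral_ge0 => x _; exact: poweR_ge0.
  apply: le_integral_ge0 => x; first exact: poweR_ge0.
  by apply: gt0_ler_poweR => //; rewrite in_itv /= abse_ge0 leey.
case: ifPn => // _; apply: le_ess_sup; apply: nearW => x /=; exact: fg.
Qed.

(** All estimates of the force and of the corrector reduce to this one: a
    supremum times the [1 / p]-th power of the measure of the support. *)
Lemma Lnorm_box_bound (p : \bar R) (f : T -> \bar R) (A : set T) (B m : R) :
  1 <= p -> measurable A -> (0 <= B)%R -> mu A = m%:E -> (0 < m)%R ->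
  (forall x, A x -> `|f x| <= B%:E) -> (forall x, ~ A x -> f x = 0) ->
  'N[mu]_p[f] <= (B * m `^ fine p^-1)%:E.
Proof.
move=> p1 mA B0 muA m0 fB f0.
have B1 x : (0 <= B * \1_A x)%R by rewrite mulr_ge0// indicE ler0n.
have fle x : `|f x| <= `|(B * \1_A x)%:E|.
  rewrite [leRHS]gee0_abs ?lee_fin// indicE.
  have [/set_mem Ax|/negP nAx] := boolP (x \in A); first by rewrite mulr1 fB.
  by rewrite f0 ?abse0 ?mulr0// => Ax; apply: nAx; exact: mem_set.
apply: (le_trans (le_Lnorm p1 fle)); rewrite unlock; case: p p1 => [r| |//] p1 /=.
  have r1 : (1 <= r)%R by rewrite -lee_fin.
  have r0 : (0 < r)%R by exact: lt_le_trans r1.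
  under eq_integral => x _.
    rewrite ger0_norm// powRM//.
    rewrite (_ : \1_A x `^ r = \1_A x)%R; last first.
      by rewrite indicE; case: (_ \in _); rewrite /= ?powR1 ?powR0 ?gt_eqF.
    rewrite EFinM; over.
  rewrite ge0_integralZl//; last 2 first.
  - by apply/measurable_EFinP; exact: measurable_indic.
  - by rewrite lee_fin powR_ge0.
  rewrite integral_indic// setIT [X in (_ * X) `^ _](muA : _ = m%:E) -EFinM poweR_EFin.
  rewrite powRM ?powR_ge0 ?(ltW m0)// -powRrM mulfV ?gt_eqF// powRr1//.
  by rewrite inver gt_eqF.
rewrite powRr0 mulr1.
case: ifPn => // _; apply/ess_supP; apply: nearW => x /=.
rewrite ger0_norm// lee_fin ler_piMr// indicE lern1; exact: leq_b1.
Qed.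

End GeneralIntegration.

Section Caratheodory.
Context d (X : measurableType d) (R : realType).

(** The real variable is approximated from the left on a grid, which makes [f]
    a limit of countable gluings of measurable functions. *)
Lemma caratheodory_measurable (D : set R) (f : X -> R -> R) :
  measurable D -> (forall r s, D r -> s <= r -> D s) ->
  (forall r, D r -> measurable_fun setT (f ^~ r)) ->
  (forall x r, D r -> f x s @[s --> within D (nbhs r)] --> f x r) ->
  measurable_fun (setT `*` D) (fun z : X * R => f z.1 z.2).
Proof.
move=> mD Ddown mf cf.
have mXD : measurable ([set: X] `*` D) by exact: measurableX.
pose g (n : nat) (r : R) : R := (Num.floor (n.+1%:R * r))%:~R / n.+1%:R.
have n0 n : (0 : R) < n.+1%:R by rewrite ltr0n.
have g_le n r : g n r <= r.
  by rewrite /g ler_pdivrMr// mulrC; exact: floor_le_tmp.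
apply: (@measurable_fun_cvg _ _ _ _ (fun n (z : X * R) => f z.1 (g n z.2))); last first.
  move=> [x r] [_ /= Dr].
  apply: (@cvg_comp _ _ _ (fun n => g n r) (f x) _ (within D (nbhs r))); last exact: cf.
  have gr : g n r @[n --> \oo] --> r.
    apply/cvgrPdist_lt => e e0.
    near=> n.
    rewrite ger0_norm ?subr_ge0// /g ltrBlDr -ltrBlDl.
    rewrite ltr_pdivlMr// mulrBl mulrC ltrBlDr.
    apply: lt_le_trans (floorD1_gt _) _; rewrite intrD lerD2l.
    rewrite -ler_pdivrMl// mulr1.
    near: n; have [N Ne] : exists N, e^-1 <= N%:R.
      exists `|Num.ceil e^-1|%N; rewrite natr_absz ger0_norm ?ceil_ge//.
      by rewrite ceil_ge0 (lt_le_trans (ltrN10 R))// invr_ge0 ltW.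
    by exists N => // n /= Nn; rewrite (le_trans Ne)// ler_nat (leq_trans Nn).
  move=> A A'; have {}A' : nbhs r (fun s => D s -> A s) by [].
  have {}A' : \forall n \near \oo, D (g n r) -> A (g n r) := gr _ A'.
  suff : \forall n \near \oo, A (g n r) by [].
  by apply: filterS A' => n; apply; exact: Ddown (g_le n r).
move=> n _ B mB.
pose c (k : int) : R := k%:~R / n.+1%:R.
pose S k : set (X * R) := [set x | D (c k) /\ B (f x (c k))] `*`
  (D `&` `[c k, c (k + 1)[%classic).
have gE r k : (r \in `[c k, c (k + 1)[) -> g n r = c k.
  rewrite in_itv /= => /andP[r1 r2]; rewrite /g /c; congr (_%:~R / _).
  by apply: floor_def; rewrite mulrC -ler_pdivrMr// -ltr_pdivlMr// r1.
have -> : ([set: X] `*` D) `&` (fun z : X * R => f z.1 (g n z.2)) @^-1` B = \bigcup_k S k.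
  apply/seteqP; split => [[x r] [[_ /= Dr] Bx]|[x r] [k _ [/= [Dc Bc] [Dr /gE e]]]].
    exists (Num.floor (n.+1%:R * r)) => //; split => /=.
      split; last exact: Bx.
      exact: Ddown (g_le n r).
    split => //; rewrite in_itv /=; apply/andP; split; first exact: g_le.
    by rewrite /c ltr_pdivlMr// mulrC floorD1_gt.
  by split => //=; rewrite e.
apply: countable_bigcupT_measurable; first exact: countableP.
move=> k; apply: measurableX; last by apply: measurableI => //; exact: measurable_itv.
have [Dc|nDc] := pselect (D (c k)).
  rewrite (_ : [set _ | _] = setT `&` (f ^~ (c k)) @^-1` B); first exact: mf.
  by apply/seteqP; split => x /=; tauto.
rewrite (_ : [set _ | _] = set0); first exact: measurable0.
by apply/seteqP; split => x //= [].
Unshelve. all: by end_near. Qed.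
End Caratheodory.

Section SpaceIntegration.
Context {R : realType}.
Local Notation E := 'rV[R]_3.
Local Notation leb := (@lebesgue_measure R).

Lemma vec3_0 (x : R * R * R) : vec3 x 0 ord0 = x.1.1.
Proof. by rewrite mxE. Qed.
Lemma vec3_1 (x : R * R * R) : vec3 x 0 (lift ord0 ord0) = x.1.2.
Proof. by rewrite mxE. Qed.
Lemma vec3_2 (x : R * R * R) : vec3 x 0 (lift ord0 (lift ord0 ord0)) = x.2.
Proof. by rewrite mxE. Qed.

Lemma ord3P (P : 'I_3 -> Prop) :
  P ord0 -> P (lift ord0 ord0) -> P (lift ord0 (lift ord0 ord0)) -> forall i, P i.
Proof.
move=> P0 P1 P2 [[|[|[|//]]] i].
- by rewrite (_ : Ordinal i = ord0) //; exact: val_inj.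
- by rewrite (_ : Ordinal i = lift ord0 ord0) //; exact: val_inj.
- by rewrite (_ : Ordinal i = lift ord0 (lift ord0 ord0)) //; exact: val_inj.
Qed.

Lemma cvg_vec3 {T : Type} (F : set_system T) {FF : Filter F} (f1 f2 f3 : T -> R) a b c :
  f1 y @[y --> F] --> a -> f2 y @[y --> F] --> b -> f3 y @[y --> F] --> c ->
  vec3 (f1 y, f2 y, f3 y) @[y --> F] --> vec3 (a, b, c).
Proof.
move=> ca cb cc; apply: cvg_row; apply: ord3P.
- by rewrite vec3_0; under eq_fun do rewrite vec3_0.
- by rewrite vec3_1; under eq_fun do rewrite vec3_1.
- by rewrite vec3_2; under eq_fun do rewrite vec3_2.
Qed.

(** The downward closed set [D] of times accommodates fields that exist up to
    a terminal time only. *)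
Lemma joint_cont_measurable (D : set R) (f : R -> E -> R) :
  measurable D -> (forall r s, D r -> s <= r -> D s) -> joint_cont D f ->
  measurable_fun (setT `*` D) (fun z : (R * R * R) * R => f z.2 (vec3 z.1)).
Proof.
move=> mD Ddown cf.
have cfx t x (F : set_system R) (FF : Filter F) (g : R -> E) : D t ->
    g s @[s --> F] --> x -> f t (g s) @[s --> F] --> f t x.
  move=> Dt gx A /(cf t x Dt) HA.
  have {}HA : \forall z \near (t, x), (D `*` [set: E]) z -> A (f z.1 z.2) by [].
  have := gx _ (near_slice_x HA); rewrite /nbhs /=.
  by apply: filterS => s; apply; split.
apply: (@caratheodory_measurable _ _ _ _ (fun x r => f r (vec3 x))) => //; last first.
  move=> x r Dr A /(cf r (vec3 x) Dr) HA.
  have {}HA : \forall z \near (r, vec3 x), (D `*` [set: E]) z -> A (f z.1 z.2) by [].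
  suff : \forall s \near r, D s -> A (f s (vec3 x)) by [].
  by apply: filterS (near_slice_t HA) => s + Ds; apply; split.
move=> r Dr.
have H3 := @caratheodory_measurable _ _ _ setT (fun (x : R * R) x3 => f r (vec3 (x, x3)))
  (@measurableT _ _) (fun _ _ _ _ => Logic.I).
rewrite setXTT in H3; apply: H3 => [x3 _|x x3 _]; last first.
  by apply: cvg_within_filter; apply: cfx => //; case: x => a b; apply: cvg_vec3 => //; exact: cvg_cst.
have H2 := @caratheodory_measurable _ _ _ setT (fun (x1 : R) x2 => f r (vec3 (x1, x2, x3)))
  (@measurableT _ _) (fun _ _ _ _ => Logic.I).
rewrite setXTT in H2; apply: H2 => [x2 _|x1 x2 _]; last first.
  by apply: cvg_within_filter; apply: cfx => //; apply: cvg_vec3 => //; exact: cvg_cst.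
apply: continuous_measurable_fun => x1.
by apply: cfx => //; apply: cvg_vec3 => //; exact: cvg_cst.
Qed.
End SpaceIntegration.

Section SigmaFiniteProduct.
Context {R : realType} d1 d2 (T1 : measurableType d1) (T2 : measurableType d2).
Variables (m1 : {sigma_finite_measure set T1 -> \bar R})
  (m2 : {sigma_finite_measure set T2 -> \bar R}).
Local Open Scope ereal_scope.

(** The product of sigma-finite measures under a name of its own, so that its
    sigma-finiteness is found by inference. *)
Definition sigma_product : set (T1 * T2)%type -> \bar R := (m1 \x m2).

HB.instance Definition _ := Measure.on sigma_product.

Lemma sigma_product_sigma_finite : sigma_finite setT sigma_product.
Proof.
have /sigma_finiteP[F [TF ndF Foo]] := sigma_finiteT m1.
have /sigma_finiteP[G [TG ndG Goo]] := sigma_finiteT m2.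
exists (fun n => F n `*` G n).
  rewrite -setXTT TF TG predeqE => -[x y]; split.
    move=> [/= [n _ Fnx] [k _ Gky]]; exists (maxn n k) => //; split.
    - by move: x Fnx; exact/subsetPset/ndF/leq_maxl.
    - by move: y Gky; exact/subsetPset/ndG/leq_maxr.
  by move=> [n _ []/= ? ?]; split; exists n.
move=> k; have [? ?] := Foo k; have [? ?] := Goo k.
split; first exact: measurableX.
by rewrite /sigma_product product_measure1E// lte_mul_pinfty// ge0_fin_numE.
Qed.

HB.instance Definition _ := Measure_isSigmaFinite.Build _ _ _ sigma_product
  sigma_product_sigma_finite.
End SigmaFiniteProduct.

Section Scaling.
Context {R : realType}.
Local Notation E := 'rV[R]_3.
Local Notation leb := (@lebesgue_measure R).
Local Open Scope ereal_scope.

Lemma measurable_affine (a c : R) : measurable_fun setT (fun x : R => a * x + c)%R.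
Proof.
apply: measurable_funD; last exact: measurable_cst.
by apply: measurable_funM => //; exact: measurable_cst.
Qed.

Section affine1.
Variables (a c : R).
Hypothesis a0 : (0 < a)%R.
Let phi (x : measurableTypeR R) : measurableTypeR R := (a * x + c)%R.
Let mphi : measurable_fun setT phi := measurable_affine a c.
Let pf : {measure set (measurableTypeR R) -> \bar R} :=
  measure_function_pushforward__canonical__measure_function_Measure leb mphi.
Let a0nn : {nonneg R} := NngNum (ltW a0).

Let mu : {measure set (measurableTypeR R) -> \bar R} :=
  mscale a0nn pf.

(** Both sides are measures that agree on intervals, and Lebesgue measure is
    determined by its values there. *)
Lemma leb_affineE (A : set (measurableTypeR R)) : measurable A -> leb A = mu A.
Proof.
apply: lebesgue_measure_unique => X [[u v] _ <-].
rewrite (_ : mu _ = a%:E * leb (phi @^-1` `]u, v]%classic))//.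
rewrite (_ : phi @^-1` _ = `](u - c) / a, (v - c) / a]%classic)%R; last first.
  apply/seteqP; split => x /=; rewrite !in_itv /= /phi => /andP[h1 h2]; apply/andP; split.
  - by rewrite ltr_pdivrMr// mulrC ltrBlDr.
  - by rewrite ler_pdivlMr// mulrC lerBrDr.
  - by rewrite -ltrBlDr mulrC -ltr_pdivrMr.
  - by rewrite -lerBrDr mulrC -ler_pdivlMr.
rewrite !lebesgue_measure_itv /= !lte_fin ltr_pM2r ?invr_gt0// ltrD2r.
case: ifPn => uv; last by rewrite mule0.
rewrite -!EFinD -EFinM; congr EFin.
by field; rewrite gt_eqF.
Qed.

Lemma ge0_integral_affine (f : R -> \bar R) : measurable_fun setT f ->
  (forall x, 0 <= f x) ->
  \int[leb]_x f (a * x + c)%R = (a^-1)%:E * \int[leb]_x f x.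
Proof.
move=> mf f0.
have -> : \int[leb]_x f x = a%:E * \int[leb]_x f (a * x + c)%R.
  rewrite (eq_measure_integral mu); last by move=> A mA _; exact: leb_affineE.
  rewrite ge0_integral_mscale//; congr (_ * _).
  rewrite ge0_integral_pushforward//.
by rewrite muleA -EFinM mulVf ?mul1e// gt_eqF.
Qed.
End affine1.

Local Notation leb2 := (sigma_product leb leb).

(** [k] is the factor by which composition with [phi] multiplies integrals. *)
Definition scales d (T : measurableType d) (m : {measure set T -> \bar R}) (phi : T -> T)
    (k : R) := [/\ measurable_fun setT phi, (0 <= k)%R &
  forall f : T -> \bar R, measurable_fun setT f -> (forall x, 0 <= f x) ->
    \int[m]_x f (phi x) = k%:E * \int[m]_x f x].

Lemma scales_leb (a c : R) : (0 < a)%R -> scales leb (fun x => a * x + c)%R a^-1.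
Proof.
move=> a0; split; [exact: measurable_affine|by rewrite invr_ge0 ltW|].
by move=> f mf f0; exact: ge0_integral_affine.
Qed.

Lemma scales_prod d1 d2 (T1 : measurableType d1) (T2 : measurableType d2)
  (m1 : {sigma_finite_measure set T1 -> \bar R})
  (m2 : {sigma_finite_measure set T2 -> \bar R}) phi1 phi2 k1 k2 :
  scales m1 phi1 k1 -> scales m2 phi2 k2 ->
  scales (m1 \x m2) (fun z => (phi1 z.1, phi2 z.2)) (k1 * k2)%R.
Proof.
move=> [mp1 k10 s1] [mp2 k20 s2].
have mp : measurable_fun setT (fun z : T1 * T2 => (phi1 z.1, phi2 z.2)).
  by apply: measurable_fun_pair; apply: measurableT_comp.
split => //; first exact: mulr_ge0.
move=> f mf f0.
rewrite fubini_tonelli1//; last exact: measurableT_comp.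
rewrite /fubini_F /=.
under eq_integral => x _.
  rewrite (s2 (fun y => f (phi1 x, y)))//; last first.
    by apply: measurableT_comp => //; exact: measurable_pair1.
  over.
rewrite ge0_integralZl//; last 2 first.
- have H : measurable_fun setT (fun x => \int[m2]_y f (x, y)).
    exact: measurable_fun_fubini_tonelli_F.
  exact: (measurableT_comp H mp1).
- by move=> x _; exact: integral_ge0.
rewrite (s1 (fun x => \int[m2]_y f (x, y)))//; last 2 first.
- exact: measurable_fun_fubini_tonelli_F.
- by move=> x; exact: integral_ge0.
by rewrite muleA -EFinM mulrC fubini_tonelli1.
Qed.

Lemma scales_leb3 (a : R) (c : E) : (0 < a)%R ->
  scales leb3 (fun x => (a * x.1.1 + c 0 ord0, a * x.1.2 + c 0 (lift ord0 ord0),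
     a * x.2 + c 0 (lift ord0 (lift ord0 ord0))))%R ((a ^+ 3)^-1)%R.
Proof.
move=> a0; rewrite (_ : (a ^+ 3)^-1 = (a^-1 * a^-1) * a^-1)%R; last first.
  by rewrite !exprS expr0 mulr1 !invfM mulrA.
have s1 := scales_leb (c 0%R ord0) a0.
have s2 := scales_leb (c 0%R (lift ord0 ord0)) a0.
have s3 := scales_leb (c 0%R (lift ord0 (lift ord0 ord0))) a0.
have s12 := @scales_prod _ _ _ _ leb leb _ _ _ _ s1 s2.
exact: (@scales_prod _ _ _ _ leb2 leb _ _ _ _ s12 s3).
Qed.
End Scaling.

Section FubiniZero.
Context {R : realType} d1 d2 (T1 : measurableType d1) (T2 : measurableType d2).
Variables (m1 : {sigma_finite_measure set T1 -> \bar R})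
  (m2 : {sigma_finite_measure set T2 -> \bar R}).
Local Open Scope ereal_scope.
Variables (A1 : set T1) (A2 : set T2) (f : T1 * T2 -> \bar R).
Hypotheses (mA1 : measurable A1) (mA2 : measurable A2).
Hypothesis intf : (m1 \x m2).-integrable (A1 `*` A2) f.

Let intf' : (m1 \x m2).-integrable setT (f \_ (A1 `*` A2)).
Proof. by apply/integrable_restrict; rewrite ?setTI//; exact: measurableX. Qed.

Lemma fubini_zero1 : (forall x, A1 x -> \int[m2]_(y in A2) f (x, y) = 0) ->
  \int[m1 \x m2]_(z in A1 `*` A2) f z = 0.
Proof.
move=> H; rewrite integral_mkcond -integral12_prod_meas1//.
apply: integral0_eq => x _; rewrite /fubini_F.
have [/set_mem Ax|/negP nAx] := boolP (x \in A1).
  rewrite -(H x Ax) [RHS]integral_mkcond; apply: eq_integral => y _.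
  by rewrite /patch in_setX /= mem_set.
apply: integral0_eq => y _; rewrite /patch in_setX /=.
by rewrite (negbTE (introN idP nAx)).
Qed.

Lemma fubini_zero2 : (forall y, A2 y -> \int[m1]_(x in A1) f (x, y) = 0) ->
  \int[m1 \x m2]_(z in A1 `*` A2) f z = 0.
Proof.
move=> H; rewrite integral_mkcond -integral21_prod_meas1//.
apply: integral0_eq => y _; rewrite /fubini_G.
have [/set_mem Ay|/negP nAy] := boolP (y \in A2).
  rewrite -(H y Ay) [RHS]integral_mkcond; apply: eq_integral => x _.
  by rewrite /patch in_setX /= (mem_set Ay) andbT.
apply: integral0_eq => x _; rewrite /patch in_setX /=.
by rewrite (negbTE (introN idP nAy)) andbF.
Qed.
End FubiniZero.

(** * Integration over the periodic cell *)

Section CellIntegral.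
Context {R : realType}.
Local Notation E := 'rV[R]_3.
Local Notation leb := (@lebesgue_measure R).
Local Notation leb2 := (sigma_product leb leb).
Local Notation unit_itv := (`[0%R, 1%R[%classic : set R).

Lemma cellE : @cell R = (unit_itv `*` unit_itv) `*` unit_itv.
Proof.
by apply/seteqP; split => [[[a b] c]|[[a b] c]] /=;
  rewrite /cell /= !in_itv /= => -[]; [move=> *|case].
Qed.

Lemma measurable_cell : measurable (@cell R).
Proof. by rewrite cellE; do 2 (apply: measurableX => //). Qed.

Lemma leb_unit : leb unit_itv = 1%E.
Proof. by rewrite lebesgue_measure_itv /= lte_fin ltr01 oppr0 adde0. Qed.

Lemma leb2_square : (leb \x leb)%E (unit_itv `*` unit_itv) = 1%E.
Proof.
rewrite (@product_measure1E _ _ _ _ _ leb leb)//.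
transitivity (1 * 1 : \bar R)%E; last by rewrite mule1.
by congr (_ * _)%E; exact: leb_unit.
Qed.

Lemma leb3_cell : leb3 (@cell R) = 1%E.
Proof.
rewrite cellE /leb3 (@product_measure1E _ _ _ _ _ leb2 leb)//; last exact: measurableX.
transitivity (1 * 1 : \bar R)%E; last by rewrite mule1.
by congr (_ * _)%E; [exact: leb2_square|exact: leb_unit].
Qed.

Definition cube : set E := [set x | forall i, 0 <= x 0 i <= 1].

Lemma cube_compact : compact cube.
Proof.
have := @rV_compact R 3 (fun _ => `[0, 1]%classic) (fun _ => @segment_compact R 0 1).
by congr compact; apply/seteqP; split => x /= H i; have := H i; rewrite in_itv.
Qed.

Lemma vec3_cell_cube x : cell x -> cube (vec3 x).
Proof.
move=> [/andP[? h1] /andP[? h2] /andP[? h3]].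
by apply: ord3P; [rewrite vec3_0|rewrite vec3_1|rewrite vec3_2]; apply/andP; split => //; exact: ltW.
Qed.

Lemma continuous_measurable3 (h : E -> R) : continuous h ->
  measurable_fun setT (fun x => h (vec3 x)).
Proof.
move=> ch.
have := @joint_cont_measurable R setT (fun _ => h) measurableT (fun _ _ _ _ => Logic.I).
rewrite setXTT => /(_ _) H.
have {}H : measurable_fun setT (fun z : (R * R * R) * R => h (vec3 z.1)).
  apply: H => t x _; apply: cvg_within_filter.
  by apply: (@continuous_cvg _ _ _ _ _ _ h); [exact: ch|exact: cvg_snd].
have H2 : measurable_fun setT (fun x : R * R * R => (x, 0 : R)).
  by apply: measurable_fun_pair => //; exact: measurable_cst.
exact: (measurableT_comp H H2).
Qed.

Lemma continuous_cube_bounded (h : E -> R) : continuous h ->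
  exists2 M, 0 <= M & forall x, cube x -> `|h x| <= M.
Proof.
move=> ch.
have cn : {within cube, continuous (fun x => `|h x|)}.
  by apply: continuous_subspaceT => x; apply: continuous_comp; [exact: ch|exact: norm_continuous].
have c0 : cube 0 by move=> i; rewrite mxE lexx ler01.
have [c _ Hc] := EVT_max_rV (ex_intro _ 0 c0) cube_compact cn.
exists `|h c| => // x cx; apply: Hc; exact: mem_set.
Qed.

Lemma cell_integrable (h : E -> R) : continuous h ->
  leb3.-integrable (@cell R) (EFin \o (fun x => h (vec3 x))).
Proof.
move=> ch; have [M M0 hM] := continuous_cube_bounded ch.
apply: measurable_bounded_integrable.
- exact: measurable_cell.
- have : (leb3 (@cell R) < +oo)%E by rewrite leb3_cell ltry.
  exact.
- exact: measurable_funS (continuous_measurable3 ch).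
- exists M; split; first exact: num_real.
  move=> y My x cx; apply/ltW; apply: le_lt_trans My; apply: hM; exact: vec3_cell_cube.
Qed.

Lemma contC (k : R) : continuous (fun _ : E => k).
Proof. exact: cst_continuous. Qed.

Lemma contD (g h : E -> R) : continuous g -> continuous h -> continuous (fun x => g x + h x).
Proof. by move=> cg ch x; exact: (cvgD (cg x) (ch x)). Qed.

Lemma contM (g h : E -> R) : continuous g -> continuous h -> continuous (fun x => g x * h x).
Proof. by move=> cg ch x; exact: (cvgM (cg x) (ch x)). Qed.

Lemma contN (h : E -> R) : continuous h -> continuous (fun x => - h x).
Proof. by move=> ch x; exact: (cvgN (ch x)). Qed.

Lemma contB (g h : E -> R) : continuous g -> continuous h -> continuous (fun x => g x - h x).
Proof. by move=> cg ch; apply: contD => //; exact: contN. Qed.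

Lemma cont_sum n (h : 'I_n -> E -> R) : (forall i, continuous (h i)) ->
  continuous (fun x => \sum_i h i x).
Proof.
move=> ch x; apply: (@cvg_big _ _ _ _ _ add_continuous _ (nbhs x)) => i _; exact: ch.
Qed.

Lemma int_T3D (g h : E -> R) : continuous g -> continuous h ->
  int_T3 (fun x => g x + h x) = int_T3 g + int_T3 h.
Proof.
move=> cg ch; rewrite /int_T3.
by rewrite -RintegralD//; [exact: measurable_cell|exact: cell_integrable..].
Qed.

Lemma int_T3Zl (k : R) (h : E -> R) : continuous h ->
  int_T3 (fun x => k * h x) = k * int_T3 h.
Proof.
move=> ch; rewrite /int_T3.
by rewrite -RintegralZl//; [exact: measurable_cell|exact: cell_integrable].
Qed.

Lemma int_T3_cst (k : R) : int_T3 (fun _ : E => k) = k.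
Proof.
rewrite /int_T3 Rintegral_cst; last exact: measurable_cell.
rewrite [X in fine X](_ : _ = 1%E) ?mulr1//; exact: leb3_cell.
Qed.

Lemma int_T3_le (g h : E -> R) : continuous g -> continuous h ->
  (forall x, cube x -> g x <= h x) -> int_T3 g <= int_T3 h.
Proof.
move=> cg ch gh; rewrite /int_T3; apply: le_Rintegral.
- exact: measurable_cell.
- exact: cell_integrable.
- exact: cell_integrable.
- by move=> x cx; apply: gh; exact: vec3_cell_cube.
Qed.

Lemma int_T3N (h : E -> R) : continuous h -> int_T3 (fun x => - h x) = - int_T3 h.
Proof.
move=> ch; rewrite -mulN1r -int_T3Zl//; congr int_T3.
by apply/funext => x; rewrite mulN1r.
Qed.

Lemma int_T3B (g h : E -> R) : continuous g -> continuous h ->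
  int_T3 (fun x => g x - h x) = int_T3 g - int_T3 h.
Proof.
by move=> cg ch; rewrite -int_T3N// -int_T3D//; exact: contN.
Qed.

Lemma int_T3_norm_le (h : E -> R) M : continuous h ->
  (forall x, cube x -> `|h x| <= M) -> `|int_T3 h| <= M.
Proof.
move=> ch hM; rewrite ler_norml; apply/andP; split.
  rewrite -[leLHS]int_T3_cst; apply: int_T3_le => //; first exact: contC.
  by move=> x /hM; rewrite ler_norml => /andP[].
rewrite -[leRHS]int_T3_cst; apply: int_T3_le => //; first exact: contC.
by move=> x /hM; rewrite ler_norml => /andP[].
Qed.

Lemma int_T3_sum (h : 'I_3 -> E -> R) : (forall i, continuous (h i)) ->
  int_T3 (fun x => \sum_i h i x) = \sum_i int_T3 (h i).
Proof.
move=> ch; rewrite !big_ord_recl big_ord0 addr0.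
under [in LHS]eq_fun do rewrite !big_ord_recl big_ord0 addr0.
by rewrite int_T3D// ?int_T3D//; exact: contD.
Qed.

Definition set_coord (i : 'I_3) (a : R) : E -> E :=
  coord_affine (\row_j (if j == i then a else 0)) (\row_j (j != i)%:R).

Lemma set_coordE i a x j : set_coord i a x 0 j = if j == i then a else x 0 j.
Proof.
by rewrite !mxE; case: eqVneq => _ /=; rewrite ?mul0r ?addr0 ?mul1r ?add0r.
Qed.

Lemma set_coord_continuous i a : continuous (set_coord i a).
Proof. exact: coord_affine_continuous. Qed.

Lemma set_coord_line i a x : set_coord i a x = a *: basis_vec i + set_coord i 0 x.
Proof.
apply/rowP => j; rewrite [RHS]mxE [X in X + _]mxE !set_coordE mxE eqxx /=.
by case: eqVneq => _ /=; rewrite ?mulr1 ?addr0 ?mulr0 ?add0r.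
Qed.

(** Fubini's theorem, integrating first along the distinguished axis. *)
Lemma int_T3_zero_lines i (h : E -> R) : continuous h ->
  (forall x, \int[leb]_(s in unit_itv) (h (set_coord i s x))%:E = 0)%E -> int_T3 h = 0.
Proof.
move=> ch H; rewrite /int_T3 /Rintegral.
suff -> : (\int[leb3]_(x in cell) (h (vec3 x))%:E = 0)%E by [].
have ih := cell_integrable ch.
have [M M0 hM] := continuous_cube_bounded ch.
have sq_int x3 : unit_itv x3 -> (leb \x leb)%E.-integrable (unit_itv `*` unit_itv)
    (EFin \o (fun z : R * R => h (vec3 (z, x3)))).
  move=> /= x3I; apply: measurable_bounded_integrable.
  - exact: measurableX.
  - have : ((leb \x leb) (unit_itv `*` unit_itv) < +oo)%E by rewrite leb2_square ltry.
    exact.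
  - apply: measurable_funS (measurableT) _ _ => //.
    have H2 : measurable_fun setT (fun z : R * R => (z, x3)).
      by apply: measurable_fun_pair => //; exact: measurable_cst.
    exact: (measurableT_comp (continuous_measurable3 ch) H2).
  - exists M; split; first exact: num_real.
    move=> y My [a b] [/= aI bI]; apply/ltW; apply: le_lt_trans My; apply: hM.
    apply: vec3_cell_cube; rewrite cellE; split => //=.
move: ih; rewrite cellE => ih.
move: i H; apply: ord3P => H.
- apply: (@fubini_zero2 _ _ _ _ _ leb2 leb) => //; first exact: measurableX.
  move=> x3 x3I.
  apply: (@fubini_zero2 _ _ _ _ _ leb leb) => //; first exact: sq_int.
  move=> x2 _.
  rewrite -[RHS](H (vec3 (0, x2, x3))); apply: eq_integral => s _.
  congr (h _)%:E; apply/rowP; apply: ord3P; rewrite set_coordE ?vec3_0 ?vec3_1 ?vec3_2 //.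
- apply: (@fubini_zero2 _ _ _ _ _ leb2 leb) => //; first exact: measurableX.
  move=> x3 x3I.
  apply: (@fubini_zero1 _ _ _ _ _ leb leb) => //; first exact: sq_int.
  move=> x1 _.
  rewrite -[RHS](H (vec3 (x1, 0, x3))); apply: eq_integral => s _.
  congr (h _)%:E; apply/rowP; apply: ord3P; rewrite set_coordE ?vec3_0 ?vec3_1 ?vec3_2 //.
- apply: (@fubini_zero1 _ _ _ _ _ leb2 leb) => //; first exact: measurableX.
  move=> [x1 x2] _.
  rewrite -[RHS](H (vec3 (x1, x2, 0))); apply: eq_integral => s _.
  congr (h _)%:E; apply/rowP; apply: ord3P; rewrite set_coordE ?vec3_0 ?vec3_1 ?vec3_2 //.
Qed.

End CellIntegral.

(** * Fundamental theorem of calculus and parameters on the cell *)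

Section CellCalculus.
Context {R : realType}.
Local Notation E := 'rV[R]_3.
Local Notation leb := (@lebesgue_measure R).

Lemma is_derive_along (h : E -> R) i (a : R) (z : E) :
  derivable h (a *: basis_vec i + z) (basis_vec i) ->
  is_derive a 1 (fun r : R => h (r *: basis_vec i + z)) (dx i h (a *: basis_vec i + z)).
Proof.
move=> /derivableP /is_derive_line H.
have -> : (fun r : R => h (r *: basis_vec i + z)) =
   (fun r : R => h (r *: basis_vec i + (a *: basis_vec i + z))) \o (fun r => r - a).
  by apply/funext => r /=; rewrite addrA -scalerDl subrK.
rewrite -[dx i h _]mulr1; apply: is_derive1_comp; first by rewrite subrr.
have := is_deriveB (is_derive_id a 1) (is_derive_cst (a : R) (a : R) (1 : R)).
by rewrite subr0.
Qed.

Lemma continuous_line (h : E -> R) i (z : E) : continuous h ->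
  continuous (fun r : R => h (r *: basis_vec i + z)).
Proof.
move=> ch r; apply: (@continuous_cvg _ _ _ _ _ _ h); first exact: ch.
apply: cvgD; last exact: cvg_cst.
by apply: cvgZ; [exact: cvg_id|exact: cvg_cst].
Qed.

(** The difference of the two integrands has zero integral along every line
    parallel to the axis, by the one-dimensional fundamental theorem of
    calculus. *)
Lemma int_T3_dx_faces i (h : E -> R) : continuous h ->
  (forall x, derivable h x (basis_vec i)) -> continuous (dx i h) ->
  int_T3 (dx i h) = int_T3 (fun z => h (set_coord i 1 z) - h (set_coord i 0 z)).
Proof.
move=> ch dh cdh.
have csc a : continuous (fun z => h (set_coord i a z)).
  move=> z; apply: continuous_comp; last exact: ch.
  exact: set_coord_continuous.
have cB := contB (csc 1) (csc 0).
apply/eqP; rewrite -subr_eq0 -int_T3B//; apply/eqP.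
apply: (@int_T3_zero_lines _ i); first exact: contB.
move=> x.
have sc2 a s : set_coord i a (set_coord i s x) = set_coord i a x.
  by apply/rowP => j; rewrite !set_coordE; case: eqVneq.
under eq_integral => s _ do rewrite !sc2.
set k := h _ - h _.
have ci : continuous (fun s : R => dx i h (set_coord i s x)).
  move=> s; under eq_fun do rewrite set_coord_line.
  rewrite set_coord_line; exact: continuous_line.
have iI (f : R -> R) : continuous f -> leb.-integrable `[0, 1] (EFin \o f).
  move=> cf; apply: continuous_compact_integrable; first exact: segment_compact.
  exact: continuous_subspaceT.
have ci2 : continuous (fun s : R => dx i h (set_coord i s x) - k).
  by move=> s; apply: cvgB; [exact: ci|exact: cvg_cst].
rewrite integral_itv_bndo_bndc; last first.
  by apply/measurable_EFinP; apply: measurable_funTS; exact: continuous_measurable_fun.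
under eq_integral do rewrite EFinB.
have ik : leb.-integrable `[0, 1] (fun=> k%:E).
  by apply: (iI (cst k)); exact: cst_continuous.
have id : leb.-integrable `[0, 1] (fun s => (dx i h (set_coord i s x))%:E).
  exact: iI ci.
rewrite integralB//.
rewrite (@continuous_FTC2 _ _ (fun s => h (set_coord i s x)) 0 1)//.
- by rewrite integral_cst//= lebesgue_measure_itv /= lte_fin ltr01 oppr0 adde0 mule1 -!EFinB subrr.
- exact: continuous_subspaceT.
- have cF : continuous (fun s : R => h (set_coord i s x)).
    move=> s; under eq_fun do rewrite set_coord_line.
    rewrite set_coord_line; exact: continuous_line.
  split.
  + move=> s _; under eq_fun do rewrite set_coord_line.
    by have [] := is_derive_along (dh (s *: basis_vec i + set_coord i 0 x)).
  + by apply: cvg_at_right_filter; exact: cF.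
  + by apply: cvg_at_left_filter; exact: cF.
- move=> s _; rewrite derive1E; under eq_fun do rewrite set_coord_line.
  rewrite [in RHS]set_coord_line.
  by have [_] := is_derive_along (dh (s *: basis_vec i + set_coord i 0 x)).
Qed.

Lemma periodic_set_coord i (h : E -> R) (z : E) : periodic h ->
  h (set_coord i 1 z) = h (set_coord i 0 z).
Proof.
move=> ph; rewrite set_coord_line addrC -[RHS](ph _ (delta_mx 0 i)); congr h.
congr (_ + _); apply/rowP => j; rewrite !mxE /= mul1r.
by case: (j == i).
Qed.

Lemma int_T3_dx_periodic i (h : E -> R) : continuous h ->
  (forall x, derivable h x (basis_vec i)) -> continuous (dx i h) -> periodic h ->
  int_T3 (dx i h) = 0.
Proof.
move=> ch dh cdh ph; rewrite int_T3_dx_faces// -[RHS](@int_T3_cst R 0).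
by congr int_T3; apply/funext => z; rewrite periodic_set_coord// subrr.
Qed.

(** ** Integrals depending on parameters *)

(** The integration variable [z] comes before the parameters [t] and [x]; only
    times in [I] matter. *)
Definition param_cont (I : set R) (F : E -> R -> E -> R) := forall z t x, I t ->
  F w.1 w.2.1 w.2.2 @[w --> within [set w : E * (R * E) | I w.2.1] (nbhs (z, (t, x)))]
    --> F z t x.

Section param.
Variables (I : set R) (F : E -> R -> E -> R).
Hypothesis cF : param_cont I F.

Lemma param_cont_z (t : R) (x : E) : I t -> continuous (fun z => F z t x).
Proof.
move=> It z A /(@cF z t x It) HA.
have {}HA : \forall w \near (z, (t, x)), I w.2.1 -> A (F w.1 w.2.1 w.2.2) by [].
suff : \forall y \near z, A (F y t x) by [].
case: HA => -[A1 A2] [/= nA1 nA2] H; apply: filterS nA1 => y A1y.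
by have := H (y, (t, x)); apply => //; split => //=; exact: nbhs_singleton.
Qed.

(** Continuity in the parameters is uniform in the integration variable, the
    cube being compact. *)
Lemma param_tube (t : R) (x : E) (e : R) : I t -> 0 < e ->
  \forall q \near (t, x), I q.1 -> forall z, cube z -> `|F z q.1 q.2 - F z t x| < e.
Proof.
move=> It e0.
have /compact_near_coveringP := @cube_compact R.
move=> /(_ (R * E)%type (nbhs (t, x)) (fun q z => I q.1 -> `|F z q.1 q.2 - F z t x| < e)
  (nbhs_filter _)) H.
suff /H : forall z, cube z -> \forall z' \near z & q \near (t, x),
    I q.1 -> `|F z' q.1 q.2 - F z' t x| < e.
  by apply: filterS => q Hq Iq z cz; exact: Hq.
move=> z _.
have e2 : 0 < e / 2 by rewrite divr_gt0.
have /cvgrPdist_lt /(_ _ e2) HA := @cF z t x It.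
have {}HA : \forall w \near (z, (t, x)), I w.2.1 -> `|F z t x - F w.1 w.2.1 w.2.2| < e / 2 by [].
case: HA => -[A1 A2] [/= nA1 nA2] HA.
exists (A1, A2) => // -[z' q] [/= A1z A2q] Iq.
have h1 := HA (z', q) (conj A1z A2q) Iq.
have h2 := HA (z', (t, x)) (conj A1z (nbhs_singleton nA2)) It.
rewrite /= in h1 h2; rewrite (_ : F z' q.1 q.2 - F z' t x =
  (F z t x - F z' t x) - (F z t x - F z' q.1 q.2)); last by ring.
by rewrite (le_lt_trans (ler_normB _ _))// [ltRHS](splitr e) ltrD.
Qed.

Lemma joint_cont_int : joint_cont I (fun t x => int_T3 (fun z => F z t x)).
Proof.
move=> t x It; apply/cvgrPdist_le => e e0.
suff : \forall q \near (t, x), (I `*` [set: E]) q ->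
  `|int_T3 (fun z => F z t x) - int_T3 (fun z => F z q.1 q.2)| <= e by [].
apply: filterS (@param_tube t x e It e0) => q Hq [/= Iq _].
rewrite -int_T3B; [|exact: param_cont_z..].
apply: int_T3_norm_le; first by apply: contB; exact: param_cont_z.
by move=> z cz; rewrite distrC ltW// Hq.
Qed.
End param.

Lemma param_bound (I : set R) (F : E -> R -> E -> R) (t : R) (x : E) : param_cont I F -> I t ->
  exists2 M, 0 <= M & \forall q \near (t, x), I q.1 -> forall z, cube z -> `|F z q.1 q.2| <= M.
Proof.
move=> cF It; have [M M0 hM] := continuous_cube_bounded (@param_cont_z _ _ cF t x It).
exists (M + 1); first exact: addr_ge0.
apply: filterS (@param_tube _ _ cF t x 1 It ltr01) => q Hq Iq z cz.
rewrite -(subrK (F z t x) (F z q.1 q.2)) (le_trans (ler_normD _ _))// addrC.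
by rewrite lerD ?hM// ltW// Hq.
Qed.

(** Dominated differentiation, with the constant [M] as dominating function on
    the cell. *)
Lemma is_derive_int (f f' : R -> E -> R) (a r M : R) : 0 < r ->
  (forall s, `|s - a| < r -> continuous (f s)) ->
  (forall s z, `|s - a| < r -> is_derive s 1 (f ^~ z) (f' s z)) ->
  (forall s z, `|s - a| < r -> cube z -> `|f' s z| <= M) -> 0 <= M ->
  is_derive a 1 (fun s => int_T3 (f s)) (int_T3 (f' a)).
Proof.
move=> r0 cf df fM M0.
have Ir s : `](a - r), (a + r)[%classic s -> `|s - a| < r.
  by rewrite /= in_itv /= ltr_distl.
have Ia : `](a - r), (a + r)[%classic a by rewrite /= in_itv /= ltrBlDr ltrDl r0.
pose T3 := (measurableTypeR R * measurableTypeR R * measurableTypeR R)%type.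
have mc : measurable (@cell R : set T3) := @measurable_cell R.
have inf s : `](a - r), (a + r)[%classic s ->
    leb3.-integrable (@cell R) (EFin \o (fun y : T3 => f s (vec3 y))).
  by move=> /Ir sr; apply: cell_integrable; exact: cf.
have dff s (y : T3) : `](a - r), (a + r)[%classic s -> cell y ->
    derivable (fun s => f s (vec3 y)) s 1.
  by move=> /Ir sr _; have [] := df s (vec3 y) sr.
have fM' s (y : T3) : `](a - r), (a + r)[%classic s -> cell y ->
    `|partial1of2 (fun s (y : T3) => f s (vec3 y)) s y| <= M.
  move=> /Ir sr cy; rewrite partial1of2E.
  have [_ ->] := df s (vec3 y) sr.
  by apply: fM => //; exact: vec3_cell_cube.
have iM : leb3.-integrable (@cell R) (EFin \o (fun _ : T3 => M)).
  exact: (@cell_integrable R (fun _ => M) (@contC R M)).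
have D := derivable_under_integral mc Ia inf dff (fun _ => M0) iM fM'.
have V := differentiation_under_integral mc Ia inf dff (fun _ => M0) iM fM'.
split; first exact: D.
move: V; rewrite derive1E => ->; apply: eq_Rintegral => y _ /=.
by rewrite partial1of2E; have [_ ->] := df a (vec3 y) (Ir _ Ia).
Qed.

End CellCalculus.

Section ParamDerivatives.
Context {R : realType}.
Local Notation E := 'rV[R]_3.
Implicit Types (I : set R) (F G : E -> R -> E -> R).

Lemma near_ball_time (t : R) (P : set R) : (\forall s \near t, P s) ->
  exists2 r : R, 0 < r & forall s, `|s - t| < r -> P s.
Proof.
move=> /nbhs_ballP[r /= r0 H]; exists r => // s sr.
by apply: H; rewrite -ball_normE /ball_ /= distrC.
Qed.

Lemma is_derive_int_time I F G (t : R) (x : E) : nbhs t I ->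
  param_cont I F -> param_cont I G ->
  (forall z s, I s -> is_derive s 1 (fun s => F z s x) (G z s x)) ->
  is_derive t 1 (fun s => int_T3 (fun z => F z s x)) (int_T3 (fun z => G z t x)).
Proof.
move=> nI cF cG dF.
have [M M0 hM] := @param_bound R I G t x cG (nbhs_singleton nI).
have H : \forall s \near t, I s /\ forall z, cube z -> `|G z s x| <= M.
  apply: filterS2 nI (near_slice_t hM) => s Is Hs; split => //; exact: Hs.
have [r r0 {}H] := near_ball_time H.
apply: (@is_derive_int _ (fun s z => F z s x) (fun s z => G z s x) _ r M) => //.
- by move=> s /H[Is _]; exact: (@param_cont_z _ I F cF s x Is).
- by move=> s z /H[Is _]; exact: dF.
- by move=> s z /H[Is]; apply.
Qed.

Lemma is_derive_int_space I F G (t : R) (x : E) i : I t ->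
  param_cont I F -> param_cont I G ->
  (forall z y, is_derive y (basis_vec i) (F z t) (G z t y)) ->
  is_derive x (basis_vec i) (fun y => int_T3 (fun z => F z t y)) (int_T3 (fun z => G z t x)).
Proof.
move=> It cF cG dF.
have [M M0 hM] := @param_bound R I G t x cG It.
have cl : (r *: basis_vec i + x) @[r --> (0 : R)] --> x.
  rewrite -[X in _ --> X]add0r -(scale0r (basis_vec i)).
  apply: cvgD; last exact: cvg_cst.
  by apply: cvgZ; [exact: cvg_id|exact: cvg_cst].
have [r r0 H] := near_ball_time (cl _ (near_slice_x hM)).
apply/is_derive_line.
have -> : int_T3 (fun z => G z t x) = int_T3 (fun z => G z t ((0 : R) *: basis_vec i + x)).
  by rewrite scale0r add0r.
apply: (@is_derive_int _ (fun s z => F z t (s *: basis_vec i + x))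
          (fun s z => G z t (s *: basis_vec i + x)) _ r M) => //.
- by move=> s _; exact: (@param_cont_z _ I F cF t _ It).
- move=> s z _; have [d e] := dF z (s *: basis_vec i + x).
  by rewrite -e; exact: is_derive_along d.
- by move=> s z /H /(_ It); apply.
Qed.

Lemma param_cont_mean I (f : R -> E -> R) : joint_cont I f ->
  param_cont I (fun z t _ => f t z).
Proof.
move=> cf z t x It A /(cf t z It) HA.
have {}HA : \forall w \near (t, z), (I `*` [set: E]) w -> A (f w.1 w.2) by [].
suff : \forall w \near (z, (t, x)), I w.2.1 -> A (f w.2.1 w.1) by [].
have c1 : w.2.1 @[w --> (z, (t, x))] --> t.
  by apply: (@cvg_comp _ _ _ snd fst _ (nbhs (t, x))); [exact: cvg_snd|exact: cvg_fst].
have c2 : w.1 @[w --> (z, (t, x))] --> z by exact: cvg_fst.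
have cc : (w.2.1, w.1) @[w --> (z, (t, x))] --> (t, z) by exact: cvg_pair c1 c2.
have {}HA : \forall w \near (z, (t, x)), (I `*` [set: E]) (w.2.1, w.1) -> A (f w.2.1 w.1) := cc _ HA.
move: HA.
by apply: filterS => w H Iw; apply: H; split.
Qed.

(** The time derivative of the mean is the mean of the time derivative, which
    puts the statement in reach of induction on the order. *)
Lemma Cn_mean n I (f : R -> E -> R) : time_set I -> open I -> Cn I n f ->
  Cn I n (fun t (_ : E) => int_T3 (f t)).
Proof.
move=> tI oI; elim: n f => [|n IHn] f fn.
  by apply/Cn0P; exact: (joint_cont_int (param_cont_mean (Cn_cont fn))).
apply: (@CnS _ _ n _ _ (fun t _ => int_T3 (dt I f t)) (fun _ _ _ => 0)) => //.
- exact: (joint_cont_int (param_cont_mean (Cn_cont fn))).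
- move=> t x It; apply: has_dt_is_derive.
  have nI s : I s -> nbhs s I by move=> Is; exact: open_nbhs_nbhs.
  apply: (@is_derive_int_time I (fun z t _ => f t z) (fun z t _ => dt I f t z) t x).
  + exact: nI.
  + exact: param_cont_mean (Cn_cont fn).
  + exact: param_cont_mean (Cn_cont (Cn_dt fn)).
  + move=> z s Is; apply: is_derive_has_dt; first exact: nI.
    exact: (Cn_has_dt fn).
- exact: IHn (Cn_dt fn).
- by move=> i; exact: Cn_cst.
Qed.

(** ** Averages along a coordinate direction *)

(** The point whose [i]-th coordinate is interpolated between that of [y] and
    that of [x] by the first coordinate of [z], the other ones being frozen at
    [y] (weight 0) or kept (weight 1). *)
Definition pull (y al : E) (i : 'I_3) (z x : E) : E :=
  coord_affine (\row_j ((1 - (al 0 j + (j == i)%:R * z 0 0)) * y 0 j))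
    (\row_j (al 0 j + (j == i)%:R * z 0 0)) x.

Lemma pullE y al i z x j :
  pull y al i z x 0 j = y 0 j + (al 0 j + (j == i)%:R * z 0 0) * (x 0 j - y 0 j).
Proof. by rewrite !mxE; ring. Qed.

(** Averages over the segment described by [pull]; differentiating in the
    interpolated coordinate produces one more factor [z 0 0], whence the
    exponent [k]. *)
Definition pull_mean y al i (k : nat) (f : R -> E -> R) (t : R) (x : E) : R :=
  int_T3 (fun z => z 0 0 ^+ k * f t (pull y al i z x)).

Section pull.
Variables (y al : E) (i : 'I_3).

Lemma param_cont_pull k (f : R -> E -> R) : joint_cont setT f ->
  param_cont setT (fun z t x => z 0 0 ^+ k * f t (pull y al i z x)).
Proof.
move=> cf z t x _; apply: cvgM.
  apply: cvg_within_filter.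
  apply: (@continuous_cvg _ _ _ _ _ _ (fun z : E => z 0 0 ^+ k)); last exact: cvg_fst.
  apply: (@continuous_comp _ _ _ (fun z : E => z 0 0) (fun r => r ^+ k)).
    exact: coord_continuous.
  exact: exprn_continuous.
apply: cvg_within_filter.
have cz : (w : E * (R * E)).1 @[w --> (z, (t, x))] --> z by exact: cvg_fst.
have ct : (w : E * (R * E)).2.1 @[w --> (z, (t, x))] --> t.
  by apply: (@cvg_comp _ _ _ snd fst _ (nbhs (t, x))); [exact: cvg_snd|exact: cvg_fst].
have cx : (w : E * (R * E)).2.2 @[w --> (z, (t, x))] --> x.
  by apply: (@cvg_comp _ _ _ snd snd _ (nbhs (t, x))); [exact: cvg_snd|exact: cvg_snd].
have cp : pull y al i w.1 w.2.2 @[w --> (z, (t, x))] --> pull y al i z x.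
  apply: (@cvg_row _ _ (nbhs (z, (t, x)))) => j; rewrite pullE.
  under eq_fun do rewrite pullE.
  have cj (g : E * (R * E) -> E) (l : E) : g w @[w --> (z, (t, x))] --> l ->
     forall j, g w 0 j @[w --> (z, (t, x))] --> l 0 j.
    move=> gl j'; apply: (@continuous_cvg _ _ _ _ _ _ (fun z : E => z 0 j')) => //.
    exact: coord_continuous.
  apply: cvgD; first exact: cvg_cst.
  apply: cvgM.
    apply: cvgD; first exact: cvg_cst.
    by apply: cvgM; [exact: cvg_cst|exact: cj].
  by apply: cvgB; [exact: cj|exact: cvg_cst].
move=> A /(cf t (pull y al i z x) Logic.I) HA.
have {}HA : \forall w \near (t, pull y al i z x), (setT `*` [set: E]) w -> A (f w.1 w.2) by [].
have cc : (w.2.1, pull y al i w.1 w.2.2) @[w --> (z, (t, x))] --> (t, pull y al i z x).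
  exact: cvg_pair ct cp.
have {}HA : \forall w \near (z, (t, x)), (setT `*` [set: E]) (w.2.1, pull y al i w.1 w.2.2) ->
   A (f w.2.1 (pull y al i w.1 w.2.2)) := cc _ HA.
suff : \forall w \near (z, (t, x)), A (f w.2.1 (pull y al i w.1 w.2.2)) by [].
by apply: filterS HA => w; apply; split.
Qed.

Lemma joint_cont_pull_mean k (f : R -> E -> R) : joint_cont setT f ->
  joint_cont setT (pull_mean y al i k f).
Proof. by move=> cf; exact: (joint_cont_int (param_cont_pull (k := k) cf)). Qed.

Lemma is_derive_pull_mean n k (f : R -> E -> R) t x j : Cn setT n.+1 f ->
  is_derive x (basis_vec j) (pull_mean y al i k f t)
    (al 0 j * pull_mean y al i k (fun t => dx j (f t)) t x +
     (j == i)%:R * pull_mean y al i k.+1 (fun t => dx j (f t)) t x).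
Proof.
move=> fn.
have cdx := Cn_cont (Cn_dx fn j).
have c1 := @param_cont_z R setT _ (param_cont_pull (k := k) cdx) t x Logic.I.
have c2 := @param_cont_z R setT _ (param_cont_pull (k := k.+1) cdx) t x Logic.I.
rewrite /pull_mean -!int_T3Zl// -int_T3D//; [|exact: contM (@contC R _) _..].
have -> : (fun z : E => al 0 j * (z 0 0 ^+ k * dx j (f t) (pull y al i z x)) +
    (j == i)%:R * (z 0 0 ^+ k.+1 * dx j (f t) (pull y al i z x))) =
  (fun z : E => (al 0 j + (j == i)%:R * z 0 0) * (z 0 0 ^+ k * dx j (f t) (pull y al i z x))).
  by apply/funext => z; rewrite exprS; ring.
apply: (@is_derive_int_space setT (fun z t x => z 0 0 ^+ k * f t (pull y al i z x))
  (fun z t x => (al 0 j + (j == i)%:R * z 0 0) * (z 0 0 ^+ k * dx j (f t) (pull y al i z x)))) => //.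
- exact: param_cont_pull (Cn_cont fn).
- have H : param_cont setT (fun (z : E) (t : R) (x : E) => al 0 j + (j == i)%:R * z 0 0).
    move=> z s x' _; apply: cvgD; first exact: cvg_cst.
    apply: cvgM; first exact: cvg_cst.
    apply: cvg_within_filter.
    apply: (@continuous_cvg _ _ _ _ _ _ (fun z : E => z 0 0)); last exact: cvg_fst.
    exact: coord_continuous.
  by move=> z s x' Is; apply: cvgM; [exact: (@H z s x' Is)|
    exact: (@param_cont_pull k (fun t => dx j (f t)) cdx z s x' Is)].
- move=> z x'.
  have := @is_derive_coord_affine _ (f t) (\row_j ((1 - (al 0 j + (j == i)%:R * z 0 0)) * y 0 j))
    (\row_j (al 0 j + (j == i)%:R * z 0 0)) x' j _ (Cn_is_derive fn _ j Logic.I).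
  rewrite mxE => D; have := is_deriveZ (z 0 0 ^+ k) D; move=> /is_derive_eq; apply.
  by rewrite /GRing.scale /= /pull; ring.
Qed.

Lemma Cn_pull_mean n k (f : R -> E -> R) : Cn setT n f -> Cn setT n (pull_mean y al i k f).
Proof.
have tT := @time_setT R.
elim: n k f => [|n IHn] k f fn.
  by apply/Cn0P; exact: joint_cont_pull_mean (Cn_cont fn).
apply: (@CnS _ _ n _ _ (pull_mean y al i k (dt setT f))
  (fun j t x => al 0 j * pull_mean y al i k (fun t => dx j (f t)) t x +
    (j == i)%:R * pull_mean y al i k.+1 (fun t => dx j (f t)) t x)) => //.
- exact: joint_cont_pull_mean (Cn_cont fn).
- move=> t x _; apply: has_dt_is_derive.
  apply: (@is_derive_int_time setT (fun z t x => z 0 0 ^+ k * f t (pull y al i z x))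
    (fun z t x => z 0 0 ^+ k * dt setT f t (pull y al i z x))).
  + exact: filterT.
  + exact: param_cont_pull (Cn_cont fn).
  + exact: param_cont_pull (Cn_cont (Cn_dt fn)).
  + move=> z s _.
    have D : is_derive s 1 (f ^~ (pull y al i z x)) (dt setT f s (pull y al i z x)).
      by apply: (@is_derive_has_dt _ setT); [exact: filterT|exact: (Cn_has_dt fn)].
    exact: (is_deriveZ (z 0 0 ^+ k) D).
- by move=> t x j _; exact: is_derive_pull_mean fn.
- exact: IHn (Cn_dt fn).
- move=> j; apply: Cn_add => //; apply: Cn_mul => //; (try exact: Cn_cst);
    apply: IHn; exact: (Cn_dx fn j).
Qed.

Section faces.
Variables (f : R -> E -> R) (t : R) (x : E).
Hypothesis f1 : Cn setT 1 f.

Lemma pull_z_line (r : R) z : pull y al i (r *: basis_vec 0 + z) x =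
  (r * (x 0 i - y 0 i)) *: basis_vec i + pull y al i z x.
Proof.
apply/rowP => j; rewrite [RHS]mxE !pullE !mxE !eqxx /=.
by case: (eqVneq j i) => [->|_] /=; ring.
Qed.

Lemma is_derive_pull_z z : is_derive z (basis_vec 0) (fun z => f t (pull y al i z x))
  ((x 0 i - y 0 i) * dx i (f t) (pull y al i z x)).
Proof.
apply/is_derive_line.
have -> : (fun h : R => f t (pull y al i (h *: basis_vec 0 + z) x)) =
   (fun h : R => f t (h *: basis_vec i + pull y al i z x)) \o (fun h => (x 0 i - y 0 i) * h).
  by apply/funext => h /=; rewrite pull_z_line mulrC.
rewrite mulrC; apply: is_derive1_comp.
  rewrite mulr0; apply/is_derive_line; exact: (Cn_is_derive f1).
have := @is_deriveZ R R R id (x 0 i - y 0 i) 0 1 1 (is_derive_id _ _).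
by rewrite /GRing.scale /= mulr1.
Qed.

Lemma pull_set_coord a z : pull y al i (set_coord 0 a z) x = pull y al i (const_mx a) x.
Proof. by apply/rowP => j; rewrite !pullE set_coordE eqxx mxE. Qed.

Let cf : joint_cont setT f := Cn_cont f1.
Let cdf : joint_cont setT (fun t => dx i (f t)) := Cn_cont (Cn_dx f1 i).

Let cp k : continuous (fun z : E => z 0 0 ^+ k * f t (pull y al i z x)).
Proof. exact: (@param_cont_z R setT _ (param_cont_pull (k := k) cf) t x Logic.I). Qed.
Let cdp k : continuous (fun z : E => z 0 0 ^+ k * dx i (f t) (pull y al i z x)).
Proof. exact: (@param_cont_z R setT _ (param_cont_pull (k := k) cdf) t x Logic.I). Qed.

(** The fundamental theorem of calculus along the segment. *)
Lemma pull_mean_dx : (x 0 i - y 0 i) * pull_mean y al i 0 (fun t => dx i (f t)) t x =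
  f t (pull y al i (const_mx 1) x) - f t (pull y al i (const_mx 0) x).
Proof.
rewrite /pull_mean -int_T3Zl; last exact: cdp.
have e z : dx 0 (fun z => f t (pull y al i z x)) z =
    (x 0 i - y 0 i) * dx i (f t) (pull y al i z x).
  by have [_ <-] := is_derive_pull_z z.
have c0 : continuous (fun z : E => f t (pull y al i z x)).
  rewrite (_ : (fun z : E => _) = (fun z : E => z 0 0 ^+ 0 * f t (pull y al i z x))).
    exact: cp.
  by apply/funext => z; rewrite expr0 mul1r.
have c1 : continuous (dx 0 (fun z => f t (pull y al i z x))).
  have -> : dx 0 (fun z => f t (pull y al i z x)) =
    (fun z => (x 0 i - y 0 i) * (z 0 0 ^+ 0 * dx i (f t) (pull y al i z x))).
    by apply/funext => z; rewrite e expr0 mul1r.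
  by apply: contM; [exact: contC|exact: cdp].
have -> : (fun z : E => (x 0 i - y 0 i) * (z 0 0 ^+ 0 * dx i (f t) (pull y al i z x))) =
   dx 0 (fun z => f t (pull y al i z x)).
  by apply/funext => z; rewrite e expr0 mul1r.
rewrite int_T3_dx_faces//; last by move=> z; have [] := is_derive_pull_z z.
under [X in int_T3 X]eq_fun do rewrite !pull_set_coord.
by rewrite int_T3_cst.
Qed.

(** Integration by parts along the segment: the derivative of [s * f s] is [f
    s + s * f' s]. *)
Lemma pull_mean_primitive :
  pull_mean y al i 0 f t x + (x 0 i - y 0 i) * pull_mean y al i 1 (fun t => dx i (f t)) t x =
  f t (pull y al i (const_mx 1) x).
Proof.
rewrite /pull_mean -int_T3Zl; last exact: cdp.
rewrite -int_T3D; [|exact: cp|by apply: contM; [exact: contC|exact: cdp]].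
pose h (z : E) := z 0 0 * f t (pull y al i z x).
have dh z : is_derive z (basis_vec 0) h (z 0 0 ^+ 0 * f t (pull y al i z x) +
    (x 0 i - y 0 i) * (z 0 0 ^+ 1 * dx i (f t) (pull y al i z x))).
  have d1 : is_derive z (basis_vec 0) (fun z : E => z 0 0) 1.
    have := @is_derive_coord R id z 0 0 _ (is_derive_id _ _).
    by rewrite eqxx mulr1.
  have := is_deriveM d1 (is_derive_pull_z z); move=> /is_derive_eq; apply.
  by rewrite /GRing.scale /=; ring.
have ch : continuous h.
  rewrite (_ : h = (fun z : E => z 0 0 ^+ 1 * f t (pull y al i z x))); first exact: cp.
  by apply/funext => z; rewrite expr1.
have e : (fun z : E => z 0 0 ^+ 0 * f t (pull y al i z x) +
    (x 0 i - y 0 i) * (z 0 0 ^+ 1 * dx i (f t) (pull y al i z x))) = dx 0 h.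
  by apply/funext => z; have [_ <-] := dh z.
have cdh : continuous (dx 0 h).
  rewrite -e; apply: contD; first exact: cp.
  by apply: contM; [exact: contC|exact: cdp].
rewrite [X in int_T3 X]e int_T3_dx_faces //.
rewrite -[RHS](@int_T3_cst R); congr int_T3; apply/funext => z.
by rewrite /h !pull_set_coord !set_coordE eqxx mul1r mul0r subr0.
Qed.
End faces.
End pull.

Lemma mvt_dir (f : E -> R) j (h : R) z : 0 < h ->
  (forall x, derivable f x (basis_vec j)) ->
  exists2 s, 0 <= s <= h & f (h *: basis_vec j + z) - f z = h * dx j f (s *: basis_vec j + z).
Proof.
move=> h0 df.
have D (r : R) : is_derive r 1 (fun r : R => f (r *: basis_vec j + z))
    (dx j f (r *: basis_vec j + z)) by exact: is_derive_along.
have [|s sI] := @MVT _ (fun r : R => f (r *: basis_vec j + z))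
   (fun r : R => dx j f (r *: basis_vec j + z)) 0 h h0 (fun r _ => D r).
  by apply: derivable_within_continuous => r _; have [] := D r.
rewrite subr0 scale0r add0r mulrC => e; exists s => //.
by move: sI; rewrite in_itv /= => /andP[s1 s2]; rewrite (ltW s1) (ltW s2).
Qed.

(** Schwarz's theorem. The mean value theorem, used twice in either order,
    expresses one second difference by both mixed derivatives at nearby
    points. *)
Lemma dxC (f : E -> R) j k x :
  (forall x, derivable f x (basis_vec j)) -> (forall x, derivable f x (basis_vec k)) ->
  (forall x, derivable (dx j f) x (basis_vec k)) ->
  (forall x, derivable (dx k f) x (basis_vec j)) ->
  continuous (dx k (dx j f)) -> continuous (dx j (dx k f)) ->
  dx k (dx j f) x = dx j (dx k f) x.
Proof.
move=> dj dk djk dkj c1 c2.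
(* a second difference is a value of each of the two mixed derivatives nearby *)
have key (a b : 'I_3) h : 0 < h -> (forall x, derivable f x (basis_vec a)) ->
    (forall x, derivable (dx a f) x (basis_vec b)) ->
    exists s r, [/\ 0 <= s <= h, 0 <= r <= h &
     f (h *: basis_vec a + h *: basis_vec b + x) - f (h *: basis_vec a + x) -
     (f (h *: basis_vec b + x) - f x) =
     h * h * dx b (dx a f) (s *: basis_vec a + r *: basis_vec b + x)].
  move=> h0 da dab.
  pose g z := f (h *: basis_vec b + z) - f z.
  have dsh z : is_derive z (basis_vec a) (fun z => f (h *: basis_vec b + z))
      (dx a f (h *: basis_vec b + z)).
    apply/is_derive_line.
    have := is_derive_along (i := a) (a := 0) (z := h *: basis_vec b + z) (h := f) (da _).
    rewrite scale0r add0r; congr is_derive; apply/funext => r.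
    by rewrite addrCA.
  have dg z : is_derive z (basis_vec a) g (dx a f (h *: basis_vec b + z) - dx a f z).
    by have := is_deriveB (dsh z) (derivableP (da z)).
  have [s sI e] := @mvt_dir g a h x h0 (fun z => let: DeriveDef d _ := dg z in d).
  have [r rI e2] := @mvt_dir (dx a f) b h (s *: basis_vec a + x) h0 dab.
  exists s, r; split; [exact: sI|exact: rI|].
  move: e; rewrite /g (_ : dx a _ _ = dx a f (h *: basis_vec b + (s *: basis_vec a + x)) -
     dx a f (s *: basis_vec a + x)); last by have [_ <-] := dg (s *: basis_vec a + x).
  rewrite e2 -mulrA => e; rewrite [s *: _ + r *: _]addrC -[_ + _ + x in RHS]addrA -e.
  rewrite [h *: _ + h *: _]addrC -[h *: _ + _ + x]addrA; lra.
have cl (D : E -> R) e : continuous D -> 0 < e ->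
    exists2 r : R, 0 < r & forall z, `|z - x| < r -> `|D z - D x| < e.
  move=> cD e0.
  have /nbhs_ballP[r /= r0 H] : \forall z \near x, `|D z - D x| < e.
    by move/(_ x): cD => /cvgr_dist_lt /(_ e e0); apply: filterS => z; rewrite distrC.
  by exists r => // z zr; apply: H; rewrite -ball_normE /ball_ /= distrC.
have tri (A B D : R) : `|D - A| < `|A - B| / 2 -> `|D - B| < `|A - B| / 2 -> False.
  move=> h1 h2; have := ler_distD D A B; rewrite [`|A - D|]distrC; lra.
apply/eqP; rewrite -subr_eq0; apply/negPn/negP => ne.
have e0 : 0 < `|dx k (dx j f) x - dx j (dx k f) x| / 2 by rewrite divr_gt0 // normr_gt0.
have [r1 r10 H1] := cl _ _ c1 e0; have [r2 r20 H2] := cl _ _ c2 e0.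
pose h := Num.min r1 r2 / 4.
have h0 : 0 < h by rewrite divr_gt0 // lt_min r10 r20.
have [s1 [q1 [s1I q1I E1]]] := key j k h h0 dj djk.
have [s2 [q2 [s2I q2I E2]]] := key k j h h0 dk dkj.
have small (s q : R) (a b : 'I_3) : 0 <= s <= h -> 0 <= q <= h ->
    `|s *: basis_vec a + q *: basis_vec b + x - x| < Num.min r1 r2.
  move=> /andP[s0 sh] /andP[q0 qh]; rewrite addrK.
  have nb (c : 'I_3) : `|basis_vec c : E| <= 1.
    rewrite /Num.norm /= mx_normrE; apply/bigmax_leP; split => // -[a' b'] _ /=.
    by rewrite mxE; case: (_ && _); rewrite ?normr1 ?normr0.
  apply: (@le_lt_trans _ _ (h + h)).
    apply: (le_trans (ler_normD _ _)); rewrite !normrZ !ger0_norm//.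
    by apply: lerD; apply: (le_trans (ler_piMr _ (nb _))).
  have m0 : 0 < Num.min r1 r2 by rewrite lt_min r10 r20.
  rewrite /h; move: m0; set m := Num.min r1 r2 => m0.
  by rewrite -mulrDl ltr_pdivrMr//; move: m0; clear; lra.
have := H1 _ (lt_le_trans (small s1 q1 j k s1I q1I) _); rewrite ge_min lexx => /(_ isT) B1.
have := H2 _ (lt_le_trans (small s2 q2 k j s2I q2I) _); rewrite ge_min lexx orbT => /(_ isT) B2.
have eq12 : dx k (dx j f) (s1 *: basis_vec j + q1 *: basis_vec k + x) =
    dx j (dx k f) (s2 *: basis_vec k + q2 *: basis_vec j + x).
  apply: (@mulfI _ (h * h)); first by rewrite mulf_neq0 // gt_eqF.
  have alg (A B C D : R) : A - B - (C - D) = A - C - (B - D) by ring.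
  apply: (etrans (esym E1)); apply: (etrans (alg _ _ _ _)); apply: (etrans _ E2).
  by congr (f (_ + x) - _ - _); exact: addrC.
move: B1; rewrite eq12 => B1.
exact: (tri _ _ _ B1 B2).
Qed.

End ParamDerivatives.

(** * Vector fields and vector potentials *)

Section VectorFields.
Context {R : realType}.
Local Notation E := 'rV[R]_3.
Implicit Types (I : set R).

Definition entry (j : 'I_3) (x : E) : R := x 0 j.
Lemma entry_linear j : linear (entry j).
Proof. by move=> a x z; rewrite /entry !mxE. Qed.
HB.instance Definition _ j := GRing.isLinear.Build R E R *%R (entry j) (entry_linear j).

Lemma entry_continuous j : continuous (entry j).
Proof. exact: coord_continuous. Qed.

Definition along (w : E) (r : R) : E := r *: w.
Lemma along_linear w : linear (along w).
Proof. by move=> a x z; rewrite /along scalerDl scalerA. Qed.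
HB.instance Definition _ w := GRing.isLinear.Build R R E *:%R (along w) (along_linear w).
Lemma along_continuous w : continuous (along w).
Proof. by move=> r; apply: cvgZ; [exact: cvg_id|exact: cvg_cst]. Qed.

Lemma Cn_entry n I (f : R -> E -> E) j : time_set I -> Cn I n f ->
  Cn I n (fun t x => f t x 0 j).
Proof. by move=> tI; exact: (@Cn_lin R _ _ (entry j) (@entry_continuous j) n I f tI). Qed.

Lemma Cn_sum {V : normedModType R} n I m (f : 'I_m -> R -> E -> V) : time_set I ->
  (forall i, Cn I n (f i)) -> Cn I n (fun t x => \sum_i f i t x).
Proof.
move=> tI; elim: m f => [|m IHm] f fn.
  apply: (@Cn_ext _ _ n I _ (fun _ _ => 0)); last exact: Cn_cst.
  by move=> t x _; rewrite big_ord0.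
apply: (@Cn_ext _ _ n I _ (fun t x => f ord0 t x + \sum_i f (lift ord0 i) t x)).
  by move=> t x _; rewrite big_ord_recl.
by apply: Cn_add => //; apply: IHm => i; exact: fn.
Qed.

Lemma Cn_scale n I (k : R) (f : R -> E -> R) : time_set I -> Cn I n f ->
  Cn I n (fun t x => k * f t x).
Proof. by move=> tI fn; apply: Cn_mul => //; exact: Cn_cst. Qed.

Lemma Cn_sub n I (f g : R -> E -> R) : time_set I -> Cn I n f -> Cn I n g ->
  Cn I n (fun t x => f t x - g t x).
Proof.
move=> tI fn gn; apply: (@Cn_ext _ _ n I _ (fun t x => f t x + (-1) * g t x)).
  by move=> t x _; rewrite mulN1r.
by apply: Cn_add => //; exact: Cn_scale.
Qed.

Lemma Cn_row n I (f : R -> E -> E) : time_set I ->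
  (forall j, Cn I n (fun t x => f t x 0 j)) -> Cn I n f.
Proof.
move=> tI fn; apply: (@Cn_ext _ _ n I _ (fun t x => \sum_j f t x 0 j *: basis_vec j)).
  by move=> t x _; exact: row_delta_sum.
apply: Cn_sum => // j.
exact: (@Cn_lin R _ _ (along (basis_vec j)) (@along_continuous _) n I _ tI (fn j)).
Qed.

Lemma dt_entry n I (f : R -> E -> E) t x j : time_set I -> I t -> Cn I n.+1 f ->
  dt I f t x 0 j = dt I (fun t x => f t x 0 j) t x.
Proof.
move=> tI It fn; apply/esym/has_dt_uniq => //.
have H := @has_dt_lin R _ _ (entry j) (@entry_continuous j) I f t x _ (@Cn_has_dt _ _ _ _ _ fn t x It).
refine H.
Qed.

Lemma dx_entry (f : E -> E) i x j : derivable f x (basis_vec i) ->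
  dx i f x 0 j = dx i (fun x => f x 0 j) x.
Proof.
move=> df; have D := derivableP df.
have [_ e] := @is_derive_lin R _ _ (entry j) (@entry_continuous j) f x _ _ D.
by rewrite [RHS]e.
Qed.

Lemma derivable_row (f : E -> E) i x : (forall j, derivable (fun x => f x 0 j) x (basis_vec i)) ->
  derivable f x (basis_vec i).
Proof.
move=> df.
have D j := @is_derive_lin R _ _ (along (basis_vec j)) (@along_continuous _)
   (fun x => f x 0 j) x (basis_vec i) _ (derivableP (df j)).
have -> : f = \sum_j (along (basis_vec j) \o (fun x => f x 0 j)).
  by apply/funext => z; rewrite fct_sumE [LHS]row_delta_sum.
by apply: derivable_sum => j; have [] := D j.
Qed.

Definition momentum nu I (u : 'I_3 -> R -> E -> R) (p : R -> E -> R) (j : 'I_3) t x : R :=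
  dt I (u j) t x + \sum_i u i t x * dx i (u j t) x - nu * \sum_i dx i (dx i (u j t)) x
  + dx j (p t) x.

Definition divergence (u : 'I_3 -> E -> R) x : R := \sum_i dx i (u i) x.

Section entries.
Variables (I : set R) (u : R -> E -> E).
Hypotheses (tI : time_set I) (u2 : Cn I 2 u).

Lemma dx_dx_entry i t x j : I t ->
  dx i (dx i (u t)) x 0 j = dx i (dx i (fun x => u t x 0 j)) x.
Proof.
move=> It; have u21 := Cn_dx u2 i.
rewrite dx_entry; last by have [] := Cn_is_derive u21 x i It.
apply: dx_local; apply: filterE => z.
by rewrite dx_entry //; have [] := Cn_is_derive u2 z i It.
Qed.

Lemma momentum_entry nu p t x j : I t ->
  (dt I u t x + advect (u t) (u t) x - nu *: laplacian (u t) x + grad (p t) x) 0 j =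
  momentum nu I (fun j t x => u t x 0 j) p j t x.
Proof.
move=> It; rewrite !mxE /momentum (dt_entry _ _ tI It u2) /advect /laplacian !summxE.
congr (_ + _ - _ * _ + _).
- apply: eq_bigr => i _; rewrite mxE dx_entry //.
  by have [] := Cn_is_derive u2 x i It.
- by apply: eq_bigr => i _; rewrite dx_dx_entry.
Qed.

Lemma div_entry t x : I t -> div (u t) x = divergence (fun j x => u t x 0 j) x.
Proof.
move=> It; rewrite /div /divergence; apply: eq_bigr => i _.
by rewrite dx_entry //; have [] := Cn_is_derive u2 x i It.
Qed.

(** Componentwise form of the equations: every vector-valued derivative
    becomes a scalar one. All later computations are made in this form. *)
Lemma NS_eqnsP nu f p : NS_eqns nu I f u p <->
  forall t x, I t -> (forall j, momentum nu I (fun j t x => u t x 0 j) p j t x = f t x 0 j) /\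
    divergence (fun j x => u t x 0 j) x = 0.
Proof.
split=> H t x It; have [h1 h2] := H t x It; split.
- by move=> j; rewrite -h1 momentum_entry.
- by rewrite -div_entry.
- by apply/rowP => j; rewrite momentum_entry// h1.
- by rewrite div_entry.
Qed.
End entries.

(** ** Vector potentials *)

Definition curl (B : 'I_3 -> E -> R) (j : 'I_3) (x : E) : R :=
  dx (j + 1) (B (j + 1 + 1)) x - dx (j + 1 + 1) (B (j + 1)) x.

Lemma ord3_add3 (j : 'I_3) : j + 1 + 1 + 1 = j.
Proof. by apply/val_inj; case: j => -[|[|[|]]]. Qed.

Lemma Cn_dx_cont n (f : R -> E -> R) t : Cn setT n f -> continuous (f t).
Proof.
move=> /Cn_cont cf x A /(cf t x Logic.I) HA.
have {}HA : \forall w \near (t, x), (setT `*` [set: E]) w -> A (f w.1 w.2) by [].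
by have := near_slice_x HA; apply: filterS => z; apply; split.
Qed.

(** The terms cancel in pairs because mixed derivatives commute; the indices
    are shifted cyclically. *)
Lemma div_curl (B : 'I_3 -> R -> E -> R) t x : (forall j, Cn setT 2 (B j)) ->
  divergence (curl (fun j => B j t)) x = 0.
Proof.
move=> B2; rewrite /divergence /curl.
have d1 i j z : derivable (B i t) z (basis_vec j).
  by have [] := Cn_is_derive (B2 i) z j (Logic.I : [set: R] t).
have d2 i j k z : derivable (dx j (B i t)) z (basis_vec k).
  by have [] := Cn_is_derive (Cn_dx (B2 i) j) z k (Logic.I : [set: R] t).
have c2 i j k : continuous (dx k (dx j (B i t))).
  exact: (@Cn_dx_cont 0 (fun t => dx k (dx j (B i t)))  t (Cn_dx (Cn_dx (B2 i) j) k)).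
under eq_bigr => j _.
  have -> : dx j (fun x => dx (j + 1) (B (j + 1 + 1) t) x - dx (j + 1 + 1) (B (j + 1) t) x) x =
     dx j (dx (j + 1) (B (j + 1 + 1) t)) x - dx j (dx (j + 1 + 1) (B (j + 1) t)) x.
    have [_ e] := is_deriveB (derivableP (d2 (j + 1 + 1) (j + 1) j x))
      (derivableP (d2 (j + 1) (j + 1 + 1) j x)).
    exact: e.
  over.
rewrite sumrB; apply/eqP; rewrite subr_eq0; apply/eqP.
rewrite [RHS](reindex_inj (@addIr _ 1)) /=; apply: eq_bigr => j _.
by rewrite ord3_add3; apply: dxC => //; exact: c2.
Qed.

Lemma on_axis (X b p q : R) :
  true%:R * b + X * (false%:R * p + true%:R * q) = b + X * q.
Proof. by rewrite !mul1r mul0r add0r. Qed.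

Lemma off_axis (X b p q : R) :
  false%:R * b + X * (true%:R * p + false%:R * q) = X * p.
Proof. by rewrite !mul1r !mul0r addr0 add0r. Qed.

Lemma off_axes (X b p q : R) :
  false%:R * b + X * (false%:R * p + false%:R * q) = 0.
Proof. by rewrite !mul0r addr0 mulr0 add0r. Qed.

Local Notation i0 := (ord0 : 'I_3).
Local Notation i1 := (lift ord0 ord0 : 'I_3).
Local Notation i2 := (lift ord0 (lift ord0 ord0) : 'I_3).

Lemma sum3 (F : 'I_3 -> R) : \sum_i F i = F i0 + (F i1 + F i2).
Proof. by rewrite !big_ord_recl big_ord0 addr0. Qed.

Section potential.
Variables (y : E) (a : 'I_3 -> R -> E -> R).
Hypothesis sa : forall j, smooth_on setT (a j).
Hypothesis diva : forall t x, divergence (fun j => a j t) x = 0.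

Let al : E := \row_j (j != i2)%:R.
Let be : E := \row_j (j == i1)%:R.
Let b (j : 'I_3) : R -> E -> R := pull_mean y al i2 0 (a j).
Let c : R -> E -> R := pull_mean y be i0 0 (a i2).

(** A solenoidal field is the curl of a potential whose third component
    vanishes: the other two are primitives in the third coordinate, starting
    from [y], and the first of the horizontal coordinates corrects the values
    on the plane through [y]. Written with averages instead of primitives, the
    potential is linear in [x - y] with smooth coefficients, hence small near
    [y]. *)
Definition potential_coef (j m : 'I_3) : R -> E -> R := fun t x =>
  if j == i0 then (if m == i2 then b i1 t x else 0)
  else if j == i1 then (if m == i2 then - b i0 t x else if m == i0 then c t x else 0)
  else 0.

Definition potential (j : 'I_3) (t : R) (x : E) : R := \sum_m (x 0 m - y 0 m) * potential_coef j m t x.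

Lemma smooth_potential_coef j m : smooth_on setT (potential_coef j m).
Proof.
move=> n; have tT := @time_setT R.
have sb k : Cn setT n (b k) by apply: Cn_pull_mean; exact: sa.
have sc : Cn setT n c by apply: Cn_pull_mean; exact: sa.
have z : Cn setT n (fun (_ : R) (_ : E) => 0 : R) by exact: Cn_cst.
have nb : Cn setT n (fun t x => - b i0 t x).
  by apply: Cn_ext (Cn_scale (-1) tT (sb i0)) => t x _; rewrite mulN1r.
rewrite /potential_coef; case: (j == i0); first by case: (m == i2); [exact: sb|exact: z].
case: (j == i1); last exact: z.
case: (m == i2); first exact: nb.
by case: (m == i0); [exact: sc|exact: z].
Qed.

Lemma is_derive_disp i m x : is_derive x (basis_vec i) (fun x : E => x 0 m - y 0 m) (i == m)%:R.
Proof.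
have := @is_derive_coord R (fun r => r - y 0 m) x i m 1.
rewrite mulr1; apply.
by have := is_deriveB (is_derive_id (x 0 m) (1 : R)) (is_derive_cst (y 0 m) (x 0 m) (1 : R)); rewrite subr0.
Qed.

Lemma dx_disp_mul i m (f : E -> R) x l : is_derive x (basis_vec i) f l ->
  is_derive x (basis_vec i) (fun x : E => (x 0 m - y 0 m) * f x)
    ((i == m)%:R * f x + (x 0 m - y 0 m) * l).
Proof.
move=> df; have := is_deriveM (is_derive_disp i m x) df; move=> /is_derive_eq; apply.
by rewrite addrC [_ *: _ in LHS]mulrC.
Qed.

Lemma potential0 t : potential i0 t = (fun x => (x 0 i2 - y 0 i2) * b i1 t x).
Proof.
apply/funext => x; rewrite /potential !big_ord_recl big_ord0 /potential_coef /=.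
by rewrite !mulr0 !add0r addr0.
Qed.

Lemma potential1 t : potential i1 t =
  (fun x => (x 0 i0 - y 0 i0) * c t x - (x 0 i2 - y 0 i2) * b i0 t x).
Proof.
apply/funext => x; rewrite /potential !big_ord_recl big_ord0 /potential_coef /=.
by rewrite !mulr0 !add0r addr0 mulrN.
Qed.

Lemma potential2 t : potential i2 t = (fun x => 0).
Proof.
apply/funext => x; rewrite /potential !big_ord_recl big_ord0 /potential_coef /=.
by rewrite !mulr0 !add0r.
Qed.

Let db i k t x : is_derive x (basis_vec i) (b k t)
  ((i != i2)%:R * pull_mean y al i2 0 (fun t => dx i (a k t)) t x +
   (i == i2)%:R * pull_mean y al i2 1 (fun t => dx i (a k t)) t x).
Proof.
by have := @is_derive_pull_mean R y al i2 0 0 (a k) t x i (sa k 1); rewrite [al 0 i]mxE.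
Qed.

Let dc i t x : is_derive x (basis_vec i) (c t)
  ((i == i1)%:R * pull_mean y be i0 0 (fun t => dx i (a i2 t)) t x +
   (i == i0)%:R * pull_mean y be i0 1 (fun t => dx i (a i2 t)) t x).
Proof.
by have := @is_derive_pull_mean R y be i0 0 0 (a i2) t x i (sa i2 1); rewrite [be 0 i]mxE.
Qed.

Lemma pull1 x : pull y al i2 (const_mx 1) x = x.
Proof.
apply/rowP => j; rewrite pullE !mxE mulr1.
by case: (eqVneq j i2) => [->|ne]; rewrite /= ?add0r ?addr0 !mul1r addrC subrK.
Qed.

Lemma pull_be1 x : pull y be i0 (const_mx 1) x = pull y al i2 (const_mx 0) x.
Proof.
apply/rowP => j; rewrite !pullE !mxE; move: j; apply: ord3P; rewrite /=; ring.
Qed.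

Lemma pull_mean_div t x : \sum_i pull_mean y al i2 0 (fun t => dx i (a i t)) t x = 0.
Proof.
rewrite /pull_mean -int_T3_sum.
  rewrite -[RHS](@int_T3_cst R); congr int_T3; apply/funext => z.
  by rewrite -mulr_sumr -[\sum_i _]/(divergence (fun j => a j t) _) diva mulr0.
move=> i; have cd := Cn_cont (Cn_dx (sa i 1) i).
exact: (@param_cont_z R setT _ (@param_cont_pull R y al i2 0 _ cd) t x Logic.I).
Qed.

(** The first two components are the fundamental theorem of calculus in the
    third coordinate. In the last one the divergence-free condition turns
    horizontal derivatives under the average into a vertical one. *)
Lemma curl_potential j t x : curl (fun j => potential j t) j x = a j t x.
Proof.
have e1 : (i0 : 'I_3) + 1 = i1 by apply/val_inj.
have e2 : (i1 : 'I_3) + 1 = i2 by apply/val_inj.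
have e0 : (i2 : 'I_3) + 1 = i0 by apply/val_inj.
have pr k : b k t x + (x 0 i2 - y 0 i2) * pull_mean y al i2 1 (fun t => dx i2 (a k t)) t x = a k t x.
  by rewrite /b pull_mean_primitive ?pull1 //; exact: sa.
have prc : c t x + (x 0 i0 - y 0 i0) * pull_mean y be i0 1 (fun t => dx i0 (a i2 t)) t x =
    a i2 t (pull y al i2 (const_mx 0) x).
  by rewrite /c pull_mean_primitive ?pull_be1 //; exact: sa.
have simp := (mul0r, mul1r, mulr0, add0r, addr0, sub0r, subr0, opprK).
have alg (A A' X p q r : R) : X * r = A - A' -> p + (q + r) = 0 -> A' - X * p - X * q = A.
  move=> h /eqP; rewrite addr_eq0 => /eqP ->.
  by rewrite (_ : A' = A - X * r); [ring|rewrite h; ring].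
have d2 i : dx i (fun x => 0 : R) x = 0.
  by have [_ e] := is_derive_cst (0 : R) x (basis_vec i); exact: e.
have d0 i := dx_disp_mul i2 (db i i1 t x).
have d1 i := is_deriveB (dx_disp_mul i0 (dc i t x)) (dx_disp_mul i2 (db i i0 t x)).
have D21 : dx i2 (potential i1 t) x = - a i0 t x.
  rewrite potential1; have [_ e] := d1 i2; apply: (etrans e).
  apply: (etrans (congr2 (fun u w => u - w) (off_axes _ _ _ _) (on_axis _ _ _ _))).
  by rewrite pr sub0r.
have D20 : dx i2 (potential i0 t) x = a i1 t x.
  rewrite potential0; have [_ e] := d0 i2; apply: (etrans e).
  by apply: (etrans (on_axis _ _ _ _)); rewrite pr.
have D10 : dx i1 (potential i0 t) x =
    (x 0 i2 - y 0 i2) * pull_mean y al i2 0 (fun t => dx i1 (a i1 t)) t x.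
  rewrite potential0; have [_ e] := d0 i1; apply: (etrans e).
  exact: off_axis.
have D01 : dx i0 (potential i1 t) x = a i2 t (pull y al i2 (const_mx 0) x) -
    (x 0 i2 - y 0 i2) * pull_mean y al i2 0 (fun t => dx i0 (a i0 t)) t x.
  rewrite potential1; have [_ e] := d1 i0; apply: (etrans e).
  apply: (etrans (congr2 (fun u w => u - w) (on_axis _ _ _ _) (off_axis _ _ _ _))).
  by rewrite prc.
move: j; apply: ord3P; rewrite /curl ?e0 ?e1 ?e2 ?e0 ?e1.
- by rewrite potential2 d2 D21 sub0r opprK.
- by rewrite potential2 d2 D20 subr0.
- have := @pull_mean_dx R y al i2 (a i2) t x (sa i2 1); rewrite pull1 => H.
  have Dv := etrans (esym (sum3 _)) (pull_mean_div t x).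
  by rewrite D10 D01; exact: alg H Dv.
Qed.
End potential.

End VectorFields.

(** * Uniqueness of smooth solutions *)

Section Energy.
Context {R : realType}.
Local Notation E := 'rV[R]_3.
Local Notation leb := (@lebesgue_measure R).
Local Notation leb3 := (@leb3 R).
Local Notation leb2 := (sigma_product leb leb).

Definition box (y : E) (r : R) : set E := [set x | forall i, `|x 0 i - y 0 i| <= r].

Lemma box_compact y r : compact (box y r).
Proof.
have := @rV_compact _ 3 (fun i => `[y 0 i - r, y 0 i + r]%classic).
rewrite (_ : [set v | _] = box y r).
  by apply => i; exact: segment_compact.
by apply/seteqP; split=> x H i; move: (H i); rewrite /= in_itv /= ler_distl.
Qed.

Lemma joint_cont_bounded I (f : R -> E -> R) (A : set R) (B : set E) :
  joint_cont I f -> A `<=` I -> compact A -> compact B ->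
  exists2 M, 0 <= M & forall t x, A t -> B x -> `|f t x| <= M.
Proof.
move=> /joint_contP cf AI cA cB.
have cAB : compact (A `*` B) by exact: compact_setX.
have cf' : {within A `*` B, continuous (fun q : R * E => f q.1 q.2)}.
  by apply: continuous_subspaceW cf => -[t x] [/= /AI It _]; split.
have /compact_bounded[M [_ HM]] := continuous_compact cf' cAB.
exists (`|M| + 1); first by rewrite addr_ge0.
move=> t x At Bx; apply: (HM (`|M| + 1)); last by exists (t, x).
by rewrite (le_lt_trans (ler_norm _))// ltrDl.
Qed.

(** [e t * expR (- c * t)] is nonincreasing. *)
Lemma gronwall (e : R -> R) (de : R -> R) (c a : R) : 0 < a ->
  (forall t, 0 < t < a -> is_derive t 1 e (de t)) ->
  {within `[0, a], continuous e} ->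
  (forall t, 0 < t < a -> de t <= c * e t) -> e 0 = 0 -> e a <= 0.
Proof.
move=> a0 D ce dec e0.
pose g t := e t * expR (- c * t).
have Dg t : 0 < t < a -> is_derive t 1 g ((de t - c * e t) * expR (- c * t)).
  move=> /D d; have dx : is_derive t 1 (fun t : R => expR (- c * t)) (- c * expR (- c * t)).
    have := @is_derive1_comp R expR (fun t => - c * t) t _ _ (is_derive_expR _)
      (is_deriveZ (- c) (is_derive_id t (1 : R))).
    by rewrite /GRing.scale /= mulr1 mulrC.
  have := is_deriveM d dx; move=> /is_derive_eq; apply.
  by rewrite /GRing.scale /=; ring.
have cg : {within `[0, a], continuous g}.
  move=> x; apply: cvgM; first exact: ce.
  apply: continuous_subspaceT => z; apply: (@continuous_comp _ _ _ (fun t : R => - c * t) expR).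
    by apply: cvgM; [exact: cvg_cst|exact: cvg_id].
  exact: continuous_expR.
have DI s : s \in `]0, a[%R -> is_derive s 1 g ((de s - c * e s) * expR (- c * s)).
  by rewrite in_itv => sI; exact: Dg.
have [s sI] := MVT a0 DI cg.
rewrite /g e0 mul0r !subr0 => eq.
have : e a * expR (- c * a) <= 0.
  rewrite eq mulr_le0_ge0 ?(ltW a0)// mulr_le0_ge0 ?expR_ge0// subr_le0; apply: dec.
  by move: sI; rewrite in_itv.
by rewrite pmulr_lle0 // expR_gt0.
Qed.

Lemma leb3_prod (A B C : set R) : measurable A -> measurable B -> measurable C ->
  leb3 ((A `*` B) `*` C) = (leb A * leb B * leb C)%E.
Proof.
move=> mA mB mC; rewrite /Defs.leb3 (@product_measure1E _ _ _ _ _ leb2 leb)//; last exact: measurableX.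
by congr (_ * _)%E; rewrite -(@product_measure1E _ _ _ _ _ leb leb).
Qed.

Lemma slice_cont I (f : R -> E -> R) t : I t -> joint_cont I f -> continuous (f t).
Proof.
by move=> It cf; exact: (@param_cont_z _ I _ (param_cont_mean cf) t (0 : E) It).
Qed.

Lemma int_T3_EFin (h : E -> R) : continuous h ->
  (\int[leb3]_(x in cell) (h (vec3 x))%:E = (int_T3 h)%:E)%E.
Proof.
move=> ch; rewrite /int_T3 /Rintegral fineK//.
by apply: integrable_fin_num; [exact: measurable_cell|exact: cell_integrable].
Qed.

Definition frac (x : E) : E := \row_j (x 0 j - (Num.floor (x 0 j))%:~R).
Definition floorv (x : E) : 'rV[int]_3 := \row_j Num.floor (x 0 j).

Lemma frac_floor x : frac x + int_vec (floorv x) = x.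
Proof. by apply/rowP => j; rewrite !mxE subrK. Qed.

Lemma frac_itv x j : 0 <= frac x 0 j < 1.
Proof.
have /andP[h1 h2] := floor_itv (x 0 j).
by rewrite mxE; move: h2; rewrite intrD => h2; apply/andP; split; lra.
Qed.

Lemma periodic_frac (V : Type) (z : E -> V) x : periodic z -> z (frac x) = z x.
Proof. by move=> pz; rewrite -[in RHS](frac_floor x) pz. Qed.

Lemma dx_periodic i (f : E -> R) : periodic f -> periodic (dx i f).
Proof.
move=> pf x k; have {2}-> : f = (fun z => f (z + int_vec k)) by apply/funext => z; rewrite pf.
by rewrite /dx /derive /shift /=; under eq_fun do rewrite addrA.
Qed.

Lemma vec3_row (z : E) : vec3 (z 0 ord0, z 0 (lift ord0 ord0), z 0 (lift ord0 (lift ord0 ord0))) = z.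
Proof. by apply/rowP; apply: ord3P; rewrite ?vec3_0 ?vec3_1 ?vec3_2. Qed.

Lemma vec3_frac x : exists2 c, cell c & vec3 c = frac x.
Proof.
exists (frac x 0 ord0, frac x 0 (lift ord0 ord0), frac x 0 (lift ord0 (lift ord0 ord0))).
  by split; exact: frac_itv.
exact: vec3_row.
Qed.

(** A positive value would persist on a small box contained in the cell. *)
Lemma int_T3_eq0 (h : E -> R) x : continuous h -> (forall z, 0 <= h z) -> int_T3 h = 0 ->
  cell x -> h (vec3 x) = 0.
Proof.
move=> ch h0 ih cx; apply/eqP; rewrite eq_le h0 andbT leNgt; apply/negP => hx.
pose c := h (vec3 x) / 2.
have c0 : 0 < c by rewrite divr_gt0.
have /nbhs_ballP[r /= r0 Hr] : \forall z \near vec3 x, c < h z.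
  have := ch (vec3 x); move/cvgr_gt; apply; rewrite /c ltr_pdivrMr//.
  by rewrite ltr_pMr// ltr1n.
clearbody c; case: x cx hx c0 Hr => [[a0 a1] a2] [/= /andP[p0 q0] /andP[p1 q1] /andP[p2 q2]] _ c0 Hr.
(* the box extends towards larger coordinates, as the cell contains its lower faces *)
pose s := Num.min (r / 2) (Num.min (1 - a0) (Num.min (1 - a1) (1 - a2))).
have s0 : 0 < s by rewrite !lt_min !subr_gt0 q0 q1 q2 divr_gt0.
have [sr s1 s2 s3] : [/\ s <= r / 2, s <= 1 - a0, s <= 1 - a1 & s <= 1 - a2].
  by rewrite /s !ge_min !lexx !orbT.
pose B : set (R * R * R) := (`[a0, a0 + s[ `*` `[a1, a1 + s[) `*` `[a2, a2 + s[.
have mB : measurable B by apply: measurableX; [apply: measurableX|]; exact: measurable_itv.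
have BC : B `<=` @cell R.
  move=> [[b0 b1] b2] [[]]; rewrite /= !in_itv /= => /andP[? ?] /andP[? ?] /andP[? ?].
  have unit (p b : R) : 0 <= p -> s <= 1 - p -> p <= b -> b < p + s -> 0 <= b < 1.
    by clear=> *; apply/andP; split; lra.
  by split => /=; [exact: (unit a0)|exact: (unit a1)|exact: (unit a2)].
have Bc z : B z -> c <= h (vec3 z).
  case: z => -[b0 b1] b2 [[]]; rewrite /= !in_itv /= => /andP[? ?] /andP[? ?] /andP[? ?].
  apply/ltW/Hr; rewrite -ball_normE /ball_ /= /Num.norm /= mx_normrE.
  apply/bigmax_ltP; split => // -[i j] _; rewrite ord1 /= 2![in X in `|X|]mxE.
  have close (p b : R) : p <= b -> b < p + s -> `|p - b| < r.
    by move: r0 sr; clear=> *; rewrite ltr_norml; apply/andP; split; lra.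
  by move: j; apply: ord3P; rewrite ?mxE /=; exact: close.
have ih' := int_T3_EFin ch; rewrite ih in ih'.
have mh : measurable_fun setT (fun x => (h (vec3 x))%:E).
  by apply/measurable_EFinP; exact: continuous_measurable3.
have le1 : (c%:E * leb3 B <= 0)%E.
  rewrite -[leRHS]/(0%:E) -ih' -(integral_cst leb3)//.
  apply: (@le_trans _ _ (\int[leb3]_(x in B) (h (vec3 x))%:E)%E).
    apply: ge0_le_integral => //.
    - by move=> z _; rewrite lee_fin ltW.
    - exact: measurable_funS mh.
  apply: ge0_subset_integral => //; first exact: measurable_cell.
    exact: measurable_funS mh.
  by move=> z _; rewrite lee_fin.
move: le1; rewrite leb3_prod ?measurable_itv // !lebesgue_measure_itv /=.
rewrite !lte_fin !ltrDl s0 -!EFinD -!EFinM lee_fin.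
have e a : a + s - a = s by rewrite addrC addKr.
by rewrite !e leNgt !mulr_gt0.
Qed.

Lemma time_set_right (I : set R) :
  (forall t, I t -> exists2 b, t < b & forall s, t < s < b -> I s) -> time_set I.
Proof.
move=> H t /H[b tb Ib]; apply: Build_ProperFilter_ex => P.
rewrite /within /= => nP; have {}nP : \forall s \near t^', I s -> P s by [].
have {}nP : \forall s \near t, s != t -> I s -> P s by exact: nP.
have [r r0 HP] := near_ball_time nP.
pose s := t + Num.min r (b - t) / 2.
have m0 : 0 < Num.min r (b - t) by rewrite lt_min r0 subr_gt0.
have [mr mb] : Num.min r (b - t) <= r /\ Num.min r (b - t) <= b - t by rewrite !ge_min !lexx orbT.
have st : t < s by rewrite ltrDl divr_gt0.
exists s; apply: HP; [|by rewrite gt_eqF|apply: Ib; rewrite st /= /s; lra].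
by rewrite /s addrAC subrr add0r gtr0_norm ?divr_gt0//; lra.
Qed.

Lemma time_set_bo a b : time_set (`[a, b[ : set R).
Proof.
apply: time_set_right => t /=; rewrite in_itv /= => /andP[at' tb]; exists b => // s /andP[ts sb].
by rewrite in_itv /= sb (le_trans at' (ltW ts)).
Qed.

Lemma time_set_No b : time_set (`]-oo, b[ : set R).
Proof.
apply: time_set_right => t /=; rewrite in_itv /= => tb; exists b => // s /andP[ts sb].
by rewrite in_itv.
Qed.

Lemma Cn_restrict {V : normedModType R} n (I J : set R) (f : R -> E -> V) :
  (forall t, J t -> \forall s \near t, J s <-> I s) -> Cn I n f -> Cn J n f.
Proof.
move=> JI fn; apply: Cn_local => t x Jt; exists I, f; split => //; first exact: JI.
exact: filterE.
Qed.

Lemma momentum_restrict (I J : set R) nu (u : 'I_3 -> R -> E -> R) p j t x :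
  J t -> (\forall s \near t, J s <-> I s) -> momentum nu J u p j t x = momentum nu I u p j t x.
Proof.
move=> Jt JI; rewrite /momentum; congr (_ + _ - _ + _).
by apply: dt_local => //; exact: filterE.
Qed.

(** Derivatives are local, and near each point of [J] the two sets of times
    agree. *)
Lemma NS_restrict nu (I J : set R) a f u p : J `<=` I -> (forall t, J t -> \forall s \near t, J s <-> I s) ->
  NS_solution nu I a f u p -> NS_solution nu J a f u p.
Proof.
move=> JI nJ NSu; split.
- by move=> n; exact: Cn_restrict nJ (NS_smooth_u NSu n).
- by move=> n; exact: Cn_restrict nJ (NS_smooth_p NSu n).
- by move=> t /JI It; exact: (NS_periodic_u NSu It).
- by move=> t /JI It; exact: (NS_periodic_p NSu It).
- by move=> t /JI It; exact: (NS_mean_p NSu It).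
- move=> t x Jt; rewrite (@dt_local _ _ J I u u t x Jt (nJ t Jt)); last exact: filterE.
  exact: (NS_equations NSu x (JI t Jt)).
- exact: NS_initial NSu.
Qed.

Section der.
Variables (x v : E).
Implicit Types f g : E -> R.
Lemma derD f g l m : is_derive x v f l -> is_derive x v g m ->
  is_derive x v (fun z => f z + g z) (l + m).
Proof. exact: is_deriveD. Qed.
Lemma derB f g l m : is_derive x v f l -> is_derive x v g m ->
  is_derive x v (fun z => f z - g z) (l - m).
Proof. exact: is_deriveB. Qed.
Lemma derM f g l m : is_derive x v f l -> is_derive x v g m ->
  is_derive x v (fun z => f z * g z) (l * g x + f x * m).
Proof.
move=> df dg; have := is_deriveM df dg; move=> /is_derive_eq; apply.
by rewrite addrC [_ *: l]mulrC.
Qed.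
Lemma derZ k f l : is_derive x v f l -> is_derive x v (fun z => k * f z) (k * l).
Proof. exact: is_deriveZ. Qed.
Lemma derS n (f : 'I_n -> E -> R) l : (forall i, is_derive x v (f i) (l i)) ->
  is_derive x v (fun z => \sum_i f i z) (\sum_i l i).
Proof.
move=> D; have := is_derive_sum D; congr is_derive.
by apply/funext => z; rewrite fct_sumE.
Qed.
End der.

Section uniqueness.
Variables (nu tau : R) (u u' : 'I_3 -> R -> E -> R) (p p' : R -> E -> R).
Hypothesis nu0 : 0 <= nu.
Let I : set R := `[0, tau[.
Hypotheses (su : forall j, smooth_on I (u j)) (su' : forall j, smooth_on I (u' j))
  (sp : smooth_on I p) (sp' : smooth_on I p').
Hypotheses (pu : forall t, I t -> forall j, periodic (u j t))
  (pu' : forall t, I t -> forall j, periodic (u' j t))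
  (pp : forall t, I t -> periodic (p t)) (pp' : forall t, I t -> periodic (p' t)).
Hypothesis same_force : forall j t x, I t -> momentum nu I u p j t x = momentum nu I u' p' j t x.
Hypotheses (div0 : forall t x, I t -> divergence (fun j => u j t) x = 0)
  (div0' : forall t x, I t -> divergence (fun j => u' j t) x = 0).
Hypothesis init : forall j x, u j 0 x = u' j 0 x.

Let J : set R := `]0, tau[.
Let w j t x : R := u j t x - u' j t x.
Let r t x : R := p t x - p' t x.

(** Stated for numbers standing for the values at one point: [a] for the
    difference of the two solutions, [b] for the first one, [db'] for the
    gradient of the second one. Up to the dissipation and the stretching term,
    the rate of change of [a ^+ 2] is a divergence. *)
Lemma energy_identity (a b : 'I_3 -> R) (da db db' dda : 'I_3 -> 'I_3 -> R) (q : R)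
    (dq dta : 'I_3 -> R) :
  \sum_i db i i = 0 -> \sum_i da i i = 0 ->
  (forall j, dta j = - (\sum_i b i * da i j) - (\sum_i a i * db' i j) + nu * (\sum_i dda i j) - dq j) ->
  \sum_j (dta j * a j + a j * dta j) =
  \sum_i (nu * (\sum_j 2 * (da i j * da i j + a j * dda i j))
     - (db i i * (\sum_j a j * a j) + b i * (\sum_j (da i j * a j + a j * da i j)))
     - 2 * (da i i * q + a i * dq i))
  - 2 * nu * (\sum_i \sum_j da i j ^+ 2) - 2 * (\sum_i \sum_j a i * a j * db' i j).
Proof.
rewrite !sum3 => /eqP; rewrite addr_eq0 => /eqP h1 /eqP; rewrite addr_eq0 => /eqP h2 h3.
rewrite !h3 !sum3 h1 h2; ring.
Qed.

Let tJ : time_set J.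
Proof.
have oJ : open J by exact: interval_open.
move=> t Jt; have := @time_setT R t Logic.I; congr ProperFilter.
apply/esym/within_dnbhs_localE.
have := open_nbhs_nbhs (conj oJ Jt); by apply: filterS => s Js; split.
Qed.

Let JI t : J t -> \forall s \near t, J s <-> I s.
Proof.
have oJ : open J by exact: interval_open.
move=> Jt; have := open_nbhs_nbhs (conj oJ Jt); apply: filterS => s Js; split => // _.
by move: Js; rewrite /J /I /= !in_itv /= => /andP[/ltW -> ->].
Qed.

Let JI' t : J t -> I t.
Proof. by rewrite /J /I /= !in_itv /= => /andP[/ltW -> ->]. Qed.

Let sJ (f : R -> E -> R) : smooth_on I f -> smooth_on J f.
Proof. by move=> sf n; exact: Cn_restrict JI (sf n). Qed.

Let wn j n : Cn J n (w j).
Proof. by apply: Cn_sub => //; exact: sJ. Qed.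

Let rn n : Cn J n r.
Proof. by apply: Cn_sub => //; exact: sJ. Qed.

Let dJ n i (f : R -> E -> R) t x : J t -> Cn J n.+1 f ->
  is_derive x (basis_vec i) (f t) (dx i (f t) x).
Proof. by move=> Jt fn; exact: (Cn_is_derive fn). Qed.

(** The field whose divergence appears in the energy identity; its mean
    divergence vanishes by periodicity. *)
Let flux i t x : R := nu * (\sum_j 2 * (w j t x * dx i (w j t) x))
  - u i t x * (\sum_j w j t x * w j t x) - 2 * (w i t x * r t x).

Let dflux i t x : R :=
  nu * (\sum_j 2 * (dx i (w j t) x * dx i (w j t) x + w j t x * dx i (dx i (w j t)) x))
  - (dx i (u i t) x * (\sum_j w j t x * w j t x) +
      u i t x * (\sum_j (dx i (w j t) x * w j t x + w j t x * dx i (w j t) x)))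
  - 2 * (dx i (w i t) x * r t x + w i t x * dx i (r t) x).

Let flux_derive i t x : J t -> is_derive x (basis_vec i) (flux i t) (dflux i t x).
Proof.
move=> Jt; apply: derB.
  apply: derB.
    apply/derZ/derS => j; apply/derZ/derM; first exact: dJ (wn j 1).
    exact: dJ (Cn_dx (wn j 2) i).
  apply: derM; first exact: dJ (sJ (su i) 1).
  by apply: derS => j; apply: derM; exact: dJ (wn j 1).
by apply/derZ/derM; [exact: dJ (wn i 1)|exact: dJ (rn 1)].
Qed.

Let flux_smooth i n : Cn J n (flux i).
Proof.
apply: Cn_sub => //; first apply: Cn_sub => //.
- apply: Cn_scale => //; apply: Cn_sum => // j; apply: Cn_scale => //; apply: Cn_mul => //.
  exact: Cn_dx (wn j n.+1) i.
- apply: Cn_mul => //; first exact: (sJ (su i)).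
  by apply: Cn_sum => // j; apply: Cn_mul.
- by apply: Cn_scale => //; apply: Cn_mul.
Qed.

Let flux_mean i t : J t -> int_T3 (dflux i t) = 0.
Proof.
move=> Jt; have e : dflux i t = dx i (flux i t).
  by apply/funext => x; have [_ e] := flux_derive i x Jt; exact: esym e.
have pw j : periodic (w j t) by move=> x k; rewrite /w (pu (JI' Jt)) (pu' (JI' Jt)).
have pdw j : periodic (dx i (w j t)) by exact: dx_periodic.
rewrite e; apply: int_T3_dx_periodic.
- exact: slice_cont Jt (Cn_cont (flux_smooth i 0)).
- by move=> x; have [] := flux_derive i x Jt.
- exact: slice_cont Jt (Cn_cont (Cn_dx (flux_smooth i 1) i)).
- move=> x k; have e1 j := pw j x k; have e2 j := pdw j x k.
  have E1 : \sum_j 2 * (w j t (x + int_vec k) * dx i (w j t) (x + int_vec k)) =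
     \sum_j 2 * (w j t x * dx i (w j t) x) by apply: eq_bigr => j _; rewrite e1 e2.
  have E2 : \sum_j w j t (x + int_vec k) * w j t (x + int_vec k) =
     \sum_j w j t x * w j t x by apply: eq_bigr => j _; rewrite e1.
  by rewrite /flux E1 E2 e1 /r (pu (JI' Jt)) (pp (JI' Jt)) (pp' (JI' Jt)).
Qed.

Lemma momentum_difference (a b : 'I_3 -> R) (da db dda ddb : 'I_3 -> R) (ta tb qa qb : R) :
  ta + \sum_i a i * da i - nu * \sum_i dda i + qa =
  tb + \sum_i b i * db i - nu * \sum_i ddb i + qb ->
  ta - tb = - (\sum_i a i * (da i - db i)) - (\sum_i (a i - b i) * db i)
    + nu * (\sum_i (dda i - ddb i)) - (qa - qb).
Proof.
move=> h; apply: subr0_eq; rewrite -[RHS](subrr (tb + \sum_i b i * db i - nu * \sum_i ddb i + qb)).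
by rewrite -{1}h !sum3; ring.
Qed.

Let dxw i j t x : J t -> dx i (w j t) x = dx i (u j t) x - dx i (u' j t) x.
Proof.
move=> Jt; have [_ e] := derB (dJ i x Jt (sJ (su j) 1)) (dJ i x Jt (sJ (su' j) 1)).
exact: e.
Qed.

Let ddw i j t x : J t -> dx i (dx i (w j t)) x = dx i (dx i (u j t)) x - dx i (dx i (u' j t)) x.
Proof.
move=> Jt.
have -> : dx i (w j t) = (fun z => dx i (u j t) z - dx i (u' j t) z).
  by apply/funext => z; exact: dxw.
have [_ e] := derB (dJ i x Jt (Cn_dx (sJ (su j) 2) i)) (dJ i x Jt (Cn_dx (sJ (su' j) 2) i)).
exact: e.
Qed.

Let dtw j t x : J t -> dt J (w j) t x =
  - (\sum_i u i t x * dx i (w j t) x) - (\sum_i w i t x * dx i (u' j t) x)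
  + nu * (\sum_i dx i (dx i (w j t)) x) - dx j (r t) x.
Proof.
move=> Jt.
have -> : dt J (w j) t x = dt J (u j) t x - dt J (u' j) t x.
  apply: has_dt_uniq => //; apply: has_dt_is_derive.
  have nJ : nbhs t J by apply: open_nbhs_nbhs; split => //; exact: interval_open.
  have d1 := is_derive_has_dt nJ (@Cn_has_dt _ _ _ _ _ (sJ (su j) 1) t x Jt).
  have d2 := is_derive_has_dt nJ (@Cn_has_dt _ _ _ _ _ (sJ (su' j) 1) t x Jt).
  exact: is_deriveB d1 d2.
have [_ dr] := derB (dJ j x Jt (sJ sp 1)) (dJ j x Jt (sJ sp' 1)).
rewrite [dx j (r t) x]dr.
under [\sum_i u i t x * _]eq_bigr do rewrite dxw//.
under [\sum_i dx i (dx i _) x]eq_bigr do rewrite ddw//.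
apply: momentum_difference.
have := same_force j x (JI' Jt).
by rewrite -!(momentum_restrict nu _ _ _ _ Jt (JI Jt)).
Qed.

Let energy t : R := int_T3 (fun z => \sum_j w j t z * w j t z).
Let denergy t : R := int_T3 (fun z => \sum_j (dt J (w j) t z * w j t z + w j t z * dt J (w j) t z)).

Let sq_smooth n : Cn J n (fun t z => \sum_j w j t z * w j t z).
Proof. by apply: Cn_sum => // j; apply: Cn_mul. Qed.

Let dsq_smooth n : Cn J n (fun t z => \sum_j (dt J (w j) t z * w j t z + w j t z * dt J (w j) t z)).
Proof.
apply: Cn_sum => // j; have := Cn_dt (wn j n.+1) => wt.
by apply: Cn_add => //; apply: Cn_mul.
Qed.

Let energy_derive t : J t -> is_derive t 1 energy (denergy t).
Proof.
move=> Jt.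
have nJ s : J s -> nbhs s J by move=> Js; apply: open_nbhs_nbhs; split => //; exact: interval_open.
apply: (@is_derive_int_time _ J (fun z t _ => \sum_j w j t z * w j t z)
  (fun z t _ => \sum_j (dt J (w j) t z * w j t z + w j t z * dt J (w j) t z)) t (0 : E)).
- exact: nJ.
- exact: param_cont_mean (Cn_cont (sq_smooth 0)).
- exact: param_cont_mean (Cn_cont (dsq_smooth 0)).
- move=> z s Js.
  have D j : is_derive s 1 (fun s => w j s z * w j s z) (dt J (w j) s z * w j s z + w j s z * dt J (w j) s z).
    have d := is_derive_has_dt (nJ s Js) (@Cn_has_dt _ _ _ _ _ (wn j 1) s z Js).
    have := is_deriveM d d; move=> /is_derive_eq; apply.
    by rewrite addrC [X in X + _ = _]mulrC.
  have := is_derive_sum D; congr is_derive.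
  by apply/funext => s'; rewrite fct_sumE.
Qed.

(** [`|a i * a j|] is at most half of [a i ^+ 2 + a j ^+ 2]. *)
Lemma quadratic_bound (a : 'I_3 -> R) (db : 'I_3 -> 'I_3 -> R) K :
  (forall i j, `|db i j| <= K) -> - (\sum_i \sum_j a i * a j * db i j) <= 3 * K * \sum_j a j * a j.
Proof.
move=> hK; have K0 : 0 <= K := le_trans (normr_ge0 _) (hK ord0 ord0).
have term i j : - (a i * a j * db i j) <= K / 2 * (a i * a i) + K / 2 * (a j * a j).
  apply: (@le_trans _ _ (`|a i * a j| * K)).
    by rewrite (le_trans (ler_norm _))// normrN normrM ler_wpM2l.
  have : `|a i * a j| <= (a i * a i + a j * a j) / 2.
    by rewrite ler_norml; apply/andP; split; [have := sqr_ge0 (a i + a j)|have := sqr_ge0 (a i - a j)]; nra.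
  move=> /(ler_wpM2r K0) h; apply: (le_trans h); lra.
rewrite -sumrN (le_trans (_ : _ <= \sum_i \sum_j (K / 2 * (a i * a i) + K / 2 * (a j * a j))))//.
  by apply: ler_sum => i _; rewrite -sumrN; apply: ler_sum => j _.
by rewrite !sum3; lra.
Qed.

Let energy_growth t K : J t -> (forall z i j, cube z -> `|dx i (u' j t) z| <= K) ->
  denergy t <= 6 * K * energy t.
Proof.
move=> Jt hK.
have cd i : continuous (dflux i t).
  have -> : dflux i t = dx i (flux i t).
    by apply/funext => x; have [_ e] := flux_derive i x Jt; exact: esym e.
  exact: slice_cont Jt (Cn_cont (Cn_dx (flux_smooth i 1) i)).
have csum : continuous (fun z => \sum_i dflux i t z) by exact: cont_sum.
have csq : continuous (fun z => 6 * K * \sum_j w j t z * w j t z).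
  by apply: contM; [exact: contC|exact: slice_cont Jt (Cn_cont (sq_smooth 0))].
have -> : 6 * K * energy t = int_T3 (fun z => \sum_i dflux i t z + 6 * K * \sum_j w j t z * w j t z).
  rewrite int_T3D// int_T3_sum// int_T3Zl; last exact: slice_cont Jt (Cn_cont (sq_smooth 0)).
  by rewrite big1 ?add0r// => i _; exact: flux_mean.
apply: int_T3_le; first exact: slice_cont Jt (Cn_cont (dsq_smooth 0)).
  exact: contD.
move=> z cz.
have dv : \sum_i dx i (u i t) z = 0 := div0 z (JI' Jt).
have dvw : \sum_i dx i (w i t) z = 0.
  under eq_bigr do rewrite dxw//.
  have := div0' z (JI' Jt); rewrite /divergence => dv'.
  by rewrite sumrB dv dv' subrr.
have -> := @energy_identity (fun j => w j t z) (fun j => u j t z) (fun i j => dx i (w j t) z)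
  (fun i j => dx i (u j t) z) (fun i j => dx i (u' j t) z) (fun i j => dx i (dx i (w j t)) z)
  (r t z) (fun j => dx j (r t) z) (fun j => dt J (w j) t z) dv dvw (fun j => dtw j z Jt).
rewrite -[X in X - _ - _]/(\sum_i dflux i t z) -!addrA lerD2l.
have := @quadratic_bound (fun j => w j t z) (fun i j => dx i (u' j t) z) K (fun i j => hK z i j cz).
have : 0 <= 2 * nu * \sum_i \sum_j dx i (w j t) z ^+ 2.
  apply: mulr_ge0; first exact: mulr_ge0.
  by apply: sumr_ge0 => i _; apply: sumr_ge0 => j _; exact: sqr_ge0.
set A := 2 * nu * _; set B := \sum_i \sum_j _; set S := \sum_j _; lra.
Qed.

Let continuous_energy b : b < tau -> {within `[0, b], continuous energy}.
Proof.
move=> bt; have cw j : joint_cont I (w j).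
  move=> t x It; apply: cvgB; first exact: (Cn_cont (su j 0)).
  exact: (Cn_cont (su' j 0)).
have csq : joint_cont I (fun t z => \sum_j w j t z * w j t z).
  move=> t x It; under eq_fun do rewrite sum3; rewrite sum3.
  by apply: (@cvgD _ _ _ _ _ _ _ _ _); [|apply: (@cvgD _ _ _ _ _ _ _ _ _)]; apply: cvgM; exact: cw.
have /joint_contP ce := joint_cont_int (param_cont_mean csq).
apply/subspace_continuousP => t tb A /=.
have It : I t by move: tb; rewrite /I /= !in_itv /= => /andP[-> /le_lt_trans]; exact.
have /subspace_continuousP /(_ (t, 0 : E)) := ce.
move=> /(_ (conj It Logic.I)) H /H HA.
have {}HA : \forall q \near (t, 0 : E), (I `*` [set: E]) q -> A (energy q.1) by [].
have := near_slice_t HA.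
suff : (\forall s \near t, (I `*` [set: E]) (s, 0 : E) -> A (energy s)) ->
    \forall s \near t, `[0, b]%classic s -> A (energy s) by [].
apply: filterS => s Hs sb; apply: Hs; split => //=.
by move: sb; rewrite /I /= !in_itv /= => /andP[-> /le_lt_trans]; exact.
Qed.

(** The energy [e] of the difference satisfies [e' <= 6 * K * e], where [K]
    bounds the gradient of the second solution up to time [t]. It vanishes
    initially, hence at all times by Gronwall's lemma. *)
Theorem smooth_solutions_agree j t x : I t -> u j t x = u' j t x.
Proof.
move=> It; have /andP[t0 tt] : 0 <= t < tau by move: It; rewrite /I /= in_itv.
move: t0; rewrite le_eqVlt => /predU1P[<-//|t0].
have sub : `[0, t]%classic `<=` I.
  by move=> s; rewrite /I /= !in_itv /= => /andP[-> /le_lt_trans]; exact.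
have /choice[M HM] : forall ij : 'I_3 * 'I_3, exists M, 0 <= M /\
    forall s z, `[0, t]%classic s -> cube z -> `|dx ij.1 (u' ij.2 s) z| <= M.
  move=> [i k]; have [M M0 hM] := @joint_cont_bounded I (fun s => dx i (u' k s)) `[0, t]%classic cube
    (Cn_cont (Cn_dx (su' k 1) i)) sub (@segment_compact R 0 t) (@cube_compact R).
  by exists M.
pose K := \sum_i M i.
have hK s z i k : `[0, t]%classic s -> cube z -> `|dx i (u' k s) z| <= K.
  move=> st cz; have [_ h] := HM (i, k); apply: (le_trans (h s z st cz)).
  by rewrite /K (bigD1 (i, k))//= lerDl sumr_ge0// => ij _; have [] := HM ij.
have e0 : energy 0 = 0.
  rewrite /energy -[RHS](@int_T3_cst R); congr int_T3; apply/funext => z.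
  by rewrite big1// => k _; rewrite /w init subrr mul0r.
have JJ s : 0 < s < t -> J s.
  by move=> /andP[s0 st]; rewrite /J /= in_itv /= s0 (lt_trans st tt).
have := @gronwall energy denergy (6 * K) t t0 (fun s st => energy_derive (JJ s st))
  (continuous_energy tt).
have Jt : J t by rewrite /J /= in_itv /= t0 tt.
have csq := slice_cont Jt (Cn_cont (sq_smooth 0)).
have sq0 z : 0 <= \sum_k w k t z * w k t z.
  by apply: sumr_ge0 => k _; rewrite -expr2 sqr_ge0.
move=> /(_ _ e0) en; have {en} E0 : energy t = 0.
  apply/eqP; rewrite eq_le en /=; last first.
    move=> s sI; apply: energy_growth; first exact: JJ.
    move=> z i k cz; apply: hK => //; rewrite /= in_itv /=.
    by case/andP: sI => /ltW-> /ltW->.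
  by rewrite -(@int_T3_cst R 0) int_T3_le//; exact: contC.
have [c cc ce] := vec3_frac x.
have := int_T3_eq0 csq sq0 E0 cc; rewrite ce => /eqP.
rewrite psumr_eq0; last by move=> k _; rewrite -expr2 sqr_ge0.
move=> /allP /(_ j); rewrite mem_index_enum => /(_ isT) /=; rewrite mulf_eq0 orbb subr_eq0 => /eqP.
by rewrite (periodic_frac x (pu It j)) (periodic_frac x (pu' It j)).
Qed.

End uniqueness.
End Energy.

(** * Functions oscillating at a small scale *)

Section Zoom.
Context {R : realType}.
Local Notation E := 'rV[R]_3.
Variables (T : R) (y : E).
Implicit Types (e : R) (f g : R -> E -> R).

(** Parabolic rescaling about the space-time point [(T, y)]. *)
Definition zoom e f (t : R) (x : E) : R := f ((t - T) / e ^+ 2) (e^-1 *: (x - y)).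

Let zc e : E := - (e^-1 *: y).
Let zd e : E := const_mx e^-1.

Lemma zoomE e f : zoom e f =
  fun t x => f ((e ^+ 2)^-1 * t + (- (e ^+ 2)^-1 * T)) (coord_affine (zc e) (zd e) x).
Proof.
apply/funext => t; apply/funext => x; rewrite /zoom; congr f; first by ring.
by apply/rowP => j; rewrite !mxE; ring.
Qed.

Section positive.
Variables (e : R).
Hypothesis e0 : 0 < e.
Let e2 : (e ^+ 2)^-1 != 0. Proof. by rewrite invr_eq0 expf_neq0 // gt_eqF. Qed.

Lemma Cn_zoom (I J : set R) n f : time_set I -> (forall t, I t -> J ((t - T) / e ^+ 2)) ->
  Cn J n f -> Cn I n (zoom e f).
Proof.
move=> tI IJ fn; rewrite zoomE; apply: (@Cn_affine _ n I J) => // s /IJ.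
by congr J; ring.
Qed.

Lemma zoom_derive f t x i l : is_derive (e^-1 *: (x - y)) (basis_vec i) (f ((t - T) / e ^+ 2)) l ->
  is_derive x (basis_vec i) (zoom e f t) (e^-1 * l).
Proof.
move=> D; have := @is_derive_coord_affine _ (f ((t - T) / e ^+ 2)) (zc e) (zd e) x i l.
have ec : coord_affine (zc e) (zd e) x = e^-1 *: (x - y).
  by apply/rowP => j; rewrite !mxE; ring.
rewrite ec => /(_ D); rewrite mxE; congr is_derive.
apply/funext => z; rewrite /zoom /=; congr f.
by apply/rowP => j; rewrite !mxE; ring.
Qed.

Lemma zoom_dt (I J : set R) f t x l : (forall t, I t -> J ((t - T) / e ^+ 2)) ->
  has_dt J f ((t - T) / e ^+ 2) (e^-1 *: (x - y)) l ->
  has_dt I (zoom e f) t x ((e ^+ 2)^-1 * l).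
Proof.
move=> IJ D; rewrite zoomE; apply: (@has_dt_affine _ I J) => //.
  by move=> s /IJ; congr J; ring.
have -> : (e ^+ 2)^-1 * t + - (e ^+ 2)^-1 * T = (t - T) / e ^+ 2 by ring.
have -> // : coord_affine (zc e) (zd e) x = e^-1 *: (x - y).
by apply/rowP => j; rewrite !mxE; ring.
Qed.

End positive.

Variable (rho : R).
Hypothesis rho0 : 0 < rho.

Definition bump f := smooth_on setT f /\
  forall s z, f s z != 0 -> `|s| <= rho /\ box 0 rho z.

(** The symbol calculus behind all estimates. A function of order [o] is a
    finite sum of products of a scalar of size [e ^ (1 - o)], a fixed bump
    seen at scale [e] around [(T, y)], and a fixed smooth function. A space
    derivative raises the order by one and a time derivative by two;
    smoothness, support and size are read off the order. *)
Inductive oscillating : nat -> (R -> R -> E -> R) -> Prop :=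
| osc_atom o (c : R -> R) f g : (forall e, 0 < e <= 1 -> `|c e| * e ^+ o <= e) ->
    bump f -> smooth_on setT g ->
    oscillating o (fun e t x => c e * (zoom e f t x * g t x))
| osc_add o F G : oscillating o F -> oscillating o G ->
    oscillating o (fun e t x => F e t x + G e t x)
| osc_ext o F G : (forall e t x, 0 < e <= 1 -> F e t x = G e t x) ->
    oscillating o G -> oscillating o F.

Lemma osc_smooth o F e : oscillating o F -> 0 < e <= 1 -> smooth_on setT (F e).
Proof.
have tT := @time_setT R.
move=> OF eI n; have /andP[e0 _] := eI; elim: OF => [m c f g _ [sf _] sg|o1 F1 G1 _ IF _ IG|o1 F1 G1 FG _ IG].
- apply: Cn_scale => //; apply: Cn_mul => //.
  by apply: (@Cn_zoom e e0 setT setT) => //; exact: sf.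
- exact: Cn_add.
- by apply: Cn_ext IG => t x _; exact: FG.
Qed.

Lemma osc_is_derive o F e t x i : oscillating o F -> 0 < e <= 1 ->
  is_derive x (basis_vec i) (F e t) (dx i (F e t) x).
Proof.
by move=> OF eI; exact: (Cn_is_derive (osc_smooth OF eI 1) x i (Logic.I : [set: R] t)).
Qed.

Lemma osc_has_dt o F e t x : oscillating o F -> 0 < e <= 1 ->
  has_dt setT (F e) t x (dt setT (F e) t x).
Proof.
by move=> OF eI; exact: (@Cn_has_dt _ _ _ _ _ (osc_smooth OF eI 1) t x Logic.I).
Qed.

Lemma oscW o o' F : (o <= o')%N -> oscillating o F -> oscillating o' F.
Proof.
move=> oo OF; elim: OF o' oo => [m c f g hc bf sg|o1 F1 G1 _ IF _ IG|o1 F1 G1 FG _ IG] o' oo.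
- apply: osc_atom => // e eI; apply: le_trans (hc e eI).
  by case/andP: eI => e0 e1; rewrite ler_wpM2l// ler_wiXn2l// ltW.
- by apply: osc_add; [exact: IF|exact: IG].
- by apply: osc_ext FG _; exact: IG.
Qed.

Lemma bump_mul f g : bump f -> bump g -> bump (fun t x => f t x * g t x).
Proof.
move=> [sf hf] [sg _]; split; first by move=> n; apply: Cn_mul (sf n) (sg n); exact: time_setT.
by move=> s z; rewrite mulf_eq0 => /norP[/hf].
Qed.

Lemma near_out (a b c : R) (h : R -> R) x : b < `|x - a| -> \forall z \near x, b < `|z - a|.
Proof.
move=> bx; have : (fun z : R => `|z - a|) z @[z --> x] --> `|x - a|.
  by apply: cvg_norm; apply: cvgB; [exact: cvg_id|exact: cvg_cst].
by move/cvgr_gt; apply.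
Qed.

Lemma near_out_box (z0 z : E) (r : R) : ~ box z0 r z -> \forall w \near z, ~ box z0 r w.
Proof.
move=> /existsNP[i /negP]; rewrite -ltNge => h.
have : continuous (fun w : E => `|w 0 i - z0 0 i|).
  move=> w; apply: (@continuous_comp _ _ _ (fun w : E => w 0 i - z0 0 i) (fun r => `|r|)).
    by apply: contB; [exact: coord_continuous|exact: contC].
  exact: norm_continuous.
move/(_ z).
by move/cvgr_gt => /(_ _ h); apply: filterS => w hw /(_ i); rewrite leNgt hw.
Qed.

Lemma bump_dx i f : bump f -> bump (fun t => dx i (f t)).
Proof.
move=> [sf hf]; split; first by move=> n; exact: Cn_dx (sf n.+1) i.
have d0 : forall z, dx i (fun _ : E => 0 : R) z = 0.
  by move=> z; have [_ e] := is_derive_cst (0 : R) z (basis_vec i); exact: e.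
move=> s z; apply: contra_neqP => /not_andP[h|h].
  rewrite -[RHS](d0 z); apply: dx_local; apply: filterE => w.
  by apply/eqP/negPn/negP => /hf[].
rewrite -[RHS](d0 z); apply: dx_local; have := near_out_box h; apply: filterS => w hw.
by apply/eqP/negPn/negP => /hf[].
Qed.

Lemma bump_dt f : bump f -> bump (dt setT f).
Proof.
move=> [sf hf]; split; first by move=> n; exact: Cn_dt (sf n.+1).
have d0 : forall s z, dt setT (fun (_ : R) (_ : E) => 0 : R) s z = 0.
  move=> s z; apply: has_dt_uniq => //; first exact: time_setT.
  by apply: has_dt_is_derive; exact: is_derive_cst.
move=> s z; apply: contra_neqP => /not_andP[h|h].
  rewrite -[RHS](d0 s z); apply: dt_local => //; first exact: filterE.
  have := @near_out 0 rho 0 id s; rewrite subr0 ltNge => /(_ (introT negP h)).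
  apply: filterS => w; rewrite subr0 ltNge => /negP hw _.
  by apply/eqP/negPn/negP => /hf[].
rewrite -[RHS](d0 s z); apply: dt_local => //; first exact: filterE.
by apply: filterE => w _; apply/eqP/negPn/negP => /hf[].
Qed.

(** Differentiating the bump costs a factor [e^-1]; differentiating the smooth
    factor costs nothing. *)
Lemma osc_dx i o F : oscillating o F -> oscillating o.+1 (fun e t => dx i (F e t)).
Proof.
elim=> [m c f g hc bf sg|o1 F1 G1 OF IF OG IG|o1 F1 G1 FG _ IG].
- apply: (@osc_ext _ _ (fun e t x => c e * e^-1 * (zoom e (fun t => dx i (f t)) t x * g t x) +
      c e * (zoom e f t x * dx i (g t) x))).
    move=> e t x /andP[e0 _].
    have [_ D] := derZ (c e) (derM (zoom_derive (Cn_is_derive (bf.1 1%N) _ i (Logic.I : [set: R] ((t - T) / e ^+ 2))))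
       (Cn_is_derive (sg 1%N) x i (Logic.I : [set: R] t))).
    by rewrite [LHS]D; rewrite /zoom; ring.
  apply: osc_add.
    apply: osc_atom => //; last exact: bump_dx.
    move=> e eI; apply: le_trans (hc e eI); case/andP: eI => e0 _.
    by rewrite normrM normfV (gtr0_norm e0) exprS mulrA mulfVK// gt_eqF.
  apply: osc_atom => //; last by move=> n; exact: Cn_dx (sg n.+1) i.
  move=> e eI; have := hc e eI; case/andP: eI => e0 e1; rewrite exprS mulrCA => h.
  apply: le_trans (ler_wpM2l (ltW e0) h) _; by rewrite ger_pMl.
- apply: osc_ext (osc_add IF IG) => e t x eI.
  by have [_ D] := derD (osc_is_derive t x i OF eI) (osc_is_derive t x i OG eI); exact: D.
- apply: osc_ext IG => e t x eI; congr (dx i _ x); apply/funext => z; exact: FG.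
Qed.

(** As in space, with time rescaled by [e ^+ 2]. *)
Lemma osc_dt o F : oscillating o F -> oscillating o.+2 (fun e => dt setT (F e)).
Proof.
have tT := @time_setT R.
elim=> [m c f g hc bf sg|o1 F1 G1 OF IF OG IG|o1 F1 G1 FG _ IG].
- apply: (@osc_ext _ _ (fun e t x => c e * (e ^+ 2)^-1 * (zoom e (dt setT f) t x * g t x) +
      c e * (zoom e f t x * dt setT g t x))).
    move=> e t x /andP[e0 _]; apply: has_dt_uniq => //.
    have nT (s : R) : nbhs s [set: R] by exact: filterT.
    apply: has_dt_is_derive.
    have d1 : is_derive t 1 (fun t => zoom e f t x) ((e ^+ 2)^-1 * zoom e (dt setT f) t x).
      apply: (is_derive_has_dt (nT t)); apply: (zoom_dt (J := setT) e0) => //.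
      exact: (@Cn_has_dt _ _ _ _ _ (bf.1 1%N)).
    have d2 : is_derive t 1 (fun t => g t x) (dt setT g t x).
      by apply: (is_derive_has_dt (nT t)); exact: (@Cn_has_dt _ _ _ _ _ (sg 1%N)).
    have := is_deriveZ (c e) (is_deriveM d1 d2); move=> /is_derive_eq; apply.
    by rewrite /GRing.scale /=; ring.
  apply: osc_add.
    apply: osc_atom => //; last exact: bump_dt.
    move=> e eI; apply: le_trans (hc e eI); case/andP: eI => e0 _.
    rewrite normrM normfV (gtr0_norm (exprn_gt0 _ e0)) (_ : m.+2 = 2 + m)%N// exprD mulrA mulfVK//.
    by rewrite expf_neq0 // gt_eqF.
  apply: osc_atom => //; last by move=> n; exact: Cn_dt (sg n.+1).
  move=> e eI; have h := hc e eI; case/andP: eI => e0 e1.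
  have -> : e ^+ m.+2 = e ^+ m * e ^+ 2 by rewrite -exprD addn2.
  rewrite mulrA.
  apply: (@le_trans _ _ (e * e ^+ 2)); first by rewrite ler_wpM2r// exprn_ge0// ltW.
  by rewrite ger_pMr// exprn_ile1// ltW.
- apply: osc_ext (osc_add IF IG) => e t x eI; apply: has_dt_uniq => //.
  exact: (@has_dtD _ _ setT (F1 e) (G1 e) t x _ _ (@osc_has_dt _ _ e t x OF eI) (@osc_has_dt _ _ e t x OG eI)).
- apply: osc_ext IG => e t x eI; congr (dt _ _ t x); apply/funext => s; apply/funext => z; exact: FG.
Qed.

Lemma osc_smul o F g : oscillating o F -> smooth_on setT g ->
  oscillating o (fun e t x => F e t x * g t x).
Proof.
move=> OF sg; elim: OF => [m c f h hc bf sh|o1 F1 G1 OF IF OG IG|o1 F1 G1 FG _ IG].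
- apply: (@osc_ext _ _ (fun e t x => c e * (zoom e f t x * (h t x * g t x)))).
    by move=> e t x _; ring.
  by apply: osc_atom => // n; apply: Cn_mul (sh n) (sg n); exact: time_setT.
- by apply: osc_ext (osc_add IF IG) => e t x _; rewrite mulrDl.
- by apply: osc_ext IG => e t x eI; rewrite FG.
Qed.

Lemma osc_scale o F (k : R) : oscillating o F -> oscillating o (fun e t x => k * F e t x).
Proof.
move=> OF; apply: osc_ext (@osc_smul o F (fun _ _ => k) OF _) => [e t x _|n].
  by rewrite mulrC.
by apply: Cn_cst; exact: time_setT.
Qed.

Lemma osc_sub o F G : oscillating o F -> oscillating o G ->
  oscillating o (fun e t x => F e t x - G e t x).
Proof.
by move=> OF OG; apply: osc_ext (osc_add OF (osc_scale (-1) OG)) => e t x _; rewrite mulN1r.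
Qed.

Lemma osc_mul o o' F G : oscillating o F -> oscillating o' G ->
  oscillating (o + o') (fun e t x => F e t x * G e t x).
Proof.
move=> OF OG; elim: OF => [m c f g hc bf sg|o1 F1 H1 _ IF _ IH|o1 F1 H1 FH _ IH].
- elim: OG => [m' c' f' g' hc' bf' sg'|o2 F' G' _ IF' _ IG'|o2 F' G' FG' _ IG'].
  + apply: (@osc_ext _ _ (fun e t x => c e * c' e *
      (zoom e (fun t x => f t x * f' t x) t x * (g t x * g' t x)))).
      by move=> e t x _; rewrite /zoom; ring.
    apply: osc_atom; [|exact: bump_mul|by move=> n; apply: Cn_mul (sg n) (sg' n); exact: time_setT].
    move=> e eI; have h := hc e eI; have h' := hc' e eI; case/andP: eI => e0 e1.
    rewrite normrM exprD mulrACA; apply: (@le_trans _ _ (e * e)).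
      by apply: ler_pM => //; rewrite mulr_ge0// exprn_ge0// ltW.
    by rewrite ger_pMl.
  + by apply: osc_ext (osc_add IF' IG') => e t x _; rewrite mulrDr.
  + by apply: osc_ext IG' => e t x eI; rewrite FG'.
- by apply: osc_ext (osc_add IF IH) => e t x _; rewrite mulrDl.
- by apply: osc_ext IH => e t x eI; rewrite FH.
Qed.

Lemma osc_sum o (F : 'I_3 -> R -> R -> E -> R) : (forall i, oscillating o (F i)) ->
  oscillating o (fun e t x => \sum_i F i e t x).
Proof.
move=> OF; apply: (@osc_ext _ _ (fun e t x => F ord0 e t x + (F (lift ord0 ord0) e t x +
   F (lift ord0 (lift ord0 ord0)) e t x))).
  by move=> e t x _; rewrite sum3.
by apply: osc_add => //; exact: osc_add.
Qed.

Lemma osc_supp o F e t x : oscillating o F -> 0 < e <= 1 -> F e t x != 0 ->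
  `|t - T| <= rho * e ^+ 2 /\ box y (rho * e) x.
Proof.
move=> OF eI; elim: OF => [m c f g _ [_ sf] _|o1 F1 G1 _ IF _ IG|o1 F1 G1 FG _ IG].
- rewrite !mulf_eq0 => /norP[_ /norP[/sf[h1 h2] _]]; case/andP: eI => e0 _; split.
    move: h1; rewrite normrM normfV (gtr0_norm (exprn_gt0 _ e0)).
    by rewrite ler_pdivrMr// exprn_gt0.
  move=> i; have := h2 i; rewrite !mxE subr0 normrM normfV (gtr0_norm e0) mulrC.
  by rewrite ler_pdivrMr.
- have [->|/IF//] := eqVneq (F1 e t x) 0; by rewrite add0r.
- by rewrite FG.
Qed.

(** For [e <= 1] the zoomed bump lives in one compact set, where the smooth
    factor is bounded. *)
Lemma osc_bound o F : oscillating o F -> exists2 B, 0 <= B &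
  forall e t x, 0 < e <= 1 -> `|F e t x| * e ^+ o <= B * e.
Proof.
elim=> [m c f g hc bf sg|o1 F1 G1 _ [B B0 IF] _ [B' B'0 IG]|o1 F1 G1 FG _ [B B0 IG]].
- have [M M0 hM] := @joint_cont_bounded _ setT f `[- rho, rho]%classic (box 0 rho)
    (Cn_cont (bf.1 0%N)) (@subsetT _ _) (@segment_compact R _ _) (@box_compact R _ _).
  have [N N0 hN] := @joint_cont_bounded _ setT g `[T - rho, T + rho]%classic (box y rho)
    (Cn_cont (sg 0%N)) (@subsetT _ _) (@segment_compact R _ _) (@box_compact R _ _).
  exists (M * N); first exact: mulr_ge0.
  move=> e t x eI; have [z|nz] := eqVneq (zoom e f t x) 0.
    rewrite z mul0r mulr0 normr0 mul0r mulr_ge0 ?mulr_ge0//; by case/andP: eI => /ltW.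
  have [h1 h2] := bf.2 _ _ nz.
  have O1 : oscillating 1 (fun e t x => 1 * (zoom e f t x * 1)).
    apply: (@osc_atom 1 (fun=> 1) f (fun _ _ => 1)) => //.
      by move=> ? _; rewrite normr1 mul1r expr1.
    by move=> n; apply: Cn_cst; exact: time_setT.
  have [h3 h4] : `|t - T| <= rho * e ^+ 2 /\ box y (rho * e) x.
    by apply: (osc_supp O1 eI); rewrite mul1r mulr1.
  case/andP: (eI) => e0 e1.
  have e2 : rho * e ^+ 2 <= rho by rewrite ger_pMr// exprn_ile1// ltW.
  have e3 : rho * e <= rho by rewrite ger_pMr.
  rewrite !normrM mulrAC mulrC; apply: ler_pM; rewrite ?mulr_ge0 ?exprn_ge0 ?(ltW e0)//; last exact: hc.
  apply: ler_pM => //.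
    by apply: hM => //; rewrite /= in_itv /= -ler_norml.
  apply: hN; last by move=> i; exact: le_trans (h4 i) e3.
  by rewrite /= in_itv /= -ler_distl; exact: le_trans h3 e2.
- exists (B + B'); first exact: addr_ge0.
  move=> e t x eI; rewrite mulrDl; apply: le_trans (lerD (IF e t x eI) (IG e t x eI)).
  by rewrite -mulrDl ler_wpM2r// ?exprn_ge0 ?ler_normD//; case/andP: eI => /ltW.
- by exists B => // e t x eI; rewrite FG// IG.
Qed.

End Zoom.

(** * Starting the block smoothly from rest *)

Section Block.
Context {R : realType}.
Local Notation E := 'rV[R]_3.

Lemma time_set_oo (a b : R) : time_set (`]a, b[ : set R).
Proof.
apply: time_set_right => t /=; rewrite in_itv /= => /andP[at' tb]; exists b => // s /andP[ts sb].
by rewrite in_itv /= sb (lt_trans at' ts).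
Qed.

Lemma near_oo (a b t : R) : a < t < b -> \forall s \near t, a < s < b.
Proof.
move=> tI; have : open (`]a, b[%classic : set R) by exact: interval_open.
move=> /(@conj _ (t \in `]a, b[%R)) oI.
have := open_nbhs_nbhs (conj (interval_open _ _ : open (`]a, b[%classic : set R)) (_ : `]a, b[%classic t)).
rewrite /= in_itv => /(_ isT isT tI); apply: filterS => s /=.
by rewrite in_itv.
Qed.

Lemma near_lt (b t : R) : t < b -> \forall s \near t, s < b.
Proof.
move=> tb; have := @near_oo (t - 1) b t; rewrite ltrBlDr ltrDl ltr01 tb => /(_ isT).
by apply: filterS => s /andP[].
Qed.

Lemma near_gt (a t : R) : a < t -> \forall s \near t, a < s.
Proof.
move=> ta; have := @near_oo a (t + 1) t; rewrite ltrDl ltr01 ta => /(_ isT).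
by apply: filterS => s /andP[].
Qed.

Lemma has_dt_sub (I J : set R) (f : R -> E -> R) t x l : J `<=` I ->
  has_dt I f t x l -> has_dt J f t x l.
Proof.
move=> JI H A HA; have {}HA : within I t^' ((tquot f t x) @^-1` A) := H A HA.
suff : within J t^' ((tquot f t x) @^-1` A) by [].
by move: HA; rewrite /within /=; apply: filterS => s Hs /JI Is; exact: Hs.
Qed.

Lemma has_dtB (I : set R) (f g : R -> E -> R) t x l m :
  has_dt I f t x l -> has_dt I g t x m ->
  has_dt I (fun t x => f t x - g t x) t x (l - m).
Proof.
move=> H1 H2.
rewrite /has_dt (_ : tquot _ t x = (fun s => tquot f t x s - tquot g t x s)).
  exact: cvgB H1 H2.
by apply/funext => s; rewrite /tquot -scalerBr; congr (_ *: _); ring.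
Qed.

Lemma dx_scale i (k : R) (f : E -> R) x : derivable f x (basis_vec i) ->
  dx i (fun z => k * f z) x = k * dx i f x.
Proof. by move=> /derivableP df; have [_ e] := derZ k df; exact: e. Qed.

Lemma dx_zero i x : dx i (fun _ : E => 0 : R) x = 0.
Proof. by have [_ e] := is_derive_cst (0 : R) x (basis_vec i); exact: e. Qed.

Lemma dx_near0 i (f : E -> R) x : (\forall z \near x, f z = 0) -> dx i f x = 0.
Proof. by move=> f0; rewrite -(dx_zero i x); exact: dx_local. Qed.

Section extension.
Variables (nu r : R) (u : 'I_3 -> R -> E -> R) (p : R -> E -> R) (f : 'I_3 -> R -> E -> R).
Variables (th th' : R -> R).
Hypotheses (r0 : 0 <= r) (sth : smooth1 th) (sth' : smooth1 th') (dth : forall s : R, is_derive s 1 th (th' s)).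
Hypotheses (th0 : forall s, s <= - (2 / 3) -> th s = 0) (th1 : forall s, - (1 / 3) <= s -> th s = 1).
Local Notation O := (`]-1, 0[%classic : set R).
Local Notation L := (`]-oo, 0[%classic : set R).
Hypotheses (su : forall j, smooth_on O (u j)) (sp : smooth_on O p)
  (sf : forall j, smooth_on setT (f j)).
Hypotheses (eqs : forall j s x, O s -> momentum nu O u p j s x = f j s x)
  (div0 : forall s x, O s -> divergence (fun j => u j s) x = 0).
Hypotheses (suppu : forall j s x, O s -> u j s x != 0 -> box 0 r x)
  (suppp : forall s x, O s -> p s x != 0 -> box 0 r x)
  (suppf : forall j s x, f j s x != 0 -> `|s| <= r + 2 /\ box 0 (r + 2) x).

Definition ramped (g : R -> E -> R) (s : R) (x : E) : R := th s * g s x.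

(** The force that drives [th * u]. The second summand collects [th' * u] and
    the defect of the quadratic term; it vanishes once [th] is 1, so the force
    stays smooth through the blow-up time 0. *)
Definition ramp_force j s x : R := th s * f j s x +
  (th' s * u j s x + (th s ^+ 2 - th s) * \sum_i u i s x * dx i (u j s) x).

Let OP s : O s <-> -1 < s < 0. Proof. by rewrite /= in_itv. Qed.
Let LP s : L s <-> s < 0. Proof. by rewrite /= in_itv. Qed.
Let tO : time_set O. Proof. exact: time_set_oo. Qed.
Let tL : time_set L. Proof. exact: time_set_No. Qed.
Let nOL s : O s -> \forall s' \near s, L s' <-> O s'.
Proof.
move=> /OP /near_oo; apply: filterS => s' h; split => _; [exact/OP|].
by apply/LP; case/andP: h.
Qed.

Let early s : ~ O s -> s < 0 -> s < - (2 / 3).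
Proof.
move=> nO s0; rewrite ltNge; apply/negP => h; apply: nO; apply/OP; rewrite s0 andbT.
lra.
Qed.

Lemma ramped_smooth g : smooth_on O g -> smooth_on L (ramped g).
Proof.
move=> sg n; apply: Cn_local => s x /LP s0.
have [Os|nO] := pselect (O s).
  exists O, (ramped g); split; last exact: filterE; last exact: nOL.
  by apply: Cn_mul (sg n) => //; exact: Cn_smooth1_time.
exists setT, (fun _ _ => 0); split.
- by apply: Cn_cst; exact: time_setT.
- by have := near_lt s0; apply: filterS => s' h; split => // _; exact/LP.
- have := near_time x (near_lt (early nO s0)); apply: filterS => -[s' x'] /= h _.
  by rewrite /ramped th0 ?mul0r // ltW.
Qed.

Lemma th'0 s : s < - (2 / 3) \/ - (1 / 3) < s -> th' s = 0.
Proof.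
have D (k : R) : (\forall s' \near s, th s' = k) -> th' s = 0.
  move=> H; have [_ <-] := dth s.
  have [_ e] := is_derive_cst k s (1 : R); rewrite -[RHS]e.
  exact: near_eq_derive.
case=> h.
  by apply: (D 0); have := near_lt h; apply: filterS => s' /ltW /th0.
by apply: (D 1); have := near_gt h; apply: filterS => s' /ltW /th1.
Qed.

(** Near each time one of three descriptions applies: before the block exists
    [th] is 0, during its life all factors are smooth, and close to time 0
    only the smooth force [f] is left. *)
Lemma ramp_force_smooth j : smooth_on setT (ramp_force j).
Proof.
have tT := @time_setT R.
move=> n; apply: Cn_add => //.
  by apply: Cn_mul => //; [exact: Cn_smooth1_time|exact: sf].
apply: Cn_local => s x _.
have zero : (s < - (2 / 3) \/ - (1 / 3) < s) ->
    \forall s' \near s, th' s' = 0 /\ th s' ^+ 2 - th s' = 0.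
  case=> h.
    have := near_lt h; apply: filterS => s' h'; rewrite th'0; last by left.
    by rewrite th0 ?expr0n ?subrr //= ?ltW.
  have := near_gt h; apply: filterS => s' h'; rewrite th'0; last by right.
  by rewrite th1 ?expr1n ?subrr // ltW.
have [[Os h]|nO] := pselect (O s /\ ~ (s < - (2 / 3) \/ - (1 / 3) < s)).
  exists O, (fun s x => th' s * u j s x + (th s ^+ 2 - th s) * \sum_i u i s x * dx i (u j s) x).
  split; last exact: filterE.
    have cth : Cn O n (fun s (_ : E) => th s) by exact: Cn_smooth1_time.
    apply: Cn_add => //; apply: Cn_mul => //; first exact: Cn_smooth1_time.
    - exact: su.
    - apply: Cn_sub => //; exact: Cn_mul.
    - apply: Cn_sum => // i; apply: Cn_mul => //; first exact: su.
      exact: Cn_dx (su j n.+1) i.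
  by move/OP: Os => /near_oo; apply: filterS => s' h'; split => // _; exact/OP.
have {}nO : s < - (2 / 3) \/ - (1 / 3) < s.
  apply: contrapT => h; apply: nO; split => //; apply/OP.
  move/not_orP: h => [/negP + /negP]; rewrite -!leNgt => h1 h2; apply/andP; split; lra.
exists setT, (fun _ _ => 0); split.
- exact: Cn_cst.
- exact: filterE.
- have := near_time x (zero nO); apply: filterS => -[s' x'] /= [-> ->] _.
  by rewrite !mul0r addr0.
Qed.

Lemma ramp_force_supp j s x : ramp_force j s x != 0 -> `|s| <= r + 2 /\ box 0 (r + 2) x.
Proof.
have [h|h] := pselect (s < - (2 / 3) \/ - (1 / 3) < s).
  have -> : ramp_force j s x = th s * f j s x.
    rewrite /ramp_force th'0// mul0r add0r; case: h => h; last by rewrite th1 ?ltW// expr1n subrr mul0r addr0.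
    by rewrite th0 ?ltW// expr0n subrr !mul0r addr0.
  by rewrite mulf_eq0 => /norP[_ /suppf].
move: h => /not_orP[/negP + /negP]; rewrite -!leNgt => h1 h2.
have Os : O s by apply/OP/andP; split; lra.
move=> nz; have [fz|/suppf//] := eqVneq (f j s x) 0.
split.
  by rewrite ler_norml; apply/andP; split; move: r0 h1 h2; lra.
have [k uk] : exists k, u k s x != 0.
  apply: contrapT => /forallNP H; have H' k : u k s x = 0 by apply/eqP/negPn/negP; exact: H.
  move: nz; rewrite /ramp_force fz H' !mulr0 !add0r big1 ?mulr0 ?eqxx// => i _.
  by rewrite H' mul0r.
by move=> i; apply: (le_trans (suppu Os uk i)); rewrite lerDl.
Qed.

Lemma ramped_dx i g s x : smooth_on O g -> O s -> dx i (ramped g s) x = ramped (fun s => dx i (g s)) s x.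
Proof. by move=> sg Os; apply: dx_scale; have [] := Cn_is_derive (sg 1%N) x i Os. Qed.

Lemma ramped_momentum j s x : L s ->
  momentum nu L (fun j => ramped (u j)) (ramped p) j s x = ramp_force j s x.
Proof.
move=> Ls; have s0 : s < 0 by exact/LP.
have [Os|nO] := pselect (O s); last first.
  have e := early nO s0; have [z1 z2] : th s = 0 /\ th' s = 0.
    by rewrite th0 ?th'0//; [left|exact: ltW].
  have z g : ramped g s = (fun _ => 0) by apply/funext => z; rewrite /ramped z1 mul0r.
  rewrite /momentum /ramp_force z1 z2 expr0n subrr !mul0r !addr0 !z dx_zero.
  have -> : dt L (ramped (u j)) s x = 0.
    apply: has_dt_uniq => //; apply: (@has_dt_local _ _ L setT _ (fun _ _ => 0)) => //.
    - by have := near_lt s0; apply: filterS => s' h; split => // _; exact/LP.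
    - by have := near_lt e; apply: filterS => s' h _; rewrite /ramped th0 ?mul0r// ltW.
    - apply: has_dt_is_derive; exact: is_derive_cst.
  rewrite !big1 ?mulr0 ?subrr ?addr0//.
  - by rewrite subrr.
  - move=> i _; have -> : dx i (fun=> 0 : R) = (fun _ : E => 0) by apply/funext => w; exact: dx_zero.
    exact: dx_zero.
  - by move=> i _; rewrite dx_zero mulr0.
have D g : smooth_on O g -> forall i, dx i (ramped g s) = (fun x => th s * dx i (g s) x).
  by move=> sg i; apply/funext => w; exact: ramped_dx.
have sdu i : smooth_on O (fun s => dx i (u j s)) by move=> n; exact: Cn_dx (su j n.+1) i.
rewrite /ramp_force -(eqs j x Os) /momentum; cbv beta.
have -> : dt L (ramped (u j)) s x = th' s * u j s x + th s * dt O (u j) s x.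
  apply: has_dt_uniq => //; apply: (@has_dt_local _ _ L O _ (ramped (u j))) => //; first exact: nOL.
    exact: filterE.
  apply: (@has_dtM _ O (fun s _ => th s) (u j)) => //.
  - exact: (Cn_cont (su j 0%N)).
  - exact: has_dt_is_derive (dth s).
  - exact: (@Cn_has_dt _ _ _ _ _ (su j 1%N)).
under [X in _ + X - _ + _ = _]eq_bigr => i _.
  rewrite (D _ (su j)) /ramped mulrACA; over.
under [X in _ + _ - _ * X + _ = _]eq_bigr => i _.
  rewrite (D _ (su j)).
  have -> : dx i (fun x => th s * dx i (u j s) x) x = th s * dx i (dx i (u j s)) x.
    by apply: dx_scale; have [] := Cn_is_derive (sdu i 1%N) x i Os.
  over.
rewrite (D _ sp) -!mulr_sumr; ring.
Qed.

Lemma ramped_div s x : L s -> divergence (fun j => ramped (u j) s) x = 0.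
Proof.
move=> Ls; have s0 : s < 0 by exact/LP.
have [Os|nO] := pselect (O s); last first.
  have z1 : th s = 0 by apply: th0; apply: ltW; exact: early.
  have z g : ramped g s = (fun _ => 0) by apply/funext => z; rewrite /ramped z1 mul0r.
  by rewrite /divergence big1// => i _; rewrite z dx_zero.
rewrite /divergence; under eq_bigr => i _ do rewrite ramped_dx//.
by rewrite /ramped -mulr_sumr -/(divergence (fun j => u j s) x) div0// mulr0.
Qed.

Lemma ramped_supp j s x : L s -> ramped (u j) s x != 0 -> - (2 / 3) < s /\ box 0 r x.
Proof.
move=> /LP s0; rewrite mulf_eq0 => /norP[t0 u0].
have h : - (2 / 3) < s by rewrite ltNge; apply/negP => /th0 h; rewrite h eqxx in t0.
split => //; apply: (suppu _ u0); apply/OP; rewrite s0 andbT; lra.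
Qed.

Lemma ramped_supp_p s x : L s -> ramped p s x != 0 -> - (2 / 3) < s /\ box 0 r x.
Proof.
move=> /LP s0; rewrite mulf_eq0 => /norP[t0 u0].
have h : - (2 / 3) < s by rewrite ltNge; apply/negP => /th0 h; rewrite h eqxx in t0.
split => //; apply: (suppp _ u0); apply/OP; rewrite s0 andbT; lra.
Qed.

End extension.
End Block.

(** * Removing the background and inserting the block *)

Section Corrector.
Context {R : realType}.
Local Notation E := 'rV[R]_3.
Local Notation i0 := (ord0 : 'I_3).
Local Notation i1 := (lift ord0 ord0 : 'I_3).
Local Notation i2 := (lift ord0 (lift ord0 ord0) : 'I_3).
Variables (T : R) (y : E) (r : R).
Hypothesis r0 : 0 <= r.
Local Notation zoom := (zoom T y).
Local Notation oscillating := (oscillating T y (r + 2)).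

Definition cutoff (s : R) (x : E) : R := plateau 1 (3 / 2) s *
  (plateau (r + 1) (r + 2) (x 0 i0) *
    (plateau (r + 1) (r + 2) (x 0 i1) * plateau (r + 1) (r + 2) (x 0 i2))).

Let lt1 : (1 : R) < 3 / 2. Proof. lra. Qed.
Let lt2 : r + 1 < r + 2. Proof. lra. Qed.

Lemma bump_cutoff : bump (r + 2) cutoff.
Proof.
have tT := @time_setT R; split => [n|s x].
  have sx i : Cn setT n (fun (_ : R) (x : E) => plateau (r + 1) (r + 2) (x 0 i)).
    by apply: Cn_smooth1_coord => //; exact: smooth1_plateau.
  apply: Cn_mul => //; first by apply: Cn_smooth1_time => //; exact: smooth1_plateau.
  by apply: Cn_mul => //; apply: Cn_mul.
have key (a b c d : R) : a * (b * (c * d)) != 0 -> [/\ a != 0, b != 0, c != 0 & d != 0].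
  by rewrite !mulf_eq0 !negb_or => /and4P.
move=> /key[hs h0 h1 h2]; split.
  rewrite leNgt; apply/negP => h; move/eqP: hs; apply; apply: plateau0 => //.
  by move: r0 h; lra.
have out i : plateau (r + 1) (r + 2) (x 0 i) != 0 -> `|x 0 i - (0 : E) 0 i| <= r + 2.
  rewrite mxE subr0 => hi; rewrite leNgt; apply/negP => h; move/eqP: hi; apply.
  by apply: plateau0 => //; exact: ltW.
by apply: ord3P; exact: out.
Qed.

Lemma cutoff1 (s : R) (x : E) : `|s| <= 1 -> (forall i, `|x 0 i| <= r + 1) -> cutoff s x = 1.
Proof. by move=> hs hx; rewrite /cutoff !plateau1 // !mulr1. Qed.

Variable vt : 'I_3 -> R -> E -> R.
Hypotheses (svt : forall j, smooth_on setT (vt j))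
  (dvt : forall t x, divergence (fun j => vt j t) x = 0).

(** [vt] is the curl of its potential, so cutting off the potential localizes
    the field while keeping it solenoidal. *)
Definition cut_potential e (j : 'I_3) (t : R) (x : E) : R :=
  zoom e cutoff t x * potential y vt j t x.

(** The factor [x - y] of the potential is [e] times a zoomed coordinate,
    which absorbs the loss from the cut-off: order 0, so that the corrector
    has order 1 and is bounded uniformly in [e]. *)
Lemma osc_cut_potential j : oscillating 0 (fun e => cut_potential e j).
Proof.
apply: (@osc_ext _ _ _ _ _ _ (fun e t x =>
  \sum_m e * (zoom e (fun s z => z 0 m * cutoff s z) t x * potential_coef y vt j m t x))).
  move=> e t x /andP[e0 _]; rewrite /cut_potential /potential mulr_sumr.
  apply: eq_bigr => m _; rewrite /zoom; set c := cutoff _ _; rewrite !mxE.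
  by field; exact: lt0r_neq0.
apply: osc_sum => m; apply: osc_atom.
- by move=> e /andP[e0 _]; rewrite expr0 mulr1 gtr0_norm.
- have [sc hc] := bump_cutoff; split.
    move=> n; apply: Cn_mul (sc n); first exact: time_setT.
    by apply: (@Cn_smooth1_coord _ n _ id); [exact: time_setT|exact: smooth1_id].
  by move=> s z; rewrite mulf_eq0 => /norP[_ /hc].
- exact: smooth_potential_coef.
Qed.

Definition corrector e (j : 'I_3) (t : R) : E -> R := curl (fun k => cut_potential e k t) j.

Lemma osc_corrector j : oscillating 1 (fun e => corrector e j).
Proof. by apply: osc_sub; apply: osc_dx; exact: osc_cut_potential. Qed.

Lemma corrector_div e t x : 0 < e <= 1 -> divergence (fun j => corrector e j t) x = 0.
Proof.
move=> eI; apply: (@div_curl _ (fun k => cut_potential e k)) => j.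
exact: osc_smooth (osc_cut_potential j) eI 2.
Qed.

Lemma near_inside (k : R) (x : E) : (forall i, `|x 0 i - y 0 i| < k) ->
  \forall z \near x, forall i, `|(z : E) 0 i - y 0 i| < k.
Proof.
move=> h.
have H i : \forall z \near x, `|(z : E) 0 i - y 0 i| < k.
  have : continuous (fun w : E => `|w 0 i - y 0 i|).
    move=> w; apply: (@continuous_comp _ _ _ (fun w : E => w 0 i - y 0 i) (fun r => `|r|)).
      by apply: contB; [exact: coord_continuous|exact: contC].
    exact: norm_continuous.
  by move/(_ x)/cvgr_lt; apply.
by apply: filterS3 (H i0) (H i1) (H i2) => z h0 h1 h2; apply: ord3P.
Qed.

(** Where the cut-off equals 1 the corrector is the curl of the whole
    potential. *)
Lemma corrector_eq e t (x : E) j : 0 < e <= 1 -> `|t - T| <= e ^+ 2 ->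
  (forall i, `|x 0 i - y 0 i| < (r + 1) * e) -> \forall z \near x, corrector e j t z = vt j t z.
Proof.
move=> /andP[e0 _] ht hx; have := near_inside hx; apply: filterS => z hz.
rewrite -(curl_potential y svt dvt) /corrector /curl.
have loc k : \forall w \near z, cut_potential e k t w = potential y vt k t w.
  have := near_inside hz; apply: filterS => w hw.
  rewrite /cut_potential /zoom cutoff1 ?mul1r//.
    by rewrite normrM normfV (gtr0_norm (exprn_gt0 _ e0)) ler_pdivrMr ?exprn_gt0// mul1r.
  move=> i; rewrite !mxE normrM normfV (gtr0_norm e0) mulrC ler_pdivrMr//.
  exact: ltW.
by congr (_ - _); apply: dx_local; exact: loc.
Qed.

Lemma corrector_supp e j t x : 0 < e <= 1 -> corrector e j t x != 0 ->
  `|t - T| <= 3 / 2 * e ^+ 2.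
Proof.
move=> eI; apply: contra_neqP => /negP; rewrite -ltNge => h.
have /andP[e0 _] := eI.
have z k : cut_potential e k t = (fun _ => 0).
  apply/funext => w; rewrite /cut_potential /zoom /cutoff (@plateau0 _ 1 (3/2)) ?mul0r//.
  by rewrite normrM normfV (gtr0_norm (exprn_gt0 _ e0)) ler_pdivlMr ?exprn_gt0// ltW.
by rewrite /corrector /curl !z !dx_zero subrr.
Qed.

Variables (nu : R) (G : 'I_3 -> R -> E -> R).
Hypothesis bG : forall j, bump (r + 2) (G j).

(** What remains of the momentum equation of [v - corrector + block], given
    that the block does not overlap [v - corrector]. *)
Definition force_diff e (j : 'I_3) (t : R) (x : E) : R :=
  (e ^+ 3)^-1 * zoom e (G j) t x - dt setT (corrector e j) t x
  - \sum_i vt i t x * dx i (corrector e j t) x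
  - \sum_i corrector e i t x * dx i (vt j t) x
  + \sum_i corrector e i t x * dx i (corrector e j t) x
  + nu * \sum_i dx i (dx i (corrector e j t)) x.

(** The rescaled force of the block, of size [e ^- 3], is the dominant term:
    order 4. *)
Lemma osc_force_diff j : oscillating 4 (fun e => force_diff e j).
Proof.
have oc := osc_corrector; have od i k := osc_dx i (oc k).
have sdv i : smooth_on setT (fun t => dx i (vt j t)) by move=> n; exact: Cn_dx (svt j n.+1) i.
apply: osc_add; last first.
  by apply: osc_scale; apply: osc_sum => i; apply: (oscW (o := 3)) => //; exact: osc_dx (od i j).
apply: osc_add; last first.
  by apply: osc_sum => i; apply: (oscW (o := 1 + 2)) => //; exact: osc_mul (oc i) (od i j).
apply: osc_sub; last first.
  by apply: osc_sum => i; apply: (oscW (o := 1)) => //; exact: osc_smul (oc i) (sdv i).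
apply: osc_sub; last first.
  apply: osc_sum => i; apply: (oscW (o := 2)) => //.
  by apply: osc_ext (osc_smul (od i j) (svt i)) => e t x _; rewrite mulrC.
apply: osc_sub; last by apply: (oscW (o := 3)) => //; exact: osc_dt (oc j).
apply: (@osc_ext _ _ _ _ _ _ (fun e t x => (e ^+ 3)^-1 * (zoom e (G j) t x * 1))).
  by move=> e t x _; rewrite mulr1.
apply: (@osc_atom _ _ _ _ 4 (fun e => (e ^+ 3)^-1) (G j) (fun _ _ => 1)) => //.
  move=> e /andP[e0 _]; rewrite gtr0_norm ?invr_gt0 ?exprn_gt0//.
  by rewrite [e ^+ 4]exprSr mulrA mulVf ?mul1r// expf_neq0// gt_eqF.
by move=> n; apply: Cn_cst; exact: time_setT.
Qed.

(** ** Insertion of the rescaled block *)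
Local Notation L := (`]-oo, 0[%classic : set R).
Local Notation LT := (`]-oo, T[%classic : set R).
Local Notation J := (`[0, T[%classic : set R).
Variables (V : 'I_3 -> R -> E -> R) (Q : R -> E -> R).
Hypotheses (sV : forall j, smooth_on L (V j)) (sQ : smooth_on L Q).
Hypotheses (eqV : forall j s x, L s -> momentum nu L V Q j s x = G j s x)
  (divV : forall s x, L s -> divergence (fun j => V j s) x = 0).
Hypotheses (suppV : forall j s x, L s -> V j s x != 0 -> - (2 / 3) < s /\ box 0 r x).

Definition rescaled_velocity e j t x : R := e^-1 * zoom e (V j) t x.
Definition rescaled_pressure e t x : R := (e ^+ 2)^-1 * zoom e Q t x.

Section fixed_scale.
Variable (e : R).
Hypothesis eI : 0 < e <= 1.
Let e0 : 0 < e. Proof. by case/andP: eI. Qed.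

Let LTL t : LT t -> L ((t - T) / e ^+ 2).
Proof. by rewrite /= !in_itv /= => h; rewrite pmulr_llt0 ?invr_gt0 ?exprn_gt0// subr_lt0. Qed.

Let tLT : time_set LT. Proof. exact: time_set_No. Qed.

Lemma rescaled_velocity_smooth j : smooth_on LT (rescaled_velocity e j).
Proof. by move=> n; apply: Cn_scale => //; apply: (Cn_zoom y e0 tLT LTL); exact: sV. Qed.

Lemma rescaled_pressure_smooth : smooth_on LT (rescaled_pressure e).
Proof. by move=> n; apply: Cn_scale => //; apply: (Cn_zoom y e0 tLT LTL); exact: sQ. Qed.

Let dzoom f i t x : LT t -> smooth_on L f ->
  dx i (zoom e f t) x = e^-1 * zoom e (fun s => dx i (f s)) t x.
Proof.
move=> /LTL Lt sf.
by have [_ D] := zoom_derive (T := T) (y := y) (Cn_is_derive (sf 1%N) (e^-1 *: (x - y)) i Lt); exact: D.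
Qed.

Let zoom_derivable f i t x : LT t -> smooth_on L f -> derivable (zoom e f t) x (basis_vec i).
Proof.
move=> /LTL Lt sf.
by have [] := zoom_derive (T := T) (y := y) (Cn_is_derive (sf 1%N) (e^-1 *: (x - y)) i Lt).
Qed.

Lemma rescaled_dx i j t x : LT t ->
  dx i (rescaled_velocity e j t) x = e^-1 * (e^-1 * zoom e (fun s => dx i (V j s)) t x).
Proof. by move=> Lt; rewrite dx_scale ?dzoom//; exact: zoom_derivable. Qed.

Lemma scaling_algebra (k k2 k3 : R) (w dw ddw : 'I_3 -> R) (tw qw : R) :
  k2 = k ^+ 2 -> k3 = k ^+ 3 -> k * (k2 * tw) + \sum_i (k * w i) * (k * (k * dw i)) - nu * \sum_i k * (k * (k * ddw i))
    + k2 * (k * qw) =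
  k3 * (tw + \sum_i w i * dw i - nu * \sum_i ddw i + qw).
Proof. by move=> -> ->; rewrite !sum3; ring. Qed.

Let ddxV i j t x : LT t -> dx i (dx i (rescaled_velocity e j t)) x =
  e^-1 * (e^-1 * (e^-1 * zoom e (fun s => dx i (dx i (V j s))) t x)).
Proof.
move=> Lt.
have sdV : smooth_on L (fun s => dx i (V j s)) by move=> n; exact: Cn_dx (sV j n.+1) i.
have -> : dx i (rescaled_velocity e j t) = (fun x => e^-1 * (e^-1 * zoom e (fun s => dx i (V j s)) t x)).
  by apply/funext => z; exact: rescaled_dx.
have D0 := zoom_derive (T := T) (y := y) (Cn_is_derive (sdV 1%N) (e^-1 *: (x - y)) i (LTL Lt)).
have [_ D] := derZ e^-1 (derZ e^-1 D0); exact: D.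
Qed.

(** The equations are invariant under this scaling, the force being multiplied
    by [e ^- 3]. *)
Lemma rescaled_momentum j t x : LT t ->
  momentum nu LT (rescaled_velocity e) (rescaled_pressure e) j t x = (e ^+ 3)^-1 * zoom e (G j) t x.
Proof.
move=> Lt; have L' := LTL Lt.
rewrite /zoom -(eqV _ _ L') /momentum.
have -> : dt LT (rescaled_velocity e j) t x = e^-1 * ((e ^+ 2)^-1 * zoom e (dt L (V j)) t x).
  apply: has_dt_uniq => //.
  have h := zoom_dt (y := y) e0 LTL (@Cn_has_dt _ _ _ _ _ (sV j 1%N) ((t - T) / e ^+ 2) (e^-1 *: (x - y)) L').
  have nLT : nbhs t LT by apply: open_nbhs_nbhs; split => //; exact: interval_open.
  apply: has_dt_is_derive; have := is_derive_has_dt nLT h => D.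
  have Z := is_deriveZ e^-1 D; exact: Z.
under [X in _ + X - _ + _ = _]eq_bigr => i _ do rewrite rescaled_dx//.
under [X in _ + _ - _ * X + _ = _]eq_bigr => i _ do rewrite ddxV//.
rewrite dx_scale ?dzoom//; last exact: zoom_derivable.
exact: (scaling_algebra (fun i => zoom e (V i) t x)
  (fun i => zoom e (fun s => dx i (V j s)) t x)
  (fun i => zoom e (fun s => dx i (dx i (V j s))) t x)
  (zoom e (dt L (V j)) t x) (zoom e (fun s => dx j (Q s)) t x) (esym (exprVn e 2)) (esym (exprVn e 3))).
Qed.

Lemma rescaled_div t x : LT t -> divergence (fun j => rescaled_velocity e j t) x = 0.
Proof.
move=> Lt; rewrite /divergence; under eq_bigr => i _ do rewrite rescaled_dx//.
rewrite -!mulr_sumr.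
have -> : \sum_i zoom e (fun s => dx i (V i s)) t x = 0 by exact: (divV _ (LTL Lt)).
by rewrite !mulr0.
Qed.

Variables (v g : 'I_3 -> R -> E -> R) (q : R -> E -> R) (b : R).
Hypotheses (sv : forall j, smooth_on J (v j)) (sq : smooth_on J q).
Hypotheses (eqv : forall j t x, J t -> momentum nu J v q j t x = g j t x)
  (divv : forall t x, J t -> divergence (fun j => v j t) x = 0).
Hypotheses (eb : 3 / 2 * e ^+ 2 <= b) (vvt : forall j t x, `|t - T| <= b -> v j t x = vt j t x).

Definition glued_velocity j t x : R := v j t x - corrector e j t x + rescaled_velocity e j t x.
Definition glued_pressure t x : R := q t x + rescaled_pressure e t x.

Let JLT t : J t -> LT t. Proof. by rewrite /= !in_itv /= => /andP[]. Qed.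
Let tJ : time_set J. Proof. exact: time_set_bo. Qed.

(** Block and corrected background have disjoint supports: where the rescaled
    block does not vanish, the corrector equals the background. This removes
    every interaction term from the equations. *)
Lemma glued_dichotomy t (x : E) : J t ->
  (forall j, \forall z \near x, rescaled_velocity e j t z = 0) \/
  (forall j, \forall z \near x, v j t z - corrector e j t z = 0).
Proof.
move=> Jt; have L' := LTL (JLT Jt).
have [h|h] := leP ((t - T) / e ^+ 2) (- (2 / 3)).
  left => j; apply: filterE => z; rewrite /rescaled_velocity /zoom.
  have [->|/(suppV L')[]] := eqVneq (V j ((t - T) / e ^+ 2) (e^-1 *: (z - y))) 0; first by rewrite mulr0.
  by rewrite ltNge h.
have ht : `|t - T| <= e ^+ 2.
  have e2 : 0 < e ^+ 2 by rewrite exprn_gt0.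
  have t0 : t - T < 0 by move: Jt; rewrite /= in_itv /= subr_lt0 => /andP[].
  rewrite ltr0_norm//; move: h; rewrite ltr_pdivlMr// => h.
  by move: h e2; set k := e ^+ 2; lra.
have [hx|hx] := pselect (forall i, `|x 0 i - y 0 i| < (r + 1) * e).
  right => j; have := corrector_eq j eI ht hx; apply: filterS => z ->.
  rewrite vvt ?subrr//; apply: (le_trans ht); apply: le_trans eb.
  by have := exprn_ge0 2 (ltW e0); set k := e ^+ 2; lra.
left => j; move: hx => /existsNP[i /negP]; rewrite -leNgt => hx.
have : ~ box y (r * e) x.
  by move=> /(_ i); apply/negP; rewrite -ltNge; apply: lt_le_trans hx; rewrite ltr_pM2r//; lra.
move/near_out_box; apply: filterS => z hz.
rewrite /rescaled_velocity /zoom.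
have [->|/(suppV L')[_ hb]] := eqVneq (V j ((t - T) / e ^+ 2) (e^-1 *: (z - y))) 0; first by rewrite mulr0.
case: hz => k; have := hb k; rewrite !mxE subr0 normrM normfV (gtr0_norm e0) mulrC.
by rewrite ler_pdivrMr.
Qed.

(** [at_] stands for the extended background, [c] for the corrector and [w]
    for the block; the last four hypotheses are the coincidence of the two
    backgrounds on the support of [c] and the absence of interactions. *)
Lemma glue_algebra (a c w at_ : 'I_3 -> R) (da dc dw dat dda ddc ddw : 'I_3 -> R) (ta tc tw qa qw ga gw : R) :
  ta + \sum_i a i * da i - nu * \sum_i dda i + qa = ga ->
  tw + \sum_i w i * dw i - nu * \sum_i ddw i + qw = gw ->
  \sum_i at_ i * dc i = \sum_i a i * dc i -> \sum_i c i * dat i = \sum_i c i * da i ->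
  \sum_i (a i - c i) * dw i = 0 -> \sum_i w i * (da i - dc i) = 0 ->
  (ta - tc + tw) + \sum_i (a i - c i + w i) * (da i - dc i + dw i)
    - nu * \sum_i (dda i - ddc i + ddw i) + (qa + qw) =
  ga + (gw - tc - \sum_i at_ i * dc i - \sum_i c i * dat i + \sum_i c i * dc i + nu * \sum_i ddc i).
Proof.
move=> <- <- -> -> h5 h6; apply: subr0_eq.
transitivity (\sum_i (a i - c i) * dw i + \sum_i w i * (da i - dc i)); last by rewrite h5 h6 addr0.
by rewrite !sum3; ring.
Qed.

Let sc j : smooth_on setT (corrector e j).
Proof. exact: osc_smooth (osc_corrector j) eI. Qed.

Let glued_derivs j i t x : J t -> dx i (glued_velocity j t) x =
  dx i (v j t) x - dx i (corrector e j t) x + dx i (rescaled_velocity e j t) x.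
Proof.
move=> Jt; have [_ D] := derD (derB (Cn_is_derive (sv j 1%N) x i Jt)
  (Cn_is_derive (sc j 1%N) x i (Logic.I : [set: R] t)))
  (Cn_is_derive (rescaled_velocity_smooth j 1%N) x i (JLT Jt)).
exact: D.
Qed.

Let glued_derivs2 j i t x : J t -> dx i (dx i (glued_velocity j t)) x =
  dx i (dx i (v j t)) x - dx i (dx i (corrector e j t)) x + dx i (dx i (rescaled_velocity e j t)) x.
Proof.
move=> Jt.
have -> : dx i (glued_velocity j t) = (fun x => dx i (v j t) x - dx i (corrector e j t) x
    + dx i (rescaled_velocity e j t) x) by apply/funext => z; exact: glued_derivs.
have [_ D] := derD (derB (Cn_is_derive (Cn_dx (sv j 2%N) i) x i Jt)
  (Cn_is_derive (Cn_dx (sc j 2%N) i) x i (Logic.I : [set: R] t)))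
  (Cn_is_derive (Cn_dx (rescaled_velocity_smooth j 2%N) i) x i (JLT Jt)).
exact: D.
Qed.

Lemma glued_momentum j t x : J t ->
  momentum nu J glued_velocity glued_pressure j t x = g j t x + force_diff e j t x.
Proof.
move=> Jt; have Lt := JLT Jt.
rewrite /momentum.
have -> : dt J (glued_velocity j) t x =
    dt J (v j) t x - dt setT (corrector e j) t x + dt LT (rescaled_velocity e j) t x.
  apply: has_dt_uniq => //.
  have d1 := @Cn_has_dt _ _ _ _ _ (sv j 1%N) t x Jt.
  have d2 : has_dt J (corrector e j) t x (dt setT (corrector e j) t x).
    by apply: (@has_dt_sub _ setT) => //; exact: (@Cn_has_dt _ _ _ _ _ (sc j 1%N) t x Logic.I).
  have d3 := @has_dt_sub _ LT J _ t x _ JLT (@Cn_has_dt _ _ _ _ _ (rescaled_velocity_smooth j 1%N) t x Lt).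
  exact: has_dtD (has_dtB d1 d2) d3.
have -> : dx j (glued_pressure t) x = dx j (q t) x + dx j (rescaled_pressure e t) x.
  have [_ D] := derD (Cn_is_derive (sq 1%N) x j Jt) (Cn_is_derive (rescaled_pressure_smooth 1%N) x j Lt).
  exact: D.
under [X in _ + X - _ + _ = _]eq_bigr => i _ do rewrite glued_derivs// /glued_velocity.
under [X in _ + _ - _ * X + _ = _]eq_bigr => i _ do rewrite glued_derivs2//.
have cz : (forall i z, v i t z = vt i t z) \/ (forall i, corrector e i t = fun _ => 0).
  have [h|h] := leP `|t - T| b; first by left => i z; exact: vvt.
  right => i; apply/funext => z; apply/eqP/negPn/negP => /(corrector_supp eI).
  by rewrite leNgt (le_lt_trans eb h).
apply: glue_algebra.
- exact: eqv.
- exact: rescaled_momentum.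
- apply: eq_bigr => i _; case: cz => h; first by rewrite h.
  by rewrite h dx_zero !mulr0.
- apply: eq_bigr => i _; case: cz => h; last by rewrite h !mul0r.
  by rewrite (_ : vt j t = v j t)//; apply/funext => z; rewrite h.
- rewrite big1// => i _; have [h|h] := glued_dichotomy x Jt.
    by rewrite (dx_near0 i (h j)) mulr0.
  by rewrite (nbhs_singleton (h i)) mul0r.
- rewrite big1// => i _; have [h|h] := glued_dichotomy x Jt.
    by rewrite (nbhs_singleton (h i)) mul0r.
  have := dx_near0 i (h j).
  have [_ D] := derB (Cn_is_derive (sv j 1%N) x i Jt) (Cn_is_derive (sc j 1%N) x i (Logic.I : [set: R] t)).
  by rewrite [dx i _ x]D => ->; rewrite mulr0.
Qed.

Lemma glued_div t x : J t -> divergence (fun j => glued_velocity j t) x = 0.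
Proof.
move=> Jt; rewrite /divergence; under eq_bigr => i _ do rewrite glued_derivs//.
rewrite big_split sumrB /= -/(divergence (fun j => v j t) x) divv//.
rewrite -/(divergence (fun j => corrector e j t) x) corrector_div//.
by rewrite -/(divergence (fun j => rescaled_velocity e j t) x) (rescaled_div x (JLT Jt)) subrr addr0.
Qed.

End fixed_scale.
End Corrector.

(** * Periodization *)

Section Periodization.
Context {R : realType}.
Local Notation E := 'rV[R]_3.

Lemma joint_cont_subset (I J : set R) (f : R -> E -> R) : J `<=` I ->
  joint_cont I f -> joint_cont J f.
Proof.
move=> JI cf t x Jt A HA; have := cf t x (JI _ Jt) A HA => {}HA.
have {}HA : \forall w \near (t, x), (I `*` [set: E]) w -> A (f w.1 w.2) by [].
suff : \forall w \near (t, x), (J `*` [set: E]) w -> A (f w.1 w.2) by [].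
by move: HA; apply: filterS => -[s z] h [/= /JI Is _]; apply: h.
Qed.

Lemma Cn_subset n (I J : set R) (f : R -> E -> R) : J `<=` I -> time_set J ->
  Cn I n f -> Cn J n f.
Proof.
move=> JI tJ; elim: n f => [|n IHn] f fn.
  by apply/Cn0P; exact: joint_cont_subset (Cn_cont fn).
apply: (@CnS _ _ n J f (dt I f) (fun i t => dx i (f t))) => //.
- exact: joint_cont_subset (Cn_cont fn).
- by move=> t x Jt; apply: (@has_dt_sub _ I) => //; exact: (@Cn_has_dt _ _ _ _ _ fn t x (JI _ Jt)).
- by move=> t x i Jt; exact: (Cn_is_derive fn x i (JI _ Jt)).
- exact: IHn (Cn_dt fn).
- by move=> i; exact: IHn (Cn_dx fn i).
Qed.

Lemma near_space (t : R) (x : E) (P : set E) : (\forall z \near x, P z) ->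
  \forall z \near (t, x), P z.2.
Proof.
move=> nP; have c : z.2 @[z --> (t, x)] --> x by exact: cvg_snd.
exact: c nP.
Qed.

Definition translate (m : 'rV[int]_3) (x : E) : E := x - int_vec m.

Lemma frac_add (x : E) (k : 'rV[int]_3) : frac (x + int_vec k) = frac x.
Proof.
by apply/rowP => j; rewrite !mxE floorDrz ?intr_int// intrKfloor intrD; ring.
Qed.

Definition periodize (V : Type) (f : E -> V) (x : E) : V := f (frac x).

Lemma periodize_periodic (V : Type) (f : E -> V) : periodic (periodize f).
Proof. by move=> x k; rewrite /periodize frac_add. Qed.

Lemma near_coord (x : E) i (e : R) : 0 < e -> \forall z \near x, `|(z : E) 0 i - x 0 i| < e.
Proof.
move=> e0; have : continuous (fun w : E => `|w 0 i - x 0 i|).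
  move=> w; apply: (@continuous_comp _ _ _ (fun w : E => w 0 i - x 0 i) (fun r => `|r|)).
    by apply: contB; [exact: coord_continuous|exact: contC].
  exact: norm_continuous.
by move/(_ x)/cvgr_lt; apply; rewrite subrr normr0.
Qed.

Lemma int_between (a b : int) (k c : R) : k <= c - a%:~R <= 1 - k -> `|c - b%:~R| < k -> False.
Proof.
move=> /andP[h1 h2]; rewrite ltr_norml => /andP[h3 h4].
have : (0 : R) < (b - a)%:~R by rewrite intrB; lra.
have : (b - a)%:~R < (1 : R) by rewrite intrB; lra.
rewrite -[1]/(1%:~R) -[0]/(0%:~R) !ltr_int; lia.
Qed.

(** If [f] differs from a periodic function only well inside the cell, its
    periodization is locally a translate of [f]; so it inherits every local
    property of [f]. *)
Lemma periodize_local (I : set R) (f h : R -> E -> R) (k : R) x : 0 < k ->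
  (forall t, I t -> periodic (h t)) ->
  (forall t z, I t -> f t z != h t z -> forall i, k <= z 0 i <= 1 - k) ->
  \forall z \near x, forall t, I t -> periodize (f t) z = f t (translate (floorv x) z).
Proof.
move=> k0 ph fh.
have [[i xi]|nx] := pselect (exists i, frac x 0 i = 0).
  have := near_coord x i k0; apply: filterS => z hz t It.
  have xE : x 0 i = (floorv x 0 i)%:~R by move: xi; rewrite !mxE => /eqP; rewrite subr_eq0 => /eqP.
  have out m : ~ (k <= z 0 i - m%:~R <= 1 - k).
    by move=> h1; apply: (@int_between m (floorv x 0 i) k (z 0 i)) => //; rewrite -xE.
  have eqh m : f t (translate m z) = h t (translate m z).
    apply/eqP/negPn/negP => /(fh t _ It)/(_ i); rewrite !mxE; exact: out.
  have ht m : h t (translate m z) = h t z.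
    rewrite -[in RHS](subrK (int_vec m) z); apply/esym; exact: (ph t It).
  have -> : periodize (f t) z = f t (translate (floorv z) z).
    by rewrite /periodize; congr (f t _); apply/rowP => j; rewrite !mxE.
  by rewrite !eqh !ht.
have H j : \forall z \near x, Num.floor ((z : E) 0 j) = Num.floor (x 0 j).
  have fj : 0 < frac x 0 j < 1.
    have /andP[a b] := frac_itv x j; rewrite b andbT lt_neqAle a andbT eq_sym.
    by apply/eqP => hj; apply: nx; exists j.
  pose d := Num.min (frac x 0 j) (1 - frac x 0 j).
  have d0 : 0 < d by rewrite lt_min subr_gt0.
  have := near_coord x j d0; apply: filterS => z; rewrite ltr_norml => /andP[h1 h2].
  have [m1 m2] : d <= frac x 0 j /\ d <= 1 - frac x 0 j by rewrite /d !ge_min !lexx orbT.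
  apply: floor_def; move: h1 h2 m1 m2 d0; rewrite !mxE intrD.
  by move=> *; apply/andP; split; lra.
apply: filterS3 (H ord0) (H (lift ord0 ord0)) (H (lift ord0 (lift ord0 ord0))) => z h0 h1 h2 t _.
rewrite /periodize; congr (f t _); apply/rowP; apply: ord3P; by rewrite !mxE ?h0 ?h1 ?h2.
Qed.

Lemma translateE m : translate m = coord_affine (- int_vec m) (const_mx 1).
Proof. by apply/funext => x; apply/rowP => j; rewrite !mxE mul1r addrC. Qed.

Lemma Cn_translate n (I : set R) (f : R -> E -> R) m : time_set I -> Cn I n f ->
  Cn I n (fun t x => f t (translate m x)).
Proof.
move=> tI fn; rewrite translateE.
have := @Cn_affine R n I I f (- int_vec m) (const_mx 1) 1 0 (oner_neq0 _) tI.
move=> /(_ _ fn) H; apply: Cn_ext (H _) => [t x _|s Is]; by rewrite mul1r addr0.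
Qed.

Lemma dx_translate i (f : E -> R) m x : dx i (fun x => f (translate m x)) x = dx i f (translate m x).
Proof.
rewrite /dx /derive /translate /shift /=.
by under eq_fun do rewrite -addrA.
Qed.

Section periodize.
Variables (I : set R) (k : R).
Hypotheses (tI : time_set I) (k0 : 0 < k).
Definition near_periodic (f : R -> E -> R) := exists h : R -> E -> R,
  (forall t, I t -> periodic (h t)) /\
  (forall t z, I t -> f t z != h t z -> forall i, k <= z 0 i <= 1 - k).

Definition periodizet (f : R -> E -> R) (t : R) : E -> R := periodize (f t).

Lemma Cn_periodize n f : near_periodic f -> Cn I n f -> Cn I n (periodizet f).
Proof.
move=> [h [ph fh]] fn; apply: Cn_local => t x It.
exists I, (fun t z => f t (translate (floorv x) z)); split.
- exact: Cn_translate.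
- exact: filterE.
- have := near_space t (periodize_local x k0 ph fh); apply: filterS => -[s z] /= H Is.
  exact: H.
Qed.

Lemma dx_periodize i f t x : near_periodic f -> I t ->
  dx i (periodizet f t) x = dx i (f t) (translate (floorv x) x).
Proof.
move=> [h [ph fh]] It; rewrite -dx_translate; apply: dx_local.
by have := periodize_local x k0 ph fh; apply: filterS => z; apply.
Qed.

(** Away from the set where [f] and [h] differ their derivatives coincide,
    which keeps the margin [k]. *)
Lemma near_periodic_dx i f : near_periodic f -> near_periodic (fun t => dx i (f t)).
Proof.
move=> [h [ph fh]]; exists (fun t => dx i (h t)); split.
  by move=> t It; apply: dx_periodic; exact: ph.
move=> t z It ne j; rewrite leNgt; apply/andP; split; apply/negP.
  move=> zk; move/eqP: ne; apply; apply: dx_local.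
  have /(near_coord z j) : 0 < k - z 0 j by rewrite subr_gt0.
  apply: filterS => w hw; apply/eqP/negPn/negP => /(fh t w It)/(_ j)/andP[].
  by move: hw; rewrite ltr_norml => /andP[_ hw] hk; lra.
move=> /negP; rewrite -ltNge => zk; move/eqP: ne; apply; apply: dx_local.
have /(near_coord z j) : 0 < z 0 j - (1 - k) by rewrite subr_gt0.
apply: filterS => w hw; apply/eqP/negPn/negP => /(fh t w It)/(_ j)/andP[].
by move: hw; rewrite ltr_norml => /andP[hw _] _ hk; lra.
Qed.

Lemma ddx_periodize i f t x : near_periodic f -> I t ->
  dx i (dx i (periodizet f t)) x = dx i (dx i (f t)) (translate (floorv x) x).
Proof.
move=> nf It; rewrite -(dx_periodize i x (near_periodic_dx i nf) It); congr (dx i _ x).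
apply/funext => z; rewrite dx_periodize// /periodizet /periodize; congr (dx i (f t) _).
by apply/rowP => j; rewrite !mxE.
Qed.

Lemma translate_floorv x : translate (floorv x) x = frac x.
Proof. by apply/rowP => j; rewrite !mxE. Qed.

Lemma dt_periodize f t x : near_periodic f -> I t ->
  dt I (periodizet f) t x = dt I f t (frac x).
Proof.
move=> [h [ph fh]] It; rewrite -translate_floorv.
have e : forall s, I s -> periodizet f s x = f s (frac x) by [].
by rewrite /dt /tquot translate_floorv.
Qed.

Lemma periodize_momentum nu (u : 'I_3 -> R -> E -> R) p j t x :
  (forall i, near_periodic (u i)) -> near_periodic p -> I t ->
  momentum nu I (fun i => periodizet (u i)) (periodizet p) j t x = momentum nu I u p j t (frac x).
Proof.
move=> nu_ np It; rewrite /momentum dt_periodize// dx_periodize// -translate_floorv.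
have e1 : \sum_i periodizet (u i) t x * dx i (periodizet (u j) t) x =
    \sum_i u i t (translate (floorv x) x) * dx i (u j t) (translate (floorv x) x).
  by apply: eq_bigr => i _; rewrite dx_periodize// /periodizet /periodize translate_floorv.
have e2 : \sum_i dx i (dx i (periodizet (u j) t)) x =
    \sum_i dx i (dx i (u j t)) (translate (floorv x) x).
  by apply: eq_bigr => i _; rewrite ddx_periodize.
exact: (congr2 (fun a b => _ + a - nu * b + _) e1 e2).
Qed.

Lemma periodize_div (u : 'I_3 -> R -> E -> R) t x : (forall i, near_periodic (u i)) -> I t ->
  divergence (fun j => periodizet (u j) t) x = divergence (fun j => u j t) (frac x).
Proof.
move=> nu_ It; rewrite /divergence -translate_floorv; apply: eq_bigr => i _.
by rewrite dx_periodize.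
Qed.

End periodize.
End Periodization.

(** * Euclidean norms and mixed norms of localized fields *)

Section EuclideanNorm.
Context {R : realType}.
Local Notation E := 'rV[R]_3.

Definition l2 (I : finType) (a : I -> R) : R := Num.sqrt (\sum_i a i ^+ 2).

Section l2.
Variable I : finType.
Implicit Types a b : I -> R.

Lemma l2_ge0 a : 0 <= l2 a. Proof. exact: sqrtr_ge0. Qed.

Lemma sum_sq_ge0 a : 0 <= \sum_i a i ^+ 2.
Proof. by apply: sumr_ge0 => i _; exact: sqr_ge0. Qed.

Lemma l2_sq a : l2 a ^+ 2 = \sum_i a i ^+ 2.
Proof. by rewrite sqr_sqrtr // sum_sq_ge0. Qed.

Lemma l2_scale (k : R) a : 0 <= k -> l2 (fun i => k * a i) = k * l2 a.
Proof.
move=> k0; rewrite /l2; under eq_bigr do rewrite exprMn.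
by rewrite -mulr_sumr sqrtrM ?sqr_ge0// sqrtr_sqr ger0_norm.
Qed.

Lemma cauchy_schwarz a b : \sum_i a i * b i <= l2 a * l2 b.
Proof.
have key : (\sum_i a i * b i) ^+ 2 <= (\sum_i a i ^+ 2) * (\sum_i b i ^+ 2).
  rewrite -subr_ge0 -(@pmulr_rge0 _ 2)//.
  suff -> : 2 * ((\sum_i a i ^+ 2) * (\sum_i b i ^+ 2) - (\sum_i a i * b i) ^+ 2) =
     \sum_i \sum_j (a i * b j - a j * b i) ^+ 2.
    by apply: sumr_ge0 => i _; apply: sumr_ge0 => j _; exact: sqr_ge0.
  transitivity (\sum_i \sum_j ((a i ^+ 2 * b j ^+ 2 + b i ^+ 2 * a j ^+ 2) -
      2 * ((a i * b i) * (a j * b j)))); last first.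
    by apply: eq_bigr => i _; apply: eq_bigr => j _; ring.
  under [RHS]eq_bigr => i _ do rewrite sumrB big_split/= -!mulr_sumr.
  by rewrite sumrB big_split/= -mulr_sumr -!mulr_suml; ring.
rewrite (le_trans (ler_norm _))// -(@ler_pXn2r _ 2)// ?nnegrE ?mulr_ge0 ?l2_ge0//.
by rewrite real_normK ?num_real// exprMn !l2_sq.
Qed.

Lemma l2D a b : l2 (fun i => a i + b i) <= l2 a + l2 b.
Proof.
rewrite -(@ler_pXn2r _ 2)// ?nnegrE ?addr_ge0 ?l2_ge0// l2_sq.
under eq_bigr do rewrite sqrrD.
rewrite !big_split/= sqrrD !l2_sq lerD2r lerD2l mulr2n.
by rewrite lerD // cauchy_schwarz.
Qed.

Lemma l2_le (B : R) a : 0 <= B -> (forall i, `|a i| <= B) -> l2 a <= #|I|%:R * B.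
Proof.
move=> B0 h; rewrite -(@ler_pXn2r _ 2)// ?nnegrE ?l2_ge0 ?mulr_ge0// l2_sq exprMn.
apply: (@le_trans _ _ (\sum_(i : I) B ^+ 2)).
  apply: ler_sum => i _; rewrite -real_normK ?num_real//.
  by rewrite ler_pXn2r ?nnegrE.
rewrite sumr_const -[leLHS]mulr_natl; apply: ler_wpM2r; first exact: sqr_ge0.
by rewrite -natrX ler_nat; case: #|I| => // n; rewrite -mulnn leq_pmulr.
Qed.

Lemma l2_0 a : (forall i, a i = 0) -> l2 a = 0.
Proof. by move=> h; rewrite /l2 big1 ?sqrtr0// => i _; rewrite h expr0n. Qed.

Lemma l2_mono a b : (forall i, `|a i| <= `|b i|) -> l2 a <= l2 b.
Proof.
move=> h; rewrite ler_sqrt ?sum_sq_ge0//; apply: ler_sum => i _.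
by rewrite -real_normK ?num_real// -[leRHS]real_normK ?num_real// ler_pXn2r ?nnegrE.
Qed.

End l2.

Lemma enormE (x : E) : enorm x = l2 (fun j => x 0 j).
Proof. by rewrite /enorm /dot /l2; congr Num.sqrt; apply: eq_bigr => j _; rewrite expr2. Qed.

Definition jac (u : 'I_3 -> E -> R) (x : E) : R :=
  l2 (fun ij : 'I_3 * 'I_3 => dx ij.1 (u ij.2) x).

Lemma grad_normE (z : E -> E) x : (forall i, derivable z x (basis_vec i)) ->
  grad_norm z x = jac (fun j x => z x 0 j) x.
Proof.
move=> dz; rewrite /grad_norm /jac /l2; congr Num.sqrt.
rewrite -(pair_bigA _ (fun i j => dx i (fun x => z x 0 j) x ^+ 2)) /=.
apply: eq_bigr => i _; rewrite enormE l2_sq; apply: eq_bigr => j _.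
by rewrite dx_entry.
Qed.

Lemma measurable_l2 d (T : measurableType d) (I : finType) (D : set T) (f : I -> T -> R) :
  measurable D -> (forall i, measurable_fun D (f i)) ->
  measurable_fun D (fun x => l2 (fun i => f i x)).
Proof.
move=> mD mf; apply: (@measurableT_comp _ _ _ _ _ _ (@Num.sqrt R) _ (fun x => \sum_i f i x ^+ 2)).
  by apply: continuous_measurable_fun; exact: sqrt_continuous.
by apply: measurable_sum => i; exact: measurable_funX.
Qed.

Lemma continuous_l2 (I : finType) (f : I -> E -> R) : (forall i, continuous (f i)) ->
  continuous (fun x => l2 (fun i => f i x)).
Proof.
move=> cf x; apply: (@continuous_comp _ _ _ (fun x => \sum_i f i x ^+ 2) (fun r => Num.sqrt r)).
  have cs (s : seq I) : continuous (fun x => \sum_(i <- s) f i x ^+ 2).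
    elim: s => [|i s IHs].
      by under eq_fun do rewrite big_nil; exact: contC.
    under eq_fun do rewrite big_cons expr2.
    by apply: contD IHs; exact: contM.
  exact: cs.
exact: sqrt_continuous.
Qed.

End EuclideanNorm.

Section L2Norms.
Context {R : realType}.
Local Notation E := 'rV[R]_3.
Local Notation leb := (@lebesgue_measure R).
Local Notation leb3 := (@leb3 R).
Local Notation leb2 := (sigma_product leb leb).
Local Open Scope ereal_scope.

(** Norms scale by the square root of the factor by which integrals scale. *)
Lemma Lnorm2_scale d (T : measurableType d) (m : {measure set T -> \bar R}) phi k
    (h : T -> R) (c : R) : scales m phi k -> measurable_fun setT h -> (0 <= c)%R ->
  'N[m]_2%:E[(fun x => (c * h (phi x))%:E)] = (c * Num.sqrt k)%:E * 'N[m]_2%:E[EFin \o h].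
Proof.
move=> [mphi k0 sc] mh c0; rewrite unlock.
have mh2 : measurable_fun setT (fun x => (`|h x| `^ 2)%:E).
  apply/measurable_EFinP; apply: (@measurableT_comp _ _ _ _ _ _ (fun r : R => r `^ 2)%R).
    exact: measurable_powR.
  exact: measurableT_comp.
have i0 : 0 <= \int[m]_x (`|h x| `^ 2)%:E by apply: integral_ge0 => x _; rewrite lee_fin powR_ge0.
under eq_integral => x _.
  rewrite /= normrM powRM// (ger0_norm c0) EFinM; over.
rewrite ge0_integralZl//; last 2 first.
- exact: (measurableT_comp mh2 mphi).
- by rewrite lee_fin powR_ge0.
rewrite (sc (fun x => (`|h x| `^ 2)%:E))//.
rewrite !poweRM ?mule_ge0 ?lee_fin ?powR_ge0// muleA; congr (_ * _).
rewrite !poweR_EFin -EFinM; congr EFin.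
by rewrite -powRrM mulfV ?powRr1// powR12_sqrt.
Qed.

(** Tonelli's theorem applied to the square. *)
Lemma Lnorm2_iterated d1 d2 (T1 : measurableType d1) (T2 : measurableType d2)
  (m1 : {sigma_finite_measure set T1 -> \bar R})
  (m2 : {sigma_finite_measure set T2 -> \bar R}) (f : T1 * T2 -> R) : measurable_fun setT f ->
  'N[m2]_2%:E[(fun y => 'N[m1]_2%:E[(fun x => (f (x, y))%:E)])] = 'N[m1 \x m2]_2%:E[EFin \o f] /\
  measurable_fun setT (fun y => 'N[m1]_2%:E[(fun x => (f (x, y))%:E)]).
Proof.
move=> mf; rewrite unlock.
have mf2 : measurable_fun setT (fun z => (`|f z| `^ 2)%:E).
  apply/measurable_EFinP; apply: (@measurableT_comp _ _ _ _ _ _ (fun r : R => r `^ 2)%R).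
    exact: measurable_powR.
  exact: measurableT_comp.
have p0 z : 0 <= (`|f z| `^ 2)%:E by rewrite lee_fin powR_ge0.
have mG := @measurable_fun_fubini_tonelli_G _ _ _ _ _ m1 _ mf2 p0.
split.
  congr (_ `^ _); rewrite /= (@fubini_tonelli2 _ _ _ _ _ m1 m2 _ mf2 p0).
  apply: eq_integral => y _; rewrite /fubini_G gee0_abs ?poweR_ge0//.
  by rewrite -poweRrM mulVf// poweRe1// integral_ge0.
by apply: (measurableT_comp (measurable_poweR _)).
Qed.

Definition box3 (y : E) (s : R) : set (R * R * R) := [set x | box y s (vec3 x)].

Definition ball_itv (a s : R) : set R := [set t | (`|t - a| <= s)%R].

Lemma ball_itvE (a s : R) : ball_itv a s = [set` `[(a - s)%R, (a + s)%R]].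
Proof. by apply/seteqP; split=> t; rewrite /ball_itv /= in_itv /= ler_distl. Qed.

Lemma measurable_ball_itv a s : measurable (ball_itv a s).
Proof. by rewrite ball_itvE; exact: measurable_itv. Qed.

Lemma leb_ball_itv (a s : R) : (0 < s)%R -> leb (ball_itv a s) = (2 * s)%:E.
Proof.
move=> s0; rewrite ball_itvE lebesgue_measure_itv /= lte_fin ltrBlDr -addrA ltrDl addr_gt0//.
by rewrite -EFinB; congr EFin; ring.
Qed.

Lemma box3E y s : box3 y s = (ball_itv (y 0%R ord0) s `*` ball_itv (y 0%R (lift ord0 ord0)) s)
  `*` ball_itv (y 0%R (lift ord0 (lift ord0 ord0))) s.
Proof.
apply/seteqP; split => [x h|x [[h0 h1] h2]].
  have := h ord0; have := h (lift ord0 ord0); have := h (lift ord0 (lift ord0 ord0)).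
  by rewrite vec3_0 vec3_1 vec3_2.
by apply: ord3P; rewrite ?vec3_0 ?vec3_1 ?vec3_2.
Qed.

Lemma measurable_box3 y s : measurable (box3 y s).
Proof.
by rewrite box3E; apply: measurableX; [apply: measurableX|]; exact: measurable_ball_itv.
Qed.

Lemma leb3_box3 y s : (0 < s)%R -> leb3 (box3 y s) = ((2 * s) ^+ 3)%:E.
Proof.
move=> s0; rewrite box3E leb3_prod; try exact: measurable_ball_itv.
by rewrite !leb_ball_itv// -!EFinM; congr EFin; ring.
Qed.

Lemma Lp_box_bound (p : \bar R) (y : E) (s B : R) (h : E -> R) : 1 <= p -> (0 < s)%R -> (0 <= B)%R ->
  (forall x, (`|h x| <= B)%R) -> (forall x, h x != 0%R -> box y s x) ->
  'N[leb3]_p[(fun x => (h (vec3 x))%:E)] <= (B * ((2 * s) ^+ 3) `^ fine p^-1)%:E.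
Proof.
move=> p1 s0 B0 hB hs; apply: (@Lnorm_box_bound _ _ _ leb3 p _ (box3 y s) B ((2 * s) ^+ 3)%R) => //.
- exact: measurable_box3.
- exact: leb3_box3.
- by rewrite exprn_gt0// mulr_gt0.
- by move=> x _; rewrite lee_fin.
- by move=> x nx; congr EFin; apply/eqP/negPn/negP => /hs.
Qed.

Lemma Lp_cell_bound (p : \bar R) (y : E) (h : E -> R) (s B : R) : 1 <= p -> (0 < s)%R -> (0 <= B)%R ->
  (forall x, cell x -> (`|h (vec3 x)| <= B)%R) ->
  (forall x, cell x -> h (vec3 x) != 0%R -> box y s (vec3 x)) ->
  Lp_on cell p h <= (B * ((2 * s) ^+ 3) `^ fine p^-1)%:E.
Proof.
move=> p1 s0 B0 hB hs.
apply: (@Lnorm_box_bound _ _ R leb3 p _ (box3 y s) B ((2 * s) ^+ 3)%R) => //.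
- exact: measurable_box3.
- exact: leb3_box3.
- by rewrite exprn_gt0// mulr_gt0.
- move=> x _; rewrite /patch; case: ifPn => [/set_mem cx|_]; last by rewrite abse0 lee_fin.
  by rewrite lee_fin hB.
- move=> x nx; rewrite /patch; case: ifPn => [/set_mem cx|//].
  by congr EFin; apply/eqP/negPn/negP => /(hs x cx).
Qed.

Lemma Lq_box_bound (q : \bar R) (t0 s B : R) (h : R -> \bar R) : 1 <= q -> (0 < s)%R -> (0 <= B)%R ->
  (forall t, `|h t| <= B%:E) -> (forall t, h t != 0 -> (`|t - t0| <= s)%R) ->
  'N[leb]_q[h] <= (B * (2 * s) `^ fine q^-1)%:E.
Proof.
move=> q1 s0 B0 hB hs; apply: (@Lnorm_box_bound _ _ _ leb q _ (ball_itv t0 s) B (2 * s)%R) => //.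
- exact: measurable_ball_itv.
- exact: leb_ball_itv.
- by rewrite mulr_gt0.
- by move=> t nt; apply/eqP/negPn/negP => /hs.
Qed.

End L2Norms.

(** * Energy of the perturbation *)

Section BlockNorms.
Context {R : realType}.
Local Notation E := 'rV[R]_3.
Local Notation leb := (@lebesgue_measure R).
Local Notation leb3 := (@leb3 R).
Local Notation leb2 := (sigma_product leb leb).
Local Notation leb3s := (sigma_product leb2 leb).
Local Notation L := (`]-oo, 0[%classic : set R).
Variables (T : R) (y : E) (r : R).
Variables (th : R -> R) (U : R -> E -> E) (V : 'I_3 -> R -> E -> R).
Hypotheses (th_ge0 : forall s, 0 <= th s) (th_le1 : forall s, th s <= 1)
  (th0 : forall s, s <= - (2 / 3) -> th s = 0).
Hypotheses (VE : forall j s x, V j s x = th s * U (s + 1) x 0 j)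
  (sU : smooth_on (`[0, 1[ : set R) U) (sV : forall j, smooth_on L (V j)).
Hypothesis suppV : forall j s x, L s -> V j s x != 0 -> - (2 / 3) < s /\ box 0 r x.

Definition zoom_point (e : R) (x : R * R * R) : R * R * R :=
  (e^-1 * x.1.1 + (- (e^-1 *: y)) 0 ord0, e^-1 * x.1.2 + (- (e^-1 *: y)) 0 (lift ord0 ord0),
   e^-1 * x.2 + (- (e^-1 *: y)) 0 (lift ord0 (lift ord0 ord0))).

Lemma vec3_zoom_point e x : vec3 (zoom_point e x) = e^-1 *: (vec3 x - y).
Proof.
by apply/rowP; apply: ord3P; rewrite [RHS]mxE [(vec3 x - y) _ _]mxE !(vec3_0, vec3_1, vec3_2) /= !mxE; ring.
Qed.

Lemma scales_zoom_point e : 0 < e -> scales leb3 (zoom_point e) (e ^+ 3).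
Proof.
move=> e0; have ei : 0 < e^-1 by rewrite invr_gt0.
by have := scales_leb3 (- (e^-1 *: y)) ei; rewrite exprVn invrK.
Qed.

Lemma sqrt_cube (e : R) : 0 < e -> e^-1 * Num.sqrt (e ^+ 3) = e `^ (1 / 2).
Proof.
move=> e0; rewrite exprSr sqrtrM ?sqr_ge0// sqrtr_sqr gtr0_norm// mulrA mulVf ?gt_eqF// !mul1r.
by rewrite (powR12_sqrt (ltW e0)).
Qed.

Let LP s : L s <-> s < 0. Proof. by rewrite /= in_itv. Qed.

Lemma continuous_component j s : L s -> continuous (V j s).
Proof. by move=> Ls; exact: slice_cont Ls (Cn_cont (sV j 0%N)). Qed.

(** The amplitude contributes [e^-1] and the volume [e ^+ 3] under the square
    root. *)
Lemma velocity_L2 e t : 0 < e -> t < T ->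
  ('N[leb3]_2%:E[(fun x => (l2 (fun j => rescaled_velocity T y V e j t (vec3 x)))%:E)] =
   (e `^ (1 / 2))%:E * 'N[leb3]_2%:E[(fun x => (l2 (fun j => V j ((t - T) / e ^+ 2) (vec3 x)))%:E)])%E.
Proof.
move=> e0 tT; have Ls : L ((t - T) / e ^+ 2).
  by apply/LP; rewrite pmulr_llt0 ?invr_gt0 ?exprn_gt0// subr_lt0.
pose h (x : R * R * R) := l2 (fun j => V j ((t - T) / e ^+ 2) (vec3 x)).
have mh : measurable_fun setT h.
  apply: (continuous_measurable3 (h := fun x => l2 (fun j => V j ((t - T) / e ^+ 2) x))).
  by apply: continuous_l2 => j; exact: continuous_component.
have ei : 0 <= e^-1 by rewrite invr_ge0 ltW.
rewrite -(sqrt_cube e0) -[RHS](Lnorm2_scale (scales_zoom_point e0) mh ei).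
apply: eq_Lnorm => x; rewrite /h vec3_zoom_point -l2_scale//.
Qed.

Lemma supL2_ge0 : (0 <= supL2 U)%E.
Proof.
apply: (@le_trans _ _ (Lp_R3 2%:E (U 0))); first exact: Lnorm_ge0.
apply: ereal_sup_ubound; exists 0 => //.
by rewrite /= in_itv /= lexx ltr01.
Qed.

(** The ramp only decreases the norm, and while it is nonzero the block is a
    time slice of [U]. *)
Lemma slice_le_supL2 s : L s ->
  ('N[leb3]_2%:E[(fun x => (l2 (fun j => V j s (vec3 x)))%:E)] <= supL2 U)%E.
Proof.
move=> /LP s0.
have [z|nz] := eqVneq (th s) 0.
  rewrite (_ : (fun x => _) = cst 0%E) ?Lnorm0 ?supL2_ge0//; last first.
    by apply/funext => x; rewrite l2_0// => j; rewrite VE z mul0r.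
have h : - (2 / 3) < s by rewrite ltNge; apply/negP => /th0 h; rewrite h eqxx in nz.
apply: (@le_trans _ _ (Lp_R3 2%:E (U (s + 1)))).
  apply: le_Lnorm; first by rewrite lee_fin ler1n.
  move=> x; rewrite /patch mem_set// !gee0_abs ?lee_fin ?sqrtr_ge0//.
  rewrite enormE; apply: l2_mono => j; rewrite VE normrM ger0_norm//.
  by rewrite ler_piMl.
apply: ereal_sup_ubound; exists (s + 1) => //.
by rewrite /= in_itv /=; apply/andP; split; lra.
Qed.

(** Extended by 0 to times [s >= 0], so that it is measurable on the whole
    space-time and can be rescaled there. *)
Definition block_jac (z : (R * R * R) * R) : R :=
  ((fun z : (R * R * R) * R => jac (fun j => V j z.2) (vec3 z.1)) \_ (setT `*` L)) z.

Lemma block_jacE x s : s < 0 -> block_jac (x, s) = jac (fun j => V j s) (vec3 x).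
Proof. by move=> s0; rewrite /block_jac /patch mem_set//; split => //=; apply/LP. Qed.

Lemma block_jac0 x s : 0 <= s -> block_jac (x, s) = 0.
Proof.
move=> s0; rewrite /block_jac /patch memNset//= => -[_ /LP].
by rewrite ltNge s0.
Qed.

Lemma block_jac_ge0 z : 0 <= block_jac z.
Proof. by rewrite /block_jac /patch; case: ifP => // _; exact: l2_ge0. Qed.

Lemma measurable_block_jac : measurable_fun setT block_jac.
Proof.
have mL : measurable L by exact: measurable_itv.
have mD : measurable ([set: R * R * R] `*` L) by exact: measurableX.
apply: (iffLR (measurable_restrictT (fun z : (R * R * R) * R => jac (fun j => V j z.2) (vec3 z.1)) mD)).
rewrite /jac; apply: measurable_l2 => // -[i j] /=.
apply: (@joint_cont_measurable R L (fun s => dx i (V j s))) => //.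
- by move=> a b /LP a0 ba; apply/LP; exact: le_lt_trans ba a0.
- exact: Cn_cont (Cn_dx (sV j 1%N) i).
Qed.

Lemma scales_id d (X : measurableType d) (m : {measure set X -> \bar R}) : scales m id 1.
Proof. by split => // f mf f0; rewrite mul1e. Qed.

Lemma V_dx s : s < 0 -> - (2 / 3) < s -> forall i j x,
  dx i (V j s) x = th s * dx i (fun x => U (s + 1) x 0 j) x.
Proof.
move=> s0 h i j x; rewrite -dx_scale; last first.
  have Is : (`[0, 1[%classic : set R) (s + 1) by rewrite /= in_itv /=; apply/andP; split; lra.
  by have [] := Cn_is_derive (Cn_entry j (@time_set_bo R 0 1) (sU 1%N)) x i Is.
by congr (dx i _ x); apply/funext => z; rewrite VE.
Qed.

(** A shift of time by 1 sends the lifetime of the block to that of [U]; the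
    ramp only decreases the norm. *)
Lemma block_gradL2 : ('N[leb3 \x leb]_2%:E[EFin \o block_jac] <= gradL2 U)%E.
Proof.
have sc := @scales_prod R _ _ _ _ leb3s leb _ _ _ _ (scales_id leb3s) (scales_leb (-1) ltr01).
have := Lnorm2_scale sc measurable_block_jac ler01.
rewrite invr1 !mul1r sqrtr1 mul1e => <-.
apply: le_Lnorm; first by rewrite lee_fin ler1n.
move=> [x t]; rewrite /= !mul1r (ger0_norm (block_jac_ge0 _)).
have [t1|t1] := leP 1 t.
  by rewrite block_jac0 ?subr_ge0// abse_ge0.
have s0 : t - 1 < 0 by rewrite subr_lt0.
rewrite block_jacE//.
have [h|h] := leP (t - 1) (- (2 / 3)).
  rewrite (_ : jac _ _ = 0) ?abse_ge0//.
  apply: l2_0 => -[i j] /=.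
  have -> : V j (t - 1) = (fun _ => 0) by apply/funext => z; rewrite VE th0// mul0r.
  exact: dx_zero.
rewrite /patch mem_set; last by split => //=; rewrite in_itv /=; apply/andP; split; lra.
have It : (`[0, 1[%classic : set R) t by rewrite /= in_itv /=; apply/andP; split; lra.
rewrite gee0_abs ?lee_fin ?sqrtr_ge0// grad_normE; last first.
  by move=> i; have [] := Cn_is_derive (sU 1%N) (vec3 x) i It.
apply: l2_mono => -[i j] /=; rewrite V_dx// subrK normrM ger0_norm//.
by rewrite ler_piMl.
Qed.

Definition zoomed_jac (e : R) (z : (R * R * R) * R) : R :=
  e^-1 * e^-1 * block_jac (zoom_point e z.1, (z.2 - T) / e ^+ 2).

(** Two factors [e^-1] against [sqrt (e ^+ 3 * e ^+ 2)]. *)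
Lemma zoomed_jac_L2 e : 0 < e ->
  ('N[leb]_2%:E[(fun t => 'N[leb3]_2%:E[(fun x => (zoomed_jac e (x, t))%:E)])] <=
   gradL2 U * (e `^ (1 / 2))%:E)%E /\
  measurable_fun setT (fun t => 'N[leb3]_2%:E[(fun x => (zoomed_jac e (x, t))%:E)])%E.
Proof.
move=> e0.
have a0 : 0 < (e ^+ 2)^-1 by rewrite invr_gt0 exprn_gt0.
have st := scales_leb (- (e ^+ 2)^-1 * T) a0; rewrite invrK in st.
have sc := @scales_prod R _ _ _ _ leb3s leb _ _ _ _ (scales_zoom_point e0) st.
have c0 : 0 <= e^-1 * e^-1 by rewrite mulr_ge0// invr_ge0 ltW.
have := Lnorm2_scale sc measurable_block_jac c0.
have -> : (fun z : (R * R * R) * R => (e^-1 * e^-1 *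
    block_jac (zoom_point e z.1, (e ^+ 2)^-1 * z.2 + - (e ^+ 2)^-1 * T))%:E) =
    EFin \o zoomed_jac e.
  apply/funext => z; rewrite /zoomed_jac /=; congr (_ * block_jac (_, _))%:E; ring.
have -> : e^-1 * e^-1 * Num.sqrt (e ^+ 3 * e ^+ 2) = e `^ (1 / 2).
  rewrite sqrtrM ?exprn_ge0 ?(ltW e0)// [Num.sqrt (e ^+ 2)]sqrtr_sqr (gtr0_norm e0).
  by rewrite mulrACA sqrt_cube// mulVf ?mulr1// gt_eqF.
move=> N.
have mz : measurable_fun setT (zoomed_jac e).
  apply: measurable_funM => //; apply: measurableT_comp; first exact: measurable_block_jac.
  have [mp _ _] := sc.
  rewrite (_ : (fun z => _) = (fun z : (R * R * R) * R => (zoom_point e z.1, (e ^+ 2)^-1 * z.2 + - (e ^+ 2)^-1 * T)))//.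
  by apply/funext => z; congr (_, _); ring.
have [I1 I2] := @Lnorm2_iterated R _ _ _ _ leb3s leb (zoomed_jac e) mz.
split; last exact: I2.
rewrite [leLHS]I1 [leLHS]N muleC; apply: lee_wpmul2r; first by rewrite lee_fin powR_ge0.
exact: block_gradL2.
Qed.

(** At each time the gradient of the block is bounded with compact support.
    Finiteness makes it possible to apply Minkowski's inequality in time to
    real-valued norms. *)
Lemma zoomed_jac_fin e t : 0 < e -> 0 <= r -> ('N[leb3]_2%:E[(fun x => (zoomed_jac e (x, t))%:E)] < +oo)%E.
Proof.
move=> e0 r0.
set s := (t - T) / e ^+ 2.
have [s0|s0] := ltP s 0; last first.
  rewrite (_ : (fun x => _) = cst 0%E) ?Lnorm0 ?ltry// ?eqe ?pnatr_eq0//.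
  by apply/funext => x; rewrite /zoomed_jac block_jac0// mulr0.
have Ls : L s by apply/LP.
have dsupp i j z : dx i (V j s) z != 0 -> box 0 r z.
  apply: contra_neqP => nb; apply: dx_near0; have := near_out_box nb.
  by apply: filterS => w nw; apply/eqP/negPn/negP => /(suppV Ls)[].
have /choice[M HM] : forall ij : 'I_3 * 'I_3, exists M, 0 <= M /\
    forall z, `|dx ij.1 (V ij.2 s) z| <= M.
  move=> [i j]; have sL : [set s] `<=` L by move=> _ ->.
  have [M M0 hM] := @joint_cont_bounded _ L (fun s => dx i (V j s)) [set s] (box 0 r)
     (Cn_cont (Cn_dx (sV j 1%N) i)) sL (@compact_set1 _ _) (@box_compact _ _ _).
  exists M; split => // z; have [->|/dsupp bz] := eqVneq (dx i (V j s) z) 0; first by rewrite normr0.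
  exact: hM.
pose B := \sum_ij M ij.
have B0 : 0 <= B by apply: sumr_ge0 => ij _; have [] := HM ij.
have hB ij z : `|dx ij.1 (V ij.2 s) z| <= B.
  have [_ h] := HM ij; apply: (le_trans (h z)); rewrite /B (bigD1 ij)//= lerDl.
  by apply: sumr_ge0 => k _; have [] := HM k.
pose h (x : E) := e^-1 * e^-1 * jac (fun j => V j s) (e^-1 *: (x - y)).
rewrite (_ : (fun x => _) = (fun x => (h (vec3 x))%:E)); last first.
  by apply/funext => x; rewrite /zoomed_jac (block_jacE _ s0) vec3_zoom_point.
have k0 : 0 <= e^-1 * e^-1 by rewrite mulr_ge0// invr_ge0 ltW.
apply: le_lt_trans (@Lp_box_bound R 2%:E y ((r + 1) * e) (e^-1 * e^-1 * (#|{: 'I_3 * 'I_3}|%:R * B)) h _ _ _ _ _) (ltry _).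
- by rewrite lee_fin ler1n.
- by rewrite mulr_gt0// ltr_wpDl.
- by rewrite mulr_ge0// mulr_ge0.
- move=> x; rewrite /h normrM (ger0_norm k0) ler_wpM2l// ger0_norm ?l2_ge0//.
  by apply: l2_le.
- move=> x; apply: contra_neqP => nb; rewrite /h (_ : jac _ _ = 0) ?mulr0//.
  apply: l2_0 => -[i j] /=; apply/eqP/negPn/negP => /dsupp bz; apply: nb => k.
  have := bz k; rewrite !mxE subr0 normrM normfV (gtr0_norm e0) mulrC ler_pdivrMr// => bk.
  by apply: (le_trans bk); rewrite ler_pM2r// lerDl.
Qed.

Section energy.
Variables (e rho B0 B1 : R) (c : 'I_3 -> R -> E -> R) (w : R -> E -> E).
Hypotheses (eI : 0 < e <= 1) (r0 : 0 <= r) (rho0 : 0 < rho) (B00 : 0 <= B0) (B10 : 0 <= B1) (T0 : 0 < T).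
Hypothesis sc : forall j, smooth_on setT (c j).
Hypotheses (hc : forall j t x, `|c j t x| <= B0)
  (hdc : forall i j t x, `|dx i (c j t) x| <= B1 / e)
  (supc : forall j t x, c j t x != 0 -> `|t - T| <= rho * e ^+ 2 /\ box y (rho * e) x)
  (supdc : forall i j t x, dx i (c j t) x != 0 -> `|t - T| <= rho * e ^+ 2 /\ box y (rho * e) x).
Let e0 : 0 < e. Proof. by case/andP: eI. Qed.
Let d j t x := rescaled_velocity T y V e j t x - c j t x.
Hypotheses (wd : forall t x, 0 < t < T -> cell x -> enorm (w t (vec3 x)) = l2 (fun j => d j t (vec3 x)))
  (dwd : forall t x, 0 < t < T -> cell x -> grad_norm (w t) (vec3 x) = jac (fun j => d j t) (vec3 x)).

Let LTL t : t < T -> L ((t - T) / e ^+ 2).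
Proof. by move=> tT; apply/LP; rewrite pmulr_llt0 ?invr_gt0 ?exprn_gt0// subr_lt0. Qed.

Let k2 : fine (2%:E^-1)%E = 2^-1 :> R.
Proof. by rewrite inver pnatr_eq0. Qed.

Lemma energy_sup t : 0 < t < T ->
  (Lp_T3 2%:E (w t) <= supL2 U * (e `^ (1 / 2))%:E +
     (3%:R * B0 * (((2 * (rho * e)) ^+ 3) `^ 2^-1))%:E)%E.
Proof.
move=> tI; have /andP[t0 tT] := tI; have Lt := LTL tT.
have cV j : continuous (rescaled_velocity T y V e j t).
  have -> : rescaled_velocity T y V e j t = (fun x => e^-1 * (fun z => V j ((t - T) / e ^+ 2) z) (e^-1 *: (x - y))) by [].
  apply: contM; first exact: contC.
  move=> x; apply: (@continuous_comp _ _ _ (fun x : E => e^-1 *: (x - y))); last exact: continuous_component.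
  have -> : (fun x : E => e^-1 *: (x - y)) = coord_affine (- (e^-1 *: y)) (const_mx e^-1).
    by apply/funext => z; apply/rowP => k; rewrite !mxE; ring.
  exact: coord_affine_continuous.
have cc j : continuous (c j t) by exact: slice_cont Logic.I (Cn_cont (sc j 0%N)).
pose f x := l2 (fun j => rescaled_velocity T y V e j t x).
pose g x := l2 (fun j => c j t x).
have mf : measurable_fun setT (fun x => f (vec3 x)).
  by apply: continuous_measurable3; exact: continuous_l2.
have mg : measurable_fun setT (fun x => g (vec3 x)).
  by apply: continuous_measurable3; exact: continuous_l2.
have p1 : (1 <= 2%:E :> \bar R)%E by rewrite lee_fin ler1n.
apply: (@le_trans _ _ ('N[leb3]_2%:E[EFin \o ((fun x => f (vec3 x)) \+ (fun x => g (vec3 x)))%R])%E).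
  apply: le_Lnorm => // x; rewrite /patch; case: ifPn => [/set_mem cx|_].
    rewrite /= !ger0_norm ?sqrtr_ge0 ?addr_ge0 ?l2_ge0// lee_fin wd// /d.
    apply: (le_trans (l2D _ (fun j => - c j t (vec3 x)))); rewrite lerD2l.
    by apply: l2_mono => j; rewrite normrN.
  by rewrite /= normr0 lee_fin normr_ge0.
apply: (le_trans (eminkowski leb3 mf mg p1)); apply: leeD.
  rewrite [leLHS](velocity_L2 e0 tT) muleC; apply: lee_wpmul2r; first by rewrite lee_fin powR_ge0.
  exact: slice_le_supL2.
rewrite -k2; apply: Lp_box_bound => //.
- by rewrite mulr_gt0.
- by rewrite mulr_ge0.
- move=> x; rewrite ger0_norm ?l2_ge0//; have := l2_le B00 (fun j => hc j t x).
  by rewrite card_ord.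
- move=> x gx; apply: contrapT => nb; move/eqP: gx; apply; apply: l2_0 => j.
  by apply/eqP/negPn/negP => /supc[_ /nb].
Qed.

Let lifetime : set R := [set t | 0 < t < T].

(** Minkowski's inequality in space and then in time separates the block,
    which scales exactly, from the corrector, which is bounded on a small box. *)
Lemma energy_grad :
  (Lq_time lifetime 2%:E (fun t => Lp_on cell 2%:E (grad_norm (w t))) <=
   gradL2 U * (e `^ (1 / 2))%:E +
   (9%:R * (B1 / e) * (((2 * (rho * e)) ^+ 3) `^ 2^-1) * (2 * (rho * e ^+ 2)) `^ 2^-1)%:E)%E.
Proof.
have p1 : (1 <= 2%:E :> \bar R)%E by rewrite lee_fin ler1n.
pose K := 9%:R * (B1 / e) * (((2 * (rho * e)) ^+ 3) `^ 2^-1).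
have K0 : 0 <= K by rewrite !mulr_ge0 ?powR_ge0// invr_ge0 ltW.
have [N1 N2] := zoomed_jac_L2 e0.
pose A t := 'N[leb3]_2%:E[(fun x => (zoomed_jac e (x, t))%:E)]%E.
have Afin t : A t = (fine (A t))%:E.
  by rewrite fineK// ge0_fin_numE ?Lnorm_ge0//; exact: zoomed_jac_fin.
pose b t : R := if `|t - T| <= rho * e ^+ 2 then K else 0.
have b0 t : 0 <= b t by rewrite /b; case: ifP.
have mA : measurable_fun setT (fun t => fine (A t)).
  by apply: measurableT_comp N2.
have mb : measurable_fun setT b.
  have -> : b = (fun t => K * \1_(ball_itv T (rho * e ^+ 2)) t).
    apply/funext => t; rewrite /b indicE; case: ifPn => h.
      by rewrite mem_set ?mulr1.
    by rewrite memNset ?mulr0//; apply/negP.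
  by apply: measurable_funM => //; apply: measurable_indic; exact: measurable_ball_itv.
apply: (@le_trans _ _ ('N[leb]_2%:E[EFin \o ((fun t => fine (A t)) \+ b)%R])%E).
  apply: le_Lnorm => // t; rewrite /patch; case: ifPn => [/set_mem /= tI|_]; last first.
    by rewrite abse0 abse_ge0.
  have /andP[t0 tT] := tI; have Lt := LTL tT.
  have nn : 0 <= fine (A t) + b t by rewrite addr_ge0 ?fine_ge0 ?Lnorm_ge0.
  rewrite gee0_abs ?Lnorm_ge0// [leRHS](_ : _ = (A t + (b t)%:E)%E); last first.
    by rewrite /= ger0_norm// EFinD -Afin.
  pose f x := zoomed_jac e (x, t).
  pose g x := jac (fun j => c j t) x.
  have mf : measurable_fun setT f.
    have [mp _ _] := scales_zoom_point e0.
    apply: measurable_funM => //.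
    have := measurableT_comp measurable_block_jac (measurable_pair2 ((t - T) / e ^+ 2)).
    by move=> m1; exact: (measurableT_comp m1 mp).
  have mg : measurable_fun setT (fun x => g (vec3 x)).
    apply: (continuous_measurable3 (h := g)); apply: (continuous_l2 (f := fun ij x => dx ij.1 (c ij.2 t) x)) => -[i j] /=.
    exact: slice_cont Logic.I (Cn_cont (Cn_dx (sc j 1%N) i)).
  apply: (@le_trans _ _ ('N[leb3]_2%:E[EFin \o (f \+ (fun x => g (vec3 x)))%R])%E).
    apply: le_Lnorm => // x; rewrite /patch; case: ifPn => [/set_mem cx|_]; last first.
      by rewrite abse0 abse_ge0.
    have f0 : 0 <= f x by rewrite !mulr_ge0 ?block_jac_ge0// invr_ge0 ltW.
    rewrite /= !ger0_norm ?sqrtr_ge0 ?addr_ge0 ?l2_ge0// lee_fin dwd//.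
    have -> : f x = l2 (fun ij : 'I_3 * 'I_3 => dx ij.1 (rescaled_velocity T y V e ij.2 t) (vec3 x)).
      rewrite /f /zoomed_jac block_jacE ?vec3_zoom_point; last exact/LP.
      rewrite /jac -l2_scale; last by rewrite mulr_ge0// invr_ge0 ltW.
      congr l2; apply/funext => -[i j] /=; rewrite -mulrA.
      by rewrite (rescaled_dx y sV eI) // /= in_itv.
    rewrite /g /jac; apply: (@le_trans _ _ (l2 (fun ij : 'I_3 * 'I_3 => dx ij.1 (rescaled_velocity T y V e ij.2 t) (vec3 x)
       + - dx ij.1 (c ij.2 t) (vec3 x)))).
      rewrite (_ : (fun ij : 'I_3 * 'I_3 => dx ij.1 (d ij.2 t) (vec3 x)) =
        (fun ij => dx ij.1 (rescaled_velocity T y V e ij.2 t) (vec3 x) + - dx ij.1 (c ij.2 t) (vec3 x)))//.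
      apply/funext => -[i j] /=.
      have tLT : (`]-oo, T[%classic : set R) t by rewrite /= in_itv.
      have [_ D] := derB (Cn_is_derive (rescaled_velocity_smooth T y sV eI j 1%N) (vec3 x) i tLT)
         (Cn_is_derive (sc j 1%N) (vec3 x) i (Logic.I : [set: R] t)).
      exact: D.
    apply: (le_trans (l2D _ _)); rewrite lerD2l; apply: l2_mono => ij; by rewrite normrN.
  apply: (le_trans (eminkowski leb3 mf mg p1)); apply: leeD => //.
  rewrite /b; case: ifPn => h.
    rewrite /K -k2; apply: Lp_box_bound => //.
    - by rewrite mulr_gt0.
    - by rewrite !mulr_ge0// invr_ge0 ltW.
    - move=> x; rewrite ger0_norm ?l2_ge0//.
      have := @l2_le R _ (B1 / e) (fun ij : 'I_3 * 'I_3 => dx ij.1 (c ij.2 t) x) _ (fun ij => hdc ij.1 ij.2 t x).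
      by rewrite card_prod card_ord; apply; rewrite mulr_ge0// invr_ge0 ltW.
    - move=> x gx; apply: contrapT => nb; move/eqP: gx; apply; apply: l2_0 => -[i j] /=.
      by apply/eqP/negPn/negP => /supdc[_ /nb].
  rewrite (_ : _ \o _ = cst 0%E) ?Lnorm0//.
  apply/funext => x /=; rewrite /g /jac l2_0// => -[i j] /=; apply/eqP/negPn/negP => /supdc[ht _].
  by rewrite ht in h.
apply: (le_trans (eminkowski leb mA mb p1)); apply: leeD.
  by rewrite (_ : _ \o _ = A) //; apply/funext => t /=; rewrite -Afin.
rewrite -/K; have -> : (2 * (rho * e ^+ 2)) `^ 2^-1 = (2 * (rho * e ^+ 2)) `^ fine (2%:E^-1)%E.
  by rewrite k2.
apply: (@Lq_box_bound R _ T (rho * e ^+ 2)%R K) => //.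
- by rewrite mulr_gt0// exprn_gt0.
- by move=> t; rewrite /= ger0_norm// lee_fin /b; case: ifP.
- by move=> t; rewrite /= /b; case: ifPn => // _; rewrite eqxx.
Qed.

(** The block contributes [supL2 U] and [gradL2 U] with the exact power [e ^
    (1 / 2)]; everything due to the corrector is of order [e ^ (3 / 2)]. *)
Lemma energy_bound : (supL2 U < +oo)%E ->
  (energy_norm T w <= (supL2 U + gradL2 U) * (e `^ (1 / 2))%:E +
   ((3%:R * B0 * (8%:R * rho ^+ 3) `^ 2^-1 +
     9%:R * B1 * ((8%:R * rho ^+ 3) `^ 2^-1 * (2 * rho) `^ 2^-1)) * e `^ (3 / 2))%:E)%E.
Proof.
move=> fM; have p1 : (1 <= 2%:E :> \bar R)%E by rewrite lee_fin ler1n.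
have eh : (e ^+ 3) `^ 2^-1 = e `^ (3 / 2).
  by rewrite -powR_mulrn ?(ltW e0)// -powRrM.
have e2h : (e ^+ 2) `^ 2^-1 = e.
  by rewrite -powR_mulrn ?(ltW e0)// -powRrM mulfV// powRr1// ltW.
have v3 : ((2 * (rho * e)) ^+ 3) `^ 2^-1 = (8%:R * rho ^+ 3) `^ 2^-1 * e `^ (3 / 2).
  rewrite -eh -powRM ?mulr_ge0 ?exprn_ge0 ?(ltW rho0) ?(ltW e0)//; congr (_ `^ _); ring.
have v2 : (2 * (rho * e ^+ 2)) `^ 2^-1 = (2 * rho) `^ 2^-1 * e.
  by rewrite -{2}e2h -powRM ?mulr_ge0 ?exprn_ge0 ?(ltW rho0) ?(ltW e0)//; congr (_ `^ _); ring.
have MD : (supL2 U * (e `^ (1 / 2))%:E + gradL2 U * (e `^ (1 / 2))%:E =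
    (supL2 U + gradL2 U) * (e `^ (1 / 2))%:E)%E.
  by rewrite ge0_muleDl// ?supL2_ge0 ?Lnorm_ge0.
have split_const : (3%:R * B0 * (8%:R * rho ^+ 3) `^ 2^-1 +
     9%:R * B1 * ((8%:R * rho ^+ 3) `^ 2^-1 * (2 * rho) `^ 2^-1)) * e `^ (3 / 2) =
   3%:R * B0 * (((2 * (rho * e)) ^+ 3) `^ 2^-1) +
   9%:R * (B1 / e) * (((2 * (rho * e)) ^+ 3) `^ 2^-1) * (2 * (rho * e ^+ 2)) `^ 2^-1.
  by rewrite v3 v2; field; rewrite gt_eqF.
rewrite split_const EFinD -MD addeACA; apply: leeD; last exact: energy_grad.
have MB : (supL2 U * (e `^ (1 / 2))%:E + (3%:R * B0 * (((2 * (rho * e)) ^+ 3) `^ 2^-1))%:E \is a fin_num)%E.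
  rewrite fin_numD andbC /=; rewrite fin_numM//; rewrite ge0_fin_numE ?supL2_ge0//.
pose S := fine (supL2 U * (e `^ (1 / 2))%:E + (3%:R * B0 * (((2 * (rho * e)) ^+ 3) `^ 2^-1))%:E)%E.
have SE : (supL2 U * (e `^ (1 / 2))%:E + (3%:R * B0 * (((2 * (rho * e)) ^+ 3) `^ 2^-1))%:E = S%:E)%E.
  by rewrite fineK.
have S0 : 0 <= S.
  rewrite -lee_fin -SE adde_ge0 ?mule_ge0 ?supL2_ge0 ?lee_fin ?powR_ge0//.
  by rewrite !mulr_ge0 ?powR_ge0.
rewrite SE.
have tE : [set t : R | 0 < t < T] = `]0, T[%classic by apply/seteqP; split => t; rewrite /= in_itv.
have := @Lnorm_box_bound _ _ R leb +oo%E ((fun t => Lp_T3 2%:E (w t)) \_ [set t : R | 0 < t < T])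
  [set t : R | 0 < t < T] S T.
rewrite /Lq_time powRr0 mulr1; apply => //.
- by rewrite leey.
- by rewrite tE; exact: measurable_itv.
- have : leb `]0, T[%classic = T%:E by rewrite lebesgue_measure_itv /= lte_fin T0 sube0.
  by rewrite -tE; exact.
- move=> t tI; rewrite /patch mem_set// gee0_abs ?Lnorm_ge0// -SE.
  exact: energy_sup.
- by move=> t nt; rewrite /patch memNset.
Qed.
End energy.

End BlockNorms.

(** * Fourier coefficients and Sobolev norms *)

Section Fourier.
Context {R : realType}.
Local Notation E := 'rV[R]_3.
Local Notation K := 'rV[int]_3.

Definition phase (k : K) (x : E) : R := 2 * pi * dot (int_vec k) x.

Lemma phaseE k x : phase k x = \sum_i (2 * pi * (k 0 i)%:~R) * x 0 i.
Proof. by rewrite /phase /dot mulr_sumr; apply: eq_bigr => i _; rewrite mxE mulrA. Qed.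

Lemma phaseB k l x : phase (k - l) x = phase k x - phase l x.
Proof.
by rewrite !phaseE -sumrB; apply: eq_bigr => i _; rewrite !mxE intrB; ring.
Qed.

Lemma phase_derive k x i : is_derive x (basis_vec i) (phase k) (2 * pi * (k 0 i)%:~R).
Proof.
have -> : phase k = (fun x => \sum_j (2 * pi * (k 0 j)%:~R) * x 0 j).
  by apply/funext => z; exact: phaseE.
have -> : 2 * pi * (k 0 i)%:~R = \sum_j (2 * pi * (k 0 j)%:~R) * (i == j)%:R :> R.
  rewrite (bigD1 i)//= eqxx mulr1 big1 ?addr0// => j ji.
  by rewrite eq_sym (negbTE ji) mulr0.
apply: derS => j; apply: derZ.
by have := @is_derive_coord R id x i j _ (is_derive_id _ _); rewrite mulr1.
Qed.

Lemma der_comp (g : R -> R) (f : E -> R) x v l m : is_derive x v f l -> is_derive (f x) 1 g m ->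
  is_derive x v (fun z => g (f z)) (m * l).
Proof.
move=> /is_derive_line df dg; apply/is_derive_line.
apply: (@is_derive1_comp R g (fun h : R => f (h *: v + x))) => //.
by rewrite scale0r add0r.
Qed.

Lemma cos_derive k x i : is_derive x (basis_vec i) (fun x => cos (phase k x))
  (- sin (phase k x) * (2 * pi * (k 0 i)%:~R)).
Proof. exact: der_comp (phase_derive k x i) (is_derive_cos _). Qed.

Lemma sin_derive k x i : is_derive x (basis_vec i) (fun x => sin (phase k x))
  (cos (phase k x) * (2 * pi * (k 0 i)%:~R)).
Proof. exact: der_comp (phase_derive k x i) (is_derive_sin _). Qed.

Lemma phase_continuous k : continuous (phase k).
Proof.
have -> : phase k = (fun x => \sum_j (2 * pi * (k 0 j)%:~R) * x 0 j).
  by apply/funext => z; exact: phaseE.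
by apply: cont_sum => j; apply: contM; [exact: contC|exact: coord_continuous].
Qed.

Lemma cos_phase_continuous k : continuous (fun x => cos (phase k x)).
Proof. by move=> x; apply: continuous_comp; [exact: phase_continuous|exact: continuous_cos]. Qed.

Lemma sin_phase_continuous k : continuous (fun x => sin (phase k x)).
Proof. by move=> x; apply: continuous_comp; [exact: phase_continuous|exact: continuous_sin]. Qed.

Lemma trig_nat_period (n : nat) (x : R) :
  cos (x + 2 * pi * n%:R) = cos x /\ sin (x + 2 * pi * n%:R) = sin x.
Proof.
elim: n => [|n [IHc IHs]]; first by rewrite mulr0 addr0.
have -> : x + 2 * pi * n.+1%:R = (x + 2 * pi * n%:R) + pi *+ 2.
  by rewrite -natr1 mulr2n; ring.
by split; [rewrite cosD|rewrite sinD]; rewrite cos2pi sin2pi mulr1 mulr0 ?subr0 ?addr0.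
Qed.

Lemma trig_int_period (n : int) (x : R) :
  cos (x + 2 * pi * n%:~R) = cos x /\ sin (x + 2 * pi * n%:~R) = sin x.
Proof.
case: n => n; first exact: trig_nat_period.
have [c s] := trig_nat_period n.+1 (x + 2 * pi * (Negz n)%:~R).
by move: c s; rewrite NegzE mulrNz -addrA mulrN addNr addr0.
Qed.

Lemma phase_shift k l (x : E) : exists n : int, phase k (x + int_vec l) = phase k x + 2 * pi * n%:~R.
Proof.
exists (\sum_i k 0 i * l 0 i); rewrite !phaseE.
under eq_bigr => i _ do rewrite !mxE mulrDr.
rewrite big_split /=; congr (_ + _).
rewrite (@raddf_sum _ _ (intmul 1)) mulr_sumr; apply: eq_bigr => i _.
by rewrite -mulrA -intrM.
Qed.

Lemma cos_phase_periodic k : periodic (fun x => cos (phase k x)).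
Proof. by move=> x l; have [n ->] := phase_shift k l x; have [] := trig_int_period n (phase k x). Qed.

Lemma sin_phase_periodic k : periodic (fun x => sin (phase k x)).
Proof. by move=> x l; have [n ->] := phase_shift k l x; have [] := trig_int_period n (phase k x). Qed.

Lemma phase0 x : phase 0 x = 0.
Proof. by rewrite phaseE big1// => i _; rewrite mxE mulr0 mul0r. Qed.

Let dxE (f : E -> R) i (df : E -> R) : (forall x, is_derive x (basis_vec i) f (df x)) -> dx i f = df.
Proof. by move=> D; apply/funext => x; have [_ e] := D x; exact: e. Qed.

Lemma contZ (c : R) (h : E -> R) : continuous h -> continuous (fun x => c * h x).
Proof. by move=> ch; apply: contM => //; exact: contC. Qed.

Lemma cancel_scalar (m s : R) : m != 0 -> - m^-1 * (- s * m) = s.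
Proof. by move=> m0; field. Qed.

(** For a nonzero frequency both functions are partial derivatives of periodic
    functions. *)
Lemma int_trig (k : K) : k != 0 ->
  int_T3 (fun x => cos (phase k x)) = 0 /\ int_T3 (fun x => sin (phase k x)) = 0.
Proof.
move=> k0; have [i ki] : exists i, k 0 i != 0.
  apply: contrapT => /forallNP h; move/eqP: k0; apply; apply/rowP => i; rewrite mxE.
  by apply/eqP/negPn/negP; exact: h.
pose m := 2 * pi * (k 0 i)%:~R : R.
have m0 : m != 0 by rewrite !mulf_neq0 ?pnatr_eq0 ?intr_eq0// gt_eqF// pi_gt0.
split.
  have -> : (fun x => cos (phase k x)) = (fun x => m^-1 * (cos (phase k x) * m)).
    by apply/funext => x; rewrite mulrCA mulVf// mulr1.
  have e := @dxE (fun x => sin (phase k x)) i _ (fun x => sin_derive k x i).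
  have cd : continuous (fun x => cos (phase k x) * m).
    by apply: contM; [exact: cos_phase_continuous|exact: contC].
  rewrite int_T3Zl// -e int_T3_dx_periodic ?mulr0//.
  - exact: sin_phase_continuous.
  - by move=> x; have [] := sin_derive k x i.
  - by rewrite e.
  - exact: sin_phase_periodic.
have -> : (fun x => sin (phase k x)) = (fun x => - m^-1 * (- sin (phase k x) * m)).
  by apply/funext => x; rewrite cancel_scalar.
have e := @dxE (fun x => cos (phase k x)) i _ (fun x => cos_derive k x i).
have cd : continuous (fun x => - sin (phase k x) * m).
  by apply: contM; [apply: contN; exact: sin_phase_continuous|exact: contC].
rewrite int_T3Zl// -e int_T3_dx_periodic ?mulr0//.
- exact: cos_phase_continuous.
- by move=> x; have [] := cos_derive k x i.
- by rewrite e.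
- exact: cos_phase_periodic.
Qed.

Definition fcos (f : E -> R) k : R := int_T3 (fun x => f x * cos (phase k x)).
Definition fsin (f : E -> R) k : R := int_T3 (fun x => f x * sin (phase k x)).

Lemma cont_bigsum (I : Type) (s : seq I) (h : I -> E -> R) : (forall i, continuous (h i)) ->
  continuous (fun x => \sum_(i <- s) h i x).
Proof.
move=> ch; elim: s => [|i s IHs]; first by under eq_fun do rewrite big_nil; exact: contC.
by under eq_fun do rewrite big_cons; exact: contD.
Qed.

Lemma int_T3_bigsum (I : Type) (s : seq I) (h : I -> E -> R) : (forall i, continuous (h i)) ->
  int_T3 (fun x => \sum_(i <- s) h i x) = \sum_(i <- s) int_T3 (h i).
Proof.
move=> ch; elim: s => [|i s IHs].
  by rewrite big_nil; under eq_fun do rewrite big_nil; exact: int_T3_cst.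
under eq_fun do rewrite big_cons.
by rewrite big_cons int_T3D ?IHs//; exact: cont_bigsum.
Qed.

(** The sums of [P] and [Q] below are the real and imaginary parts of the
    partial Fourier sum of [f]. The mean of the squared modulus of [f] minus
    that sum is nonnegative; the products combine into functions of [k - l]
    only, so that distinct frequencies are orthogonal, opposite ones included. *)
Lemma bessel (f : E -> R) (F : seq K) : continuous f -> uniq F ->
  \sum_(k <- F) (fcos f k ^+ 2 + fsin f k ^+ 2) <= int_T3 (fun x => f x ^+ 2).
Proof.
move=> cf uF; pose a := fcos f; pose b := fsin f.
pose P k x := a k * cos (phase k x) + b k * sin (phase k x).
pose Q k x := a k * sin (phase k x) - b k * cos (phase k x).
have cC k := @cos_phase_continuous k; have cS k := @sin_phase_continuous k.
have cP k : continuous (P k) by apply: contD; apply: contZ; [exact: cC|exact: cS].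
have cQ k : continuous (Q k) by apply: contB; apply: contZ; [exact: cS|exact: cC].
pose S := \sum_(k <- F) (a k ^+ 2 + b k ^+ 2).
have cSP := @cont_bigsum _ F _ cP; have cSQ := @cont_bigsum _ F _ cQ.
have cf2 : continuous (fun x => f x ^+ 2) by under eq_fun do rewrite expr2; exact: contM.
have I1 : int_T3 (fun x => f x * \sum_(k <- F) P k x) = S.
  under eq_fun do rewrite mulr_sumr.
  rewrite int_T3_bigsum; last by move=> k; exact: contM.
  apply: eq_bigr => k _; rewrite /P.
  transitivity (int_T3 (fun x => a k * (f x * cos (phase k x)) + b k * (f x * sin (phase k x)))).
    by congr int_T3; apply/funext => x; ring.
  have c1 : continuous (fun x => f x * cos (phase k x)) by exact: contM.
  have c2 : continuous (fun x => f x * sin (phase k x)) by exact: contM.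
  rewrite int_T3D; [|exact: contZ|exact: contZ].
  by rewrite !int_T3Zl// !expr2.
have cross k l x : P k x * P l x + Q k x * Q l x =
    (a k * a l + b k * b l) * cos (phase (k - l) x) + (a k * b l - b k * a l) * sin (phase (l - k) x).
  by rewrite !phaseB cosB sinB /P /Q; ring.
have I2 : int_T3 (fun x => (\sum_(k <- F) P k x) ^+ 2 + (\sum_(k <- F) Q k x) ^+ 2) = S.
  transitivity (int_T3 (fun x => \sum_(k <- F) \sum_(l <- F)
      ((a k * a l + b k * b l) * cos (phase (k - l) x) + (a k * b l - b k * a l) * sin (phase (l - k) x)))).
    congr int_T3; apply/funext => x; rewrite !expr2 !mulr_suml -big_split /=.
    apply: eq_bigr => k _; rewrite !mulr_sumr -big_split /=; apply: eq_bigr => l _.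
    exact: cross.
  have cc k l : continuous (fun x => (a k * a l + b k * b l) * cos (phase (k - l) x)).
    by apply: contZ; first [exact: cC|exact: cS].
  have cs k l : continuous (fun x => (a k * b l - b k * a l) * sin (phase (l - k) x)).
    by apply: contZ; first [exact: cC|exact: cS].
  rewrite int_T3_bigsum; last by move=> k; apply: cont_bigsum => l; exact: contD.
  rewrite /S; apply: eq_big_seq => k kF.
  rewrite int_T3_bigsum; last by move=> l; exact: contD.
  rewrite (bigD1_seq k)//= big1 ?addr0.
    rewrite int_T3D// !int_T3Zl// subrr.
    under eq_fun do rewrite phase0 cos0.
    under [X in _ + _ * int_T3 X]eq_fun do rewrite phase0 sin0.
    by rewrite !int_T3_cst mulr1 mulr0 addr0 !expr2.
  move=> l lk; rewrite int_T3D// !int_T3Zl//.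
  have kl : k - l != 0 by rewrite subr_eq0 eq_sym.
  have lk' : l - k != 0 by rewrite subr_eq0.
  by have [-> _] := int_trig kl; have [_ ->] := int_trig lk'; rewrite !mulr0 addr0.
(* the squared modulus of [f] minus the partial sum *)
pose g x := (f x - \sum_(k <- F) P k x) ^+ 2 + (\sum_(k <- F) Q k x) ^+ 2.
have gE : g = (fun x => (f x ^+ 2 - 2 * (f x * \sum_(k <- F) P k x)) +
    ((\sum_(k <- F) P k x) ^+ 2 + (\sum_(k <- F) Q k x) ^+ 2)).
  by apply/funext => x; rewrite /g; ring.
have c1 : continuous (fun x => f x * \sum_(k <- F) P k x) by exact: contM.
have c2 : continuous (fun x => (\sum_(k <- F) P k x) ^+ 2 + (\sum_(k <- F) Q k x) ^+ 2).
  by under eq_fun do rewrite !expr2; apply: contD; exact: contM.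
have c3 : continuous (fun x => 2 * (f x * \sum_(k <- F) P k x)) by exact: contZ.
have : 0 <= int_T3 g.
  rewrite -(@int_T3_cst R 0); apply: int_T3_le; first exact: contC.
    by rewrite gE; apply: contD => //; exact: contB.
  by move=> x _; rewrite /g addr_ge0// sqr_ge0.
rewrite gE int_T3D//; last exact: contB.
rewrite int_T3B// int_T3Zl// I1 I2 -/S -/a -/b => h.
by rewrite -subr_ge0; move: h; rewrite -/S; set A := int_T3 _; lra.
Qed.

Section derivative.
Variables (f : E -> R) (i : 'I_3).
Hypotheses (cf : continuous f) (df : forall x, derivable f x (basis_vec i))
  (cdf : continuous (dx i f)) (pf : periodic f).

(** Integration by parts multiplies the complex coefficient by [2 i pi k_i]. *)
Lemma fourier_dx k : fcos (dx i f) k ^+ 2 + fsin (dx i f) k ^+ 2 =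
  (2 * pi * (k 0 i)%:~R) ^+ 2 * (fcos f k ^+ 2 + fsin f k ^+ 2).
Proof.
pose m := 2 * pi * (k 0 i)%:~R : R.
have cC := @cos_phase_continuous k; have cS := @sin_phase_continuous k.
have c1 : continuous (fun x => dx i f x * cos (phase k x)) by exact: contM.
have c2 : continuous (fun x => dx i f x * sin (phase k x)) by exact: contM.
have c3 : continuous (fun x => f x * cos (phase k x)) by exact: contM.
have c4 : continuous (fun x => f x * sin (phase k x)) by exact: contM.
have z1 : fcos (dx i f) k - m * fsin f k = 0.
  rewrite /fcos /fsin -int_T3Zl// -int_T3B//; last by exact: contZ.
  have dfx x : is_derive x (basis_vec i) f (dx i f x) by split.
  have D x := derM (dfx x) (cos_derive k x i).
  have e : dx i (fun x => f x * cos (phase k x)) =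
      (fun x => dx i f x * cos (phase k x) - m * (f x * sin (phase k x))).
    by apply: dxE => x; have := D x; congr is_derive; rewrite /m /dx; ring.
  rewrite -e; apply: int_T3_dx_periodic.
  - exact: c3.
  - by move=> x; have [] := D x.
  - by rewrite e; apply: contB => //; exact: contZ.
  - by move=> x l; rewrite pf (cos_phase_periodic k x l).
have z2 : fsin (dx i f) k + m * fcos f k = 0.
  rewrite /fcos /fsin -int_T3Zl// -int_T3D//; last by exact: contZ.
  have dfx x : is_derive x (basis_vec i) f (dx i f x) by split.
  have D x := derM (dfx x) (sin_derive k x i).
  have e : dx i (fun x => f x * sin (phase k x)) =
      (fun x => dx i f x * sin (phase k x) + m * (f x * cos (phase k x))).
    by apply: dxE => x; have := D x; congr is_derive; rewrite /m /dx; ring.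
  rewrite -e; apply: int_T3_dx_periodic.
  - exact: c4.
  - by move=> x; have [] := D x.
  - by rewrite e; apply: contD => //; exact: contZ.
  - by move=> x l; rewrite pf (sin_phase_periodic k x l).
move/eqP: z1; rewrite subr_eq0 => /eqP ->; move/eqP: z2; rewrite addr_eq0 => /eqP ->.
by rewrite -/m; ring.
Qed.
End derivative.

(** Low frequencies [m <= la] are bounded by the first term, high ones by the
    second. *)
Lemma weight_split (s la m : R) : 0 <= s <= 1 -> 1 <= la -> 1 <= m ->
  m `^ s <= la `^ s + la `^ (s - 1) * m.
Proof.
move=> /andP[s0 s1] la1 m1; have la0 : 0 < la by exact: lt_le_trans la1.
have m0 : 0 < m by exact: lt_le_trans m1.
have [ml|lm] := leP m la.
  apply: (@le_trans _ _ (la `^ s)); last by rewrite lerDl mulr_ge0 ?powR_ge0// ltW.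
  by apply: ge0_ler_powR => //; rewrite nnegrE ltW.
apply: (@le_trans _ _ (la `^ (s - 1) * m)); last by rewrite lerDr powR_ge0.
have -> : m `^ s = m `^ (s - 1) * m.
  by rewrite -{3}(powRr1 (ltW m0)) -powRD ?subrK//; apply/implyP => _; rewrite gt_eqF.
rewrite ler_pM2r//.
have -> : s - 1 = - (1 - s) by ring.
rewrite !powRN lef_pV2 ?posrE ?powR_gt0//.
by apply: ge0_ler_powR; rewrite ?nnegrE ?subr_ge0// ltW.
Qed.

Section sobolev.
Variables (z : E -> E).
Hypotheses (cz : forall j, continuous (fun x => z x 0 j))
  (dz : forall i j x, derivable (fun x => z x 0 j) x (basis_vec i))
  (cdz : forall i j, continuous (dx i (fun x => z x 0 j)))
  (pz : forall j, periodic (fun x => z x 0 j)).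

Let en k : R := \sum_j (fcos (fun x => z x 0 j) k ^+ 2 + fsin (fun x => z x 0 j) k ^+ 2).
Let wt (k : K) : R := 1 + 4 * pi ^+ 2 * enorm (int_vec k : E) ^+ 2.

Lemma fourier_energy k : \sum_j Normc.normc (fourier z k j) ^+ 2 = en k.
Proof.
apply: eq_bigr => j _; rewrite /fourier /= sqr_sqrtr ?addr_ge0 ?sqr_ge0//.
by rewrite sqrrN.
Qed.

Lemma weight_ge1 k : 1 <= wt k.
Proof. by rewrite lerDl mulr_ge0 ?sqr_ge0// mulr_ge0 ?sqr_ge0. Qed.

Lemma en_ge0 k : 0 <= en k.
Proof. by apply: sumr_ge0 => j _; rewrite addr_ge0// sqr_ge0. Qed.

Lemma weight_energy k : wt k * en k = en k + \sum_i \sum_j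
  (fcos (dx i (fun x => z x 0 j)) k ^+ 2 + fsin (dx i (fun x => z x 0 j)) k ^+ 2).
Proof.
have -> : wt k = 1 + \sum_i (2 * pi * (k 0 i)%:~R) ^+ 2.
  rewrite /wt enormE l2_sq mulr_sumr; congr (_ + _); apply: eq_bigr => i _.
  by rewrite mxE; ring.
rewrite mulrDl mul1r mulr_suml; congr (_ + _); apply: eq_bigr => i _.
by rewrite /en mulr_sumr; apply: eq_bigr => j _; rewrite fourier_dx.
Qed.

Variables (A B : R).
Hypotheses (hA : forall j, int_T3 (fun x => z x 0 j ^+ 2) <= A)
  (hB : forall i j, int_T3 (fun x => dx i (fun x => z x 0 j) x ^+ 2) <= B).

Let weighted_sum (F : seq K) (s la : R) : uniq F -> 0 <= s <= 1 -> 1 <= la ->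
  \sum_(k <- F) wt k `^ s * en k <= la `^ s * (3 * A) + la `^ (s - 1) * (3 * A + 9 * B).
Proof.
move=> uF s01 la1.
have eA : \sum_(k <- F) en k <= 3 * A.
  rewrite exchange_big /=; apply: (@le_trans _ _ (\sum_(j : 'I_3) A)); last first.
    by rewrite sumr_const card_ord mulr_natl.
  apply: ler_sum => j _; apply: le_trans (hA j).
  exact: bessel.
have eB : \sum_(k <- F) wt k * en k <= 3 * A + 9 * B.
  under eq_bigr do rewrite weight_energy.
  rewrite big_split /=; apply: lerD => //.
  rewrite exchange_big /=; apply: (@le_trans _ _ (\sum_(i : 'I_3) \sum_(j : 'I_3) B)); last first.
    by rewrite !sumr_const !card_ord -mulrnA mulr_natl.
  apply: ler_sum => i _; rewrite exchange_big /=; apply: ler_sum => j _.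
  apply: le_trans (hB i j).
  exact: bessel.
apply: (@le_trans _ _ (\sum_(k <- F) (la `^ s * en k + la `^ (s - 1) * (wt k * en k)))).
  apply: ler_sum => k _; rewrite mulrA -mulrDl ler_wpM2r ?en_ge0//.
  exact: weight_split s01 la1 (weight_ge1 k).
rewrite big_split /= -!mulr_sumr; apply: lerD; rewrite ler_wpM2l ?powR_ge0//.
Qed.

Let term s k : R := wt k `^ s * (\sum_j Normc.normc (fourier z k j) ^+ 2).

(** Bessel's inequality for [z] and for its gradient bounds each partial sum
    of the two terms of [weight_split]. The threshold [la] is free; for a
    field living at scale [e] the two terms balance at [la = e ^- 2]. *)
Lemma Hs_bound (s la : R) : 0 <= s <= 1 -> 1 <= la ->
  (Hs_norm s z <= ((la `^ s * (3 * A) + la `^ (s - 1) * (3 * A + 9 * B)) `^ 2^-1)%:E)%E.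
Proof.
move=> s01 la1; rewrite /Hs_norm -poweR_EFin; apply: gt0_ler_poweR.
- by rewrite invr_ge0.
- by rewrite in_itv /= leey andbT; apply: esum_ge0 => k _;
     rewrite lee_fin mulr_ge0 ?powR_ge0// fourier_energy en_ge0.
- rewrite in_itv /= leey andbT lee_fin.
  by have := @weighted_sum [::] s la isT s01 la1; rewrite big_nil.
apply: ge_ereal_sup => _ [X [fX _] <-].
rewrite fsbig_finite//= sumEFin lee_fin.
under eq_bigr do rewrite fourier_energy.
apply: weighted_sum => //.
exact: finmap.fset_uniq.
Qed.

(** The weights are at least 1, so the norm increases with [s]. *)
Lemma Hs_neg_le (s : R) : s <= 0 -> (Hs_norm s z <= Hs_norm 0 z)%E.
Proof.
move=> s0; rewrite /Hs_norm; apply: gt0_ler_poweR.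
- by rewrite invr_ge0.
- by rewrite in_itv /= leey andbT; apply: esum_ge0 => k _;
     rewrite lee_fin mulr_ge0 ?powR_ge0// fourier_energy en_ge0.
- by rewrite in_itv /= leey andbT; apply: esum_ge0 => k _;
     rewrite lee_fin mulr_ge0 ?powR_ge0// fourier_energy en_ge0.
apply: le_esum => k _; rewrite lee_fin ler_wpM2r ?fourier_energy ?en_ge0//.
rewrite powRr0 -(opprK s) powRN invf_le1 ?powR_gt0//; last exact: lt_le_trans (weight_ge1 k).
by rewrite -[X in (X <= _)%R](powRr0 (wt k)); apply: ler_powR; rewrite ?weight_ge1// oppr_ge0.
Qed.

End sobolev.

Lemma int_T3_box_le (h : E -> R) (y : E) (s B : R) : continuous h -> 0 < s -> 0 <= B ->
  (forall x, 0 <= h x) -> (forall x, cell x -> h (vec3 x) <= B) ->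
  (forall x, cell x -> h (vec3 x) != 0 -> box y s (vec3 x)) ->
  int_T3 h <= B * (2 * s) ^+ 3.
Proof.
move=> ch s0 B0 h0 hB hs; rewrite -lee_fin -int_T3_EFin//.
have -> : (\int[leb3]_(x in cell) (h (vec3 x))%:E = Lp_on cell 1%E h)%E.
  rewrite /Lp_on Lnorm1 [LHS]integral_mkcond; apply: eq_integral => x _; rewrite gee0_abs//.
  by rewrite /patch; case: ifP => //; rewrite lee_fin.
have hB' x : cell x -> `|h (vec3 x)| <= B by move=> cx; rewrite ger0_norm// hB.
have := Lp_cell_bound (lexx 1%E) s0 B0 hB' hs.
by rewrite inve1 /= powRr1// exprn_ge0// mulr_ge0// ltW.
Qed.

End Fourier.

(** * Essential suprema under rescaling *)

Section Blowup.
Context {R : realType}.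
Local Notation E := 'rV[R]_3.
Local Notation leb3 := (@leb3 R).
Local Open Scope ereal_scope.

(** Superlevel sets correspond under [phi], and their measures are
    proportional. *)
Lemma ess_sup_scale d (X : measurableType d) (m : {measure set X -> \bar R}) phi (c : R) (h : X -> R) :
  scales m phi c -> (0 < c)%R -> measurable_fun setT h ->
  ess_sup m (EFin \o h) <= ess_sup m (fun x => (h (phi x))%:E).
Proof.
move=> [mphi _ sc] c0 mh; set M := ess_sup m (fun x => (h (phi x))%:E); apply/ess_supP.
pose A := [set x | M < (h x)%:E].
have mA : measurable A.
  have mE : measurable_fun setT (EFin \o h) by exact/measurable_EFinP.
  by rewrite -[A]setTI; exact: (emeasurable_fun_o_infty measurableT mE M).
have mB : measurable (phi @^-1` A) by rewrite -[X in measurable X]setTI; exact: mphi.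
have B0 : m (phi @^-1` A) = 0.
  apply: measure_negligible => //.
  have := ess_sup_ge m (fun x => (h (phi x))%:E); apply: negligibleS => x /=.
  by rewrite /A /= ltNge => /negP.
have mI : measurable_fun setT (fun x : X => (\1_A x : R)%:E).
  by apply/measurable_EFinP; exact: measurable_indic.
have A0 : m A = 0.
  have /esym/eqP : 0 = c%:E * m A.
    rewrite -B0; have := sc _ mI; rewrite integral_indic// setIT integral_indic// setIT.
    by apply => x; rewrite lee_fin.
  by rewrite mule_eq0 eqe gt_eqF//= => /eqP.
by exists A; split => // x /= /negP; rewrite -ltNge.
Qed.

Lemma Lnorm_oo_scale d (X : measurableType d) (m : {measure set X -> \bar R}) phi (c b : R) (h : X -> R) :
  scales m phi c -> (0 < c)%R -> (0 < b)%R -> measurable_fun setT h -> (forall x, 0 <= h x)%R ->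
  b%:E * 'N[m]_+oo[EFin \o h] <= 'N[m]_+oo[(fun x => (b * h (phi x))%:E)].
Proof.
move=> sc c0 b0 mh h0; rewrite unlock; case: ifPn => _; last by rewrite mule0.
have -> : abse \o (EFin \o h) = EFin \o h by apply/funext => x /=; rewrite ger0_norm.
have -> : abse \o (fun x => (b * h (phi x))%:E) = cst b%:E \* (fun x => (h (phi x))%:E).
  by apply/funext => x /=; rewrite ger0_norm ?EFinM// mulr_ge0// ltW.
by rewrite ess_sup_pZl// lee_pmul2l//; exact: ess_sup_scale sc c0 mh.
Qed.

Lemma limf_esup_pinfty (f : R -> \bar R) (F : set_system R) :
  limf_esup f F = +oo <-> forall A, F A -> ereal_sup (f @` A) = +oo.
Proof.
rewrite limf_esupE; split=> [h A FA|h].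
  by apply/eqP; rewrite -leye_eq -h; apply: ereal_inf_lbound; exists A.
by apply/eqP; rewrite -leye_eq; apply: le_ereal_inf_tmp => _ [A FA <-]; rewrite h.
Qed.

End Blowup.

(** * The perturbed solution *)

Section Assembly.
Context {R : realType}.
Local Notation E := 'rV[R]_3.
Variables (nu T r k b : R) (y : E) (vt G V : 'I_3 -> R -> E -> R) (Q : R -> E -> R).
Variables (a : E -> E) (v g : R -> E -> E) (q : R -> E -> R).
Local Notation L := (`]-oo, 0[%classic : set R).
Local Notation LT := (`]-oo, T[%classic : set R).
Local Notation J := (`[0, T[%classic : set R).
Hypotheses (T0 : 0 < T) (r0 : 0 <= r) (k0 : 0 < k) (yk : forall i, 2 * k <= y 0 i <= 1 - 2 * k).
Hypotheses (svt : forall j, smooth_on setT (vt j))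
  (dvt : forall t x, divergence (fun j => vt j t) x = 0) (bG : forall j, bump (r + 2) (G j)).
Hypotheses (sV : forall j, smooth_on L (V j)) (sQ : smooth_on L Q)
  (eqV : forall j s x, L s -> momentum nu L V Q j s x = G j s x)
  (divV : forall s x, L s -> divergence (fun j => V j s) x = 0)
  (suppV : forall j s x, L s -> V j s x != 0 -> - (2 / 3) < s /\ box 0 r x)
  (suppQ : forall s x, L s -> Q s x != 0 -> - (2 / 3) < s /\ box 0 r x).
Hypotheses (vNS : NS_solution nu J a g v q) (Fg : force_space g)
  (vvt : forall j t x, `|t - T| <= b -> v t x 0 j = vt j t x).

Let tJ : time_set J. Proof. exact: time_set_bo. Qed.
Let tLT : time_set LT. Proof. exact: time_set_No. Qed.
Let JP t : J t <-> 0 <= t < T. Proof. by rewrite /= in_itv. Qed.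
Let LTP t : LT t <-> t < T. Proof. by rewrite /= in_itv. Qed.
Let JLT : J `<=` LT. Proof. by move=> t /JP/andP[_ h]; apply/LTP. Qed.
Let vj (j : 'I_3) t x : R := v t x 0 j.

(** In order: the scale is positive and at most 1, the perturbation keeps a
    distance to the faces of the cell, it lives where the background coincides
    with its extension, and it starts after time 0. *)
Definition small e := [/\ 0 < e, e <= 1, (r + 2) * e <= k, 3 / 2 * e ^+ 2 <= b & (r + 2) * e ^+ 2 < T].

Definition difference e (j : 'I_3) t x : R := rescaled_velocity T y V e j t x - corrector T y r vt e j t x.
Definition velocity e t x : E := \row_j periodizet (glued_velocity T y r vt V e vj j) t x.
Definition block_pressure e t x : R := periodizet (rescaled_pressure T y Q e) t x.
(** The pressure of the background has mean zero already, so only the mean of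
    the block has to be removed. *)
Definition pressure e t x : R := q t x + block_pressure e t x - int_T3 (block_pressure e t).
Definition force_change e t x : E := \row_j periodizet (force_diff T y r vt nu G e j) t x.
Definition force e t x : E := g t x + force_change e t x.

Let svj n j : Cn J n (vj j). Proof. exact: Cn_entry tJ (NS_smooth_u vNS n). Qed.
Let pvj j t : J t -> periodic (vj j t).
Proof. by move=> Jt x m; rewrite /vj (NS_periodic_u vNS Jt x m). Qed.

Lemma vj_frac j t x : J t -> vj j t (frac x) = v t x 0 j.
Proof. by move=> Jt; exact: (periodic_frac x (pvj j Jt)). Qed.

Let rho0 : 0 < r + 2. Proof. by move: r0; lra. Qed.

Section scale.
Variable e : R.
Hypothesis es : small e.
Let e0 : 0 < e. Proof. by case: es. Qed.
Let eI : 0 < e <= 1. Proof. by case: es => -> ->. Qed.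
Let ek : (r + 2) * e <= k. Proof. by case: es. Qed.
Let eb : 3 / 2 * e ^+ 2 <= b. Proof. by case: es. Qed.
Let eT : (r + 2) * e ^+ 2 < T. Proof. by case: es. Qed.
Let e2 : 0 < e ^+ 2. Proof. by rewrite exprn_gt0. Qed.

Lemma box_inside (z : E) : box y ((r + 2) * e) z -> forall i, k <= z 0 i <= 1 - k.
Proof.
move=> h i; have /andP[y1 y2] := yk i; have := h i; rewrite ler_norml => /andP[h1 h2].
by move: y1 y2 h1 h2 ek; set s := _ * e; lra.
Qed.

Lemma rescaled_box (f : R -> E -> R) (c : R) t x : t < T ->
  (forall s x, L s -> f s x != 0 -> - (2 / 3) < s /\ box 0 r x) -> c * zoom T y e f t x != 0 ->
  T - 2 / 3 * e ^+ 2 < t /\ box y ((r + 2) * e) x.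
Proof.
move=> tT hf; rewrite mulf_eq0 negb_or => /andP[_ h].
have Ls : L ((t - T) / e ^+ 2) by rewrite /= in_itv /= pmulr_llt0 ?invr_gt0// subr_lt0.
have [h1 h2] := hf _ _ Ls h; split.
  by move: h1; rewrite ltr_pdivlMr//; set d := e ^+ 2; lra.
move=> i; have := h2 i; rewrite !mxE subr0 normrM normfV (gtr0_norm e0) mulrC ler_pdivrMr// => h3.
by apply: (le_trans h3); rewrite ler_pM2r//; lra.
Qed.

Lemma corrector_box j t x : corrector T y r vt e j t x != 0 ->
  `|t - T| <= 3 / 2 * e ^+ 2 /\ box y ((r + 2) * e) x.
Proof.
by move=> h; split; [exact: corrector_supp eI h|have [] := osc_supp (osc_corrector T y r0 svt j) eI h].
Qed.

(** The block vanishes unless [t > T - 2 / 3 * e ^+ 2] and the corrector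
    unless [t >= T - 3 / 2 * e ^+ 2]; both stay inside one box around [y]. *)
Lemma difference_box j t x : t < T -> difference e j t x != 0 ->
  T - 3 / 2 * e ^+ 2 <= t /\ box y ((r + 2) * e) x.
Proof.
move=> tT; rewrite /difference; have [->|h] := eqVneq (rescaled_velocity T y V e j t x) 0.
  rewrite sub0r oppr_eq0 => /corrector_box[h1 h2]; split => //.
  by move: h1; rewrite ler_norml => /andP[h1 _]; move: h1; set d := e ^+ 2; lra.
have [h1 h2] := rescaled_box tT (@suppV j) h; split => //.
by move: h1 e2; set d := e ^+ 2; lra.
Qed.

Lemma glued_difference j t x : glued_velocity T y r vt V e vj j t x = vj j t x + difference e j t x.
Proof. by rewrite /glued_velocity /difference; ring. Qed.

Lemma near_glued j : near_periodic J k (glued_velocity T y r vt V e vj j).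
Proof.
exists (vj j); split=> [t Jt|t z /JP/andP[_ tT]]; first exact: pvj.
rewrite glued_difference -subr_eq0 addrAC subrr add0r => /(difference_box tT)[_].
exact: box_inside.
Qed.

Lemma near_difference j : near_periodic J k (difference e j).
Proof.
exists (fun _ _ => 0); split=> // t z /JP/andP[_ tT] /(difference_box tT)[_]; exact: box_inside.
Qed.

Lemma near_block_pressure : near_periodic LT k (rescaled_pressure T y Q e).
Proof.
exists (fun _ _ => 0); split=> // t z /LTP tT h.
by have [_] := rescaled_box tT suppQ h; exact: box_inside.
Qed.

Lemma near_force j : near_periodic setT k (force_diff T y r vt nu G e j).
Proof.
exists (fun _ _ => 0); split=> // t z _ h.
by have [_] := osc_supp (osc_force_diff T y r0 svt nu bG j) eI h; exact: box_inside.
Qed.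

Lemma smooth_glued j n : Cn J n (glued_velocity T y r vt V e vj j).
Proof.
apply: Cn_add => //; last by apply: Cn_subset (rescaled_velocity_smooth T y sV eI j n).
apply: Cn_sub => //.
by apply: (@Cn_subset _ n setT) => //; exact: osc_smooth (osc_corrector T y r0 svt j) eI n.
Qed.

Lemma smooth_difference j n : Cn J n (difference e j).
Proof.
apply: Cn_sub => //; first by apply: Cn_subset (rescaled_velocity_smooth T y sV eI j n).
by apply: (@Cn_subset _ n setT) => //; exact: osc_smooth (osc_corrector T y r0 svt j) eI n.
Qed.

Lemma smooth_block_pressure n : Cn LT n (block_pressure e).
Proof. refine (Cn_periodize tLT k0 near_block_pressure (rescaled_pressure_smooth T y sQ eI n)). Qed.

Lemma smooth_force_change : smooth_on setT (force_change e).
Proof.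
move=> n; apply: Cn_row => [|j]; first exact: time_setT.
apply: (@Cn_ext _ _ n _ _ (periodizet (force_diff T y r vt nu G e j))) => [t x _|]; first by rewrite mxE.
apply: (Cn_periodize (@time_setT R) k0 (near_force j)).
exact: osc_smooth (osc_force_diff T y r0 svt nu bG j) eI n.
Qed.

Lemma velocityE t x j : velocity e t x 0 j = periodizet (glued_velocity T y r vt V e vj j) t x.
Proof. by rewrite mxE. Qed.

Lemma velocity_entries : (fun j t x => velocity e t x 0 j) =
  (fun j => periodizet (glued_velocity T y r vt V e vj j)).
Proof. by apply/funext => j; apply/funext => t; apply/funext => x; exact: velocityE. Qed.

Lemma smooth_velocity : smooth_on J (velocity e).
Proof.
move=> n; apply: Cn_row => // j.
apply: (@Cn_ext _ _ n _ _ (periodizet (glued_velocity T y r vt V e vj j))) => [t x _|]; first exact: velocityE.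
refine (Cn_periodize tJ k0 (near_glued j) (smooth_glued j n)).
Qed.

Lemma smooth_pressure : smooth_on J (pressure e).
Proof.
move=> n; apply: Cn_sub => //.
  apply: Cn_add => //; first exact: NS_smooth_p vNS n.
  exact: Cn_subset (smooth_block_pressure n).
apply: (Cn_subset JLT tJ); apply: Cn_mean (smooth_block_pressure n) => //; exact: interval_open.
Qed.

Lemma force_space_force : force_space (force e).
Proof.
have [sg pg [K [cK K0 hK]]] := Fg; split.
- by move=> n; apply: Cn_add (sg n) (smooth_force_change n); exact: time_setT.
- move=> t x m; have e1 : force_change e t (x + int_vec m) = force_change e t x.
    apply/rowP => j; rewrite [LHS]mxE [RHS]mxE; exact: periodize_periodic.
  by rewrite /force e1 (pg t x m).
exists (K `|` `[T - (r + 2) * e ^+ 2, T + (r + 2) * e ^+ 2]); split.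
- by apply: compactU => //; exact: segment_compact.
- move=> t [/K0//|]; rewrite /= !in_itv /= andbT => /andP[h _].
  by apply: lt_le_trans h; rewrite subr_gt0.
move=> t x /not_orP[nK nt]; rewrite /force hK// add0r; apply/rowP => j; rewrite !mxE.
apply/eqP/negPn/negP => h; apply: nt.
have [ht _] := osc_supp (osc_force_diff T y r0 svt nu bG j) eI h.
by rewrite /= in_itv /= -ler_distl.
Qed.

Lemma pressure_dx t x j : J t ->
  dx j (pressure e t) x = dx j (periodizet (glued_pressure T y Q e q) t) x.
Proof.
move=> Jt; have pE : periodizet (glued_pressure T y Q e q) t = fun x => q t x + block_pressure e t x.
  apply/funext => z; rewrite /periodizet /periodize /glued_pressure periodic_frac//.
  exact: (NS_periodic_p vNS Jt).
have D1 := Cn_is_derive (NS_smooth_p vNS 1%N) x j Jt.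
have D2 := Cn_is_derive (smooth_block_pressure 1%N) x j (JLT Jt).
have D3 : is_derive x (basis_vec j) (pressure e t) (dx j (q t) x + dx j (block_pressure e t) x - 0).
  exact: derB (derD D1 D2) (is_derive_cst (int_T3 (block_pressure e t)) x (basis_vec j)).
have [_ d3] := D3; have [_ d4] := derD D1 D2; rewrite pE.
by apply: etrans (esym d4); rewrite -[RHS]subr0; exact: d3.
Qed.

Lemma velocity_div t x : J t -> divergence (fun j => periodizet (glued_velocity T y r vt V e vj j) t) x = 0.
Proof.
move=> Jt; rewrite (periodize_div k0 x near_glued Jt).
apply: (glued_div y r0 svt sV divV eI) => // [j n|s z Js]; first exact: svj.
by have [_] := (NS_eqnsP tJ (NS_smooth_u vNS 2%N) nu g q).1 (NS_equations vNS) s z Js.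
Qed.

Lemma near_pressure : near_periodic J k (glued_pressure T y Q e q).
Proof.
exists q; split=> [t Jt|t z Jt]; first exact: (NS_periodic_p vNS Jt).
rewrite /glued_pressure -subr_eq0 addrAC subrr add0r => h.
by have [_] := rescaled_box ((LTP t).1 (JLT Jt)) suppQ h; exact: box_inside.
Qed.

(** Periodization transports the equations of the glued velocity from the cell
    to the whole space, since the glued and the background velocities differ
    only well inside the cell. *)
Lemma NS_velocity : NS_solution nu J a (force e) (velocity e) (pressure e).
Proof.
have v1 := (NS_eqnsP tJ (NS_smooth_u vNS 2%N) nu g q).1 (NS_equations vNS).
split.
- exact: smooth_velocity.
- exact: smooth_pressure.
- by move=> t Jt x m; apply/rowP => j; rewrite [LHS]mxE [RHS]mxE; exact: periodize_periodic.
- move=> t Jt x m; rewrite /pressure (NS_periodic_p vNS Jt x m); congr (_ + _ - _).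
  exact: periodize_periodic.
- move=> t Jt; have cq := slice_cont Jt (Cn_cont (NS_smooth_p vNS 0%N)).
  have cb := slice_cont (JLT Jt) (Cn_cont (smooth_block_pressure 0%N)).
  rewrite /pressure int_T3B ?int_T3D ?int_T3_cst ?(NS_mean_p vNS Jt) ?add0r ?subrr//.
    exact: contD.
  exact: contC.
- apply/(NS_eqnsP tJ (smooth_velocity 2%N)) => t x Jt; split.
    move=> j; rewrite velocity_entries.
    transitivity (momentum nu J (fun i => periodizet (glued_velocity T y r vt V e vj i))
        (periodizet (glued_pressure T y Q e q)) j t x).
      by rewrite /momentum pressure_dx.
    rewrite (periodize_momentum k0 nu j x near_glued near_pressure Jt).
    rewrite (@glued_momentum _ T y r r0 vt svt dvt nu G V Q sV sQ eqV suppV e eI vj (fun j t x => g t x 0 j) q b)//.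
    + by rewrite !mxE; congr (_ + _); rewrite periodic_frac//; have [_ pg _] := Fg => z m; rewrite pg.
    + by move=> i n; exact: svj.
    + exact: NS_smooth_p vNS.
    + by move=> i s z Js; have [+ _] := v1 s z Js; exact.
  rewrite -(velocity_div x Jt) /divergence; apply: eq_bigr => i _; congr (dx i _ x).
  by apply/funext => z; exact: velocityE.
- apply/funext => x; rewrite -(NS_initial vNS); apply/rowP => j; rewrite velocityE.
  have J0 : J 0 by apply/JP; rewrite lexx T0.
  rewrite /periodizet /periodize glued_difference (_ : difference e j 0 _ = 0) ?addr0.
    exact: vj_frac.
  apply/eqP/negPn/negP => /(difference_box T0)[h _].
  by move: h eT e2 (mulr_ge0 r0 (ltW e2)); set d := e ^+ 2; lra.
Qed.

Lemma velocity_early t x : 0 <= t <= T - 2 * e ^+ 2 -> velocity e t x = v t x.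
Proof.
move=> /andP[t0 tT]; apply/rowP => j; rewrite velocityE.
have tT' : t < T by apply: le_lt_trans tT _; rewrite ltrBlDr ltrDl mulr_gt0.
have Jt : J t by apply/JP; rewrite t0.
rewrite /periodizet /periodize glued_difference (_ : difference e j t _ = 0) ?addr0.
  exact: vj_frac.
apply/eqP/negPn/negP => /(difference_box tT')[h _].
by move: h tT e2; set d := e ^+ 2; lra.
Qed.

Definition change t x : E := velocity e t x - v t x.

Lemma changeE t x j : J t -> change t x 0 j = periodizet (difference e j) t x.
Proof.
move=> Jt; rewrite [LHS]mxE velocityE [X in _ + X]mxE /periodizet /periodize glued_difference.
rewrite vj_frac//.
by rewrite addrAC subrr add0r.
Qed.

Lemma change_derivable i t x : J t -> derivable (change t) x (basis_vec i).
Proof.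
move=> Jt; apply: derivable_row => j.
have [+ _] := Cn_is_derive (Cn_periodize tJ k0 (near_difference j) (smooth_difference j 1)) x i Jt.
suff -> : (fun z => change t z 0 j) = periodizet (difference e j) t by [].
by apply/funext => z; exact: changeE.
Qed.

Lemma change_dx i j t x : J t -> dx i (change t) x 0 j = dx i (difference e j t) (translate (floorv x) x).
Proof.
move=> Jt; rewrite dx_entry; last exact: change_derivable.
rewrite -(dx_periodize k0 i x (near_difference j) Jt); congr (dx i _ x).
by apply/funext => z; rewrite changeE.
Qed.

Lemma change_div t x : J t -> div (change t) x = 0.
Proof.
move=> Jt; rewrite /div; under eq_bigr => i _ do rewrite change_dx//.
set z := translate _ x.
have -> : \sum_i dx i (difference e i t) z =
    divergence (fun j => rescaled_velocity T y V e j t) z - divergence (fun j => corrector T y r vt e j t) z.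
  rewrite /divergence -sumrB; apply: eq_bigr => i _.
  have [_ D] := derB (Cn_is_derive (rescaled_velocity_smooth T y sV eI i 1%N) z i (JLT Jt))
    (Cn_is_derive (osc_smooth (osc_corrector T y r0 svt i) eI 1%N) z i (Logic.I : [set: R] t)).
  exact: D.
have h1 := rescaled_div y sV divV eI z (JLT Jt).
have h2 := corrector_div T y r0 svt t z eI.
by rewrite h1 h2 subrr.
Qed.

(** Near a point of the support the periodized difference is a translate of
    the local one, whose support lies in a closed box of half-side [(r + 2) *
    e]; the factor 2 exceeds [sqrt 3]. *)
Lemma change_supp t : J t -> supp (change t) `<=` torus_ball y (2 * ((r + 2) * e)).
Proof.
move=> Jt x; set s := (r + 2) * e => cx.
have s0 : 0 < s by rewrite mulr_gt0.
have nb : box y s (translate (floorv x) x).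
  apply: contrapT => nb; have nn := near_out_box nb.
  have ct : continuous (fun z : E => translate (floorv x) z).
    by rewrite translateE; exact: coord_affine_continuous.
  have n1 := ct x _ nn.
  have near_eq j : \forall z \near x, change t z 0 j = difference e j t (translate (floorv x) z).
    have [h [ph fh]] := near_difference j.
    have := periodize_local x k0 ph fh; apply: filterS => z /(_ t Jt) hz.
    by rewrite changeE.
  have n2 : \forall z \near x, change t z = 0.
    apply: filterS2 (filterI (near_eq ord0) (near_eq (lift ord0 ord0)))
      (filterI (near_eq (lift ord0 (lift ord0 ord0))) n1) => z [h1 h2] [h3 hz].
    apply/rowP => j; rewrite [RHS]mxE.
    have dz j' : difference e j' t (translate (floorv x) z) = 0.
      by apply/eqP/negPn/negP => /(difference_box ((LTP t).1 (JLT Jt)))[].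
    by move: j; apply: ord3P; rewrite ?h1 ?h2 ?h3 dz.
  have [z [/= /eqP nz hz]] := cx _ n2; exact: nz hz.
exists (- floorv x); have -> : x + int_vec (- floorv x) - y = translate (floorv x) x - y.
  by congr (_ - y); apply/rowP => j; rewrite !mxE mulrNz.
rewrite /enorm; have -> : 2 * s = Num.sqrt ((2 * s) ^+ 2) by rewrite sqrtr_sqr gtr0_norm// mulr_gt0.
rewrite ltr_sqrt ?exprn_gt0 ?mulr_gt0//.
apply: (@le_lt_trans _ _ (\sum_(i : 'I_3) s ^+ 2)).
  apply: ler_sum => i _; rewrite -expr2 -real_normK ?num_real//.
  have -> : (translate (floorv x) x - y) 0 i = translate (floorv x) x 0 i - y 0 i.
    by rewrite [LHS]mxE [X in _ + X]mxE.
  by rewrite ler_sqr ?nnegrE ?normr_ge0 ?(ltW s0)//; exact: nb.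
rewrite sumr_const card_ord -[X in X < _]mulr_natl; have : 0 < s ^+ 2 by rewrite exprn_gt0.
have -> : (2 * s) ^+ 2 = 4 * s ^+ 2 by ring.
by set d := s ^+ 2; lra.
Qed.

End scale.

Lemma frac_cell x : cell x -> frac (vec3 x) = vec3 x :> E.
Proof.
move=> [c0 c1 c2]; apply/rowP => j; rewrite [LHS]mxE (_ : Num.floor (vec3 x 0 j) = 0) ?subr0//.
by apply: floor_def; move: j; apply: ord3P; rewrite ?vec3_0 ?vec3_1 ?vec3_2.
Qed.

Lemma osc_bound_family (I : finType) o (H : I -> R -> R -> E -> R) :
  (forall i, oscillating T y (r + 2) o (H i)) -> exists2 B, 0 <= B &
  forall i e t x, 0 < e <= 1 -> `|H i e t x| * e ^+ o <= B * e.
Proof.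
move=> oH; have /choice[B hB] : forall i, exists B, 0 <= B /\
    forall e t x, 0 < e <= 1 -> `|H i e t x| * e ^+ o <= B * e.
  by move=> i; have [B B0 hB] := osc_bound rho0 (oH i); exists B.
exists (\sum_i B i) => [|i e t x eI]; first by apply: sumr_ge0 => i _; have [] := hB i.
have [_ h] := hB i; apply: (le_trans (h e t x eI)); have /andP[e0 _] := eI.
rewrite ler_pM2r// (bigD1 i)//= lerDl sumr_ge0// => i' _; by have [] := hB i'.
Qed.

Section energy.
Variables (th : R -> R) (U : R -> E -> E).
Hypotheses (th_ge0 : forall s, 0 <= th s) (th_le1 : forall s, th s <= 1)
  (th0 : forall s, s <= - (2 / 3) -> th s = 0)
  (VE : forall j s x, V j s x = th s * U (s + 1) x 0 j)
  (sU : smooth_on `[0, 1[ U) (fM : (supL2 U < +oo)%E).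

(** The corrector has order 1, its gradient order 2: these are the bounds [B0]
    and [B1 / e] of [energy_bound]. *)
Lemma change_energy : exists C, forall e, small e ->
  (energy_norm T (change e) <= (supL2 U + gradL2 U) * (e `^ (1 / 2))%:E + (C * e `^ (3 / 2))%:E)%E.
Proof.
have oc j := osc_corrector T y r0 svt j.
have [B0 B00 hB0] := osc_bound_family oc.
have [B1 B10 hB1] := osc_bound_family (fun ij : 'I_3 * 'I_3 => osc_dx ij.1 (oc ij.2)).
exists (3%:R * B0 * (8%:R * (r + 2) ^+ 3) `^ 2^-1 +
  9%:R * B1 * ((8%:R * (r + 2) ^+ 3) `^ 2^-1 * (2 * (r + 2)) `^ 2^-1)) => e es.
have [e0 e1 _ _ _] := es; have eI : 0 < e <= 1 by rewrite e0.
apply: (energy_bound th_ge0 th_le1 th0 VE sU sV suppV eI r0 rho0 B00 B10 T0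
  (c := corrector T y r vt e)) => //.
- move=> j; exact: osc_smooth (oc j) eI.
- by move=> j t x; have := hB0 j e t x eI; rewrite expr1 ler_pM2r.
- move=> i j t x; have := hB1 (i, j) e t x eI; rewrite expr2 mulrA ler_pM2r// => h.
  by rewrite ler_pdivlMr.
- by move=> j t x h; exact: osc_supp (oc j) eI h.
- by move=> i j t x h; exact: osc_supp (osc_dx i (oc j)) eI h.
- move=> t x /andP[t0 tT] cx; rewrite enormE; congr l2; apply/funext => j.
  have Jt : J t by apply/JP; rewrite (ltW t0).
  by apply: (etrans (changeE e _ j Jt)); rewrite /periodizet /periodize (frac_cell cx).
move=> t x /andP[t0 tT] cx; have Jt : J t by apply/JP; rewrite (ltW t0).
rewrite grad_normE => [|i]; last exact: change_derivable.
rewrite /jac; congr l2; apply/funext => -[i j] /=.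
rewrite -dx_entry; last exact: change_derivable.
by apply: (etrans (change_dx es i j _ Jt)); rewrite translate_floorv (frac_cell cx).
Qed.

End energy.

Let of_ j := osc_force_diff T y r0 svt nu bG j.

Lemma force_change_entry e t x j : force_change e t x 0 j = force_diff T y r vt nu G e j t (frac x).
Proof. by rewrite mxE. Qed.

Lemma force_change_late e t : 0 < e <= 1 -> (r + 2) * e ^+ 2 < `|t - T| -> force_change e t = fun _ => 0.
Proof.
move=> eI h; apply/funext => x; apply/rowP => j; rewrite force_change_entry [RHS]mxE.
by apply/eqP/negPn/negP => /(osc_supp (of_ j) eI)[]; rewrite leNgt h.
Qed.

(** The force changes by at most a multiple of [e ^- 3], on a box of sides of
    order [e] in space and [e ^+ 2] in time. *)
Lemma force_change_LqLp : exists Cpq : \bar R -> \bar R -> R, forall p q : \bar R,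
  0 <= Cpq p q /\ forall e, small e -> (1 <= p)%E -> (1 <= q)%E ->
  (LqLp_norm q p (force_change e) <= (Cpq p q * e `^ alpha p q)%:E)%E.
Proof.
have [B B0 hB] := osc_bound_family of_.
exists (fun p q => 3 * B * ((2 * (r + 2)) ^+ 3) `^ fine p^-1 * (2 * (r + 2)) `^ fine q^-1) => p q'.
split; first by rewrite !mulr_ge0 ?powR_ge0.
move=> e es p1 q1; have [e0 e1 _ _ _] := es; have eI : 0 < e <= 1 by rewrite e0.
have fB j t x : `|force_change e t x 0 j| <= B / e ^+ 3.
  rewrite force_change_entry ler_pdivlMr ?exprn_gt0//.
  by rewrite -(ler_pM2r e0) -mulrA -exprSr; exact: hB.
have Lp_le t : (Lp_T3 p (force_change e t) <=
    (3 * (B / e ^+ 3) * ((2 * ((r + 2) * e)) ^+ 3) `^ fine p^-1)%:E)%E.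
  apply: (Lp_cell_bound (y := y)) => //.
  - exact: mulr_gt0.
  - by rewrite !mulr_ge0// invr_ge0 exprn_ge0// ltW.
  - move=> x _; rewrite enormE ger0_norm ?l2_ge0//.
    rewrite -[X in X%:R * _](card_ord 3); apply: l2_le => [|j]; last exact: fB.
    by rewrite divr_ge0// exprn_ge0// ltW.
  - move=> x cx; rewrite enormE => nz.
    have [j hj] : exists j, force_change e t (vec3 x) 0 j != 0.
      apply: contrapT => /forallNP h; move/eqP: nz; apply; apply: l2_0 => j.
      by apply/eqP/negPn/negP; exact: h.
    by move: hj; rewrite force_change_entry frac_cell// => /(osc_supp (of_ j) eI)[].
have Lp0 t : (0 <= Lp_T3 p (force_change e t))%E by exact: Lnorm_ge0.
set K := 3 * (B / e ^+ 3) * _ in Lp_le.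
have K0 : 0 <= K by rewrite !mulr_ge0 ?powR_ge0// invr_ge0 exprn_ge0// ltW.
have := @Lq_box_bound R q' T ((r + 2) * e ^+ 2) K
  ((fun t => Lp_T3 p (force_change e t)) \_ `]0, +oo[) q1.
move=> /(_ _ K0) h; apply: (le_trans (h _ _ _)).
- by rewrite mulr_gt0// exprn_gt0.
- move=> t; rewrite /patch; case: ifP => _; last by rewrite abse0 lee_fin.
  by rewrite gee0_abs.
- move=> t; rewrite /patch; case: ifP => [_|]; last by rewrite eqxx.
  apply: contraNT; rewrite -ltNge => ht; rewrite (force_change_late eI ht).
  rewrite eq_le; apply/andP; split; last exact: Lnorm_ge0.
  have := @Lp_cell_bound R p y (fun _ => enorm (0 : E)) 1 0 p1 ltr01 (lexx 0).
  rewrite mul0r; apply => x _; by rewrite enormE l2_0 ?normr0 ?eqxx// => j; rewrite mxE.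
rewrite lee_fin /K.
have e0' := ltW e0; have r2 := ltW rho0.
have -> : (2 * ((r + 2) * e)) ^+ 3 = (2 * (r + 2)) ^+ 3 * e ^+ 3 by ring.
have -> : 2 * ((r + 2) * e ^+ 2) = (2 * (r + 2)) * e ^+ 2 by ring.
have -> : ((2 * (r + 2)) ^+ 3 * e ^+ 3) `^ fine p^-1 = ((2 * (r + 2)) ^+ 3) `^ fine p^-1 * e `^ (3 * fine p^-1).
  by rewrite powRM ?exprn_ge0 ?mulr_ge0// powRrM powR_mulrn.
have -> : (2 * (r + 2) * e ^+ 2) `^ fine q'^-1 = (2 * (r + 2)) `^ fine q'^-1 * e `^ (2 * fine q'^-1).
  by rewrite powRM ?exprn_ge0 ?mulr_ge0// powRrM powR_mulrn.
rewrite -(powR_mulrn 3 e0').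
have -> : e `^ alpha p q' = (e `^ 3)^-1 * (e `^ (3 * fine p^-1) * e `^ (2 * fine q'^-1)).
  by rewrite -powRN -!powRD ?(gt_eqF e0) ?implybT// /alpha addrA.
by rewrite le_eqVlt; apply/orP; left; apply/eqP; ring.
Qed.

(** With amplitude [e ^- 3], gradient [e ^- 4] and volume [e ^+ 3], the choice
    [la = e ^- 2] gives [e ^ (- s - 3 / 2)] at each time; the duration
    contributes [e ^+ 2]. *)
Lemma force_change_Hs : exists2 K, 0 <= K & forall e s, small e -> 0 <= s <= 1 ->
  (L1Hs_norm s (force_change e) <= (K * e `^ (1 / 2 - s))%:E)%E.
Proof.
have [B B0 hB] := osc_bound_family of_.
have [B' B'0 hB'] := osc_bound_family (fun ij : 'I_3 * 'I_3 => osc_dx ij.1 (of_ ij.2)).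
pose W := 8%:R * (r + 2) ^+ 3.
have W0 : 0 <= W by rewrite mulr_ge0// exprn_ge0// ltW.
pose S := W * (6 * B ^+ 2 + 9 * B' ^+ 2).
have S0 : 0 <= S by rewrite mulr_ge0// addr_ge0// mulr_ge0// sqr_ge0.
exists (S `^ 2^-1 * (2 * (r + 2))); first by rewrite mulr_ge0 ?powR_ge0// mulr_ge0// ltW.
move=> e s es s01; have [e0 e1 _ _ _] := es; have eI : 0 < e <= 1 by rewrite e0.
have tT := @time_setT R; have e0' := ltW e0.
have sf j n : Cn setT n (fun t x => force_change e t x 0 j) by exact: Cn_entry tT (smooth_force_change es n).
have It t : [set: R] t by [].
have cz t j : continuous (fun x => force_change e t x 0 j) by exact: slice_cont (It t) (Cn_cont (sf j 0%N)).
have cdz t i j : continuous (dx i (fun x => force_change e t x 0 j)).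
  exact: slice_cont (It t) (Cn_cont (Cn_dx (sf j 1%N) i)).
have dz t i j x : derivable (fun x => force_change e t x 0 j) x (basis_vec i).
  by have [] := Cn_is_derive (sf j 1%N) x i (It t).
have pz t j : periodic (fun x => force_change e t x 0 j).
  by move=> x m; rewrite [LHS]mxE [RHS]mxE; exact: periodize_periodic.
have dE t i j x : dx i (fun x => force_change e t x 0 j) x = dx i (force_diff T y r vt nu G e j t) (frac x).
  rewrite -translate_floorv -(dx_periodize k0 i x (near_force es j) (It t)); congr (dx i _ x).
  by apply/funext => z; rewrite mxE.
have s0 : 0 < (r + 2) * e by exact: mulr_gt0.
have hA t j : int_T3 (fun x => force_change e t x 0 j ^+ 2) <= (B / e ^+ 3) ^+ 2 * (2 * ((r + 2) * e)) ^+ 3.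
  apply: (@int_T3_box_le _ _ y) => //.
  - by under eq_fun do rewrite expr2; exact: contM.
  - exact: sqr_ge0.
  - by move=> x; exact: sqr_ge0.
  - move=> x cx; rewrite force_change_entry -real_normK ?num_real// ler_sqr ?nnegrE ?divr_ge0 ?exprn_ge0//.
    rewrite ler_pdivlMr ?exprn_gt0// -(ler_pM2r e0) -mulrA -exprSr; exact: hB.
  - move=> x cx; rewrite sqrf_eq0 force_change_entry frac_cell//.
    by move=> /(osc_supp (of_ j) eI)[].
have hD t i j : int_T3 (fun x => dx i (fun x => force_change e t x 0 j) x ^+ 2) <=
    (B' / e ^+ 4) ^+ 2 * (2 * ((r + 2) * e)) ^+ 3.
  apply: (@int_T3_box_le _ _ y) => //.
  - by under eq_fun do rewrite expr2; exact: contM.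
  - exact: sqr_ge0.
  - by move=> x; exact: sqr_ge0.
  - move=> x cx; rewrite dE -real_normK ?num_real// ler_sqr ?nnegrE ?divr_ge0 ?exprn_ge0//.
    rewrite ler_pdivlMr ?exprn_gt0// -(ler_pM2r e0) -mulrA -exprSr; exact: (hB' (i, j)).
  - move=> x cx; rewrite sqrf_eq0 dE frac_cell// => h.
    by have [] := osc_supp (osc_dx i (of_ j)) eI h.
have la1 : 1 <= (e ^+ 2)^-1 by rewrite invf_ge1 ?exprn_gt0// exprn_ile1.
have Hs_le t : (Hs_norm s (force_change e t) <= (S `^ 2^-1 * e `^ (- s - 3 / 2))%:E)%E.
  apply: (le_trans (Hs_bound (cz t) (dz t) (cdz t) (pz t) (hA t) (hD t) s01 la1)).
  rewrite lee_fin.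
  have -> : S `^ 2^-1 * e `^ (- s - 3 / 2) = (S * e `^ (- (2 * s) - 3)) `^ 2^-1.
    by rewrite powRM ?powR_ge0// -powRrM; congr (_ * _ `^ _); field.
  have l1 : (e ^+ 2)^-1 `^ s = e `^ (- (2 * s)).
    by rewrite -powR_mulrn// -powRN -powRrM mulNr.
  have l2 : (e ^+ 2)^-1 `^ (s - 1) = e `^ (- (2 * s)) * e ^+ 2.
    rewrite -!powR_mulrn// -powRN -powRrM -powRD ?(gt_eqF e0) ?implybT//.
    by congr (_ `^ _); ring.
  have l3 : e `^ (- (2 * s) - 3) = e `^ (- (2 * s)) / e ^+ 3.
    by rewrite -powR_mulrn// -powRN -powRD// (gt_eqF e0) implybT.
  apply: ge0_ler_powR; rewrite ?nnegrE ?invr_ge0//.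
  - have D3 : 0 <= (2 * ((r + 2) * e)) ^+ 3 by rewrite exprn_ge0// mulr_ge0// ltW.
    have P1 := mulr_ge0 (sqr_ge0 (B / e ^+ 3)) D3; have P2 := mulr_ge0 (sqr_ge0 (B' / e ^+ 4)) D3.
    apply: addr_ge0; first by apply: mulr_ge0; [exact: powR_ge0|exact: mulr_ge0].
    by apply: mulr_ge0; [exact: powR_ge0|apply: addr_ge0; exact: mulr_ge0].
  - by rewrite mulr_ge0// powR_ge0.
  rewrite l1 l2 l3 /S /W; set h := e `^ _.
  have h0 : 0 <= h by exact: powR_ge0.
  have -> : h * (3 * ((B / e ^+ 3) ^+ 2 * (2 * ((r + 2) * e)) ^+ 3)) + h * e ^+ 2 *
      (3 * ((B / e ^+ 3) ^+ 2 * (2 * ((r + 2) * e)) ^+ 3) + 9 * ((B' / e ^+ 4) ^+ 2 * (2 * ((r + 2) * e)) ^+ 3)) =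
    (8 * (r + 2) ^+ 3) * (3 * B ^+ 2 + 3 * (B ^+ 2 * e ^+ 2) + 9 * B' ^+ 2) * (h / e ^+ 3).
    by field; exact: lt0r_neq0.
  apply: ler_wpM2r; first by rewrite divr_ge0// exprn_ge0.
  apply: ler_wpM2l => //; rewrite lerD2r.
  have : B ^+ 2 * e ^+ 2 <= B ^+ 2 by rewrite ler_piMr ?sqr_ge0// exprn_ile1.
  by set u1 := B ^+ 2; set u2 := _ * _; lra.
set K := S `^ 2^-1 * _ in Hs_le.
have K0 : 0 <= K by rewrite mulr_ge0// powR_ge0.
have Hs0 z : (0 <= Hs_norm s z)%E by exact: poweR_ge0.
have := @Lq_box_bound R 1%E T ((r + 2) * e ^+ 2) K
  ((fun t => Hs_norm s (force_change e t)) \_ `]0, +oo[) (lexx _).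
move=> /(_ _ K0) h; apply: (le_trans (h _ _ _)).
- by rewrite mulr_gt0// exprn_gt0.
- move=> t; rewrite /patch; case: ifP => _; last by rewrite abse0 lee_fin.
  by rewrite gee0_abs.
- move=> t; rewrite /patch; case: ifP => [_|]; last by rewrite eqxx.
  apply: contraNT; rewrite -ltNge => ht; have z0 := force_change_late eI ht.
  rewrite eq_le Hs0 andbT.
  have zA j : int_T3 (fun x => force_change e t x 0 j ^+ 2) <= 0.
    by rewrite z0; under eq_fun do rewrite mxE expr0n; rewrite int_T3_cst.
  have zB i j : int_T3 (fun x => dx i (fun x => force_change e t x 0 j) x ^+ 2) <= 0.
    rewrite z0; under eq_fun => x do under eq_fun do rewrite mxE.
    by under eq_fun do rewrite dx_zero expr0n; rewrite int_T3_cst.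
  have := Hs_bound (cz t) (dz t) (cdz t) (pz t) zA zB s01 la1.
  by rewrite !mulr0 addr0 !mulr0 addr0 powR0 ?invr_eq0// pnatr_eq0.
rewrite lee_fin inve1 /= powRr1 ?mulr_ge0 ?exprn_ge0 ?(ltW rho0)//.
rewrite /K (_ : 1 / 2 - s = - s - 3 / 2 + 2); last by field.
have -> : e `^ (- s - 3 / 2 + 2) = e `^ (- s - 3 / 2) * e ^+ 2.
  by rewrite -(powR_mulrn 2 e0') -powRD// (gt_eqF e0) implybT.
by rewrite le_eqVlt; apply/orP; left; apply/eqP; ring.
Qed.

Lemma force_change_Hs_neg s : s < 0 -> exists2 K, 0 <= K & forall e, small e ->
  (L1Hs_norm s (force_change e) <= (K * e `^ (1 / 2))%:E)%E.
Proof.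
move=> s0; have [K K0 hK] := force_change_Hs; exists K => // e es.
have := hK e 0 es; rewrite lexx ler01 subr0 => /(_ isT); apply: le_trans.
apply: le_Lnorm => // t; rewrite /patch; case: ifP => // _.
have H0 s' z : (0 <= @Hs_norm R s' z)%E by exact: poweR_ge0.
by rewrite !gee0_abs//; apply: Hs_neg_le; exact: ltW.
Qed.

Section blowup.
Variables (th : R -> R) (U : R -> E -> E).
Hypotheses (th1 : forall s, - (1 / 3) <= s -> th s = 1)
  (VE : forall j s x, V j s x = th s * U (s + 1) x 0 j) (sU : smooth_on `[0, 1[ U)
  (blowup : limf_esup (fun t => Lp_R3 +oo (U t)) (1 : R)^'- = +oo%E).

(** Where the late block does not vanish it is the whole velocity, by
    [glued_dichotomy]. *)
Lemma velocity_near_block e t x : small e -> J t -> - (1 / 3) <= (t - T) / e ^+ 2 ->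
  enorm (U ((t - T) / e ^+ 2 + 1) (e^-1 *: (x - y))) != 0 ->
  (forall i, k <= x 0 i <= 1 - k) /\
  enorm (velocity e t x) = e^-1 * enorm (U ((t - T) / e ^+ 2 + 1) (e^-1 *: (x - y))).
Proof.
move=> es Jt ht nz; have [e0 e1 _ eb _] := es; have eI : 0 < e <= 1 by rewrite e0.
have WE j : rescaled_velocity T y V e j t x = e^-1 * U ((t - T) / e ^+ 2 + 1) (e^-1 *: (x - y)) 0 j.
  by rewrite /rescaled_velocity /zoom VE th1// mul1r.
have [j hj] : exists j, rescaled_velocity T y V e j t x != 0.
  apply: contrapT => /forallNP h; move/eqP: nz; apply; rewrite enormE; apply: l2_0 => j.
  apply/eqP/negPn/negP => hj; apply: (h j); rewrite WE; apply: mulf_neq0 => //.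
  by rewrite invr_eq0 gt_eqF.
have hx : forall i, k <= x 0 i <= 1 - k.
  by have [_] := rescaled_box es ((LTP t).1 (JLT Jt)) (@suppV j) hj; exact: box_inside es _.
split => //.
have fx : frac x = x.
  apply/rowP => i; rewrite [LHS]mxE (_ : Num.floor (x 0 i) = 0) ?subr0//.
  apply: floor_def; rewrite add0r mulr1z; have /andP[a1 a2] := hx i; apply/andP; split.
    exact: le_trans (ltW k0) a1.
  by apply: (le_lt_trans a2); rewrite ltrBlDr ltrDl.
have vc i : vj i t x - corrector T y r vt e i t x = 0.
  have [h|h] := glued_dichotomy y svt dvt suppV eI (v := vj) eb vvt x Jt.
    by move: hj; rewrite (nbhs_singleton (h j)) eqxx.
  exact: nbhs_singleton (h i).
rewrite !enormE -l2_scale ?invr_ge0 ?(ltW e0)//; congr l2; apply/funext => i.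
by rewrite velocityE /periodizet /periodize fx /glued_velocity vc add0r WE.
Qed.

Lemma block_time e s : small e -> 2 / 3 <= s < 1 ->
  [/\ J (T + e ^+ 2 * (s - 1)), ((T + e ^+ 2 * (s - 1)) - T) / e ^+ 2 = s - 1 & - (1 / 3) <= s - 1].
Proof.
move=> [e0 _ _ _ eT] /andP[s0 s1]; have e2 : 0 < e ^+ 2 by rewrite exprn_gt0.
split; last by lra.
  apply/JP; rewrite gtrDl pmulr_rlt0// subr_lt0 s1 andbT.
  have h1 : e ^+ 2 * (1 - s) <= e ^+ 2 * 1 by apply: ler_wpM2l; [exact: ltW|lra].
  have h2 : e ^+ 2 <= (r + 2) * e ^+ 2 by rewrite ler_peMl ?(ltW e2)//; move: r0; lra.
  have -> : T + e ^+ 2 * (s - 1) = T - e ^+ 2 * (1 - s) by ring.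
  rewrite subr_ge0; apply: (le_trans h1); rewrite mulr1; exact: le_trans h2 (ltW eT).
by rewrite addrAC subrr add0r mulrC mulKf// gt_eqF.
Qed.

(** The essential supremum is invariant under the change of variables, so only
    the amplitude [e^-1] remains. *)
Lemma velocity_sup_ge e s : small e -> 2 / 3 <= s < 1 ->
  (e^-1%:E * Lp_R3 +oo (U s) <= Lp_T3 +oo (velocity e (T + e ^+ 2 * (s - 1)))%R)%E.
Proof.
move=> es s01; have [Jt tE s13] := block_time es s01; have [e0 _ _ _ _] := es.
set t := T + _ in Jt tE *; have ei : 0 < e^-1 by rewrite invr_gt0.
pose h (x : R * R * R) : R := enorm (U s (vec3 x)).
have -> : Lp_R3 +oo (U s) = 'N[(@leb3 R)]_+oo[EFin \o h]%E by rewrite /Lp_R3 /Lp_on patch_setT.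
have Is : `[0, 1[%classic s by move: s01 => /andP[s0 s1]; rewrite /= in_itv /= s1 andbT; move: s0; lra.
have mh : measurable_fun setT h.
  apply: (@continuous_measurable3 R (fun z => enorm (U s z))); rewrite (_ : (fun x => enorm (U s x)) = (fun x => l2 (fun j => U s x 0 j))).
    apply: continuous_l2 => j.
    have cU : Cn `[0, 1[ 0 (fun t x => U t x 0 j) by apply: Cn_entry (sU 0%N); exact: time_set_bo.
    exact: (slice_cont Is (Cn_cont cU)).
  by apply/funext => x; exact: enormE.
have e3 : 0 < e ^+ 3 by rewrite exprn_gt0.
apply: (le_trans (Lnorm_oo_scale (scales_zoom_point y e0) e3 ei mh _)); first by move=> x; exact: sqrtr_ge0.
apply: le_Lnorm => [|x]; first exact: leey.
have -> : h (zoom_point y e x) = enorm (U s (e^-1 *: (vec3 x - y))) by rewrite /h vec3_zoom_point.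
have [->|nz] := eqVneq (enorm (U s (e^-1 *: (vec3 x - y)))) 0; first by rewrite mulr0 abse0.
have [] := @velocity_near_block e t (vec3 x) es Jt; rewrite ?tE ?subrK// => hx Ev.
have cx : cell x.
  have hi i : 0 <= vec3 x 0 i < 1.
    have /andP[a1 a2] := hx i; apply/andP; split; first exact: le_trans (ltW k0) a1.
    by apply: (le_lt_trans a2); rewrite ltrBlDr ltrDl.
  by split; [have := hi ord0; rewrite vec3_0|have := hi (lift ord0 ord0); rewrite vec3_1|
    have := hi (lift ord0 (lift ord0 ord0)); rewrite vec3_2].
by rewrite /patch (mem_set cx) Ev.
Qed.

Lemma velocity_blowup e : small e -> limf_esup (fun t => Lp_T3 +oo (velocity e t)) T^'- = +oo%E.
Proof.
move=> es; have [e0 _ _ _ _] := es; have e2 : 0 < e ^+ 2 by rewrite exprn_gt0.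
apply/limf_esup_pinfty => A [d /= d0 hd].
pose A' := [set s | 2 / 3 <= s < 1 /\ A (T + e ^+ 2 * (s - 1))].
have FA' : (1 : R)^'- A'.
  have h1 : (2 / 3 : R) < 1 by lra.
  have h2 : 1 - d / e ^+ 2 < 1 by rewrite ltrBlDr ltrDl divr_gt0.
  suff : \forall s \near (1 : R), s < 1 -> A' s by [].
  apply: filterS2 (near_gt h1) (near_gt h2) => s s1 s2 s3; split; first by rewrite (ltW s1).
  apply: hd; last by rewrite /= gtrDl pmulr_rlt0// subr_lt0.
  rewrite /ball_ /= opprD addrA subrr add0r normrN normrM (gtr0_norm e2) mulrC -ltr_pdivlMr//.
  by rewrite ltr0_norm ?subr_lt0//; move: s2; set m := _ / _; lra.
have := (limf_esup_pinfty _ _).1 blowup A' FA'.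
set S := ereal_sup _ => S'; set S2 := ereal_sup _.
have : (e^-1%:E * S <= S2)%E.
  rewrite -lee_pdivlMl ?invr_gt0// ge_ereal_sup// => _ [s [s01 As] <-].
  rewrite lee_pdivlMl ?invr_gt0//; apply: (le_trans (velocity_sup_ge es s01)).
  by apply: ereal_sup_ubound; exists (T + e ^+ 2 * (s - 1)).
by rewrite S' gt0_muley ?lte_fin ?invr_gt0// leye_eq => /eqP.
Qed.

(** A solution living beyond [T] would coincide with this one before [T] by
    uniqueness; being continuous on a compact space-time set it would be
    bounded there, against the blow-up. *)
Lemma velocity_lifespan e : 0 <= nu -> small e -> Tmax nu a (force e) = T%:E.
Proof.
move=> nu0 es; apply/eqP; rewrite eq_le; apply/andP; split; last first.
  apply: ereal_sup_ubound; exists T => //; split => //.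
  by exists (velocity e), (pressure e); exact: NS_velocity.
apply: ge_ereal_sup => _ [tau [tau0 [u [p NSu]]] <-]; rewrite lee_fin leNgt; apply/negP => Ttau.
pose I : set R := `[0, tau[%classic.
have tI : time_set I by exact: time_set_bo.
have JI : J `<=` I by move=> t /JP/andP[t0 tT]; rewrite /I /= in_itv /= t0 (lt_trans tT).
have nJI t : J t -> \forall s \near t, J s <-> I s.
  move=> /JP/andP[_ tT]; apply: filterS (near_lt tT) => s sT.
  by rewrite /I /= !in_itv /= sT (lt_trans sT Ttau).
have NSe := NS_velocity es; have NSr := NS_restrict JI nJI NSu.
have uI n j : Cn I n (fun t x => u t x 0 j) by exact: Cn_entry tI (NS_smooth_u NSu n).
have eq_u j t x : J t -> velocity e t x 0 j = u t x 0 j.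
  have h1 := (NS_eqnsP tJ (NS_smooth_u NSe 2%N) nu (force e) (pressure e)).1 (NS_equations NSe).
  have h2 := (NS_eqnsP tJ (NS_smooth_u NSr 2%N) nu (force e) p).1 (NS_equations NSr).
  apply: (@smooth_solutions_agree R nu T (fun j t x => velocity e t x 0 j) (fun j t x => u t x 0 j)
    (pressure e) p nu0) => {j t x}.
  - by move=> j n; exact: Cn_entry tJ (NS_smooth_u NSe n).
  - by move=> j n; exact: Cn_entry tJ (NS_smooth_u NSr n).
  - exact: NS_smooth_p NSe.
  - exact: NS_smooth_p NSr.
  - by move=> t Jt j x m; rewrite (NS_periodic_u NSe Jt x m).
  - by move=> t Jt j x m; rewrite (NS_periodic_u NSr Jt x m).
  - by move=> t Jt; exact: (NS_periodic_p NSe Jt).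
  - by move=> t Jt; exact: (NS_periodic_p NSr Jt).
  - by move=> j t x Jt; have [-> _] := h1 t x Jt; have [-> _] := h2 t x Jt.
  - by move=> t x Jt; have [] := h1 t x Jt.
  - by move=> t x Jt; have [] := h2 t x Jt.
  - by move=> j x; rewrite (NS_initial NSe) (NS_initial NSr).
have /choice[M hM] : forall j : 'I_3, exists M, 0 <= M /\
    forall t x, `[0, T]%classic t -> cube x -> `|u t x 0 j| <= M.
  move=> j; have [|M M0 hM] := @joint_cont_bounded R I (fun t x => u t x 0 j) `[0, T]%classic cube
      (Cn_cont (uI 0%N j)) _ (@segment_compact R 0 T) (@cube_compact R); last by exists M.
  by move=> t; rewrite /I /= !in_itv /= => /andP[-> /le_lt_trans]; exact.
pose B := \sum_j M j; have B0 : 0 <= B by apply: sumr_ge0 => j _; have [] := hM j.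
have bnd t : J t -> (Lp_T3 +oo (velocity e t) <= (3 * B)%:E)%E.
  move=> Jt; have B3 : 0 <= 3 * B by rewrite mulr_ge0.
  have := @Lnorm_box_bound _ _ R (@leb3 R) +oo%E ((fun x => (enorm (velocity e t (vec3 x)))%:E) \_ cell)
    (@cell R) (3 * B) 1 (leey _) (@measurable_cell R) B3 (@leb3_cell R) ltr01.
  rewrite powR1 mulr1; apply => x cx; rewrite /patch; last by rewrite (memNset cx).
  rewrite (mem_set cx) /= lee_fin enormE ger0_norm ?l2_ge0//.
  rewrite -[X in X%:R * _](card_ord 3); apply: l2_le => // j; rewrite eq_u//.
  have [_ h] := hM j; apply: (@le_trans _ _ (M j)).
    apply: h; last exact: vec3_cell_cube.
    by move/JP: Jt => /andP[t0 tT]; rewrite /= in_itv /= t0 ltW.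
  by rewrite /B (bigD1 j)//= lerDl sumr_ge0// => j' _; have [] := hM j'.
have FJ : T^'- J.
  suff : \forall t \near T, t < T -> J t by [].
  by apply: filterS (near_gt T0) => t t0 tT; apply/JP; rewrite ltW.
have := (limf_esup_pinfty _ _).1 (velocity_blowup es) J FJ.
have : (ereal_sup [set Lp_T3 +oo (velocity e t) | t in J] <= (3 * B)%:E)%E.
  by apply: ge_ereal_sup => _ [t Jt <-]; exact: bnd.
by move=> /[swap] ->; rewrite leye_eq.
Qed.

End blowup.

End Assembly.

(** * The block and the background flow *)

Section Preparation.
Context {R : realType}.
Local Notation E := 'rV[R]_3.
Local Notation L := (`]-oo, 0[%classic : set R).
Local Notation O := (`]-1, 0[%classic : set R).

(** The building block moved to the times [-1 < s < 0], blowing up at 0, and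
    switched on by the ramp [th]: its velocity [V], force [G] and pressure [Q]
    are defined for all negative times and vanish for [s <= - (2 / 3)]. *)
Record ramped_block (nu : R) (U : R -> E -> E) (r : R) (th : R -> R)
    (V G : 'I_3 -> R -> E -> R) (Q : R -> E -> R) : Prop := {
  rb_radius : 0 <= r ;
  rb_ge0 : forall s, 0 <= th s ;
  rb_le1 : forall s, th s <= 1 ;
  rb_off : forall s, s <= - (2 / 3) -> th s = 0 ;
  rb_on : forall s, - (1 / 3) <= s -> th s = 1 ;
  rb_velocity : forall j s x, V j s x = th s * U (s + 1) x 0 j ;
  rb_force : forall j, bump (r + 2) (G j) ;
  rb_smooth_V : forall j, smooth_on L (V j) ;
  rb_smooth_Q : smooth_on L Q ;
  rb_momentum : forall j s x, L s -> momentum nu L V Q j s x = G j s x ;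
  rb_div : forall s x, L s -> divergence (fun j => V j s) x = 0 ;
  rb_supp_V : forall j s x, L s -> V j s x != 0 -> - (2 / 3) < s /\ box 0 r x ;
  rb_supp_Q : forall s x, L s -> Q s x != 0 -> - (2 / 3) < s /\ box 0 r x }.

Definition later (f : R -> E -> R) (s : R) : E -> R := f (s + 1).

Lemma Cn_later n (I J : set R) f : time_set I -> (forall s, I s -> J (s + 1)) -> Cn J n f -> Cn I n (later f).
Proof.
move=> tI IJ fn; have IJ' s : I s -> J (1 * s + 1) by rewrite mul1r; exact: IJ.
apply: Cn_ext (Cn_affine 0 (const_mx 1) (oner_neq0 _) tI IJ' fn) => t x _.
by rewrite /later mul1r; congr (f _ _); apply/rowP => j; rewrite !mxE add0r mul1r.
Qed.

Lemma dt_later (I J : set R) f s x : time_set I -> (forall s, I s -> J (s + 1)) -> I s -> Cn J 1 f ->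
  dt I (later f) s x = dt J f (s + 1) x.
Proof.
move=> tI IJ Is fn; have IJ' s' : I s' -> J (1 * s' + 1) by rewrite mul1r; exact: IJ.
have xE (z : E) : coord_affine 0 (const_mx 1) z = z.
  by apply/rowP => j; rewrite !mxE add0r mul1r.
have fE : (fun t x => f (1 * t + 1) (coord_affine 0 (const_mx 1) x)) = later f.
  by apply/funext => t; apply/funext => z; rewrite mul1r xE.
apply: has_dt_uniq => //.
have D := @Cn_has_dt _ _ _ _ _ fn (1 * s + 1) (coord_affine 0 (const_mx 1) x) (IJ' _ Is).
have := has_dt_affine (oner_neq0 _) IJ' D; rewrite fE mul1r.
by rewrite mul1r xE.
Qed.

Lemma coord_bounded (K : set E) : compact K -> exists2 M, 0 <= M & forall x, K x -> box 0 M x.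
Proof.
move=> cK; have /choice[M hM] : forall i : 'I_3, exists M, 0 <= M /\ forall x : E, K x -> `|x 0 i| <= M.
  move=> i; have cx : Cn setT 0 (fun (_ : R) (x : E) => x 0 i).
    by apply: (@Cn_smooth1_coord _ 0 _ id); [exact: time_setT|exact: smooth1_id].
  have [M M0 h] := joint_cont_bounded (Cn_cont cx) (@subsetT _ _) (@segment_compact R 0 0) cK.
  by exists M; split => // x Kx; apply: (h 0) => //; rewrite /= in_itv /= lexx.
exists (\sum_i M i) => [|x Kx i]; first by apply: sumr_ge0 => i _; have [] := hM i.
rewrite mxE subr0; have [_ h] := hM i; apply: (le_trans (h x Kx)).
by rewrite (bigD1 i)//= lerDl sumr_ge0// => i' _; have [] := hM i'.
Qed.

Lemma spacetime_bounded (K : set (R * E)) : compact K ->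
  exists2 M, 0 <= M & forall t x, K (t, x) -> `|t| <= M /\ box 0 M x.
Proof.
move=> cK; have c1 : compact (fst @` K).
  by apply: continuous_compact => //; apply: continuous_subspaceT => z; exact: cvg_fst.
have c2 : compact (snd @` K).
  by apply: continuous_compact => //; apply: continuous_subspaceT => z; exact: cvg_snd.
have [M M0 hM] := coord_bounded c2.
have ct : Cn setT 0 (fun (t : R) (_ : E) => t).
  by apply: (@Cn_smooth1_time _ 0 _ id); [exact: time_setT|exact: smooth1_id].
have [M' M'0 hM'] := joint_cont_bounded (Cn_cont ct) (@subsetT _ _) c1 c2.
exists (M + M') => [|t x Kx]; first exact: addr_ge0.
split=> [|i].
  apply: (@le_trans _ _ M'); last by rewrite lerDr.
  by apply: (hM' t x); exists (t, x).
by apply: le_trans (hM x _ i) _; [exists (t, x)|rewrite lerDl].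
Qed.

Lemma ramped_block_exists nu U P F : building_block nu U P F ->
  exists r th V G Q, ramped_block nu U r th V G Q.
Proof.
move=> UPF; pose th (s : R) := step (3 * s + 2) : R.
have sth : smooth1 th by exact: smooth1_affine (@smooth1_step R).
have [th' sth' dth] := smooth1_der sth.
have th0 s : s <= - (2 / 3) -> th s = 0 by move=> h; apply: step0; lra.
have th1 s : - (1 / 3) <= s -> th s = 1 by move=> h; apply: step1; lra.
have [K [cK hK]] := bb_supp UPF; have [r1 r10 hr1] := coord_bounded cK.
have [KF [cKF _ hKF]] := bb_supp_F UPF; have [r2 r20 hr2] := spacetime_bounded cKF.
pose r := r1 + r2; have r0 : 0 <= r by exact: addr_ge0.
(* the margin 2 in the radius [r + 2] absorbs the time shift by 1 and leaves the
   corrector space around the block *)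
have t1 : time_set (`[0, 1[%classic : set R) by exact: time_set_bo.
have tO : time_set O by exact: time_set_oo.
have OI s : O s -> (`[0, 1[%classic : set R) (s + 1).
  by rewrite /= !in_itv /= => /andP[h1 h2]; apply/andP; split; move: h1 h2; lra.
pose u j := later (fun t x => U t x 0 j); pose p := later P.
pose f j := later (fun t x => F t x 0 j).
have sU n j : Cn (`[0, 1[%classic : set R) n (fun t x => U t x 0 j).
  exact: Cn_entry t1 (bb_smooth_U UPF n).
have su j : smooth_on O (u j) by move=> n; exact: Cn_later tO OI (sU n j).
have sp : smooth_on O p by move=> n; exact: Cn_later tO OI (bb_smooth_P UPF n).
have sf j : smooth_on setT (f j).
  move=> n; apply: (@Cn_later n setT setT) => //; first exact: time_setT.
  by apply: Cn_entry (bb_smooth_F UPF n); exact: time_setT.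
have eqs := (NS_eqnsP t1 (bb_smooth_U UPF 2%N) nu F P).1 (bb_equations UPF).
have mom j s x : O s -> momentum nu O u p j s x = f j s x.
  move=> Os; rewrite /momentum (dt_later x tO OI Os (sU 1%N j)).
  by have [h _] := eqs (s + 1) x (OI s Os); exact: h j.
have dv s x : O s -> divergence (fun j => u j s) x = 0.
  by move=> Os; have [_] := eqs (s + 1) x (OI s Os).
have inK s x : O s -> (supp (U (s + 1)) `|` supp (P (s + 1))) x -> box 0 r x.
  move=> Os h i; have /OI := Os; rewrite /= in_itv /= => Is.
  by apply: le_trans (hr1 x (hK _ Is _ h) i) _; rewrite lerDl.
have suppu j s x : O s -> u j s x != 0 -> box 0 r x.
  move=> Os h; apply: (inK s x Os); left; apply: subset_closure => /=.
  by apply: contra_neq h; rewrite /u /later => ->; rewrite mxE.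
have suppp s x : O s -> p s x != 0 -> box 0 r x.
  by move=> Os h; apply: (inK s x Os); right; exact: subset_closure.
have suppf j s x : f j s x != 0 -> `|s| <= r + 2 /\ box 0 (r + 2) x.
  move=> h; have KFx : KF (s + 1, x).
    apply: contrapT => nK; move/eqP: h; apply.
    by rewrite /f /later hKF// mxE.
  have [h1 h2] := hr2 _ _ KFx; split => [|i].
    have -> : s = (s + 1) - 1 by ring.
    apply: (le_trans (ler_normB _ _)); rewrite normr1.
    by move: h1 r10; rewrite /r; set a := `|_|; lra.
  by apply: (le_trans (h2 i)); rewrite /r; move: r10; lra.
exists r, th, (fun j => ramped th (u j)), (ramp_force u f th th'), (ramped th p); split => //.
- by move=> s; exact: step_ge0.
- by move=> s; exact: step_le1.
- move=> j; split; first exact: (ramp_force_smooth sth sth' dth th0 th1 su sf j).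
  by move=> s x h; exact: (ramp_force_supp r0 dth th0 th1 suppu suppf h).
- by move=> j; exact: (ramped_smooth sth th0 (su j)).
- exact: (ramped_smooth sth th0 sp).
- by move=> j s x Ls; exact: (ramped_momentum dth th0 th1 su sp mom j x Ls).
- by move=> s x Ls; exact: (ramped_div th0 su dv x Ls).
- by move=> j s x; exact: (ramped_supp th0 suppu).
- by move=> s x; exact: (ramped_supp_p th0 suppp).
Qed.

(** The background velocity near time [T], cut off in time so that it is
    defined and solenoidal for all times. *)
Lemma background nu (T delta : R) a g v q : 0 < T -> 0 < delta ->
  NS_solution nu `[0, T + delta] a g v q ->
  exists (b : R) (vt : 'I_3 -> R -> E -> R), [/\ 0 < b, forall j, smooth_on setT (vt j),
    forall t x, divergence (fun j => vt j t) x = 0 &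
    forall j t x, `|t - T| <= b -> v t x 0 j = vt j t x].
Proof.
move=> T0 d0 NSv; pose b := Num.min T delta / 4.
have [bT bd] : b <= T / 4 /\ b <= delta / 4 by split; rewrite ler_pM2r// ge_min lexx ?orbT.
have b0 : 0 < b by rewrite divr_gt0// lt_min T0.
have lt : b < 2 * b by move: b0; lra.
pose W : set R := `]0, T + delta[%classic; have tW : time_set W by exact: time_set_oo.
pose eta (t : R) := plateau b (2 * b) (1 * t - T).
have seta : smooth1 eta by apply: (smooth1_affine 1 (- T)); exact: smooth1_plateau.
pose vt (j : 'I_3) t (x : E) : R := eta t * v t x 0 j.
have WI : W `<=` `[0, T + delta].
  by move=> t; rewrite /W /= !in_itv /= => /andP[h1 h2]; rewrite (ltW h1) (ltW h2).
have nW t : W t -> \forall s \near t, W s <-> `[0, T + delta]%classic s.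
  rewrite {1}/W /= in_itv /= => h; apply: filterS (near_oo h) => s hs.
  by split => [/WI//|_]; rewrite /W /= in_itv.
have vW n j : Cn W n (fun t x => v t x 0 j).
  by apply: Cn_entry tW _; exact: Cn_restrict nW (NS_smooth_u NSv n).
have inW t : `|t - T| < 3 * b -> W t.
  rewrite ltr_norml => /andP[h1 h2]; rewrite /W /= in_itv /=.
  by apply/andP; split; move: h1 h2 bT bd T0 d0; lra.
have eta0 t : 2 * b <= `|t - T| -> eta t = 0 by move=> h; rewrite /eta mul1r plateau0.
have nd t (c : R) : c < `|t - T| -> \forall s \near t, c < `|s - T|.
  by move=> h; exact: (@near_out R T c 0 id t h).
exists b, vt; split => //.
- move=> j n; apply: Cn_local => t x _; have [h|h] := ltP `|t - T| (3 * b).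
    exists W, (vt j); split.
    + by apply: Cn_mul => //; apply: Cn_smooth1_time.
    + have Wt := inW t h; have := Wt; rewrite /W /= in_itv /= => ht.
      by apply: filterS (near_oo ht) => s hs; split => // _; rewrite /W /= in_itv.
    + exact: filterE.
  exists setT, (fun _ _ => 0); split.
  + by apply: Cn_cst; exact: time_setT.
  + exact: filterE.
  + have h' : 2 * b < `|t - T| by apply: lt_le_trans h; move: b0; lra.
    have c : z.1 @[z --> (t, x)] --> t by exact: cvg_fst.
    have cn : \forall z \near (t, x), 2 * b < `|z.1 - T| by exact: c (nd _ _ h').
    apply: filterS cn => -[s z] /= hs _.
    by rewrite /vt eta0 ?mul0r// ltW.
- move=> t x; have [h|h] := ltP `|t - T| (2 * b); last first.
    rewrite /divergence big1// => i _.
    have -> : vt i t = (fun _ => 0) by apply/funext => z; rewrite /vt eta0// mul0r.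
    exact: dx_zero.
  have Wt : W t by apply: inW; apply: lt_le_trans h _; move: b0; lra.
  have dv : divergence (fun j x => v t x 0 j) x = 0.
    rewrite -(div_entry (NS_smooth_u NSv 2%N) x (WI _ Wt)).
    by have [] := NS_equations NSv x (WI _ Wt).
  rewrite /divergence; under eq_bigr => i _.
    rewrite dx_scale; last by have [] := Cn_is_derive (vW 1%N i) x i Wt.
    over.
  by rewrite -mulr_sumr (_ : \sum_i _ = 0) ?mulr0//; exact: dv.
move=> j t x h; rewrite /vt /eta mul1r plateau1 ?mul1r//.
Qed.

(** The centre is pulled towards the centre of the cell. This moves each
    coordinate by at most [r0 / 2], hence the point by at most [sqrt 3 / 2 *
    r0 < 7 / 8 * r0]. *)
Lemma centred_ball (x0 : E) (r0 : R) : 0 < r0 -> r0 <= 1 / 2 -> exists y : E,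
  (forall i, 2 * (r0 / 4) <= y 0 i <= 1 - 2 * (r0 / 4)) /\
  forall rho, rho <= r0 / 8 -> torus_ball y rho `<=` torus_ball x0 r0.
Proof.
move=> r00 r01; pose y : E := \row_i ((1 - r0) * frac x0 0 i + r0 / 2).
exists y; split=> [i|rho hrho x [k hk]].
  have /andP[f0 f1] := frac_itv x0 i; rewrite mxE.
  have h : (1 - r0) * frac x0 0 i <= (1 - r0) * 1 by rewrite ler_wpM2l ?ltW//; move: r01; lra.
  have h' : 0 <= (1 - r0) * frac x0 0 i by rewrite mulr_ge0//; move: r01; lra.
  by apply/andP; split; move: h h'; set m := _ * frac x0 0 i; lra.
exists (k + floorv x0).
have -> : x + int_vec (k + floorv x0) - x0 = (x + int_vec k - y) + (y - frac x0).
  by apply/rowP => i; rewrite !mxE intrD; ring.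
have tri (p q' : E) : enorm (p + q') <= enorm p + enorm q'.
  rewrite !enormE; apply: le_trans (l2D _ _); rewrite le_eqVlt; apply/orP; left; apply/eqP.
  by congr l2; apply/funext => i; rewrite mxE.
apply: (le_lt_trans (tri _ _)).
have h7 : enorm (y - frac x0) <= 7 / 8 * r0.
  have e0 : 0 <= enorm (y - frac x0) by exact: sqrtr_ge0.
  have p0 : 0 <= 7 / 8 * r0 by rewrite mulr_ge0 ?ltW.
  rewrite -ler_sqr ?nnegrE// enormE l2_sq.
  apply: (@le_trans _ _ (\sum_(i : 'I_3) (r0 / 2) ^+ 2)).
    apply: ler_sum => i _; have /andP[f0 f1] := frac_itv x0 i.
    have -> : (y - frac x0) 0 i = r0 / 2 - r0 * frac x0 0 i.
      by rewrite [LHS]mxE [X in X + _]mxE [X in _ + X]mxE; ring.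
    have h : r0 * frac x0 0 i <= r0 * 1 by rewrite ler_wpM2l ?ltW.
    have h' : 0 <= r0 * frac x0 0 i by rewrite mulr_ge0// ltW.
    rewrite -real_normK ?num_real// ler_sqr ?nnegrE ?divr_ge0 ?(ltW r00)// ler_norml.
    by apply/andP; split; move: h h'; set m := _ * frac x0 0 i; lra.
  rewrite sumr_const card_ord -[X in X <= _]mulr_natl.
  have -> : 3%:R * (r0 / 2) ^+ 2 = 48 / 64 * r0 ^+ 2 by field.
  have -> : (7 / 8 * r0) ^+ 2 = 49 / 64 * r0 ^+ 2 by field.
  by rewrite ler_pM2r ?exprn_gt0//; lra.
apply: (lt_le_trans (ltr_leD hk h7)); move: hrho; lra.
Qed.

End Preparation.

(** * Solutions blowing up at a prescribed time *)

Theorem theorem3p6 (R : realType) (nu T delta : R)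
    (U : R -> 'rV[R]_3 -> 'rV[R]_3) (P : R -> 'rV[R]_3 -> R)
    (F : R -> 'rV[R]_3 -> 'rV[R]_3)
    (a : 'rV[R]_3 -> 'rV[R]_3)
    (v g : R -> 'rV[R]_3 -> 'rV[R]_3) (q : R -> 'rV[R]_3 -> R)
    (x0 : 'rV[R]_3) (r0 : R)
    (nu_gt0 : 0 < nu) (T_gt0 : 0 < T) (delta_gt0 : 0 < delta)
    (UPF : building_block nu U P F)
    (Xa : velocity_space a) (Fg : force_space g)
    (vqg : NS_solution nu `[0, T + delta] a g v q)
    (r0_gt0 : 0 < r0) (r0_le : r0 <= 1 / 2) :
  exists (eps0 C0 C : R) (Cpq : \bar R -> \bar R -> R) (Cs : R -> R)
    (g_ u_ : R -> R -> 'rV[R]_3 -> 'rV[R]_3) (p_ : R -> R -> 'rV[R]_3 -> R),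
  [/\ 0 < eps0,
      forall eps, 0 < eps < eps0 ->
        let w := fun t x => u_ eps t x - v t x in
        let dg := fun t x => g_ eps t x - g t x in
        [/\ force_space (g_ eps) /\
            NS_solution nu `[0, T[ a (g_ eps) (u_ eps) (p_ eps),
            Tmax nu a (g_ eps) = T%:E /\
            limf_esup (fun t => Lp_T3 +oo (u_ eps t)) T^'- = +oo%E,
            (forall t x, 0 <= t <= T - 2 * eps ^+ 2 -> u_ eps t x = v t x),
            (forall t x, 0 <= t < T -> div (w t) x = 0) /\
            (exists (y : 'rV[R]_3) (rho : R),
               [/\ 0 < rho, 2 * rho <= C0 * eps,
                   torus_ball y rho `<=` torus_ball x0 r0
                 & forall t, 0 <= t < T -> supp (w t) `<=` torus_ball y rho])
          & [/\ (energy_norm T w <=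
                   (supL2 U + gradL2 U) * (eps `^ (1 / 2))%:E
                   + (C * eps `^ (3 / 2))%:E)%E,
                (forall p q : \bar R, (1 <= p)%E -> (1 <= q)%E ->
                   (LqLp_norm q p dg <=
                    (Cpq p q *
                     (eps `^ alpha p q + eps `^ (alpha p q + 1)))%:E)%E)
              & (forall s : R, 0 <= s < 1 / 2 ->
                   (L1Hs_norm s dg <=
                    (Cs s *
                     (eps `^ (1 / 2 - s) + eps `^ (3 / 2 - s)))%:E)%E)]]
    & forall s : R, s < 0 ->
        L1Hs_norm s (fun t x => g_ eps t x - g t x) @[eps --> 0^'+] --> 0%E].
Proof.
have [r [th [V [G [Q B]]]]] := ramped_block_exists UPF.
have [b [vt [b0 svt dvt vvt]]] := background T_gt0 delta_gt0 vqg.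
have [y [yk ball]] := centred_ball x0 r0_gt0 r0_le.
pose k := r0 / 4; have k0 : 0 < k by rewrite divr_gt0.
have rge := rb_radius B; have rho0 : 0 < r + 2 by rewrite ltr_wpDl.
have sV := rb_smooth_V B; have sQ := rb_smooth_Q B; have bG := rb_force B.
have suppV := rb_supp_V B; have sU := bb_smooth_U UPF.
have vNS : NS_solution nu (`[0, T[%classic : set R) a g v q.
  apply: NS_restrict vqg => t; rewrite /= !in_itv /= => /andP[t0 tT].
    by rewrite t0 ltW// (lt_trans tT)// ltrDl.
  apply: filterS (near_lt tT) => s sT; rewrite !in_itv /= sT.
  by rewrite (ltW (lt_trans sT _)) ?ltrDl.
(* half of [b] leaves room for the factor 3 / 2 of [small], since [e ^+ 2 <= e]; the
   last bound makes the balls of radius [2 * (r + 2) * e] fit in [centred_ball] *)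
pose eps0 : R := Num.min (Num.min 1 (b / 2)) (Num.min (T / (r + 2)) (r0 / (16 * (r + 2)))).
have eps0_gt0 : 0 < eps0 by rewrite !lt_min ltr01 !divr_gt0// mulr_gt0.
have sm e : 0 < e < eps0 -> small T r k b e /\ 2 * ((r + 2) * e) <= r0 / 8.
  move=> /andP[e0]; rewrite !lt_min => /andP[/andP[e1 e2] /andP[e3 e4]].
  move: e3 e4; rewrite !ltr_pdivlMr ?mulr_gt0// => e3 e4.
  have ee : e ^+ 2 <= e by rewrite expr2 ler_piMr// ltW.
  have e5 : (r + 2) * e ^+ 2 <= (r + 2) * e by rewrite ler_pM2l.
  have h : 16 * ((r + 2) * e) < r0 by rewrite mulrA mulrC.
  have p0 : 0 < (r + 2) * e by exact: mulr_gt0.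
  split; last by move: h; set d := (r + 2) * e; lra.
  split => //; first exact: ltW.
  - by rewrite /k; move: h p0; set d := (r + 2) * e; lra.
  - by move: ee e2 b0; set d := e ^+ 2; lra.
  - by apply: le_lt_trans e5 _; rewrite mulrC.
have [C hC] := change_energy b T_gt0 rge k0 yk svt sV suppV vNS (rb_ge0 B) (rb_le1 B) (rb_off B)
  (rb_velocity B) sU (bb_L2 UPF).
have [Cpq hpq] := force_change_LqLp nu T k b y rge svt bG.
have [Ks Ks0 hs] := force_change_Hs nu T b rge k0 yk svt bG.
have dgE e : (fun t x => force nu T r y vt G g e t x - g t x) = force_change nu T r y vt G e.
  by apply/funext => t; apply/funext => x; rewrite /force [X in X - _]addrC addrK.
exists eps0, (4 * (r + 2)), C, Cpq, (fun _ => Ks).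
exists (force nu T r y vt G g), (velocity T r y vt V v), (pressure T y Q q).
split=> [//|e heps w dg|s s0].
  have [es ebd] := sm e heps; have e0 : 0 < e by case/andP: heps.
  have JP t : 0 <= t < T -> (`[0, T[%classic : set R) t by rewrite /= in_itv.
  split.
  - split; first exact: (force_space_force nu rge k0 yk svt bG Fg es).
    exact: (NS_velocity T_gt0 rge k0 yk svt dvt sV sQ (rb_momentum B) (rb_div B) suppV (rb_supp_Q B)
      vNS Fg vvt es).
  - split.
      exact: (velocity_lifespan T_gt0 rge k0 yk svt dvt sV sQ (rb_momentum B) (rb_div B) suppV (rb_supp_Q B)
        vNS Fg vvt (rb_on B) (rb_velocity B) sU (bb_blowup UPF) (ltW nu_gt0) es).
    exact: (velocity_blowup rge k0 yk svt dvt suppV vvt (rb_on B) (rb_velocity B) sU (bb_blowup UPF) es).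
  - by move=> t x ht; exact: (velocity_early y rge svt suppV vNS es x ht).
  - split=> [t x ht|]; first exact: (change_div rge k0 yk svt sV (rb_div B) suppV vNS es x (JP t ht)).
    exists y, (2 * ((r + 2) * e)); split.
    + by rewrite !mulr_gt0.
    + by rewrite le_eqVlt; apply/orP; left; apply/eqP; ring.
    + exact: ball.
    + by move=> t ht; exact: (change_supp rge k0 yk svt suppV vNS es (JP t ht)).
  - rewrite /dg dgE; split; first exact: hC.
    + move=> p q' p1 q1; have [C0 hC'] := hpq p q'; apply: (le_trans (hC' e es p1 q1)).
      by rewrite lee_fin ler_wpM2l// lerDl powR_ge0.
    + move=> s /andP[s0 s1]; apply: (le_trans (hs e s es _)).
        by rewrite s0 ltW// (lt_trans s1)//; lra.
      by rewrite lee_fin ler_wpM2l// lerDl powR_ge0.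
have [K K0 hK] := force_change_Hs_neg nu T b rge k0 yk svt bG s0.
under eq_fun do rewrite dgE.
apply: (@squeeze_cvge _ _ _ _ (fun _ => 0%E) _ (fun e => (K * Num.sqrt e)%:E)).
- suff : \forall e \near (0 : R), 0 < e ->
    (0 <= L1Hs_norm s (force_change nu T r y vt G e) <= (K * Num.sqrt e)%:E)%E by [].
  apply: filterS (near_lt eps0_gt0) => e e1 e0; have [|es _] := sm e; first by rewrite e0.
  rewrite Lnorm_ge0 /=; have := hK e es; rewrite div1r powR12_sqrt//; exact: ltW.
- exact: cvg_cst.
- apply: cvg_EFin; first exact: filterE.
  apply: cvg_at_right_filter.
  have c : continuous (fun e : R => K * Num.sqrt e).
    by move=> e; apply: cvgM; [exact: cvg_cst|exact: sqrt_continuous].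
  have z : K * Num.sqrt 0 = 0 by rewrite sqrtr0 mulr0.
  by rewrite -[X in _ --> X]z; exact: c.
Qed.
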